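(* Let $d,n\ge1$ be integers and $\alpha\in(0,d)$. Let $\eta(x)=[\eta_1(x),\ldots,\eta_{n+1}(x)]'$, $x\in\mathbb{R}^d$, be a (measurable, mean-square continuous) vector homogeneous isotropic Gaussian random field with $\mathbf{E}\eta(x)=0$, $\mathbf{E}\eta(0)\eta(0)'=\mathcal{I}$ and $\mathbf{E}\eta(0)\eta(x)'=\mathcal{I}\cdot\|x\|^{-\alpha}L(\|x\|)$ for $x\ne0$, where $\mathcal{I}$ is the unit matrix and $L$ is slowly varying at infinity. Suppose each component $\eta_j$ has a spectral density $f(\|\lambda\|)$ such that $$f(\|\lambda\|)\sim c_2(d,\alpha)\|\lambda\|^{\alpha-d}L(1/\|\lambda\|),\qquad\|\lambda\|\to0.$$ Let $a(r)$ be a continuous non-decreasing function with $a(r)\to+\infty$ as $r\to\infty$ and $a(r)=o(r^{\gamma/(2n)})$, $r\to\infty$, where $\gamma\in(0,\min(\alpha,d-\alpha))$. Let $T_n$ be the Student random field built from $\eta$ and $M_r\{T_n\}=|\{x\in\Delta(r):T_n(x)>a(r)\}|$. Then the random variable $$\sqrt{2\pi}\,(1+a(r)^2/n)^{n/2}\ \frac{M_r\{T_n\}-\frac12|\Delta|r^d\,I_{\frac{n}{n+a^2(r)}}\left(\frac n2,\frac12\right)}{r^{d-\alpha/2}L^{1/2}(r)\sqrt{c_2(d,\alpha)\,c_3(1,d,\alpha)}}$$ is asymptotically $\mathcal{N}(0,1)$ as $r\to\infty$ (converges in distribution to the standard normal law).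
   Context: $\Delta\subset\mathbb{R}^d$ is a Jordan-measurable convex bounded set with $|\Delta|>0$ containing the origin in its interior, and $\Delta(r)=r\Delta$, $r>0$. $|\cdot|$ is Lebesgue measure. Student random field: $T_n(x):=\eta_1(x)\Big/\sqrt{\frac1n(\eta_2^2(x)+\cdots+\eta_{n+1}^2(x))}$. Incomplete beta function: $I_\mu(p,q):=\frac{\Gamma(p+q)}{\Gamma(p)\Gamma(q)}\int_0^\mu t^{p-1}(1-t)^{q-1}dt$, $\mu\in(0,1]$, $p,q>0$. Constants: $c_2(d,\alpha):=\frac{\Gamma((d-\alpha)/2)}{2^\alpha\pi^{d/2}\Gamma(\alpha/2)}$ and $c_3(1,d,\alpha):=\int_{\mathbb{R}^d}|\mathcal{K}(\lambda)|^2\frac{d\lambda}{\|\lambda\|^{d-\alpha}}$, where $\mathcal{K}(x):=\int_\Delta e^{i\langle x,u\rangle}du$. The spectral density is normalized so that $\mathbf{E}\eta_j(0)\eta_j(x)=\int_{\mathbb{R}^d}e^{i\langle\lambda,x\rangle}f(\|\lambda\|)\,d\lambda$. Homogeneous isotropic means $\mathbf{E}\eta(x)\eta(y)'$ depends only on $\|x-y\|$. *)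

(* Defs.v *)
From HB Require Import structures.
From mathcomp Require Import all_boot all_order all_algebra.
From mathcomp Require Import complex.
From mathcomp Require Import all_classical all_reals all_analysis.

Set Implicit Arguments.
Unset Strict Implicit.
Unset Printing Implicit Defensive.

Import Order.TTheory GRing.Theory Num.Theory.
Import numFieldNormedType.Exports.

Local Open Scope classical_set_scope.
Local Open Scope ring_scope.

(* On 'rV[R]_d the library norm `|x| is the sup norm; the Euclidean norm is   *)
(* defined here. The topology of 'rV[R]_d is the usual one in either case.    *)
Definition dot (R : realType) (d : nat) (x y : 'rV[R]_d) : R :=
  \sum_(i < d) x ord0 i * y ord0 i.

Definition enorm (R : realType) (d : nat) (x : 'rV[R]_d) : R :=
  Num.sqrt (dot x x).

Definition rV_display : measure_display.
Proof. exact: default_measure_display. Qed.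

Section measurable_rV.
Context (R : realType) (d : nat).

Let coor : 'I_d -> 'rV[R]_d -> R := fun i x => x ord0 i.

Let rV_set0 : g_sigma_preimage coor set0.
Proof. exact: sigma_algebra0. Qed.

Let rV_setC A : g_sigma_preimage coor A -> g_sigma_preimage coor (~` A).
Proof. exact: sigma_algebraC. Qed.

Let rV_bigcup (F : _^nat) : (forall i, g_sigma_preimage coor (F i)) ->
  g_sigma_preimage coor (\bigcup_i (F i)).
Proof. exact: sigma_algebra_bigcup. Qed.

(* The Borel sigma-algebra of R^d, presented as the one generated by the      *)
(* coordinate functions.                                                      *)
HB.instance Definition _ := @isMeasurable.Build rV_display
  'rV[R]_d (g_sigma_preimage coor) rV_set0 rV_setC rV_bigcup.

End measurable_rV.

Lemma measurable_coord (R : realType) (d : nat) (i : 'I_d) :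
  measurable_fun [set: 'rV[R]_d] (fun x => x ord0 i).
Proof.
move=> _ Y mY; rewrite setTI; apply: sub_sigma_algebra => /=.
rewrite -bigcup_seq/=; exists i => /=; first by rewrite mem_index_enum.
by exists Y => //; rewrite setTI.
Qed.

Lemma measurable_fun_rVP d1 (T : measurableType d1) (R : realType) (d : nat)
    (f : T -> 'rV[R]_d) :
  (forall i, measurable_fun [set: T] (fun t => f t ord0 i)) ->
  measurable_fun [set: T] f.
Proof.
move=> mf _ A mA; rewrite setTI.
move: A mA; apply: smallest_sub.
  split=> /=.
  - by rewrite preimage_set0.
  - by move=> A mA; rewrite setTD preimage_setC; exact: measurableC.
  - by move=> F mF; rewrite preimage_bigcup; exact: bigcupT_measurable.
move=> A; rewrite -bigcup_seq/= => -[i _ [B mB <-]].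
by rewrite setTI; have := mf i measurableT B mB; rewrite setTI.
Qed.

Definition rV_cons (R : realType) (d : nat) (p : R * 'rV[R]_d) : 'rV[R]_d.+1 :=
  \row_(i < d.+1) oapp (fun j => p.2 ord0 j) p.1 (unlift ord0 i).

Lemma measurable_rV_cons (R : realType) (d : nat) :
  measurable_fun [set: R * 'rV[R]_d] (@rV_cons R d).
Proof.
apply: measurable_fun_rVP => i.
under eq_fun do rewrite mxE.
case: unliftP => [j _|_] /=; last exact: measurable_fst.
exact: (measurableT_comp (measurable_coord j) measurable_snd).
Qed.

Section lebesgue_step.
Local Open Scope ereal_scope.
Context (R : realType) (d : nat).
Variable m : {sigma_finite_measure set 'rV[R]_d -> \bar R}.

Definition lebesgue_step : set 'rV[R]_d.+1 -> \bar R :=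
  pushforward (lebesgue_measure \x m) (@rV_cons R d).

Let preim_mcons A : measurable A ->
  measurable (@rV_cons R d @^-1` A : set (measurableTypeR R * 'rV[R]_d)).
Proof.
by move=> mA; rewrite -[X in measurable X]setTI; exact: measurable_rV_cons.
Qed.

Let lebesgue_step0 : lebesgue_step set0 = 0.
Proof. by rewrite /lebesgue_step /pushforward preimage_set0 measure0. Qed.

Let lebesgue_step_ge0 A : 0 <= lebesgue_step A.
Proof. by rewrite /lebesgue_step /pushforward; exact: measure_ge0. Qed.

Let lebesgue_step_sigma_additive : semi_sigma_additive lebesgue_step.
Proof.
move=> F mF tF mUF; rewrite /lebesgue_step /pushforward preimage_bigcup.
apply: measure_semi_sigma_additive.
- by move=> n; exact: preim_mcons.
- apply/trivIsetP => /= i j _ _ ij; rewrite -preimage_setI.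
  by move/trivIsetP : tF => /(_ _ _ _ _ ij) ->//; rewrite preimage_set0.
- by rewrite -preimage_bigcup; exact: preim_mcons.
Qed.

HB.instance Definition _ := isMeasure.Build _ _ _ lebesgue_step
  lebesgue_step0 lebesgue_step_ge0 lebesgue_step_sigma_additive.

Let rV_uncons (x : 'rV[R]_d.+1) : R * 'rV[R]_d :=
  (x ord0 ord0, \row_j x ord0 (lift ord0 j)).

Let rV_consK : cancel (@rV_cons R d) rV_uncons.
Proof.
move=> [a x]; rewrite /rV_uncons mxE unlift_none/=; congr pair.
by apply/rowP => j; rewrite !mxE liftK.
Qed.

Let measurable_rV_uncons : measurable_fun setT rV_uncons.
Proof.
apply/measurable_fun_pairP; split; first exact: measurable_coord.
apply: measurable_fun_rVP => j; rewrite /comp/=.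
under eq_fun do rewrite mxE.
exact: measurable_coord.
Qed.

Let lebesgue_step_sigma_finite : sigma_finite setT lebesgue_step.
Proof.
have /sigma_finiteP[F [TF ndF Foo]] :=
  sigma_finiteT (@lebesgue_measure R : {sigma_finite_measure set _ -> \bar R}).
have /sigma_finiteP[G [TG ndG Goo]] := sigma_finiteT m.
exists (fun n => rV_uncons @^-1` (F n `*` G n)).
  rewrite -preimage_bigcup (_ : \bigcup_n _ = setT) ?preimage_setT//.
  rewrite -subTset => -[x y] _.
  have [i _ Fix] : (\bigcup_n F n) x by rewrite -TF.
  have [j _ Gjy] : (\bigcup_n G n) y by rewrite -TG.
  exists (maxn i j) => //; split => /=.
  - by move: x Fix; exact/subsetPset/ndF/leq_maxl.
  - by move: y Gjy; exact/subsetPset/ndG/leq_maxr.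
move=> k; have [mF Fk] := Foo k; have [mG Gk] := Goo k; split.
  rewrite -[X in measurable X]setTI; apply: measurable_rV_uncons => //.
  exact: measurableX.
rewrite /lebesgue_step /pushforward -comp_preimage.
rewrite (_ : rV_uncons \o _ = id) ?preimage_id; last exact/funext/rV_consK.
by rewrite product_measure1E// lte_mul_pinfty// ge0_fin_numE.
Qed.

HB.instance Definition _ := Measure_isSigmaFinite.Build _ _ _ lebesgue_step
  lebesgue_step_sigma_finite.

End lebesgue_step.

(* d-dimensional Lebesgue measure: a point mass for d = 0, and the product of *)
(* the one-dimensional measure with the d-dimensional one for d + 1. As a set *)
(* function it is monotone on all subsets of R^d, so that it has the expected *)
(* value on Jordan measurable sets even when they are not Borel.              *)
Fixpoint leb (R : realType) (d : nat) :
    {sigma_finite_measure set 'rV[R]_d -> \bar R} :=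
  match d with
  | 0%N => dirac (0 : 'rV[R]_0)
  | d'.+1 => lebesgue_step (leb R d')
  end.

Lemma leb_prod (R : realType) (d : nat) (A : 'I_d -> set R) :
  (forall i, measurable (A i)) ->
  leb R d [set x | forall i, A i (x ord0 i)] =
  (\prod_(i < d) lebesgue_measure (A i))%E.
Proof.
elim: d A => [|d IH] A mA.
  rewrite big_ord0/= diracE mem_set//; by case.
have mB : measurable [set x : 'rV[R]_d | forall i, A (lift ord0 i) (x ord0 i)].
  rewrite (_ : mkset _ =
      \bigcap_(i in [set: 'I_d])
        ((fun x : 'rV[R]_d => x ord0 i) @^-1` A (lift ord0 i))).
    apply: fin_bigcap_measurable => // i _.
    by rewrite -[X in measurable X]setTI; exact: measurable_coord.
  by apply/seteqP; split=> x /= Ax i; [move=> _|]; exact: Ax.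
rewrite big_ord_recl -IH// -product_measure1E//; last exact: mA.
rewrite /= /lebesgue_step /pushforward.
congr product_measure1.
apply/seteqP; split => -[a x]/= Aax.
  split; first by have := Aax ord0; rewrite mxE unlift_none.
  by move=> i; have := Aax (lift ord0 i); rewrite mxE liftK.
case: Aax => Aa Ax i; rewrite mxE; by case: unliftP => [j ->|->].
Qed.

Definition box (R : realType) (d : nat) (a b : 'rV[R]_d) : set 'rV[R]_d :=
  [set x | forall i, a ord0 i <= x ord0 i <= b ord0 i].

Definition elementary (R : realType) (d : nat) (E : set 'rV[R]_d) : Prop :=
  exists s : seq ('rV[R]_d * 'rV[R]_d), E = \big[setU/set0]_(p <- s) box p.1 p.2.

(* Inner and outer Jordan contents coincide.                                  *)
Definition jordan_measurable (R : realType) (d : nat) (A : set 'rV[R]_d) : Prop :=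
  forall e : R, 0 < e -> exists E F : set 'rV[R]_d,
    [/\ elementary E, elementary F, E `<=` A, A `<=` F
      & (leb R d (F `\` E) < e%:E)%E].

Definition dilate (R : realType) (d : nat) (r : R) (A : set 'rV[R]_d) :
    set 'rV[R]_d := [set r *: x | x in A].

Definition gamma_fun (R : realType) (s : R) : R :=
  \int[lebesgue_measure]_(t in `]0%R, +oo[) (t `^ (s - 1) * expR (- t)).

Definition incomplete_beta (R : realType) (u p q : R) : R :=
  gamma_fun (p + q) / (gamma_fun p * gamma_fun q) *
  \int[lebesgue_measure]_(t in `]0%R, u[) (t `^ (p - 1) * (1 - t) `^ (q - 1)).

Definition expi (R : realType) (t : R) : R[i] := (cos t +i* sin t)%C.

Definition Cintegral (dT : measure_display) (T : measurableType dT)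
    (R : realType) (mu : {measure set T -> \bar R}) (D : set T) (g : T -> R[i]) : R[i] :=
  (\int[mu]_(x in D) complex.Re (g x) +i* \int[mu]_(x in D) complex.Im (g x))%C.

(* int_A e^{i<x,u>} du                                                        *)
Definition fourier_set (R : realType) (d : nat) (A : set 'rV[R]_d)
    (x : 'rV[R]_d) : R[i] :=
  Cintegral (leb R d) A (fun u => expi (dot x u)).

Definition c2 (R : realType) (d : nat) (alpha : R) : R :=
  gamma_fun ((d%:R - alpha) / 2) /
  (2 `^ alpha * pi `^ (d%:R / 2) * gamma_fun (alpha / 2)).

(* c_3(1, d, alpha), with A in the role of the convex set Delta.              *)
Definition c3 (R : realType) (d : nat) (A : set 'rV[R]_d) (alpha : R) : R :=
  \int[leb R d]_l
    (ComplexField.Normc.normc (fourier_set A l) ^+ 2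
     / enorm l `^ (d%:R - alpha)).

Definition slowly_varying (R : realType) (L : R -> R) : Prop :=
  [/\ measurable_fun (`]0, +oo[ : set R) L,
      \forall t \near +oo, 0 < L t
    & forall s, 0 < s -> L (s * t) / L t @[t --> +oo] --> (1 : R)].

(* Normal laws on R, point masses (zero variance) included; in the library    *)
(* normal_prob m 0 is not a point mass.                                       *)
Definition gaussian_law (R : realType) (mu : set R -> \bar R) : Prop :=
  (exists m s : R, 0 < s /\
     forall A, measurable A -> mu A = normal_prob m s A) \/
  (exists m : R, forall A, measurable A -> mu A = \d_m A).

(* X r converges in distribution to mu as r --> +oo: X r is eventually a      *)
(* random variable and its distribution function converges to that of mu at   *)
(* every continuity point of the latter.                                      *)
Definition cvg_in_law (dO : measure_display) (Omega : measurableType dO)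
    (R : realType) (P : probability Omega R) (X : R -> Omega -> R)
    (mu : set R -> \bar R) : Prop :=
  (\forall r \near +oo, measurable_fun [set: Omega] (X r)) /\
  forall t : R, {for t, continuous (fun u : R => fine (mu `]-oo, u]%classic))} ->
    P [set w | X r w <= t] @[r --> +oo] --> mu `]-oo, t]%classic.

Section random_fields.
Context (dO : measure_display) (Omega : measurableType dO) (R : realType)
  (P : probability Omega R) (d m : nat).
(* A random field on R^d with values in R^m: eta x j is the j-th component at *)
(* the point x.                                                               *)
Implicit Type eta : 'rV[R]_d -> 'I_m -> {RV P >-> R}.

Definition measurable_field eta : Prop :=
  forall j, measurable_fun [set: 'rV[R]_d * Omega] (fun p => eta p.1 j p.2).

Definition mean_square_continuous eta : Prop :=
  forall j x, ('E_P[fun w => ((eta y j w - eta x j w) ^+ 2)%R])%E @[y --> x] --> 0%E.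

(* All finite-dimensional distributions are Gaussian: every finite linear     *)
(* combination of the values of the components has a (possibly degenerate)    *)
(* normal law.                                                                *)
Definition gaussian_field eta : Prop :=
  forall (k : nat) (x : 'I_k -> 'rV[R]_d) (c : 'I_k -> 'I_m -> R),
    gaussian_law (pushforward P
      (fun w => \sum_(i < k) \sum_(j < m) c i j * eta (x i) j w : R)).

Definition centered_field eta : Prop :=
  forall x j, ('E_P[eta x j])%E = 0%E.

(* E eta(x) eta(y)'                                                           *)
Definition cross_moment eta (x y : 'rV[R]_d) : 'M[R]_m :=
  \matrix_(i < m, j < m) fine ('E_P[fun w => (eta x i w * eta y j w)%R])%E.

Definition homogeneous_isotropic eta : Prop :=
  exists B : R -> 'M[R]_m, forall x y, cross_moment eta x y = B (enorm (x - y)).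

(* f(|lambda|) is the density of the spectral measure of the j-th component.  *)
Definition spectral_density eta (j : 'I_m) (f : R -> R) : Prop :=
  [/\ measurable_fun (`[0, +oo[ : set R) f,
      forall u, 0 <= u -> 0 <= f u,
      (leb R d).-integrable [set: 'rV[R]_d] (fun l => (f (enorm l))%:E)
    & forall x, (cross_moment eta 0 x j j)%:C%C =
        Cintegral (leb R d) [set: 'rV[R]_d]
          (fun l => expi (dot l x) * (f (enorm l))%:C%C)].

End random_fields.

Section student_field.
Context (dO : measure_display) (Omega : measurableType dO) (R : realType)
  (P : probability Omega R) (d n : nat).
Variable eta : 'rV[R]_d -> 'I_n.+1 -> {RV P >-> R}.

Definition student (x : 'rV[R]_d) (w : Omega) : R :=
  eta x ord0 w /
  Num.sqrt (n%:R^-1 * \sum_(j < n) eta x (lift ord0 j) w ^+ 2).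

(* M_r{T_n} = |{x in Delta(r) : T_n(x) > a(r)}|                               *)
Definition sojourn (Delta : set 'rV[R]_d) (a : R -> R) (r : R) (w : Omega) : R :=
  fine (leb R d [set x | dilate r Delta x /\ a r < student x w]).

End student_field.

(* Main.v *)
(* Composed with the Gaussian field, the indicator of [student > a r] splits in Hermite expansion into
   its mean [I/2], a multiple of [eta_1] and a residual orthogonal to the constants and to the
   coordinates.  The coefficient of [eta_1] is [(2 pi)^(-1/2) (1 + a^2/n)^(-n/2)], which is the inverse
   of the normalization.  By Mehler's formula the covariance of the residual is at most a constant times
   the squared correlation, so after normalization the space integral of the residual has variance
   of order [a^(2n) r^(-sigma) / (r^(-alpha) L r)] for every [sigma < min (2 alpha, d)]; this vanishes since
   [a^(2n) = o(r^gamma)] and [gamma < min (alpha, d - alpha)].  The space integral of [eta_1] is an L^2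
   limit of Gaussian variables.  By regular variation and dominated convergence its variance is
   equivalent to [r^(2d - alpha) L r] times the Riesz energy of [Delta] of exponent [alpha], and this
   energy equals [c_2 c_3] by Plancherel for Riesz kernels. *)
From HB Require Import structures.
From mathcomp Require Import all_boot all_order all_algebra.
From mathcomp Require Import complex ring lra.
From mathcomp Require Import all_classical all_reals all_analysis.
From mathcomp Require Import measurable_realfun.
Require Import Defs.
Set Implicit Arguments.
Unset Strict Implicit.
Unset Printing Implicit Defensive.
Import Order.TTheory GRing.Theory Num.Theory.
Import numFieldNormedType.Exports.
Local Open Scope classical_set_scope.
Local Open Scope ring_scope.

(** * Lebesgue measure on R^d *)

(** Several obstacles shape the proof. Gaussianity is given for linear combinations only, that is,
    through laws on the line, whereas Mehler's formula needs the joint law of two vectors; a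
    Cramer-Wold theorem supplies it. [Delta] is Jordan measurable but possibly not Borel, so it is
    squeezed between two Borel sets of equal measure, and monotonicity is used for arbitrary sets.
    Exchanging signed integrals would require integrability each time; integrands are made
    nonnegative instead: [1 + cos] stands for the characteristic function, [(H x + H y) ^ 2] for a
    covariance, and the added terms are cancelled afterwards. The level [a r] moves with [r]: the
    residual is bounded with constants independent of the level, without any gain from a high level,
    and the growth condition on [a] pays for the resulting factor. At bounded distances slow
    variation says nothing about [L]; there the only information is that a correlation is at most 1
    in modulus. *)

Section leb_integral.
Context (R : realType).
Local Open Scope ereal_scope.

Lemma emeasurable_prod dT (T : measurableType dT) (I : Type) (s : seq I) (D : set T)
    (h : I -> T -> \bar R) :
  (forall i, measurable_fun D (h i)) -> measurable_fun D (fun x => \prod_(i <- s) h i x).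
Proof.
move=> mh; elim: s => [|i s IH].
  by under eq_fun do rewrite big_nil; exact: measurable_cst.
under eq_fun do rewrite big_cons.
exact: emeasurable_funM.
Qed.

Lemma leb_integral0 (F : 'rV[R]_0 -> \bar R) :
  measurable_fun [set: 'rV[R]_0] F -> \int[leb R 0]_x F x = F 0%R.
Proof.
by move=> mF; rewrite /= integral_dirac// diracT mul1e.
Qed.

Lemma leb_integralS d (F : 'rV[R]_d.+1 -> \bar R) :
  measurable_fun [set: 'rV[R]_d.+1] F -> (forall x, 0 <= F x) ->
  \int[leb R d.+1]_x F x =
  \int[lebesgue_measure]_a \int[leb R d]_x F (rV_cons (a, x)).
Proof.
move=> mF F0.
rewrite [LHS](_ : _ = \int[pushforward (lebesgue_measure \x leb R d) (@rV_cons R d)]_x F x)//.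
rewrite ge0_integral_pushforward//; last exact: measurable_rV_cons.
rewrite preimage_setT fubini_tonelli1//.
- exact: measurableT_comp (@measurable_rV_cons R d).
- by move=> x; exact: F0.
Qed.

Lemma measurable_leb_integral d (F : 'rV[R]_d.+1 -> \bar R) :
  measurable_fun [set: 'rV[R]_d.+1] F -> (forall x, 0 <= F x) ->
  measurable_fun [set: R] (fun a => \int[leb R d]_x F (rV_cons (a, x))).
Proof.
move=> mF F0.
apply: (@measurable_fun_fubini_tonelli_F _ _ (measurableTypeR R) _ R (leb R d) (F \o @rV_cons R d)).
- exact: measurableT_comp (@measurable_rV_cons R d).
- by move=> x; exact: F0.
Qed.

Lemma rV_consS d (x : 'rV[R]_d.+1) : rV_cons (x ord0 ord0, \row_j x ord0 (lift ord0 j)) = x.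
Proof.
apply/rowP => i; rewrite mxE; case: unliftP => [j ->|->]//=; by rewrite mxE.
Qed.

Lemma rV_cons0 d (a : R) (x : 'rV[R]_d) : rV_cons (a, x) ord0 ord0 = a.
Proof. by rewrite mxE unlift_none. Qed.

Lemma rV_consl d (a : R) (x : 'rV[R]_d) j : rV_cons (a, x) ord0 (lift ord0 j) = x ord0 j.
Proof. by rewrite mxE liftK. Qed.

Lemma rV_cons_affine d (r a b : R) (x y : 'rV[R]_d) :
  (r *: rV_cons (a, x) + rV_cons (b, y) = rV_cons (r * a + b, r *: x + y))%R.
Proof.
apply/rowP => i; rewrite !mxE; case: unliftP => [j _|_] /=; by rewrite ?mxE.
Qed.

Lemma leb_prod_integral d (g : 'I_d -> R -> \bar R) :
  (forall i, measurable_fun [set: R] (g i)) ->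
  (forall i x, 0 <= g i x) ->
  \int[leb R d]_x (\prod_(i < d) g i (x ord0 i)) =
  \prod_(i < d) \int[lebesgue_measure]_x g i x.
Proof.
have mp k (h : 'I_k -> R -> \bar R) : (forall i, measurable_fun [set: R] (h i)) ->
   measurable_fun [set: 'rV[R]_k] (fun x : 'rV[R]_k => \prod_(i < k) h i (x ord0 i)).
  move=> mh; apply: emeasurable_prod => i.
  exact: (measurableT_comp (mh i) (measurable_coord i)).
elim: d g => [|d IH] g mg g0.
  rewrite leb_integral0 ?big_ord0//; exact: mp.
rewrite leb_integralS; last 2 first.
- exact: mp.
- by move=> x; apply: prode_ge0.
rewrite big_ord_recl.
transitivity (\int[lebesgue_measure]_a
    (g ord0 a * \prod_(i < d) \int[lebesgue_measure]_x g (lift ord0 i) x)).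
  apply: eq_integral => a _; rewrite -(IH (fun i => g (lift ord0 i)))//.
  rewrite -ge0_integralZl//; [|exact: (mp _ (fun i => g (lift ord0 i)))|by move=> x _; apply: prode_ge0].
  apply: eq_integral => x _; rewrite big_ord_recl rV_cons0; congr (_ * _).
  by apply: eq_bigr => i _; rewrite rV_consl.
rewrite ge0_integralZr//; first exact: mg.
by apply: prode_ge0 => i _; apply: integral_ge0 => x _.
Qed.

Lemma measurable_affine (r b : R) : measurable_fun [set: R] (fun x : R => r * x + b)%R.
Proof. by apply: measurable_funD => //; apply: measurable_funM. Qed.

(** [r] times the image of Lebesgue measure under [x |-> r * x + b] gives every half-open interval
    its length, hence is Lebesgue measure. *)
Lemma lebesgue_affine (F : R -> \bar R) (r b : R) : (0 < r)%R ->
  measurable_fun [set: R] F -> (forall x, 0 <= F x) ->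
  \int[lebesgue_measure]_x F (r * x + b)%R = r^-1%:E * \int[lebesgue_measure]_x F x.
Proof.
move=> r0 mF F0.

pose h (x : measurableTypeR R) : measurableTypeR R := (r * x + b)%R.
have mh : measurable_fun [set: measurableTypeR R] h by exact: measurable_affine.
pose nu0 : {measure set (measurableTypeR R) -> \bar R} :=
  mscale (NngNum (ltW r0)) (pushforward lebesgue_measure h).
pose nu := nu0 mh.
have E (A : set (measurableTypeR R)) : measurable A -> lebesgue_measure A = nu A.
  move=> mA; apply: lebesgue_measure_unique => // _ [[a c]] _ <-.
  rewrite [RHS](_ : _ = r%:E * lebesgue_measure (h @^-1` [set` `]a, c]%R]))//.
  have -> : h @^-1` `]a, c] = [set` `](a - b) / r, (c - b) / r]%R].
    apply/seteqP; split=> x /=; rewrite !in_itv/= /h.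
      by rewrite ltr_pdivrMr// ler_pdivlMr// ltrBlDr lerBrDr mulrC.
    by rewrite ltr_pdivrMr// ler_pdivlMr// ltrBlDr lerBrDr mulrC.
  rewrite !lebesgue_measure_itv/= !lte_fin ltr_pM2r ?invr_gt0// ltrD2r.
  case: ifPn => _; last by rewrite mule0.
  rewrite -!EFinD -EFinM; congr EFin; field; exact: lt0r_neq0.
rewrite [in RHS](@eq_measure_integral _ _ R setT nu); last by move=> A mA _; exact: E.
rewrite /nu /nu0 ge0_integral_mscale//= muleA -EFinM mulVf ?gt_eqF// mul1e.
by rewrite ge0_integral_pushforward// preimage_setT.
Qed.

Lemma measurable_rV_affine d (r : R) (b : 'rV[R]_d) :
  measurable_fun [set: 'rV[R]_d] (fun x => r *: x + b)%R.
Proof.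
apply: measurable_fun_rVP => i.
rewrite (_ : (fun _ => _) = (fun x : R => r * x + b ord0 i)%R \o (fun x : 'rV[R]_d => x ord0 i)).
  exact: (measurableT_comp (measurable_affine _ _) (measurable_coord i)).
by apply/funext => x /=; rewrite !mxE.
Qed.

Lemma leb_affine d (F : 'rV[R]_d -> \bar R) (r : R) (b : 'rV[R]_d) : (0 < r)%R ->
  measurable_fun [set: 'rV[R]_d] F -> (forall x, 0 <= F x) ->
  \int[leb R d]_x F (r *: x + b)%R = (r^-1 ^+ d)%:E * \int[leb R d]_x F x.
Proof.
move=> r0; elim: d F b => [|d IH] F b mF F0.
  rewrite !leb_integral0//; last exact: measurableT_comp (measurable_rV_affine _ _).
  by rewrite expr0 mul1e; congr F; apply/rowP; case.
have mG := measurableT_comp mF (measurable_rV_affine r b).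
rewrite leb_integralS//.
rewrite (leb_integralS mF F0).
pose b0 := b ord0 ord0; pose b' : 'rV[R]_d := \row_j b ord0 (lift ord0 j).
pose G a := \int[leb R d]_x F (rV_cons (a, x)).
have mFc a : measurable_fun [set: 'rV[R]_d] (fun x => F (rV_cons (a, x))).
  apply: (measurableT_comp mF); apply: (measurableT_comp (@measurable_rV_cons R d)).
  exact: measurable_pair1.
transitivity (\int[lebesgue_measure]_a ((r^-1 ^+ d)%:E * G (r * a + b0)%R)).
  apply: eq_integral => a _; rewrite /G -(IH _ b')//.
  by apply: eq_integral => x _; rewrite -[b]rV_consS rV_cons_affine.
have G0 a : 0 <= G a by exact: integral_ge0.
have mGm : measurable_fun [set: R] G by exact: measurable_leb_integral.
rewrite (@ge0_integralZl_EFin _ (measurableTypeR R) R _ _ measurableT (fun a => G (r * a + b0)%R)); last 3 first.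
- by move=> a _; exact: G0.
- exact: (measurableT_comp mGm (measurable_affine _ _)).
- by rewrite exprn_ge0// invr_ge0 ltW.
by rewrite lebesgue_affine// muleA -EFinM -exprSr.
Qed.

Lemma measurable_row_mx m n :
  measurable_fun [set: 'rV[R]_m * 'rV[R]_n] (fun p => row_mx p.1 p.2).
Proof.
apply: measurable_fun_rVP => i.
case: (split_ordP i) => j ->.
  under eq_fun do rewrite row_mxEl.
  exact: (measurableT_comp (measurable_coord j) measurable_fst).
under eq_fun do rewrite row_mxEr.
exact: (measurableT_comp (measurable_coord j) measurable_snd).
Qed.

Lemma row_mx_cons m n (a : R) (x : 'rV[R]_m) (y : 'rV[R]_n) :
  row_mx (rV_cons (a, x)) y = rV_cons (a, row_mx x y) :> 'rV[R]_(m.+1 + n).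
Proof.
apply/rowP => i.
case: (split_ordP i) => j ->.
  rewrite row_mxEl; case: (unliftP ord0 j) => [k ->|->].
    rewrite rV_consl (_ : lshift n (lift ord0 k) = lift ord0 (lshift n k)) ?rV_consl ?row_mxEl//.
    exact: val_inj.
  rewrite rV_cons0 (_ : lshift n ord0 = ord0) ?rV_cons0//; exact: val_inj.
rewrite row_mxEr (_ : rshift m.+1 j = lift ord0 (rshift m j)) ?rV_consl ?row_mxEr//.
exact: val_inj.
Qed.

Lemma leb_split m n (F : 'rV[R]_(m + n) -> \bar R) :
  measurable_fun [set: 'rV[R]_(m + n)] F -> (forall x, 0 <= F x) ->
  \int[leb R (m + n)]_x F x = \int[leb R m]_x \int[leb R n]_y F (row_mx x y).
Proof.
elim: m F => [|m IH] F mF F0.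
  rewrite leb_integral0.
    apply: eq_integral => x _; congr F; apply/rowP => i.
    rewrite [in RHS](_ : i = rshift 0 i) ?row_mxEr//; exact: val_inj.
  apply: (@measurable_fun_fubini_tonelli_F _ _ _ _ R (leb R n) (fun p : 'rV[R]_0 * 'rV[R]_n => F (row_mx p.1 p.2))) => //.
  exact: (measurableT_comp mF (@measurable_row_mx 0 n)).
rewrite (leb_integralS (d := m + n)%N)// leb_integralS; last 2 first.
- apply: (@measurable_fun_fubini_tonelli_F _ _ _ _ R (leb R n) (fun p : 'rV[R]_m.+1 * 'rV[R]_n => F (row_mx p.1 p.2))) => //.
  exact: (measurableT_comp mF (@measurable_row_mx m.+1 n)).
- by move=> x; apply: integral_ge0.
apply: eq_integral => a _.
have mFa : measurable_fun [set: 'rV[R]_(m + n)] (fun x => F (rV_cons (a, x))).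
  apply: (measurableT_comp mF); apply: (measurableT_comp (@measurable_rV_cons R (m + n))).
  exact: measurable_pair1.
rewrite (IH _ mFa); last by move=> x; exact: F0.
by apply: eq_integral => x _; apply: eq_integral => y _; rewrite row_mx_cons.
Qed.

(** The integral of a nonnegative function is a supremum over the simple functions below it, so
    monotonicity holds for arbitrary functions. This is what permits sets such as [Delta] that need
    not be Borel. *)
Lemma ge0_le_integralT dT (T : measurableType dT) (mu : {measure set T -> \bar R}) (f g : T -> \bar R) :
  (forall x, 0 <= f x) -> (forall x, f x <= g x) -> \int[mu]_x f x <= \int[mu]_x g x.
Proof.
move=> f0 fg.
have g0 x : 0 <= g x by exact: le_trans (fg x).
rewrite !ge0_integralTE//.
by apply: le_ereal_sup => _ [h hf <-]; exists h => // x; exact: le_trans (hf x) _.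
Qed.

Lemma le_leb d (A B : set 'rV[R]_d) : A `<=` B -> leb R d A <= leb R d B.
Proof.
elim: d A B => [|d IH] A B AB.
  rewrite /= !diracE lee_fin ler_nat; case: (boolP (_ \in A)) => //; rewrite !inE => /AB B0.
  by rewrite mem_set.
rewrite /= /lebesgue_step /pushforward /product_measure1.
apply: ge0_le_integralT => // x /=; apply: IH => y.
by rewrite /xsection /= !inE; exact: AB.
Qed.
End leb_integral.

(** * Gaussian measures *)

Section density.
Local Open Scope ereal_scope.
Context dT (T : measurableType dT) (R : realType).
Import HBNNSimple.

(** Both sides are limits along the same increasing simple functions, for which the identity reduces
    to indicators; [F] may take the value [+oo]. *)
Lemma ge0_integral_density (mu nu : {measure set T -> \bar R}) (g : T -> R) :
  measurable_fun [set: T] g -> (forall x, (0 <= g x)%R) ->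
  (forall A, measurable A -> nu A = \int[mu]_(x in A) (g x)%:E) ->
  forall F : T -> \bar R, measurable_fun [set: T] F -> (forall x, 0 <= F x) ->
  \int[nu]_x F x = \int[mu]_x (F x * (g x)%:E).
Proof.
move=> mg g0 nuE F mF F0.
pose h := nnsfun_approx measurableT mF.
have mg' : measurable_fun [set: T] (EFin \o g) by exact/measurable_EFinP.
have mhE n : measurable_fun [set: T] (EFin \o h n).
  by apply/measurable_EFinP; exact: measurable_funP.
have hcvg x : (EFin \o h n) x @[n --> \oo] --> F x.
  by apply: cvg_nnsfun_approx => // y _.
have -> : \int[nu]_x F x = lim (\int[nu]_x (EFin \o h n) x @[n --> \oo]).
  rewrite -monotone_convergence//.
  - by apply: eq_integral => x _; apply/esym/cvg_lim => //; exact: hcvg.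
  - by move=> n x _ /=; rewrite lee_fin.
  - by move=> x _ a b ab; rewrite lee_fin; exact/lefP/nd_nnsfun_approx.
have -> : \int[mu]_x (F x * (g x)%:E) =
    lim (\int[mu]_x ((EFin \o h n) x * (g x)%:E) @[n --> \oo]).
  rewrite -monotone_convergence//.
  - apply: eq_integral => x _; apply/esym/cvg_lim => //.
    by apply: cvgeZr => //; exact: hcvg.
  - by move=> n; exact: emeasurable_funM.
  - by move=> n x _; rewrite mule_ge0 ?lee_fin.
  - by move=> x _ a b ab/=; rewrite lee_wpmul2r ?lee_fin//; exact/lefP/nd_nnsfun_approx.
suff E n : \int[nu]_x (EFin \o h n) x = \int[mu]_x ((EFin \o h n) x * (g x)%:E).
  by under eq_fun do rewrite E.
have indich r : measurable_fun [set: T] (fun x => (r * \1_(h n @^-1` [set r]) x)%:E).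
  by apply/measurable_EFinP; apply: measurable_funM.
transitivity (\int[nu]_x (\sum_(y \in range (h n)) (y * \1_(h n @^-1` [set y]) x)%:E)).
  by apply: eq_integral => t tE; rewrite /= [in LHS]fimfunE -fsumEFin.
rewrite ge0_integral_fsum//; last by move=> m y Ey; exact: nnfun_muleindic_ge0.
transitivity (\int[mu]_x (\sum_(y \in range (h n))
    (y * \1_(h n @^-1` [set y]) x)%:E * (g x)%:E)); last first.
  apply: eq_integral => x xE.
  rewrite -ge0_mule_fsuml => [|y]; last exact: nnfun_muleindic_ge0.
  by rewrite fsumEFin // -(fimfunE _ x).
rewrite ge0_integral_fsum//; last 2 first.
- by move=> y; apply: emeasurable_funM.
- by move=> m y Ey; rewrite mule_ge0 ?lee_fin//; exact: nnfun_muleindic_ge0.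
apply: eq_fsbigr => r /set_mem [t _ <-].
set A := h n @^-1` _.
have mA : measurable A by rewrite -[A]setTI; exact: measurable_funP.
rewrite integralZl_indic_nnsfun// integral_indic// setIT nuE//.
under [RHS]eq_integral do rewrite EFinM -muleA.
rewrite ge0_integralZl//; last 3 first.
- by apply: emeasurable_funM => //; apply/measurable_EFinP.
- by move=> x _; rewrite mule_ge0 ?lee_fin.
- by rewrite lee_fin.
congr (_ * _); rewrite integral_mkcond; apply: eq_integral => x _.
by rewrite epatch_indic muleC.
Qed.

Lemma integrable_density (mu nu : {measure set T -> \bar R}) (g : T -> R) :
  measurable_fun [set: T] g -> (forall x, (0 <= g x)%R) ->
  (forall A, measurable A -> nu A = \int[mu]_(x in A) (g x)%:E) ->
  forall F : T -> R, measurable_fun [set: T] F ->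
  mu.-integrable setT (fun x => (F x * g x)%:E) ->
  nu.-integrable setT (EFin \o F) /\ \int[nu]_x (F x)%:E = \int[mu]_x (F x * g x)%:E.
Proof.
move=> mg g0 nuE F mF iF.
have mFE : measurable_fun [set: T] (EFin \o F) by exact/measurable_EFinP.
have H (G : T -> R) : measurable_fun [set: T] G -> (forall x, (0 <= G x)%R) ->
    \int[nu]_x (G x)%:E = \int[mu]_x (G x * g x)%:E.
  move=> mG G0; rewrite (ge0_integral_density mg g0 nuE)//.
  exact/measurable_EFinP.
split.
  apply/integrableP; split => //.
  have := integrable_abse iF => /integrableP[_].
  under eq_integral do rewrite /= normr_id normrM (ger0_norm (g0 _)).
  by rewrite -H//; exact: measurableT_comp.
rewrite integralE [RHS]integralE; congr (_ - _).
  transitivity (\int[nu]_x (Num.max (F x) 0)%:E).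
    by apply: eq_integral => x _; rewrite funeposE -EFin_max.
  rewrite H//; last 2 first.
  - exact: measurable_maxr.
  - by move=> x; rewrite le_max lexx orbT.
  by apply: eq_integral => x _; rewrite funeposE -EFin_max maxr_pMl// mul0r.
transitivity (\int[nu]_x (Num.max (- F x) 0)%:E).
  by apply: eq_integral => x _; rewrite funenegE -EFin_max.
rewrite H//; last 2 first.
- by apply: measurable_maxr => //; exact: measurableT_comp.
- by move=> x; rewrite le_max lexx orbT.
by apply: eq_integral => x _; rewrite funenegE -EFin_max maxr_pMl// mul0r mulNr.
Qed.

Lemma dominated_cvg_integral (mu : {measure set T -> \bar R}) (f_ : nat -> T -> \bar R)
    (f g : T -> \bar R) :
  (forall n, measurable_fun [set: T] (f_ n)) ->
  (forall x, f_ n x @[n --> \oo] --> f x) ->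
  mu.-integrable setT g -> (forall n x, `|f_ n x| <= g x) ->
  \int[mu]_x f_ n x @[n --> \oo] --> \int[mu]_x f x.
Proof.
move=> mf_ cvf ig fg.
have mf : measurable_fun [set: T] f.
  by apply: (emeasurable_fun_cvg _ f mf_) => x _; exact: cvf.
have H1 : {ae mu, forall x, [set: T] x -> f_ ^~ x @ \oo --> f x}.
  by apply/aeW => x _; exact: cvf.
have H2 : {ae mu, forall x n, [set: T] x -> `|f_ n x| <= g x}.
  by apply/aeW => x n _; exact: fg.
by have [] := dominated_convergence measurableT mf_ mf H1 ig H2.
Qed.
End density.

(** * The standard normal density on the line: Stein's identity and the characteristic function *)

Section line.
Context (R : realType).
Notation mu := (@lebesgue_measure R).

(** Fundamental theorem of calculus on growing symmetric intervals, then dominated convergence by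
    [|f|]. With [F = h * phi] it becomes Gaussian integration by parts. *)
Lemma integral_derivative_eq0 (F f : R -> R) :
  (forall x : R, is_derive x 1 F (f x)) -> continuous f ->
  mu.-integrable setT (EFin \o f) ->
  F x @[x --> +oo] --> 0 -> F x @[x --> -oo] --> 0 ->
  (\int[mu]_x (f x)%:E = 0)%E.
Proof.
move=> dF cf fi Fy FNy.
pose g (n : nat) (x : R) : \bar R := ((EFin \o f) \_ `[(- (n.+1%:R))%R, n.+1%:R]%classic) x.
have mf : measurable_fun [set: R] (EFin \o f).
  by apply/measurable_EFinP; exact: continuous_measurable_fun.
have mg n : measurable_fun [set: R] (g n).
  by apply/(measurable_restrictT _ _).1 => //; exact: measurable_funTS.
have gf (x : R) : g n x @[n --> \oo] --> (EFin \o f) x.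
  apply: cvg_near_cst.
  near=> n; rewrite /g patchE mem_set//= in_itv/= -ler_norml.
  near: n; exists (Num.trunc `|x|) => // n /= ln.
  by apply: (le_trans (ltW (truncnS_gt _))); rewrite ler_nat ltnS.
have gb (x : R) (n : nat) : (`|g n x| <= `|(EFin \o f) x|)%E.
  by rewrite /g patchE; case: ifPn => // _; rewrite abse0.
have := @dominated_cvg_integral _ (measurableTypeR R) R mu g
  (EFin \o f) (abse \o (EFin \o f)) mg gf (integrable_abse fi) (fun n x => gb x n).
have FyN : F n.+1%:R @[n --> \oo] --> 0.
  move/cvg_pinftyP : Fy; apply; apply/cvgryPge => r.
  near=> n; near: n; exists (Num.trunc r) => // n /= rn.
  by apply: (le_trans (ltW (truncnS_gt _))); rewrite ler_nat ltnS.
have FNyN : F (- n.+1%:R) @[n --> \oo] --> 0.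
  move/cvg_ninftyP : FNy; apply; apply/cvgrNyPle => r.
  near=> n; rewrite lerNl; near: n; exists (Num.trunc (- r)) => // n /= rn.
  by apply: (le_trans (ltW (truncnS_gt _))); rewrite ler_nat ltnS.
have gE (n : nat) : (\int[mu]_x g n x = (F n.+1%:R - F (- n.+1%:R))%:E)%E.
  rewrite /g -integral_mkcond (@continuous_FTC2 _ f F)//.
  - by rewrite -subr_gt0 opprK addr_gt0.
  - exact: continuous_subspaceT.
  - split.
    + by move=> x _; exact: ex_derive.
    + apply: cvg_at_right_filter; apply: differentiable_continuous; apply/derivable1_diffP; exact: ex_derive.
    + apply: cvg_at_left_filter; apply: differentiable_continuous; apply/derivable1_diffP; exact: ex_derive.
  - by move=> x _; rewrite derive1E derive_val.
move=> H.
apply/esym; apply: cvg_unique H => //=.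
under eq_fun do rewrite gE.
apply: cvg_EFin; first by near=> n.
have H0 := cvgB FyN FNyN; rewrite subr0 in H0; exact: H0.
Unshelve. all: by end_near. Qed.

Notation phi := (normal_pdf 0 (1:R)).

Lemma phiE x : phi x = normal_peak 1 * expR (- (x ^+ 2 / 2)).
Proof.
rewrite normal_pdfE ?oner_neq0// /normal_fun subr0 expr1n mulNr.
by rewrite -mulr_natr mul1r.
Qed.

Lemma peak1_gt0 : 0 < normal_peak (1:R).
Proof. by rewrite normal_peak_gt0 ?oner_neq0. Qed.

Lemma phi_gt0 x : 0 < phi x.
Proof. by rewrite phiE mulr_gt0 ?peak1_gt0 ?expR_gt0. Qed.

Lemma is_derive_phi (x : R) : is_derive x 1 phi (- x * phi x).
Proof.
rewrite (_ : phi = fun x : R => normal_peak 1 * expR (- (x ^+ 2 / 2))); last first.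
  by apply/funext => y; rewrite phiE.
have H : is_derive x (1:R) (fun x : R => - (x ^+ 2 / 2)) (- x).
  by apply: is_derive_eq; rewrite /GRing.scale /=; field.
have H2 := @is_derive1_comp _ expR (fun x : R => - (x ^+ 2 / 2)) _ _ _ (is_derive_expR (- (x ^+ 2 / 2))) H.
apply: (is_derive_eq (is_deriveZ (normal_peak 1 : R) H2)).
by rewrite /GRing.scale /=; ring.
Qed.

Lemma continuous_phi : continuous phi.
Proof. by apply: continuous_normal_pdf; rewrite oner_neq0. Qed.

Lemma measurable_phi : measurable_fun [set: R] phi.
Proof. exact: measurable_normal_pdf. Qed.

Lemma integral_phi : (\int[mu]_x (phi x)%:E = 1)%E.
Proof. exact: integral_normal_pdf. Qed.

(** Up to a constant, [phi x] is the square of [exp (- x^2 / 4)]: one factor absorbs [x^2] through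
    [y <= exp y], the other is a normal density of variance 2. Integrability of every function of
    quadratic growth then follows from the normalization of that density. *)
Lemma sqr_phi_le (x : R) : x ^+ 2 * phi x <= 4 * Num.sqrt 2 * normal_pdf 0 (Num.sqrt 2) x.
Proof.
rewrite phiE normal_pdfE ?gt_eqF ?sqrtr_gt0// /normal_fun subr0 sqr_sqrtr//.
have -> : 4 * Num.sqrt 2 * (normal_peak (Num.sqrt 2) * expR (- x ^+ 2 / (2 *+ 2)))
  = normal_peak 1 * (4 * expR (- (x ^+ 2 / 4))) :> R.
  have -> : normal_peak (Num.sqrt 2) = (Num.sqrt 2)^-1 * normal_peak 1 :> R.
    rewrite /normal_peak sqr_sqrtr// expr1n -mulrnAr sqrtrM// mul1r invfM//.
  have s2 : Num.sqrt 2 != 0 :> R by rewrite gt_eqF// sqrtr_gt0.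
  rewrite (_ : - x ^+ 2 / (2 *+ 2) = - (x ^+ 2 / 4)); last first.
    by rewrite mulNr -mulr_natr -natrM.
  by field.
rewrite mulrCA ler_pM2l ?peak1_gt0//.
rewrite (_ : x ^+ 2 / 2 = x ^+ 2 / 4 + x ^+ 2 / 4); last by field.
rewrite opprD expRD mulrA ler_pM2r ?expR_gt0// expRN.
rewrite ler_pdivrMr ?expR_gt0//.
have := expR_ge1Dx (x ^+ 2 / 4); lra.
Qed.

Lemma integrable_poly_phi (h : R -> R) (C : R) :
  measurable_fun [set: R] h -> (forall x, `|h x| <= C * (1 + x ^+ 2)) ->
  mu.-integrable setT (fun x => (h x * phi x)%:E).
Proof.
move=> mh hC.
have C0 : 0 <= C.
  by have := hC 0; rewrite expr0n addr0 mulr1; exact: le_trans.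
pose g x := (C * phi x + C * (4 * Num.sqrt 2) * normal_pdf 0 (Num.sqrt 2) x)%R.
apply: (@le_integrable _ (measurableTypeR R) _ mu _ measurableT _ (EFin \o g)).
- by apply/measurable_EFinP; apply: measurable_funM => //; exact: measurable_normal_pdf.
- move=> x _ /=; rewrite lee_fin normrM (ger0_norm (ltW (phi_gt0 _))).
  apply: le_trans (ler_norm _); rewrite /g -mulrA -mulrDr.
  apply: (@le_trans _ _ (C * (1 + x ^+ 2) * phi x)).
    by rewrite ler_wpM2r ?(ltW (phi_gt0 _)).
  by rewrite -mulrA ler_wpM2l// mulrDl mul1r lerD2l sqr_phi_le.
- rewrite /g (_ : EFin \o _ = (fun x => C%:E * (phi x)%:E) \+ (fun x => (C * (4 * Num.sqrt 2))%:E * (normal_pdf 0 (Num.sqrt 2) x)%:E))%E; last first.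
    by apply/funext => x /=; rewrite EFinD !EFinM.
  by apply: integrableD => //; apply: integrableZl => //; exact: integrable_normal_pdf.
Qed.

Lemma cvg_mul_phi (h : R -> R) (c : R) : 0 < c -> (forall x, `|h x| <= c * (1 + `|x|)) ->
  (h x * phi x @[x --> +oo] --> 0) /\ (h x * phi x @[x --> -oo] --> 0).
Proof.
move=> c0 hC.
have K : exists C : R, 0 < C /\ forall x, 1 <= `|x| -> `|h x * phi x| <= C / `|x|.
  exists (c * (2 * (4 * Num.sqrt 2 * normal_peak (Num.sqrt 2)))).
  have s2 : 0 < Num.sqrt 2 :> R by rewrite sqrtr_gt0.
  split; first by rewrite !mulr_gt0// normal_peak_gt0// gt_eqF.
  move=> x x1; have x0 : 0 < `|x| by exact: lt_le_trans x1.
  rewrite normrM (ger0_norm (ltW (phi_gt0 _))) ler_pdivlMr// mulrAC -!mulrA.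
  apply: (@le_trans _ _ (c * (2 * `|x|) * (`|x| * phi x))).
    rewrite ler_wpM2r ?mulr_ge0 ?(ltW (phi_gt0 _))//.
    by rewrite (le_trans (hC _))// ler_pM2l//; lra.
  rewrite -!(mulrA c) !(ler_pM2l c0) -!(mulrA 2) !(ler_pM2l (@ltr0Sn _ 1)) !mulrA -expr2 real_normK ?num_real//.
  rewrite (le_trans (sqr_phi_le x))// ler_pM2l ?mulr_gt0//.
  by rewrite normal_pdf_ub// gt_eqF.
have [C [C0 hK]] := K.
have fin (e x : R) : 0 < e -> Num.max 1 (C / e) <= `|x| -> `|0 - h x * phi x| <= e.
  move=> e0; rewrite sub0r normrN ge_max => /andP[x1 xC].
  by rewrite (le_trans (hK _ x1))// ler_pdivrMr ?(lt_le_trans _ x1)// mulrC -ler_pdivrMr.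
split; apply/cvgrPdist_le => e e0; near=> x; apply: fin => //.
  apply: le_trans (ler_norm _); near: x; apply: nbhs_pinfty_ge.
  by rewrite num_real.
rewrite -normrN; apply: le_trans (ler_norm _); rewrite lerNr.
by near: x; apply: nbhs_ninfty_le; rewrite num_real.
Unshelve. all: by end_near. Qed.

(** Stein's identity: since [phi' = - x phi], the integrand is the derivative of [h * phi]. *)
Lemma integral_by_parts_phi (h h' : R -> R) (c : R) : 0 < c ->
  (forall x : R, is_derive x 1 h (h' x)) -> continuous h' ->
  (forall x, `|h x| <= c * (1 + `|x|)) -> (forall x, `|h' x| <= c * (1 + `|x|)) ->
  (\int[mu]_x ((h' x - x * h x) * phi x)%:E = 0)%E.
Proof.
move=> c0 dh ch' hb hb'.
have ch : continuous h.
  move=> x; apply: differentiable_continuous; apply/derivable1_diffP; exact: ex_derive.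
have cc : continuous (fun x => h' x - x * h x).
  by move=> x; apply: cvgB; [exact: ch'|apply: cvgM; [exact: cvg_id|exact: ch]].
have [H1 H2] := cvg_mul_phi c0 hb.
apply: (@integral_derivative_eq0 (h * phi)).
- move=> x; apply: (is_derive_eq (is_deriveM (dh x) (is_derive_phi x))).
  by rewrite /GRing.scale /=; ring.
- move=> x; apply: cvgM; last exact: continuous_phi.
  exact: cc.
- apply: (@integrable_poly_phi _ (3 * c)).
    by apply: continuous_measurable_fun.
  move=> x; apply: (le_trans (ler_normB _ _)); rewrite normrM.
  have := hb x; have := hb' x => h1 h2.
  have : `|x| * `|h x| <= `|x| * (c * (1 + `|x|)) by rewrite ler_wpM2l.
  rewrite -(real_normK (num_real x)).
  have : 0 <= c * (1 - `|x|) ^+ 2 by rewrite mulr_ge0 ?sqr_ge0// ltW.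
  nra.
- exact: H1.
- exact: H2.
Qed.

Lemma integral_id_phi : (\int[mu]_x (x * phi x)%:E = 0)%E.
Proof.
have := @integral_by_parts_phi (fun=> -1) (fun=> 0) 1 ltr01 _ _ _ _.
under eq_integral do rewrite sub0r mulrN1 opprK.
apply.
- by move=> x; exact: cvg_cst.
- by move=> x; rewrite normrN1 mul1r lerDl.
- by move=> x; rewrite normr0 mul1r addr_ge0.
Qed.

Lemma integral_sqr_phi : (\int[mu]_x (x ^+ 2 * phi x)%:E = 1)%E.
Proof.
have H := @integral_by_parts_phi (fun x => x) (fun=> 1) 1 ltr01 _ _ _ _.
have i1 : mu.-integrable setT (fun x => (phi x)%:E) by exact: integrable_normal_pdf.
have i2 : mu.-integrable setT (fun x => (x ^+ 2 * phi x)%:E).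
  apply: (@integrable_poly_phi _ 1); first exact: measurable_funX.
  by move=> x; rewrite mul1r ger0_norm ?sqr_ge0// lerDr.
have : (\int[mu]_x ((phi x)%:E - (x ^+ 2 * phi x)%:E) = 0)%E.
  rewrite -[RHS]H//.
  - by apply: eq_integral => x _; rewrite -EFinB mulrBl mul1r expr2.
  - by move=> x; exact: cvg_cst.
  - by move=> x; rewrite mul1r lerDr.
  - by move=> x; rewrite normr1 mul1r lerDl.
rewrite integralB// integral_phi => /eqP; rewrite sube_eq ?add0e; [by move=> /eqP <-|by []|].
by rewrite fin_num_adde_defr.
Qed.

Lemma integrable_bounded_phi (h : R -> R) (C : R) :
  measurable_fun [set: R] h -> (forall x, `|h x| <= C) ->
  mu.-integrable setT (fun x => (h x * phi x)%:E).
Proof.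
move=> mh hC; apply: (@integrable_poly_phi _ C) => // x.
rewrite (le_trans (hC x))// ler_peMr ?lerDl ?sqr_ge0//.
exact: le_trans (hC 0).
Qed.

Lemma norm_cos_le1 (x : R) : `|cos x| <= 1.
Proof. by rewrite ler_norml cos_geN1 cos_le1. Qed.

Lemma norm_sin_le1 (x : R) : `|sin x| <= 1.
Proof. by rewrite ler_norml sin_geN1 sin_le1. Qed.

Lemma is_derive_cosl (th x t : R) : is_derive t (1:R) (fun t => cos (th + t * x)) (- (x * sin (th + t * x))).
Proof.
have H : is_derive t (1:R) (fun t : R => th + t * x) x.
  by apply: is_derive_eq; rewrite /GRing.scale /=; ring.
have H2 := @is_derive1_comp _ cos (fun t : R => th + t * x) _ _ _ (is_derive_cos (th + t * x)) H.
by apply: (is_derive_eq H2); ring.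
Qed.

Lemma is_derive_sinr (th x t : R) : is_derive x (1:R) (fun x => sin (th + t * x)) (t * cos (th + t * x)).
Proof.
have H : is_derive x (1:R) (fun x : R => th + t * x) t.
  by apply: is_derive_eq; rewrite /GRing.scale /=; ring.
have H2 := @is_derive1_comp _ sin (fun x : R => th + t * x) _ _ _ (is_derive_sin (th + t * x)) H.
by apply: (is_derive_eq H2); ring.
Qed.

Lemma continuous_cosl (th t : R) : continuous (fun x => cos (th + t * x)).
Proof.
move=> x; apply: (@continuous_comp _ _ _ (fun x => th + t * x) cos); last exact: continuous_cos.
by apply: cvgD; [exact: cvg_cst|apply: cvgM; [exact: cvg_cst|exact: cvg_id]].
Qed.

(** Differentiation under the integral followed by Stein's identity for the sine gives [C' = - t C],
    so [C t * exp (t^2 / 2)] is constant in [t]. The phase [th] carries the real and the imaginary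
    part of the characteristic function at once. *)
Lemma integral_cos_phi (th t : R) :
  (\int[mu]_x (cos (th + t * x) * phi x)%:E = (cos th * expR (- (t ^+ 2 / 2)))%:E)%E.
Proof.
pose f (t x : R) := cos (th + t * x) * phi x.
pose C (t : R) : R := \int[mu]_x f t x.
have fi t' : mu.-integrable setT (EFin \o f t').
  apply: (@integrable_bounded_phi _ 1); last by move=> x; exact: norm_cos_le1.
  by apply: continuous_measurable_fun; exact: continuous_cosl.
have df t' x : is_derive t' (1:R) (f ^~ x) (- (x * sin (th + t' * x)) * phi x).
  rewrite (_ : f ^~ x = phi x \*: (fun t => cos (th + t * x))); last first.
    by apply/funext => u; rewrite /f /= /GRing.scale /= mulrC.
  apply: (is_derive_eq (is_deriveZ (phi x) (is_derive_cosl th x t'))).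
  by rewrite /GRing.scale /= mulrC.
have d1f t' x : partial1of2 f t' x = - (x * sin (th + t' * x)) * phi x.
  by rewrite partial1of2E derive_val.
have dC t' : is_derive t' (1:R) C (- t' * C t').
  have I0 : `](t' - 1), (t' + 1)[%classic t'.
    by rewrite /= in_itv/= ltrBlDr ltrDl ltr01.
  have iG : mu.-integrable setT (EFin \o (fun x => `|x| * phi x)).
    apply: (@integrable_poly_phi _ 1) => //.
    by move=> x; rewrite normr_id mul1r -(real_normK (num_real x)); have := sqr_ge0 (`|x| - 1); nra.
  have G0 x : 0 <= `|x| * phi x by rewrite mulr_ge0// ltW// phi_gt0.
  have Gub u x : `](t' - 1), (t' + 1)[%classic u -> [set: R] x -> `|partial1of2 f u x| <= `|x| * phi x.
    move=> _ _; rewrite d1f normrM (ger0_norm (ltW (phi_gt0 _))) ler_wpM2r ?(ltW (phi_gt0 _))//.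
    by rewrite normrN normrM ler_piMr// norm_sin_le1.
  have dfb u x : `](t' - 1), (t' + 1)[%classic u -> [set: R] x -> derivable (f ^~ x) u 1.
    by move=> _ _; exact: ex_derive.
  have D := @derivable_under_integral _ _ (measurableTypeR R) mu f setT measurableT t' _ _ I0 (fun x _ => fi x) dfb _ G0 iG Gub.
  have E := @differentiation_under_integral _ _ (measurableTypeR R) mu f setT measurableT t' _ _ I0 (fun x _ => fi x) dfb _ G0 iG Gub.
  apply: DeriveDef => //; rewrite -derive1E E.
  rewrite /Rintegral.
  have i1 : mu.-integrable setT (fun x => (t' * f t' x)%:E).
    under eq_fun do rewrite EFinM; apply: integrableZl => //; exact: fi.
  have i2 : mu.-integrable setT (fun x => (x * sin (th + t' * x) * phi x)%:E).
    apply: (@integrable_poly_phi _ 1).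
      apply: measurable_funM => //; apply: continuous_measurable_fun => x.
      by apply: differentiable_continuous; apply/derivable1_diffP; have [] := is_derive_sinr th x t'.
    move=> x; rewrite mul1r normrM (@le_trans _ _ `|x|)//.
      by rewrite ler_piMr// norm_sin_le1.
    by rewrite -(real_normK (num_real x)); have := sqr_ge0 (`|x| - 1); nra.
  have H : (\int[mu]_x ((t' * f t' x)%:E - (x * sin (th + t' * x) * phi x)%:E) = 0)%E.
    rewrite -[RHS](@integral_by_parts_phi (fun x => sin (th + t' * x)) (fun x => t' * cos (th + t' * x)) (1 + `|t'|)).
    - by apply: eq_integral => x _; rewrite -EFinB; congr EFin; rewrite /f; ring.
    - by rewrite ltr_pwDl.
    - by move=> x; exact: is_derive_sinr.
    - by move=> x; apply: cvgM; [exact: cvg_cst|exact: continuous_cosl].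
    - move=> x; rewrite (le_trans (norm_sin_le1 _))//.
      have := normr_ge0 t'; have := normr_ge0 x; nra.
    - move=> x; rewrite normrM (@le_trans _ _ `|t'|)//.
        by rewrite ler_piMr// norm_cos_le1.
      have := normr_ge0 t'; have := normr_ge0 x; nra.
  rewrite integralB//= in H.
  have E2 : (\int[mu]_x (t' * f t' x)%:E = (t' * C t')%:E)%E.
    under eq_integral do rewrite EFinM.
    rewrite integralZl//; last exact: fi.
    by rewrite EFinM /C /Rintegral fineK//; apply: integrable_fin_num => //; exact: fi.
  have E3 : (\int[mu]_x (x * sin (th + t' * x) * phi x)%:E = (t' * C t')%:E)%E.
    move/eqP: H; rewrite E2 sube_eq ?add0e//; by move=> /eqP <-.
  rewrite (_ : (\int[mu]_x _)%E = (-1)%:E * (\int[mu]_x (x * sin (th + t' * x) * phi x)%:E))%E.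
    by rewrite E3 -EFinM /= mulN1r mulNr.
  rewrite -integralZl//; apply: eq_integral => x _.
  by rewrite d1f -EFinM mulN1r mulNr.
pose E (u : R) := C u * expR (u ^+ 2 / 2).
have dE u : is_derive u (1:R) E 0.
  have H : is_derive u (1:R) (fun x : R => x ^+ 2 / 2) u.
    by apply: is_derive_eq; rewrite /GRing.scale /=; field.
  have H2 := @is_derive1_comp _ expR (fun x : R => x ^+ 2 / 2) _ _ _ (is_derive_expR (u ^+ 2 / 2)) H.
  apply: (is_derive_eq (is_deriveM (dC u) H2)).
  by rewrite /GRing.scale /=; ring.
have := is_derive_0_is_cst t 0 dE.
rewrite /E expr0n mul0r expR0 mulr1 => Et.
have C0 : C 0 = cos th.
  rewrite /C /Rintegral /f; under eq_integral do rewrite mul0r addr0 EFinM.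
  rewrite integralZl//; last exact: integrable_normal_pdf.
  by rewrite integral_phi mule1.
rewrite -C0 -Et -mulrA -expRD addrN expR0 mulr1 /C /Rintegral fineK//.
by apply: integrable_fin_num => //; exact: fi.
Qed.
End line.

(** * The standard Gaussian measure on R^m *)

Section gauss_measure.
Context (R : realType).
Notation mu := (@lebesgue_measure R).
Notation phi := (normal_pdf 0 (1:R)).

Definition gpdf m (x : 'rV[R]_m) : R := \prod_(i < m) phi (x ord0 i).

Definition gauss m (A : set 'rV[R]_m) : \bar R := (\int[leb R m]_(x in A) (gpdf x)%:E)%E.
Arguments gauss m A : clear implicits.

Lemma gpdf_gt0 m (x : 'rV[R]_m) : 0 < gpdf x.
Proof. by apply: prodr_gt0 => i _; exact: phi_gt0. Qed.

Lemma gpdf_ge0 m (x : 'rV[R]_m) : 0 <= gpdf x.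
Proof. exact/ltW/gpdf_gt0. Qed.

Lemma measurable_gpdf m : measurable_fun [set: 'rV[R]_m] (@gpdf m).
Proof.
apply: measurable_prod => i _.
exact: (measurableT_comp (@measurable_phi R) (measurable_coord i)).
Qed.

Lemma gpdf_cons m (a : R) (x : 'rV[R]_m) : gpdf (rV_cons (a, x)) = phi a * gpdf x.
Proof.
rewrite /gpdf big_ord_recl rV_cons0; congr (_ * _).
by apply: eq_bigr => i _; rewrite rV_consl.
Qed.

Lemma integral_gpdf m : (\int[leb R m]_x (gpdf x)%:E = 1)%E.
Proof.
under eq_integral do rewrite /gpdf -prodEFin.
rewrite (@leb_prod_integral R m (fun=> EFin \o phi)).
- by apply: big1 => i _; exact: integral_phi.
- by move=> i; apply/measurable_EFinP; exact: measurable_phi.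
- by move=> i x; rewrite lee_fin ltW// phi_gt0.
Qed.

Lemma integrable_gpdf m : (leb R m).-integrable setT (EFin \o @gpdf m).
Proof.
apply/integrableP; split; first by apply/measurable_EFinP; exact: measurable_gpdf.
under eq_integral do rewrite /= (ger0_norm (gpdf_ge0 _)).
by rewrite integral_gpdf ltry.
Qed.

Section instance.
Context (m : nat).

Let gauss0 : gauss m set0 = 0%E.
Proof. by rewrite /gauss integral_set0. Qed.

Let gauss_ge0 (A : set 'rV[R]_m) : (0 <= gauss m A)%E.
Proof. by apply: integral_ge0 => x _; rewrite lee_fin gpdf_ge0. Qed.

Let gauss_sigma_additive : semi_sigma_additive (gauss m).
Proof.
move=> /= A mA tA mUA.
rewrite /gauss/= integral_bigcup//=; last first.
  by apply: (integrableS _ _ (subsetT _)) => //; exact: integrable_gpdf.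
apply: is_cvg_ereal_nneg_natsum_cond => n _ _.
by apply: integral_ge0 => /= x ?; rewrite lee_fin gpdf_ge0.
Qed.

HB.instance Definition _ := isMeasure.Build _ _ _ (gauss m)
  gauss0 gauss_ge0 gauss_sigma_additive.

Let gauss_setT : gauss m [set: 'rV[R]_m] = 1%E.
Proof. exact: integral_gpdf. Qed.

HB.instance Definition _ := @Measure_isProbability.Build _ _ R (gauss m) gauss_setT.

End instance.

Lemma gauss_integral m (F : 'rV[R]_m -> \bar R) :
  measurable_fun [set: 'rV[R]_m] F -> (forall x, 0 <= F x)%E ->
  (\int[gauss m]_x F x = \int[leb R m]_x (F x * (gpdf x)%:E))%E.
Proof.
move=> mF F0.
exact: (@ge0_integral_density _ _ R (leb R m) (gauss m) (@gpdf m) (@measurable_gpdf m) (@gpdf_ge0 m)).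
Qed.

Lemma gauss_integralS m (F : 'rV[R]_m.+1 -> \bar R) :
  measurable_fun [set: 'rV[R]_m.+1] F -> (forall x, 0 <= F x)%E ->
  (\int[gauss m.+1]_x F x =
   \int[mu]_a ((\int[gauss m]_x F (rV_cons (a, x))) * (phi a)%:E))%E.
Proof.
move=> mF F0.
have mg k : measurable_fun [set: 'rV[R]_k] (fun x => (gpdf x)%:E).
  by apply/measurable_EFinP; exact: measurable_gpdf.
rewrite gauss_integral//.
rewrite leb_integralS; last 2 first.
- by apply: emeasurable_funM => //; exact: mg.
- by move=> x; rewrite mule_ge0// lee_fin gpdf_ge0.
apply: eq_integral => a _.
have mFa : measurable_fun [set: 'rV[R]_m] (fun x => F (rV_cons (a, x))).
  apply: (measurableT_comp mF); apply: (measurableT_comp (@measurable_rV_cons R m)).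
  exact: measurable_pair1.
rewrite gauss_integral// -ge0_integralZr//; last 3 first.
- by apply: emeasurable_funM => //; exact: mg.
- by move=> x _; rewrite mule_ge0// lee_fin gpdf_ge0.
- by rewrite lee_fin ltW// phi_gt0.
by apply: eq_integral => x _; rewrite gpdf_cons mulrC EFinM muleA.
Qed.

Lemma dot_cons m (a b : R) (x y : 'rV[R]_m) : dot (rV_cons (a, x)) (rV_cons (b, y)) = a * b + dot x y.
Proof.
rewrite /dot big_ord_recl !rV_cons0; congr (_ + _).
by apply: eq_bigr => i _; rewrite !rV_consl.
Qed.

Lemma measurable_dot m : measurable_fun [set: 'rV[R]_m * 'rV[R]_m] (fun p => dot p.1 p.2).
Proof.
rewrite /dot; apply: measurable_sum => i; apply: measurable_funM.
  exact: (measurableT_comp (measurable_coord i) measurable_fst).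
exact: (measurableT_comp (measurable_coord i) measurable_snd).
Qed.

Lemma dot_ge0 m (x : 'rV[R]_m) : 0 <= dot x x.
Proof. by apply: sumr_ge0 => i _; rewrite -expr2 sqr_ge0. Qed.

Lemma measurable_cos : measurable_fun [set: R] (@cos R).
Proof. by apply: continuous_measurable_fun; exact: continuous_cos. Qed.

Lemma measurable_1Dcos dT (T : measurableType dT) (h : T -> R) :
  measurable_fun [set: T] h -> measurable_fun [set: T] (fun x => (1 + cos (h x))%:E).
Proof.
move=> mh; apply/measurable_EFinP; apply: measurable_funD => //.
exact: (measurableT_comp measurable_cos).
Qed.

Lemma onePcos_ge0 (x : R) : (0 <= (1 + cos x)%:E)%E.
Proof. by rewrite lee_fin; have := cos_geN1 x; lra. Qed.

(** The summand 1 makes the integrand nonnegative, so coordinates are integrated one by one without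
    integrability conditions. The phase is arbitrary because the coordinate kept outside enters the
    phase of the induction hypothesis. *)
Lemma gauss_cos m (v : 'rV[R]_m) (th : R) :
  (\int[gauss m]_z (1 + cos (th + dot v z))%:E = (1 + cos th * expR (- (dot v v / 2)))%:E)%E.
Proof.
have md k (u : 'rV[R]_k) th' : measurable_fun [set: 'rV[R]_k] (fun z => th' + dot u z).
  apply: measurable_funD => //.
  exact: (measurableT_comp (@measurable_dot k) (@measurable_pair1 _ _ _ _ u)).
elim: m v th => [|m IH] v th.
  rewrite gauss_integral; [|by apply: measurable_1Dcos; exact: md|by move=> ?; exact: onePcos_ge0].
  rewrite leb_integral0; last first.
    apply: emeasurable_funM; first by apply: measurable_1Dcos; exact: md.
    by apply/measurable_EFinP; exact: measurable_gpdf.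
  by rewrite /gpdf /dot !big_ord0 mule1 mul0r oppr0 expR0 addr0 mulr1.
rewrite gauss_integralS; [|by apply: measurable_1Dcos; exact: md|by move=> ?; exact: onePcos_ge0].
pose v0 := v ord0 ord0; pose v' : 'rV[R]_m := \row_j v ord0 (lift ord0 j).
have vE : v = rV_cons (v0, v') by rewrite rV_consS.
pose e := expR (- (dot v' v' / 2)).
have i1 : mu.-integrable setT (fun x => (phi x)%:E) by exact: integrable_normal_pdf.
have i2 : mu.-integrable setT (fun x => (cos (th + v0 * x) * phi x)%:E).
  apply: (@integrable_bounded_phi _ _ 1); last by move=> x; exact: norm_cos_le1.
  by apply: continuous_measurable_fun; exact: continuous_cosl.
transitivity (\int[mu]_a ((phi a)%:E + e%:E * (cos (th + v0 * a) * phi a)%:E))%E.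
  apply: eq_integral => a _.
  have -> : (\int[gauss m]_x (1 + cos (th + dot v (rV_cons (a, x))))%:E =
      \int[gauss m]_x (1 + cos (th + v0 * a + dot v' x))%:E)%E.
    by apply: eq_integral => x _; rewrite [in LHS]vE dot_cons addrA.
  by rewrite IH -!EFinM -EFinD; congr EFin; rewrite /e; ring.
rewrite integralD//; last exact: integrableZl.
rewrite integral_phi integralZl// integral_cos_phi -EFinM -EFinD.
congr EFin; rewrite vE dot_cons mulrDl opprD expRD -expr2 /e; ring.
Qed.
End gauss_measure.
Arguments gauss R m A : clear implicits.

Section tonelli.
Local Open Scope ereal_scope.

Lemma tonelli d1 d2 (T1 : measurableType d1) (T2 : measurableType d2) (R : realType)
    (m1 : {sigma_finite_measure set T1 -> \bar R})
    (m2 : {sigma_finite_measure set T2 -> \bar R}) (f : T1 -> T2 -> \bar R) :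
  measurable_fun [set: T1 * T2] (fun p => f p.1 p.2) -> (forall x y, 0 <= f x y) ->
  \int[m1]_x \int[m2]_y f x y = \int[m2]_y \int[m1]_x f x y.
Proof.
by move=> mf f0; apply: (@fubini_tonelli _ _ _ _ _ m1 m2 (fun p => f p.1 p.2)) => // p; exact: f0.
Qed.
End tonelli.

(** * Measures on R^m determined by their one-dimensional projections *)

Section cramer_wold.
Context (R : realType).

Lemma gpdfE m (x : 'rV[R]_m) : gpdf x = normal_peak 1 ^+ m * expR (- (dot x x / 2)).
Proof.
elim: m x => [|m IH] x; first by rewrite /gpdf /dot !big_ord0 mul0r oppr0 expR0 mulr1.
by rewrite -[x]rV_consS gpdf_cons IH dot_cons phiE mulrACA -expRD -opprD -mulrDl -exprS -expr2.
Qed.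

Lemma measurable_dot_comp dT (T : measurableType dT) m (f g : T -> 'rV[R]_m) :
  measurable_fun [set: T] f -> measurable_fun [set: T] g ->
  measurable_fun [set: T] (fun x => dot (f x) (g x)).
Proof.
move=> mf mg; rewrite /dot; apply: measurable_sum => i; apply: measurable_funM.
  exact: (measurableT_comp (measurable_coord i) mf).
exact: (measurableT_comp (measurable_coord i) mg).
Qed.

Definition orthant m (t : 'rV[R]_m) : set 'rV[R]_m := [set x | forall i, x ord0 i <= t ord0 i].

Lemma measurable_orthant m (t : 'rV[R]_m) : measurable (orthant t).
Proof.
rewrite (_ : orthant t = \bigcap_(i in [set: 'I_m]) ((fun x : 'rV[R]_m => x ord0 i) @^-1` `]-oo, t ord0 i])).
  apply: fin_bigcap_measurable => // i _.
  by rewrite -[X in measurable X]setTI; apply: measurable_coord.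
apply/seteqP; split=> x /= H i; first by move=> _; rewrite /= in_itv/=; exact: H.
by have := H i Logic.I; rewrite /= in_itv.
Qed.

(** Orthants are stable under intersection and exhaust the space; what remains is that they generate
    the sigma-algebra of the coordinates. *)
Lemma orthant_unique m (mu nu : {measure set 'rV[R]_m -> \bar R}) :
  (mu setT < +oo)%E -> (forall t, mu (orthant t) = nu (orthant t)) ->
  forall A, measurable A -> mu A = nu A.
Proof.
move=> muT H A mA.
pose G : set (set 'rV[R]_m) := range (@orthant m).
have GI : setI_closed G.
  move=> _ _ [s _ <-] [t _ <-].
  exists (\row_i Num.min (s ord0 i) (t ord0 i)) => //.
  apply/seteqP; split=> x /=; rewrite /orthant/=.
    by move=> xst; split=> i; have := xst i; rewrite mxE le_min => /andP[].
  by move=> [xs xt] i; rewrite mxE le_min xs xt.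
pose g (k : nat) : set 'rV[R]_m := orthant (const_mx k%:R).
have gT : \bigcup_k g k = [set: 'rV[R]_m].
  apply/seteqP; split => // x _.
  exists (\sum_(i < m) (Num.trunc `|x ord0 i|).+1)%N => // i.
  rewrite mxE (le_trans (ler_norm _))// (le_trans (ltW (truncnS_gt _)))// ler_nat.
  by rewrite (bigD1 i)//= leq_addr.
have mG : G `<=` measurable by move=> _ [t _ <-]; exact: measurable_orthant.
apply: (@g_sigma_algebra_measure_unique _ _ _ G mG g) => //.
- by move=> k; exists (const_mx k%:R).
- by move=> _ [t _ <-]; exact: H.
- by move=> k; apply: le_lt_trans muT; apply: le_measure; rewrite ?inE//; exact: measurable_orthant.
move: A mA; apply: smallest_sub; first exact: smallest_sigma_algebra.
rewrite -bigcup_seq => B /= [i _ [C mC <-]]; rewrite setTI.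
(* Good sets: those whose preimage under the coordinate [i] is generated by orthants. A ray is a
   union of orthants whose other bounds [k] tend to infinity; half-open intervals follow by
   difference. *)
pose S : set (set R) := [set D | <<s G >> ((fun x : 'rV[R]_m => x ord0 i) @^-1` D)].
have sG := @smallest_sigma_algebra _ setT G.
have [sG0 sGC sGU] := sG.
have SS : sigma_algebra setT S.
  split.
  - by rewrite /S /= preimage_set0.
  - by move=> D; rewrite /S /= => SD; rewrite setTD preimage_setC -setTD; exact: sGC.
  - by move=> D; rewrite /S /= => SD; rewrite preimage_bigcup; exact: sGU.
suff : @ocitv R `<=` S by move/(smallest_sub SS); apply.
have Sray t : S `]-oo, t]%classic.
  rewrite /S /=.
  rewrite (_ : _ @^-1` _ = \bigcup_k orthant (\row_j (if j == i then t else k%:R))).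
    by apply: sGU => k; apply: sub_sigma_algebra; exists (\row_j (if j == i then t else k%:R)).
  apply/seteqP; split=> x /=; rewrite in_itv/=.
    move=> xt; have [k _ xk] : (\bigcup_k g k) x by rewrite gT.
    by exists k => // j; rewrite mxE; case: eqP => [->//|_]; have := xk j; rewrite mxE.
  by move=> [k _ /(_ i)]; rewrite mxE eqxx.
move=> _ [[a b] _ <-] /=.
rewrite (_ : `]a, b]%classic = `]-oo, b]%classic `&` (setT `\` `]-oo, a]%classic)); last first.
  apply/seteqP; split=> x /=; rewrite !in_itv/=.
    by move=> /andP[ax ->]; split => //; split => //; apply/negP; rewrite -ltNge.
  by move=> [-> [_ /negP]]; rewrite -ltNge => ->.
have SI D E : S D -> S E -> S (D `&` E).
  move=> SD SE; have [_ sc su] := SS.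
  rewrite (_ : D `&` E = setT `\` (\bigcup_k (bigcup2 (~` D) (~` E)) k)); last first.
    by rewrite bigcup2E setTD setCU !setCK.
  suff H2 k : S (bigcup2 (~` D) (~` E) k) by exact: (sc _ (su _ H2)).
  case: k => [|[|k]] /=.
  - by have := sc _ SD; rewrite setTD.
  - by have := sc _ SE; rewrite setTD.
  - by have [] := SS.
by apply: SI; [exact: Sray|have [_ sc _] := SS; apply: sc; exact: Sray].
Qed.

Local Open Scope ereal_scope.

(** A real substitute for the characteristic function: [th = 0] and [th = - pi / 2] give its real
    and imaginary parts, up to the mass of [mu]. *)
Definition cosint m (mu : {measure set 'rV[R]_m -> \bar R}) (c : 'rV[R]_m) (th : R) : \bar R :=
  \int[mu]_w (1 + cos (th + dot c w))%:E.

Variables (m : nat) (mu nu : probability 'rV[R]_m R).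
Hypothesis mn : forall c th, cosint mu c th = cosint nu c th.

Let intcst (la : probability 'rV[R]_m R) (r : \bar R) : \int[la]_w r = r.
Proof.
have la1 : la [set: 'rV[R]_m] = 1 by exact: probability_setT.
by rewrite integral_cst// -[RHS]mule1; congr (_ * _).
Qed.

Let smooth_gpdf (y : 'rV[R]_m) (e : R) :
  \int[mu]_w (gpdf (e *: (y - w))%R)%:E = \int[nu]_w (gpdf (e *: (y - w))%R)%:E.
Proof.
have maff : measurable_fun [set: 'rV[R]_m] (fun w => e *: (y - w))%R.
  rewrite (_ : (fun _ => _) = (fun w => (- e) *: w + e *: y)%R); last first.
    by apply/funext => w; rewrite scalerBr addrC scaleNr.
  exact: measurable_rV_affine.
have mexp : measurable_fun [set: 'rV[R]_m] (fun w => (expR (- (dot (e *: (y - w)) (e *: (y - w)) / 2)))%:E)%R.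
  apply/measurable_EFinP; apply: measurableT_comp => //; apply: measurableT_comp => //.
  apply: measurable_funM => //.
  exact: measurable_dot_comp.
have mc : measurable_fun [set: 'rV[R]_m * 'rV[R]_m] (fun p => (1 + cos (0 + dot (e *: (y - p.1)) p.2))%:E)%R.
  apply: measurable_1Dcos; apply: measurable_funD => //.
  apply: measurable_dot_comp; first exact: (measurableT_comp maff measurable_fst).
  exact: measurable_snd.
(* The Gaussian is its own Fourier transform: as a function of [w], the bump centred at [y] is an
   average of cosines over a Gaussian frequency [z]. Tonelli exchanges the two averages, and the
   inner integral becomes [cosint]. *)
have H (la : probability 'rV[R]_m R) :
    1 + \int[la]_w (expR (- (dot (e *: (y - w)) (e *: (y - w)) / 2)))%:E =
    \int[gauss R m]_z cosint la (- e *: z)%R (e * dot y z)%R.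
  transitivity (\int[la]_w \int[gauss R m]_z (1 + cos (0 + dot (e *: (y - w)) z))%R%:E).
    under [RHS]eq_integral do rewrite gauss_cos cos0 mul1r EFinD.
    rewrite ge0_integralD//.
    by rewrite intcst.
  have c0 (p : 'rV[R]_m * 'rV[R]_m) : 0 <= (1 + cos (0 + dot (e *: (y - p.1)) p.2))%R%:E.
    exact: onePcos_ge0.
  rewrite (@tonelli _ _ _ _ _ la (gauss R m) (fun w z => (1 + cos (0 + dot (e *: (y - w)) z))%R%:E) mc (fun w z => c0 (w, z))).
  apply: eq_integral => z _; apply: eq_integral => w _; congr ((1 + cos _)%:E)%R.
  rewrite add0r /dot mulr_sumr -big_split/=; apply: eq_bigr => i _; rewrite !mxE; ring.
have fin (la : probability 'rV[R]_m R) :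
    \int[la]_w (expR (- (dot (e *: (y - w)) (e *: (y - w)) / 2)))%:E \is a fin_num.
  rewrite ge0_fin_numE; last by apply: integral_ge0 => w _; rewrite lee_fin expR_ge0.
  apply: (@le_lt_trans _ _ (\int[la]_w 1)).
    apply: ge0_le_integral => //.
    - by move=> w _; rewrite lee_fin -[leRHS]expR0 ler_expR oppr_le0 divr_ge0// dot_ge0.
  by rewrite intcst ltry.
have E : \int[mu]_w (expR (- (dot (e *: (y - w)) (e *: (y - w)) / 2)))%:E =
         \int[nu]_w (expR (- (dot (e *: (y - w)) (e *: (y - w)) / 2)))%:E.
  have Hmu := H mu; have Hnu := H nu.
  have E1 : 1 + \int[mu]_w (expR (- (dot (e *: (y - w)) (e *: (y - w)) / 2)))%:E =
     1 + \int[nu]_w (expR (- (dot (e *: (y - w)) (e *: (y - w)) / 2)))%:E.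
    by rewrite Hmu Hnu; apply: eq_integral => z _; exact: mn.
  by move: E1; rewrite -(fineK (fin mu)) -(fineK (fin nu)) -!EFinD => -[/addrI ->].
under eq_integral do rewrite gpdfE EFinM.
under [RHS]eq_integral do rewrite gpdfE EFinM.
have pk : (0 <= normal_peak (1:R) ^+ m)%R by rewrite exprn_ge0// normal_peak_ge0.
rewrite !ge0_integralZl// ?E//; move=> w _; by rewrite lee_fin expR_ge0.
Qed.

(** The substitution [y = e z + w] turns an indicator smoothed by Gaussian noise into a mixture over
    [y] of Gaussian bumps in [w], on which [mu] and [nu] agree by [smooth_gpdf]. *)
Let smooth_orthant (t : 'rV[R]_m) (e : R) : (0 < e)%R ->
  \int[mu]_w \int[gauss R m]_z (\1_(orthant t) (e *: z + w)%R)%:E =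
  \int[nu]_w \int[gauss R m]_z (\1_(orthant t) (e *: z + w)%R)%:E.
Proof.
move=> e0.
have mor : measurable_fun [set: 'rV[R]_m] (fun y => (\1_(orthant t) y)%:E : \bar R).
  by apply/measurable_EFinP; apply: measurable_indic; exact: measurable_orthant.
have mg : measurable_fun [set: 'rV[R]_m * 'rV[R]_m] (fun p => (gpdf (e^-1 *: (p.2 - p.1)))%:E)%R.
  apply/measurable_EFinP; apply: (measurableT_comp (@measurable_gpdf R m)).
  apply: measurable_fun_rVP => i; under eq_fun do rewrite !mxE.
  apply: measurable_funM => //; apply: measurable_funB.
    exact: (measurableT_comp (measurable_coord i) measurable_snd).
  exact: (measurableT_comp (measurable_coord i) measurable_fst).
have mg1 (w : 'rV[R]_m) : measurable_fun [set: 'rV[R]_m] (fun y => (gpdf (e^-1 *: (y - w)))%:E)%R.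
  exact: (measurableT_comp mg (@measurable_pair1 _ _ _ _ w)).
have mg2 (y : 'rV[R]_m) : measurable_fun [set: 'rV[R]_m] (fun w => (gpdf (e^-1 *: (y - w)))%:E)%R.
  exact: (measurableT_comp mg (@measurable_pair2 _ _ _ _ y)).
have H (la : probability 'rV[R]_m R) :
   \int[la]_w \int[gauss R m]_z (\1_(orthant t) (e *: z + w)%R)%:E =
   \int[leb R m]_y ((e^-1 ^+ m)%:E * ((\1_(orthant t) y)%:E * \int[la]_w (gpdf (e^-1 *: (y - w))%R)%:E)).
  transitivity (\int[la]_w \int[leb R m]_y ((e^-1 ^+ m)%:E * ((\1_(orthant t) y)%:E * (gpdf (e^-1 *: (y - w))%R)%:E))).
    apply: eq_integral => w _.
    rewrite gauss_integral; last 2 first.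
    - exact: (measurableT_comp mor (measurable_rV_affine e w)).
    - by move=> z; rewrite lee_fin.
    rewrite ge0_integralZl//; last 3 first.
    - exact: emeasurable_funM.
    - by move=> y _; rewrite mule_ge0// lee_fin// gpdf_ge0.
    - by rewrite lee_fin exprn_ge0// invr_ge0 ltW.
    have mp : measurable_fun [set: 'rV[R]_m] (fun y => (\1_(orthant t) y)%:E * (gpdf (e^-1 *: (y - w))%R)%:E).
      exact: emeasurable_funM.
    have p0 y : 0 <= (\1_(orthant t) y)%:E * (gpdf (e^-1 *: (y - w))%R)%:E.
      by rewrite mule_ge0// lee_fin// gpdf_ge0.
    rewrite -(leb_affine w e0 mp p0).
    apply: eq_integral => z _; congr (_ * (gpdf _)%:E).
    by rewrite addrK scalerA mulVf ?scale1r// gt_eqF.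
  pose F (p : 'rV[R]_m * 'rV[R]_m) := (e^-1 ^+ m)%:E * ((\1_(orthant t) p.2)%:E * (gpdf (e^-1 *: (p.2 - p.1))%R)%:E).
  have mFF : measurable_fun [set: 'rV[R]_m * 'rV[R]_m] F.
    apply: emeasurable_funM => //; apply: emeasurable_funM => //.
    exact: (measurableT_comp mor measurable_snd).
  have F0 p : 0 <= F p.
    by rewrite !mule_ge0// lee_fin ?gpdf_ge0// exprn_ge0// invr_ge0 ltW.
  rewrite (@tonelli _ _ _ _ _ la (leb R m) (fun w y => (e^-1 ^+ m)%:E * ((\1_(orthant t) y)%:E * (gpdf (e^-1 *: (y - w))%R)%:E)) mFF (fun w y => F0 (w, y))).
  apply: eq_integral => y _ /=.
  rewrite -!ge0_integralZl//.
  - exact: emeasurable_funM.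
  - by move=> w _; rewrite mule_ge0// lee_fin// gpdf_ge0.
  - by rewrite lee_fin exprn_ge0// invr_ge0 ltW.
  - by move=> w _; rewrite lee_fin gpdf_ge0.
rewrite !H; apply: eq_integral => y _; by rewrite smooth_gpdf.
Qed.

Theorem cramer_wold (A : set 'rV[R]_m) : measurable A -> mu A = nu A.
Proof.
apply: (@orthant_unique m mu nu); first exact: (le_lt_trans (probability_le1 mu measurableT) (ltry _)).
move=> t.
(* The orthant is enlarged by [dl k] while the noise has the smaller scale [dl k ^+ 2]. The
   enlargement eventually beats the noise at boundary points too, so the smoothed indicators
   converge at every [w], not only off a null set. *)
pose dl (k : nat) : R := (k.+1%:R^-1)%R.
pose tk (k : nat) : 'rV[R]_m := (t + const_mx (dl k))%R.
pose h (k : nat) (w z : 'rV[R]_m) : \bar R := (\1_(orthant (tk k)) (dl k ^+ 2 *: z + w)%R)%:E.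
have dl0 k : (0 < dl k)%R by rewrite invr_gt0.
have hcvg w z : h k w z @[k --> \oo] --> (\1_(orthant t) w)%:E.
  apply: cvg_near_cst.
  have [tw|/existsNP[i /negP]] := pselect (orthant t w).
    exists (\sum_(i < m) (Num.trunc `|z ord0 i|).+1)%N => // k /= km.
    rewrite /h !indicE !mem_set// => i; rewrite !mxE addrC lerD//.
    rewrite expr2 -mulrA ger_pMr// ler_pdivrMl// mulr1.
    rewrite (le_trans (ler_norm _))// (le_trans (ltW (truncnS_gt _)))// ler_nat.
    by rewrite (leq_trans _ (leqW km))// (bigD1 i)//= leq_addr.
  rewrite -ltNge => tw.
  exists (Num.trunc ((1 + `|z ord0 i|) / (w ord0 i - t ord0 i))%R).+1 => // k /= km.
  rewrite /h !indicE !memNset//; first by move=> /(_ i); rewrite leNgt tw.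
  move=> /(_ i); rewrite !mxE; apply/negP; rewrite -ltNge.
  have H1 : (dl k * (1 + `|z ord0 i|) < w ord0 i - t ord0 i)%R.
    rewrite ltr_pdivrMl// mulrC -ltr_pdivrMl ?subr_gt0// mulrC.
    by apply: (lt_le_trans (truncnS_gt _)); rewrite ler_nat (leq_trans km).
  have H2 : (- (dl k * `|z ord0 i|) <= dl k ^+ 2 * z ord0 i)%R.
    rewrite lerNl -mulrN expr2 -mulrA ler_pM2l//.
    rewrite (@le_trans _ _ (dl k * `|z ord0 i|)%R)//.
      by rewrite ler_pM2l// -normrN ler_norm.
    by rewrite ler_piMl// invf_le1// ler1n.
  rewrite mulrDr mulr1 in H1; lra.
have mh k w : measurable_fun [set: 'rV[R]_m] (h k w).
  apply/measurable_EFinP; apply: (measurableT_comp _ (measurable_rV_affine _ w)).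
  by apply: measurable_indic; exact: measurable_orthant.
have mh2 k : measurable_fun [set: 'rV[R]_m * 'rV[R]_m] (fun p => h k p.1 p.2).
  apply/measurable_EFinP.
  apply: (@measurableT_comp _ _ _ _ _ _ (\1_(orthant (tk k)) : 'rV[R]_m -> R)).
    by apply: measurable_indic; exact: measurable_orthant.
  apply: measurable_fun_rVP => i; under eq_fun do rewrite !mxE.
  apply: measurable_funD; first apply: measurable_funM => //.
    exact: (measurableT_comp (measurable_coord i) measurable_snd).
  exact: (measurableT_comp (measurable_coord i) measurable_fst).
have i1 (la : probability 'rV[R]_m R) : la.-integrable setT (cst (1%:E : \bar R)).
  exact: finite_measure_integrable_cst.
have F_cvg w : \int[gauss R m]_z h k w z @[k --> \oo] --> (\1_(orthant t) w)%:E.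
  rewrite -[X in _ --> X](_ : \int[gauss R m]_z (cst (\1_(orthant t) w)%:E z) = _); last first.
    by rewrite intcst.
  apply: (dominated_cvg_integral (g := cst 1%:E)) => //.
  - exact: (i1 (gauss R m)).
  - by move=> k z; rewrite /h gee0_abs ?lee_fin// indicE; case: (_ \in _).
have mF k : measurable_fun [set: 'rV[R]_m] (fun w => \int[gauss R m]_z h k w z).
  apply: (@measurable_fun_fubini_tonelli_F _ _ _ _ R (gauss R m) (fun p => h k p.1 p.2)) => //.
  by move=> p; rewrite /h lee_fin.
have G_cvg (la : probability 'rV[R]_m R) :
    \int[la]_w (\int[gauss R m]_z h k w z) @[k --> \oo] --> la (orthant t).
  rewrite -[X in _ --> X](_ : \int[la]_w (\1_(orthant t) w)%:E = _); last first.
    by rewrite integral_indic ?setIT//; exact: measurable_orthant.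
  apply: (dominated_cvg_integral (g := cst 1%:E)) => //; first exact: (i1 la).
  move=> k w; rewrite gee0_abs; last by apply: integral_ge0 => z _; rewrite lee_fin.
  apply: (@le_trans _ _ (\int[gauss R m]_z cst 1%:E z)); last first.
    by rewrite intcst.
  apply: ge0_le_integral => //.
  - by move=> z _; rewrite lee_fin.
  - by move=> z _; rewrite lee_fin indicE; case: (_ \in _).
have Gmu := G_cvg mu; have Gnu := G_cvg nu.
apply: cvg_unique Gmu _ => //.
rewrite (_ : (fun k => _) = (fun k => \int[nu]_w \int[gauss R m]_z h k w z)) //.
by apply/funext => k; apply: smooth_orthant; rewrite exprn_gt0.
Qed.
End cramer_wold.

Section quadratic_bounds.
Context (R : realDomainType).

Lemma normr_le_1Dsqr (x : R) : `|x| <= 1 * (1 + x ^+ 2).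
Proof. by rewrite mul1r -(real_normK (num_real x)); have := sqr_ge0 (`|x| - 1); nra. Qed.

Lemma normr_sqr_le_1Dsqr (x : R) : `|x ^+ 2| <= 1 * (1 + x ^+ 2).
Proof. by rewrite mul1r ger0_norm ?sqr_ge0// lerDr. Qed.
End quadratic_bounds.

(** * Real Gaussian variables: moments and characteristic function *)

Section gaussian_rv.
Context (R : realType).
Notation mu := (@lebesgue_measure R).
Notation phi := (normal_pdf 0 (1:R)).

Lemma normal_pdf_affine (m s z : R) : 0 < s -> normal_pdf m s (s * z + m) = s^-1 * phi z.
Proof.
move=> s0; rewrite !normal_pdfE ?gt_eqF// /normal_fun addrK subr0 mulrA; congr (_ * expR _).
  rewrite /normal_peak -[in LHS]mulrnAr expr1n sqrtrM ?sqr_ge0// sqrtr_sqr gtr0_norm// invfM.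
  by rewrite mul1r.
by rewrite expr1n exprMn; field; rewrite gt_eqF.
Qed.

Lemma normal_prob_affine (m s : R) (A : set R) : 0 < s -> measurable A ->
  normal_prob m s A = normal_prob 0 1 ((fun z => s * z + m) @^-1` A).
Proof.
move=> s0 mA; rewrite /normal_prob integral_mkcond [RHS]integral_mkcond.
pose F (x : R) : \bar R := ((\1_A x)%:E * (normal_pdf m s x)%:E)%E.
have mF : measurable_fun [set: R] F.
  by apply: emeasurable_funM; apply/measurable_EFinP => //; exact: measurable_normal_pdf.
have F0 x : (0 <= F x)%E by rewrite mule_ge0// lee_fin// normal_pdf_ge0.
transitivity (\int[mu]_x F x)%E.
  by apply: eq_integral => x _; rewrite epatch_indic muleC.
have L := lebesgue_affine m s0 mF F0.
have -> : (\int[mu]_x F x = s%:E * \int[mu]_x F (s * x + m)%R)%E.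
  by rewrite L muleA -EFinM mulfV ?gt_eqF// mul1e.
have mF2 : measurable_fun [set: R] (fun x => F (s * x + m)).
  exact: (measurableT_comp mF (measurable_affine _ _)).
rewrite -(@ge0_integralZl_EFin _ (measurableTypeR R) R mu _ measurableT (fun x => F (s * x + m)))//; last exact: ltW.
apply: eq_integral => x _; rewrite epatch_indic /F normal_pdf_affine// -!EFinM.
congr EFin; rewrite indicE [in RHS]indicE.
have -> : (x \in (fun z => s * z + m) @^-1` A) = (s * x + m \in A) by [].
by field; rewrite gt_eqF.
Qed.

(** Point masses correspond to [s = 0]: all Gaussian laws become images of one measure, and the
    computations of moments below need not distinguish the degenerate case. *)
Lemma gaussian_lawP (la : set R -> \bar R) : gaussian_law la ->
  exists m s : R, 0 <= s /\
  forall A, measurable A -> la A = normal_prob 0 1 ((fun z => s * z + m) @^-1` A).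
Proof.
move=> [[m [s [s0 H]]]|[m H]].
  exists m, s; split; first exact: ltW.
  by move=> A mA; rewrite (H _ mA); exact: normal_prob_affine.
exists m, 0; split => // A mA; rewrite H// diracE.
have [Am|Am] := boolP (m \in A).
  rewrite (_ : _ @^-1` A = setT); first by rewrite probability_setT.
  by apply/seteqP; split => // x _ /=; rewrite mul0r add0r; rewrite inE in Am.
rewrite (_ : _ @^-1` A = set0); first by rewrite measure0.
by apply/seteqP; split => // x /=; rewrite mul0r add0r; rewrite notin_setE in Am.
Qed.

Context (dO : measure_display) (Omega : measurableType dO) (P : probability Omega R).

Section transfer.
Variables (X : Omega -> R) (m s : R).
Hypothesis mX : measurable_fun [set: Omega] X.
Hypothesis H : forall A : set R, measurable A ->
  P (X @^-1` A) = normal_prob 0 1 ((fun z => s * z + m) @^-1` A).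

Lemma gaussian_ge0_integral (F : R -> \bar R) :
  measurable_fun [set: R] F -> (forall x, 0 <= F x)%E ->
  (\int[P]_w F (X w) = \int[mu]_z (F (s * z + m)%R * (phi z)%:E))%E.
Proof.
move=> mF F0.
pose h (x : measurableTypeR R) : measurableTypeR R := (s * x + m)%R.
have mh : measurable_fun [set: measurableTypeR R] h by exact: measurable_affine.
pose N : {measure set (measurableTypeR R) -> \bar R} := normal_prob 0 (1:R).
have mX' : measurable_fun [set: Omega] (X : Omega -> measurableTypeR R) by exact: mX.
transitivity (\int[pushforward P (X : Omega -> measurableTypeR R)]_x F x)%E.
  by rewrite ge0_integral_pushforward// preimage_setT.
transitivity (\int[pushforward N h]_x F x)%E.
  apply: eq_measure_integral => A mA _; exact: H.
rewrite ge0_integral_pushforward// preimage_setT.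
rewrite (@ge0_integral_density _ _ R mu N phi)//.
- exact: measurable_phi.
- by move=> x; rewrite ltW// phi_gt0.
- exact: (measurableT_comp mF mh).
- by move=> x; exact: F0.
Qed.

Lemma gaussian_integral (F : R -> R) (C : R) :
  measurable_fun [set: R] F -> (forall x, `|F x| <= C * (1 + x ^+ 2)) ->
  P.-integrable setT (fun w => (F (X w))%:E) /\
  (\int[P]_w (F (X w))%:E = \int[mu]_z (F (s * z + m)%R * phi z)%:E)%E.
Proof.
move=> mF FC.
pose h (x : measurableTypeR R) : measurableTypeR R := (s * x + m)%R.
have mh : measurable_fun [set: measurableTypeR R] h by exact: measurable_affine.
pose N : {measure set (measurableTypeR R) -> \bar R} := normal_prob 0 (1:R).
have mX' : measurable_fun [set: Omega] (X : Omega -> measurableTypeR R) by exact: mX.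
have iF : mu.-integrable setT (fun z => (F (s * z + m)%R * phi z)%:E).
  apply: (@integrable_poly_phi _ _ (C * (1 + 2 * s ^+ 2 + 2 * m ^+ 2))).
    exact: (measurableT_comp mF mh).
  move=> x; apply: (le_trans (FC _)).
  have C0 : 0 <= C by have := FC 0; rewrite expr0n addr0 mulr1; exact: le_trans.
  rewrite -mulrA ler_wpM2l//.
  have := sqr_ge0 (s * x - m); have := sqr_ge0 (m * x); nra.
have iP : P.-integrable setT (fun w => (F (X w))%:E).
  apply/integrableP; split; first by apply/measurable_EFinP; exact: measurableT_comp.
  rewrite (@gaussian_ge0_integral (fun x => `|(F x)%:E|%E))//; last first.
    by apply/measurable_EFinP; exact: measurableT_comp.
  have := integrable_abse iF => /integrableP[_].
  by under eq_integral do rewrite /= normr_id normrM (ger0_norm (ltW (phi_gt0 _))).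
split => //.
transitivity (\int[pushforward P (X : Omega -> measurableTypeR R)]_x (F x)%:E)%E.
  by rewrite integral_pushforward// ?preimage_setT//; exact/measurable_EFinP.
transitivity (\int[pushforward N h]_x (F x)%:E)%E.
  apply: eq_measure_integral => A mA _; exact: H.
have mphi : measurable_fun [set: measurableTypeR R] phi by exact: measurable_phi.
have mFh : measurable_fun [set: measurableTypeR R] (F \o h) by exact: (measurableT_comp mF mh).
have [iN IN] := @integrable_density _ _ R mu N phi mphi (fun x => ltW (phi_gt0 x)) (fun A mA => erefl) (F \o h) mFh iF.
by rewrite integral_pushforward// ?preimage_setT//; exact/measurable_EFinP.
Qed.
End transfer.

Lemma gaussian_moments (X : Omega -> R) :
  measurable_fun [set: Omega] X -> gaussian_law (pushforward P X) ->
  P.-integrable setT (EFin \o X) /\ P.-integrable setT (fun w => (X w ^+ 2)%:E).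
Proof.
move=> mX /gaussian_lawP[m [s [s0 H]]].
split.
- by have [] := @gaussian_integral X m s mX H (fun x => x) 1 (@measurable_id _ _ _) (@normr_le_1Dsqr R).
- have m2 : measurable_fun [set: R] (fun x : R => x ^+ 2) by exact: measurable_funX.
  by have [] := @gaussian_integral X m s mX H (fun x => x ^+ 2) 1 m2 (@normr_sqr_le_1Dsqr R).
Qed.

Lemma centered_gaussian_law (X : Omega -> R) (v : R) :
  measurable_fun [set: Omega] X -> gaussian_law (pushforward P X) ->
  (\int[P]_w (X w)%:E = 0)%E -> (\int[P]_w (X w ^+ 2)%:E = v%:E)%E ->
  0 <= v /\ forall A : set R, measurable A ->
  P (X @^-1` A) = normal_prob 0 1 ((fun z => Num.sqrt v * z + 0) @^-1` A).
Proof.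
move=> mX /gaussian_lawP[m [s [s0 H]]] EX EX2.
have i0 : mu.-integrable setT (fun z => (phi z)%:E) by exact: integrable_normal_pdf.
have i1 : mu.-integrable setT (fun z => (z * phi z)%:E).
  by apply: (@integrable_poly_phi _ _ 1) => //; exact: normr_le_1Dsqr.
have m2 : measurable_fun [set: R] (fun x : R => x ^+ 2) by exact: measurable_funX.
have i2 : mu.-integrable setT (fun x => (x ^+ 2 * phi x)%:E).
  by apply: (@integrable_poly_phi _ _ 1) => //; exact: normr_sqr_le_1Dsqr.
have m0 : m = 0.
  have [_] := @gaussian_integral X m s mX H (fun x => x) 1 (@measurable_id _ _ _) (@normr_le_1Dsqr R).
  rewrite EX.
  under eq_integral do rewrite mulrDl -mulrA EFinD EFinM (EFinM m).
  rewrite integralD//; [|exact: integrableZl|exact: integrableZl].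
  by rewrite !integralZl// integral_id_phi integral_phi mule0 add0e mule1 => -[].
have vE : v = s ^+ 2.
  have [_] := @gaussian_integral X m s mX H (fun x => x ^+ 2) 1 m2 (@normr_sqr_le_1Dsqr R).
  rewrite EX2 m0.
  under eq_integral do rewrite addr0 exprMn -mulrA EFinM.
  by rewrite integralZl// integral_sqr_phi mule1 => -[].
rewrite vE sqrtr_sqr ger0_norm// sqr_ge0; split => // A mA.
by rewrite -[P _]/(pushforward P X A) (H A mA) m0.
Qed.

Lemma centered_gaussian_cos (X : Omega -> R) (v th : R) :
  measurable_fun [set: Omega] X -> gaussian_law (pushforward P X) ->
  (\int[P]_w (X w)%:E = 0)%E -> (\int[P]_w (X w ^+ 2)%:E = v%:E)%E ->
  (\int[P]_w (1 + cos (th + X w))%:E = (1 + cos th * expR (- (v / 2)))%:E)%E.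
Proof.
move=> mX gX EX EX2.
have [v0 H] := centered_gaussian_law mX gX EX EX2.
rewrite (gaussian_ge0_integral mX H (F := fun x => (1 + cos (th + x))%:E)); last 2 first.
- by apply: measurable_1Dcos; exact: measurable_funD.
- by move=> x; exact: onePcos_ge0.
have i0 : mu.-integrable setT (fun z => (phi z)%:E) by exact: integrable_normal_pdf.
have i2 : mu.-integrable setT (fun x => (cos (th + Num.sqrt v * x) * phi x)%:E).
  apply: (@integrable_bounded_phi _ _ 1); last by move=> x; exact: norm_cos_le1.
  by apply: continuous_measurable_fun; exact: continuous_cosl.
under eq_integral do rewrite addr0 -EFinM mulrDl mul1r EFinD.
by rewrite integralD// integral_phi integral_cos_phi sqr_sqrtr// -EFinD.
Qed.
End gaussian_rv.

(** * Gaussian fields *)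

Section gauss_law.
Context (R : realType).
Local Open Scope ereal_scope.

Lemma gpdf_row_mx m n (x : 'rV[R]_m) (y : 'rV[R]_n) : gpdf (row_mx x y) = (gpdf x * gpdf y)%R.
Proof.
rewrite /gpdf big_split_ord /=; congr (_ * _)%R; apply: eq_bigr => i _.
  by rewrite row_mxEl.
by rewrite row_mxEr.
Qed.

Lemma gauss_split m n (F : 'rV[R]_(m + n) -> \bar R) :
  measurable_fun [set: 'rV[R]_(m + n)] F -> (forall x, 0 <= F x) ->
  \int[gauss R (m + n)]_x F x = \int[gauss R m]_x \int[gauss R n]_y F (row_mx x y).
Proof.
move=> mF F0.
have mg k : measurable_fun [set: 'rV[R]_k] (fun x => (gpdf x)%:E).
  by apply/measurable_EFinP; exact: measurable_gpdf.
have mFr := measurableT_comp mF (@measurable_row_mx R m n).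
have mFx (x : 'rV[R]_m) : measurable_fun [set: 'rV[R]_n] (fun y => F (row_mx x y)).
  exact: (measurableT_comp mFr (@measurable_pair1 _ _ _ _ x)).
have mI : measurable_fun [set: 'rV[R]_m] (fun x => \int[gauss R n]_y F (row_mx x y)).
  apply: (@measurable_fun_fubini_tonelli_F _ _ _ _ R (gauss R n) (fun p => F (row_mx p.1 p.2))) => //.
have mFg : measurable_fun [set: 'rV[R]_(m + n)] (fun x => F x * (gpdf x)%:E).
  by apply: emeasurable_funM => //; exact: mg.
rewrite (gauss_integral mF F0) (leb_split mFg); last first.
  by move=> x; rewrite mule_ge0// lee_fin gpdf_ge0.
rewrite (gauss_integral mI); last by move=> x; apply: integral_ge0 => y _; exact: F0.
apply: eq_integral => x _.
rewrite (gauss_integral (mFx x)); last by move=> y; exact: F0.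
have mFxg : measurable_fun [set: 'rV[R]_n] (fun y => F (row_mx x y) * (gpdf y)%:E).
  by apply: emeasurable_funM; [exact: mFx|exact: mg].
rewrite -ge0_integralZr//; last 2 first.
- by move=> y _; rewrite mule_ge0// lee_fin gpdf_ge0.
- by rewrite lee_fin gpdf_ge0.
by apply: eq_integral => y _; rewrite gpdf_row_mx EFinM [in LHS](muleC (gpdf x)%:E) muleA.
Qed.

Context (dO : measure_display) (Omega : measurableType dO) (P : probability Omega R).

(** By [gauss_cos] the hypothesis says that the law of [W] and the Gaussian measure have the same
    [cosint]; Cramer-Wold identifies them. *)
Lemma gauss_law m (W : Omega -> 'rV[R]_m) :
  measurable_fun [set: Omega] W ->
  (forall c th, \int[P]_w (1 + cos (th + dot c (W w)))%:E =
    (1 + cos th * expR (- (dot c c / 2)))%:E) ->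
  forall F : 'rV[R]_m -> \bar R, measurable_fun [set: 'rV[R]_m] F -> (forall x, 0 <= F x) ->
  \int[P]_w F (W w) = \int[gauss R m]_x F x.
Proof.
move=> mW HW F mF F0.
pose W' : {mfun Omega >-> 'rV[R]_m} := mfun_Sub (mem_set mW).
pose la : probability 'rV[R]_m R := distribution P W'.
have E G : measurable_fun [set: 'rV[R]_m] G -> (forall x, 0 <= G x) ->
    \int[la]_x G x = \int[P]_w G (W w).
  by move=> mG G0; rewrite /la /distribution ge0_integral_pushforward// preimage_setT.
rewrite -E//; apply: eq_measure_integral => A mA _.
apply: (cramer_wold (mu := la) (nu := gauss R m)) => // c th.
have mc : measurable_fun [set: 'rV[R]_m] (fun w => (1 + cos (th + dot c w))%:E : \bar R).
  apply: measurable_1Dcos; apply: measurable_funD => //.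
  by apply: measurable_dot_comp => //; exact: measurable_id.
by rewrite /cosint gauss_cos -HW (E _ mc (fun w => onePcos_ge0 _)).
Qed.
End gauss_law.

Section field.
Context (dO : measure_display) (Omega : measurableType dO) (R : realType)
  (P : probability Omega R) (d m : nat) (eta : 'rV[R]_d -> 'I_m -> {RV P >-> R})
  (K : 'rV[R]_d -> 'rV[R]_d -> R).
Hypothesis eta_gauss : gaussian_field eta.
Hypothesis eta_centered : centered_field eta.
Hypothesis eta_cov : forall x y, cross_moment eta x y = (K x y)%:M.
Local Open Scope ereal_scope.

Let eta_law x j : gaussian_law (pushforward P (eta x j)).
Proof.
have := eta_gauss (fun _ : 'I_1 => x) (fun _ j' => (j' == j)%:R)%R.
congr gaussian_law; congr pushforward; apply/funext => w.
rewrite big_ord1 (bigD1 j)//= eqxx mul1r big1 ?addr0// => i ij.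
by rewrite (negbTE ij) mul0r.
Qed.

Lemma eta_integrable x j : P.-integrable setT (EFin \o eta x j).
Proof. by have [] := gaussian_moments (@measurable_funPT _ _ _ _ (eta x j)) (eta_law x j). Qed.

Lemma eta_sqr_integrable x j : P.-integrable setT (fun w => (eta x j w ^+ 2)%:E).
Proof. by have [] := gaussian_moments (@measurable_funPT _ _ _ _ (eta x j)) (eta_law x j). Qed.

Lemma eta_prod_integrable x i y j : P.-integrable setT (fun w => (eta x i w * eta y j w)%:E).
Proof.
have i2 := integrableD measurableT (eta_sqr_integrable x i) (eta_sqr_integrable y j).
apply: le_integrable i2 => //.
  by apply/measurable_EFinP; apply: measurable_funM.
move=> w _ /=; rewrite lee_fin normrM (@ger0_norm _ (_ + _)); last by rewrite addr_ge0// sqr_ge0.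
rewrite -(real_normK (num_real (eta x i w))) -(real_normK (num_real (eta y j w))).
have := sqr_ge0 (`|eta x i w| - `|eta y j w|)%R.
have := sqr_ge0 (`|eta x i w| + `|eta y j w|)%R; nra.
Qed.

Lemma eta_mean x j : \int[P]_w (eta x j w)%:E = 0.
Proof. by have := eta_centered x j; rewrite unlock. Qed.

Lemma eta_prod_mean x i y j : \int[P]_w (eta x i w * eta y j w)%:E = (K x y *+ (i == j))%:E.
Proof.
have := eta_cov x y => /matrixP /(_ i j); rewrite !mxE => <-.
by rewrite unlock fineK//; apply: integrable_fin_num => //; exact: eta_prod_integrable.
Qed.

Lemma comb_mean k (x : 'I_k -> 'rV[R]_d) (c : 'I_k -> 'I_m -> R) :
  \int[P]_w (\sum_(i < k) \sum_(j < m) c i j * eta (x i) j w)%:E = 0.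
Proof.
under eq_integral do rewrite pair_bigA -sumEFin.
rewrite integral_sum//; last first.
  by move=> p; under eq_fun do rewrite EFinM; apply: integrableZl => //; exact: eta_integrable.
apply: big1 => p _; under eq_integral do rewrite EFinM.
by rewrite integralZl//; [rewrite eta_mean mule0|exact: eta_integrable].
Qed.

Lemma comb_sqr_mean k (x : 'I_k -> 'rV[R]_d) (c : 'I_k -> 'I_m -> R) :
  \int[P]_w ((\sum_(i < k) \sum_(j < m) c i j * eta (x i) j w) ^+ 2)%:E =
  (\sum_(i < k) \sum_(i' < k) K (x i) (x i') * \sum_(j < m) c i j * c i' j)%:E.
Proof.
have ip (p q : 'I_k * 'I_m) : P.-integrable setT (fun w => (c p.1 p.2 * c q.1 q.2 * (eta (x p.1) p.2 w * eta (x q.1) q.2 w))%:E).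
  by under eq_fun do rewrite EFinM; apply: integrableZl => //; exact: eta_prod_integrable.
transitivity (\int[P]_w \sum_p \sum_(q : 'I_k * 'I_m) (c p.1 p.2 * c q.1 q.2 * (eta (x p.1) p.2 w * eta (x q.1) q.2 w))%:E).
  apply: eq_integral => w _; rewrite pair_bigA expr2 big_distrlr/= -sumEFin.
  apply: eq_bigr => p _; rewrite -sumEFin; apply: eq_bigr => q _; congr EFin; ring.
rewrite integral_sum//; last by move=> p; apply: integrable_sum => // q _.
transitivity (\sum_(p : 'I_k * 'I_m) \sum_(q : 'I_k * 'I_m) (c p.1 p.2 * c q.1 q.2 * (K (x p.1) (x q.1) *+ (p.2 == q.2)))%:E).
  apply: eq_bigr => p _; rewrite integral_sum//; apply: eq_bigr => q _.
  under eq_integral do rewrite EFinM.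
  by rewrite integralZl//; [rewrite eta_prod_mean -EFinM|exact: eta_prod_integrable].
under eq_bigr do rewrite sumEFin.
rewrite sumEFin; congr EFin.
rewrite -(pair_bigA _ (fun i j => \sum_(q : 'I_k * 'I_m) c i j * c q.1 q.2 * (K (x i) (x q.1) *+ (j == q.2))))%R/=.
apply: eq_bigr => i _.
under eq_bigr => j _ do rewrite -(pair_bigA _ (fun i' j' => c i j * c i' j' * (K (x i) (x i') *+ (j == j'))))%R/=.
rewrite exchange_big/=; apply: eq_bigr => i' _.
rewrite mulr_sumr; apply: eq_bigr => j _.
rewrite (bigD1 j)//= eqxx mulr1n big1 ?addr0; first by rewrite mulrC.
by move=> j' jj'; rewrite eq_sym (negbTE jj') mulr0.
Qed.

Lemma comb_cos k (x : 'I_k -> 'rV[R]_d) (c : 'I_k -> 'I_m -> R) (th : R) :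
  \int[P]_w (1 + cos (th + \sum_(i < k) \sum_(j < m) c i j * eta (x i) j w))%:E =
  (1 + cos th * expR (- ((\sum_(i < k) \sum_(i' < k) K (x i) (x i') * \sum_(j < m) c i j * c i' j) / 2)))%:E.
Proof.
apply: centered_gaussian_cos.
- apply: measurable_sum => i; apply: measurable_sum => j; exact: measurable_funM.
- exact: eta_gauss.
- exact: comb_mean.
- exact: comb_sqr_mean.
Qed.

Definition field_row x w : 'rV[R]_m := \row_j eta x j w.

Lemma measurable_field_row x : measurable_fun [set: Omega] (field_row x).
Proof. by apply: measurable_fun_rVP => j; under eq_fun do rewrite mxE; exact: measurable_funPT. Qed.

Lemma one_point_law x (F : 'rV[R]_m -> \bar R) : K x x = 1%R ->
  measurable_fun [set: 'rV[R]_m] F -> (forall v, 0 <= F v) ->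
  \int[P]_w F (field_row x w) = \int[gauss R m]_v F v.
Proof.
move=> Kx; apply: gauss_law; first exact: measurable_field_row.
move=> c th.
have := @comb_cos 1 (fun=> x) (fun _ j => c ord0 j) th.
rewrite !big_ord1 Kx mul1r -/(dot c c) => <-.
apply: eq_integral => w _; rewrite big_ord1; congr ((1 + cos (th + _))%:E)%R.
by apply: eq_bigr => j _; rewrite mxE.
Qed.

(** Gram-Schmidt: the vector [(eta y - r eta x) / k] is uncorrelated with [eta x] and has unit
    covariance, so the pair is standard Gaussian in dimension [m + m]. *)
Lemma two_point_law x y (r k : R) (F : 'rV[R]_m -> 'rV[R]_m -> \bar R) :
  K x x = 1%R -> K y y = 1%R -> K x y = r -> K y x = r -> (0 < k)%R -> (k ^+ 2 = 1 - r ^+ 2)%R ->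
  measurable_fun [set: 'rV[R]_m * 'rV[R]_m] (fun p => F p.1 p.2) -> (forall u v, 0 <= F u v) ->
  \int[P]_w F (field_row x w) (field_row y w) =
  \int[gauss R m]_u \int[gauss R m]_v F u (k *: v + r *: u)%R.
Proof.
move=> Kx Ky Kxy Kyx k0 kr mF F0.
pose W w : 'rV[R]_(m + m) := row_mx (field_row x w) (k^-1 *: (field_row y w - r *: field_row x w))%R.
have mW : measurable_fun [set: Omega] W.
  apply: measurable_fun_rVP => j; rewrite /W.
  case: (split_ordP j) => i ->.
    by under eq_fun do rewrite row_mxEl mxE; exact: measurable_funPT.
  under eq_fun do rewrite row_mxEr !mxE.
  by apply: measurable_funM => //; apply: measurable_funB => //; apply: measurable_funM.
pose G (v : 'rV[R]_(m + m)) := F (lsubmx v) (k *: rsubmx v + r *: lsubmx v)%R.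
have mG : measurable_fun [set: 'rV[R]_(m + m)] G.
  have ml : measurable_fun [set: 'rV[R]_(m + m)] (fun v : 'rV[R]_(m + m) => lsubmx v).
    apply: measurable_fun_rVP => j; under eq_fun do rewrite mxE; exact: measurable_coord.
  have ma : measurable_fun [set: 'rV[R]_(m + m)] (fun v : 'rV[R]_(m + m) => k *: rsubmx v + r *: lsubmx v)%R.
    apply: measurable_fun_rVP => j; under eq_fun do rewrite !mxE.
    by apply: measurable_funD; apply: measurable_funM => //; exact: measurable_coord.
  have mp : measurable_fun [set: 'rV[R]_(m + m)] (fun v : 'rV[R]_(m + m) => (lsubmx v, (k *: rsubmx v + r *: lsubmx v)%R)).
    exact/measurable_fun_pairP.
  exact: (measurableT_comp mF mp).
transitivity (\int[P]_w G (W w)).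
  apply: eq_integral => w _; rewrite /G /W row_mxKl row_mxKr scalerA divff ?gt_eqF// scale1r.
  by rewrite subrK.
have G0 v : 0 <= G v by exact: F0.
have HW c th : \int[P]_w (1 + cos (th + dot c (W w)))%:E =
    (1 + cos th * expR (- (dot c c / 2)))%:E.
  pose c1 : 'I_m -> R := fun j => c ord0 (lshift m j).
  pose c2 : 'I_m -> R := fun j => c ord0 (rshift m j).
  (* A functional with coefficients [c1], [c2] on the orthogonalized pair is a combination of field
     values with weights [c1 - r c2 / k] at [x] and [c2 / k] at [y]. Its variance collapses to
     [dot c c] because [k^2 + r^2 = 1]. *)
  have := @comb_cos 2 (fun i => if i == ord0 then x else y)
     (fun i j => if i == ord0 then c1 j - r * (c2 j / k) else c2 j / k)%R th.
  rewrite !big_ord_recl !big_ord0/= Kx Ky Kxy Kyx !addr0.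
  have -> : (1 * (\sum_(j < m) (c1 j - r * (c2 j / k)) * (c1 j - r * (c2 j / k))) +
     r * (\sum_(j < m) (c1 j - r * (c2 j / k)) * (c2 j / k)) +
     (r * (\sum_(j < m) c2 j / k * (c1 j - r * (c2 j / k))) + 1 * (\sum_(j < m) c2 j / k * (c2 j / k))) =
     dot c c)%R.
    rewrite /dot big_split_ord/= !mulr_sumr -!big_split/=; apply: eq_bigr => j _.
    rewrite -/(c1 j) -/(c2 j).
    have -> : (c2 j * c2 j = (c2 j / k) * (c2 j / k) * (1 - r ^+ 2))%R.
      by rewrite -kr; field; rewrite gt_eqF.
    ring.
  move=> <-; apply: eq_integral => w _; rewrite !big_ord_recl big_ord0/= addr0; congr ((1 + cos (th + _))%:E)%R.
  rewrite /dot /W big_split_ord/= -!big_split/=; apply: eq_bigr => j _.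
  rewrite row_mxEl row_mxEr !mxE -/(c1 j) -/(c2 j).
  by field; rewrite gt_eqF.
rewrite (gauss_law mW HW mG G0) (gauss_split mG G0).
by apply: eq_integral => u _; apply: eq_integral => v _; rewrite /G row_mxKl row_mxKr.
Qed.
End field.

(** * Mehler's inequality *)

Section mehler_real.
Context (R : realType).

Lemma expR_taylor2 (x : R) : `|expR x - 1 - x| <= x ^+ 2 * expR `|x|.
Proof.
have e1 := expR_ge1Dx x.
rewrite ger0_norm; last by rewrite subr_ge0 lerBrDl.
have e2 : expR x - 1 <= x * expR x.
  have := expR_ge1Dx (- x) => e2.
  have := ler_wpM2r (expR_ge0 x) e2; rewrite -expRD addNr expR0 mulrDl mul1r; lra.
have [x0|x0] := leP 0 x.
  rewrite ger0_norm//; nra.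
have : 1 <= expR `|x| by rewrite -[leLHS]expR0 ler_expR.
have := expR_gt0 x; nra.
Qed.

(** Exponent of the Mehler kernel, the density of a pair of Gaussian vectors of correlation [r] with
    respect to the product of the marginals; [s] stands for the scalar product of the two vectors
    and [w] for the sum of their squared norms. *)
Definition mehler_exponent (r s w : R) : R := (2 * r * s - r ^+ 2 * w) / (2 * (1 - r ^+ 2)).

(** First-order expansion in [r]. The restriction on [r] gives an exponent of modulus at most
    [w / 16], so that once the powers of [w] are absorbed the remainder costs no more than
    [expR (w / 8)]. Against functions bounded by [expR (dot u u / 8)] in each variable the total
    weight is [expR (w / 4)], which is still Gaussian integrable. *)
Lemma mehler_kernel_taylor m (r k s w : R) : `|r| <= 16^-1 -> 0 < k -> k ^+ 2 = 1 - r ^+ 2 ->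
  2 * `|s| <= w ->
  `|(k ^+ m)^-1 * expR (mehler_exponent r s w) - 1 - r * s| <=
    (m%:R * 2 ^+ m + 1040) * r ^+ 2 * expR (w / 8).
Proof.
move=> r16 k0 kr sw.
set E := mehler_exponent r s w.
have w0 : 0 <= w by apply: le_trans sw; rewrite mulr_ge0.
have r0 := normr_ge0 r.
have rr : r ^+ 2 = `|r| ^+ 2 by rewrite real_normK ?num_real.
have D0 : 0 < 2 * (1 - r ^+ 2) by rewrite rr; nra.
have Ers : `|E - r * s| <= r ^+ 2 * w.
  have -> : E - r * s = r ^+ 2 * (2 * r * s - w) / (2 * (1 - r ^+ 2)).
    by rewrite /E /mehler_exponent; field; rewrite -kr gt_eqF// exprn_gt0.
  rewrite normrM normfV (gtr0_norm D0) ler_pdivrMr// normrM (ger0_norm (sqr_ge0 r)) -[leRHS]mulrA.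
  rewrite ler_wpM2l ?sqr_ge0// (le_trans (ler_normB _ _))// (ger0_norm w0) !normrM.
  rewrite normr_nat rr.
  have h1 : `|r| * (2 * `|s|) <= `|r| * w by rewrite ler_wpM2l.
  have h2 : 0 <= (1 - `|r| - 2 * `|r| ^+ 2) * w by rewrite mulr_ge0//; nra.
  lra.
clearbody E.
have Eb : `|E| <= `|r| * w.
  have : `|E| <= `|E - r * s| + `|r * s| by rewrite -[leLHS](congr1 Num.norm (subrK (r * s) E)) ler_normD.
  have h1 : `|r| * (2 * `|s|) <= `|r| * w by rewrite ler_wpM2l.
  have h2 : 0 <= (`|r| * w) * (1 / 2 - `|r|) by rewrite mulr_ge0 ?mulr_ge0//; lra.
  rewrite normrM => h3; rewrite rr in Ers; lra.
have Ew : `|E| <= w / 16.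
  by apply: (le_trans Eb); rewrite mulrC ler_wpM2l.
have T := expR_taylor2 E.
have e16 : expR `|E| <= expR (w / 16) by rewrite ler_expR.
(* Absorption of [w ^+ 2] and of [w] costs 1024 and 16, which add up to the 1040 of the statement;
   its other term [m%:R * 2 ^+ m] comes from [(k ^+ m)^-1 - 1]. *)
have wle : w <= 32 * expR (w / 32) by have := expR_ge1Dx (w / 32); lra.
have w2le : w ^+ 2 <= 1024 * expR (w / 16).
  have -> : w / 16 = w / 32 + w / 32 by field.
  rewrite expRD; nra.
have e168 : expR (w / 16) * expR (w / 16) = expR (w / 8) by rewrite -expRD; congr expR; field.
have e1 : 1 <= expR (w / 16) by rewrite -[leLHS]expR0 ler_expR divr_ge0.
have wle2 : w <= 16 * expR (w / 16) by have := expR_ge1Dx (w / 16); lra.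
have r2 := sqr_ge0 r.
have H1 : `|expR E - 1 - r * s| <= 1040 * r ^+ 2 * expR (w / 8).
  have -> : expR E - 1 - r * s = (expR E - 1 - E) + (E - r * s) by ring.
  rewrite (le_trans (ler_normD _ _))//.
  have E2 : E ^+ 2 <= r ^+ 2 * w ^+ 2.
    by rewrite rr -exprMn -(real_normK (num_real E)) lerXn2r ?nnegrE ?mulr_ge0.
  have T2 : E ^+ 2 * expR `|E| <= r ^+ 2 * (1024 * expR (w / 8)).
    rewrite -e168 mulrA mulrA ler_pM ?expR_ge0 ?sqr_ge0//.
    by rewrite (le_trans E2)// -mulrA ler_wpM2l.
  have T3 : r ^+ 2 * w <= r ^+ 2 * (16 * expR (w / 8)).
    by rewrite ler_wpM2l// -e168; nra.
  lra.
have a0 : 0 < k ^+ m by rewrite exprn_gt0.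
have k1 : k <= 1 by nra.
have kk : 1 - r ^+ 2 <= k by nra.
have rs1 : r ^+ 2 <= 2^-1 by rewrite rr; nra.
have am : 1 - m%:R * r ^+ 2 <= k ^+ m.
  have : 1 - m%:R * r ^+ 2 <= (1 - r ^+ 2) ^+ m.
    elim: m {a0} => [|m IH]; first by rewrite mul0r subr0 expr0.
    have : (1 - r ^+ 2) * (1 - m%:R * r ^+ 2) <= (1 - r ^+ 2) ^+ m.+1.
      by rewrite [leRHS]exprS ler_wpM2l//; lra.
    have : 0 <= m%:R * (r ^+ 2 * r ^+ 2) by rewrite mulr_ge0// mulr_ge0.
    rewrite -natr1; nra.
  move=> /le_trans; apply; apply: lerXn2r => //; rewrite ?nnegrE; lra.
have ai : (k ^+ m)^-1 <= 2 ^+ m.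
  rewrite -exprVn lerXn2r ?nnegrE ?invr_ge0 ?(ltW k0)//.
  rewrite -[leRHS]invrK lef_pV2 ?posrE ?invr_gt0//; lra.
have H2 : (k ^+ m)^-1 - 1 <= m%:R * 2 ^+ m * r ^+ 2.
  have -> : (k ^+ m)^-1 - 1 = (k ^+ m)^-1 * (1 - k ^+ m) by rewrite mulrBr mulr1 mulVf// gt_eqF.
  have -> : m%:R * 2 ^+ m * r ^+ 2 = 2 ^+ m * (m%:R * r ^+ 2) :> R by ring.
  apply: ler_pM => //.
  - by rewrite invr_ge0 ltW.
  - by rewrite subr_ge0 exprn_ile1// ltW.
  - lra.
have H20 : 0 <= (k ^+ m)^-1 - 1.
  by rewrite subr_ge0 invf_ge1// exprn_ile1// ltW.
have -> : (k ^+ m)^-1 * expR E - 1 - r * s = ((k ^+ m)^-1 - 1) * expR E + (expR E - 1 - r * s) by ring.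
rewrite (le_trans (ler_normD _ _))// normrM (ger0_norm H20) (gtr0_norm (expR_gt0 E)).
have eE : expR E <= expR (w / 8).
  rewrite ler_expR (le_trans (ler_norm _))// (le_trans Ew)//; lra.
have : ((k ^+ m)^-1 - 1) * expR E <= m%:R * 2 ^+ m * r ^+ 2 * expR (w / 8).
  by apply: ler_pM => //; exact: expR_ge0.
lra.
Qed.
End mehler_real.

Section exp_moment.
Context (R : realType).
Notation phi := (normal_pdf 0 (1:R)).

Lemma measurable_dotxx m : measurable_fun [set: 'rV[R]_m] (fun u => dot u u).
Proof. by apply: measurable_dot_comp; exact: measurable_id. Qed.

(** In each coordinate, [expR (x ^+ 2 / 4) * phi x] is [Num.sqrt 2] times the normal density of
    variance 2. *)
Lemma gauss_exp_quarter m :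
  (\int[gauss R m]_u (expR (dot u u / 4))%:E = (Num.sqrt 2 ^+ m)%:E)%E.
Proof.
have me : measurable_fun [set: 'rV[R]_m] (fun u => (expR (dot u u / 4))%:E).
  apply/measurable_EFinP; apply: measurableT_comp => //.
  by apply: measurable_funM => //; exact: measurable_dotxx.
rewrite (gauss_integral me); last by move=> u; rewrite lee_fin expR_ge0.
pose g (x : R) : \bar R := ((Num.sqrt 2)%:E * (normal_pdf 0 (Num.sqrt 2) x)%:E)%E.
have gE x : (expR (x ^+ 2 / 4) * phi x)%:E = g x.
  rewrite /g -EFinM; congr EFin.
  have s2 : Num.sqrt 2 != 0 :> R by rewrite gt_eqF// sqrtr_gt0.
  rewrite phiE [in RHS]normal_pdfE// /normal_fun subr0 sqr_sqrtr//.
  have -> : normal_peak (Num.sqrt 2) = (Num.sqrt 2)^-1 * normal_peak 1 :> R.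
    by rewrite /normal_peak sqr_sqrtr// expr1n -mulrnAr sqrtrM// mul1r invfM.
  rewrite mulrCA -expRD mulrA mulrA mulfV// mul1r; congr (_ * expR _).
  by rewrite -[2 *+ 2]mulr_natr; field.
transitivity (\int[leb R m]_u \prod_(i < m) g (u ord0 i))%E.
  apply: eq_integral => u _; rewrite -EFinM.
  under eq_bigr do rewrite -gE; rewrite prodEFin big_split/=; congr (_ * _)%:E.
  rewrite /dot mulr_suml; elim/big_ind2 : _ => //; first by rewrite expR0.
  by move=> a b c e <- <-; rewrite expRD.
have mg : measurable_fun [set: R] g.
  by apply: emeasurable_funM => //; apply/measurable_EFinP; exact: measurable_normal_pdf.
have g0 x : (0 <= g x)%E by rewrite mule_ge0// lee_fin ?sqrtr_ge0 ?normal_pdf_ge0.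
rewrite (@leb_prod_integral R m (fun=> g))//.
under eq_bigr => i _.
  rewrite /g integralZl//; last exact: integrable_normal_pdf.
  rewrite integral_normal_pdf mule1; over.
by rewrite prodEFin prodr_const card_ord.
Qed.
End exp_moment.

Section mehler.
Context (dO : measure_display) (Omega : measurableType dO) (R : realType)
  (P : probability Omega R) (d m : nat) (eta : 'rV[R]_d -> 'I_m -> {RV P >-> R})
  (K : 'rV[R]_d -> 'rV[R]_d -> R).
Hypothesis eta_gauss : gaussian_field eta.
Hypothesis eta_centered : centered_field eta.
Hypothesis eta_cov : forall x y, cross_moment eta x y = (K x y)%:M.
Local Open Scope ereal_scope.

Let G := gauss R m \x gauss R m.

Definition mehler_kernel (r k : R) (p : 'rV[R]_m * 'rV[R]_m) : R :=
  ((k ^+ m)^-1 * expR (mehler_exponent r (dot p.1 p.2) (dot p.1 p.1 + dot p.2 p.2)))%R.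

(** The left side is the conditional density of the second vector given that the first is [u]; the
    kernel is its ratio to the marginal density. *)
Lemma mehler_kernelE (r k : R) u y : (0 < k)%R -> (k ^+ 2 = 1 - r ^+ 2)%R ->
  ((k^-1 ^+ m) * gpdf (k^-1 *: (y - r *: u)) = mehler_kernel r k (u, y) * gpdf y)%R.
Proof.
move=> k0 kr; rewrite /mehler_kernel /mehler_exponent exprVn !gpdfE mulrA mulrACA; congr (_ * _)%R.
rewrite -expRD; congr expR => /=.
have -> : (dot (k^-1 *: (y - r *: u)) (k^-1 *: (y - r *: u)) =
    (1 - r ^+ 2)^-1 * (dot y y - 2 * r * dot u y + r ^+ 2 * dot u u))%R.
  rewrite /dot !mulr_sumr -sumrN -!big_split/= mulr_sumr; apply: eq_bigr => i _.
  by rewrite !mxE -kr; field; rewrite gt_eqF.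
by field; rewrite -kr gt_eqF// exprn_gt0.
Qed.

Lemma measurable_mehler_kernel r k : measurable_fun [set: 'rV[R]_m * 'rV[R]_m] (mehler_kernel r k).
Proof.
apply: measurable_funM => //; apply: measurableT_comp => //.
apply: measurable_funM => //; apply: measurable_funB; apply: measurable_funM => //.
  exact: measurable_dot.
apply: measurable_funD; apply: measurable_dot_comp; by [exact: measurable_fst|exact: measurable_snd].
Qed.

Section pair.
Variables (x y : 'rV[R]_d) (r : R).
Hypotheses (Kx : K x x = 1%R) (Ky : K y y = 1%R) (Kxy : K x y = r) (Kyx : K y x = r).

Lemma two_point_density (k : R) (F : 'rV[R]_m -> 'rV[R]_m -> \bar R) :
  (0 < k)%R -> (k ^+ 2 = 1 - r ^+ 2)%R ->
  measurable_fun [set: 'rV[R]_m * 'rV[R]_m] (fun p => F p.1 p.2) -> (forall u v, 0 <= F u v) ->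
  \int[P]_w F (field_row eta x w) (field_row eta y w) =
  \int[G]_p (F p.1 p.2 * (mehler_kernel r k p)%:E).
Proof.
move=> k0 kr mF F0.
rewrite (two_point_law eta_gauss eta_centered eta_cov Kx Ky Kxy Kyx k0 kr mF F0).
have mM : measurable_fun [set: 'rV[R]_m * 'rV[R]_m] (fun p => (mehler_kernel r k p)%:E).
  by apply/measurable_EFinP; exact: measurable_mehler_kernel.
have M0 p : (0 <= mehler_kernel r k p)%R by rewrite mulr_ge0 ?expR_ge0// invr_ge0 exprn_ge0// ltW.
have mFM : measurable_fun [set: 'rV[R]_m * 'rV[R]_m] (fun p => F p.1 p.2 * (mehler_kernel r k p)%:E).
  exact: emeasurable_funM.
have FM0 p : 0 <= F p.1 p.2 * (mehler_kernel r k p)%:E by rewrite mule_ge0// lee_fin.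
rewrite /G fubini_tonelli1; try exact: mFM; try exact: FM0.
apply: eq_integral => u _; rewrite /fubini_F/=.
have mFu : measurable_fun [set: 'rV[R]_m] (F u) by exact: (measurableT_comp mF (@measurable_pair1 _ _ _ _ u)).
have mFMu : measurable_fun [set: 'rV[R]_m] (fun v => F u v * (mehler_kernel r k (u, v))%:E).
  exact: (measurableT_comp mFM (@measurable_pair1 _ _ _ _ u)).
have ma : measurable_fun [set: 'rV[R]_m] (fun v => F u (k *: v + r *: u)%R).
  exact: (measurableT_comp mFu (measurable_rV_affine _ _)).
rewrite (gauss_integral ma)//; rewrite (gauss_integral mFMu); last first.
  by move=> v; rewrite mule_ge0// lee_fin.
pose H (v : 'rV[R]_m) := F u v * (gpdf (k^-1 *: (v - r *: u))%R)%:E.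
have mg : measurable_fun [set: 'rV[R]_m] (fun v => (gpdf (k^-1 *: (v - r *: u))%R)%:E).
  apply/measurable_EFinP; apply: (measurableT_comp (@measurable_gpdf R m)).
  apply: measurable_fun_rVP => i; under eq_fun do rewrite !mxE.
  by apply: measurable_funM => //; apply: measurable_funB => //; exact: measurable_coord.
have mH : measurable_fun [set: 'rV[R]_m] H by exact: emeasurable_funM.
have H0 v : 0 <= H v by rewrite mule_ge0// lee_fin gpdf_ge0.
have L := leb_affine (r *: u)%R k0 mH H0.
transitivity (\int[leb R m]_v H (k *: v + r *: u)%R).
  apply: eq_integral => v _; rewrite /H addrK scalerA mulVf ?gt_eqF// scale1r//.
rewrite L -ge0_integralZl//; last by rewrite lee_fin exprn_ge0// invr_ge0 ltW.
apply: eq_integral => v _; rewrite /H muleCA -EFinM mehler_kernelE// EFinM muleA//.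
Qed.

Variables (h : 'rV[R]_m -> R) (c : R).
Hypotheses (mh : measurable_fun [set: 'rV[R]_m] h)
  (hc : forall u, (`|h u| <= c * expR (dot u u / 8))%R).
Hypotheses (h0 : \int[gauss R m]_u (h u)%:E = 0)
  (h1 : forall j, \int[gauss R m]_u (h u * u ord0 j)%:E = 0).

Let c0 : (0 <= c)%R.
Proof.
have := hc 0%R; rewrite (_ : dot 0 0 = 0)%R ?mul0r ?expR0 ?mulr1; first exact: le_trans.
by rewrite /dot big1// => i _; rewrite mxE mul0r.
Qed.

Let hh (p : 'rV[R]_m * 'rV[R]_m) := (h p.1 * h p.2)%R.

Let mhh : measurable_fun [set: 'rV[R]_m * 'rV[R]_m] hh.
Proof.
apply: measurable_funM; first exact: (measurableT_comp mh measurable_fst).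
exact: (measurableT_comp mh measurable_snd).
Qed.

Let me4 : measurable_fun [set: 'rV[R]_m] (fun u => (expR (dot u u / 4))%:E).
Proof.
apply/measurable_EFinP; apply: measurableT_comp => //.
by apply: measurable_funM => //; exact: measurable_dotxx.
Qed.

Let E4 (p : 'rV[R]_m * 'rV[R]_m) : R := expR ((dot p.1 p.1 + dot p.2 p.2) / 4).

Let mE4 : measurable_fun [set: 'rV[R]_m * 'rV[R]_m] E4.
Proof.
apply: measurableT_comp => //; apply: measurable_funM => //.
apply: measurable_funD; apply: measurable_dot_comp; by [exact: measurable_fst|exact: measurable_snd].
Qed.

Let intE4 : \int[G]_p (E4 p)%:E = (2 ^+ m)%:E.
Proof.
rewrite /G fubini_tonelli1//; last 2 first.
- exact/measurable_EFinP.
- by move=> p; rewrite lee_fin expR_ge0.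
transitivity (\int[gauss R m]_u ((expR (dot u u / 4))%:E * (Num.sqrt 2 ^+ m)%:E)).
  apply: eq_integral => u _; rewrite /fubini_F /E4/=.
  under eq_integral do rewrite mulrDl expRD EFinM.
  rewrite ge0_integralZl ?gauss_exp_quarter// ?lee_fin ?expR_ge0//.
rewrite ge0_integralZr ?gauss_exp_quarter// ?lee_fin ?exprn_ge0 ?sqrtr_ge0//.
by rewrite -EFinM -exprMn -expr2 sqr_sqrtr.
Qed.

Let integrableG (f : 'rV[R]_m * 'rV[R]_m -> R) (C : R) :
  measurable_fun [set: 'rV[R]_m * 'rV[R]_m] f -> (forall p, (`|f p| <= C * E4 p)%R) ->
  G.-integrable setT (fun p => (f p)%:E).
Proof.
move=> mf fC.
have C0 : (0 <= C)%R.
  have := fC (0%R, 0%R); rewrite /E4/= (_ : dot 0 0 = 0)%R ?addr0 ?mul0r ?expR0 ?mulr1; first exact: le_trans.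
  by rewrite /dot big1// => i _; rewrite mxE mul0r.
have iE : G.-integrable setT (fun p => (E4 p)%:E).
  apply/integrableP; split; first exact/measurable_EFinP.
  under eq_integral do rewrite /= ger0_norm ?expR_ge0//.
  by rewrite intE4 ltry.
apply: (le_integrable measurableT _ _ (integrableZl measurableT C iE)) => //; first exact/measurable_EFinP.
move=> p _ /=; rewrite lee_fin (le_trans (fC p))//; exact: ler_norm.
Qed.

Let integrable1 (f : 'rV[R]_m -> R) (C : R) :
  measurable_fun [set: 'rV[R]_m] f -> (forall u, (`|f u| <= C * expR (dot u u / 4))%R) ->
  (gauss R m).-integrable setT (fun p => (f p)%:E).
Proof.
move=> mf fC.
have iE : (gauss R m).-integrable setT (fun u => (expR (dot u u / 4))%:E).
  apply/integrableP; split => //.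
  under eq_integral do rewrite /= ger0_norm ?expR_ge0//.
  by rewrite gauss_exp_quarter ltry.
apply: (le_integrable measurableT _ _ (integrableZl measurableT C iE)) => //; first exact/measurable_EFinP.
move=> p _ /=; rewrite lee_fin (le_trans (fC p))//; exact: ler_norm.
Qed.

Let exp84 (t : R) : (expR (t / 8) * expR (t / 8) = expR (t / 4))%R.
Proof. by rewrite -expRD; congr expR; field. Qed.

Let hh_bound p : (`|hh p| <= c ^+ 2 * expR ((dot p.1 p.1 + dot p.2 p.2) / 8))%R.
Proof.
rewrite normrM (le_trans (ler_pM _ _ (hc _) (hc _)))//.
by rewrite mulrDl expRD mulrACA expr2.
Qed.

Let dot_cs (u v : 'rV[R]_m) : (2 * `|dot u v| <= dot u u + dot v v)%R.
Proof.
rewrite /dot mulrC -ler_pdivlMr// (le_trans (ler_norm_sum _ _ _))//.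
rewrite -big_split/= mulr_suml; apply: ler_sum => i _.
rewrite normrM ler_pdivlMr// -!expr2 -(real_normK (num_real (u ord0 i))) -(real_normK (num_real (v ord0 i))).
have := sqr_ge0 (`|u ord0 i| - `|v ord0 i|)%R; lra.
Qed.

Let e8_ge1 (t : R) : (0 <= t -> 1 <= expR (t / 8))%R.
Proof. by move=> t0; rewrite -[leLHS]expR0 ler_expR divr_ge0. Qed.

Let w_ge0 (p : 'rV[R]_m * 'rV[R]_m) : (0 <= dot p.1 p.1 + dot p.2 p.2)%R.
Proof. by rewrite addr_ge0// dot_ge0. Qed.

Let ihh : G.-integrable setT (fun p => (hh p)%:E).
Proof.
apply: (integrableG (C := (c ^+ 2)%R)) => // p.
rewrite (le_trans (hh_bound p))// /E4 -exp84 ler_wpM2l ?sqr_ge0//.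
by rewrite ler_peMr ?expR_ge0// e8_ge1.
Qed.

Let int_hh : \int[G]_p (hh p)%:E = 0.
Proof.
rewrite /G -integral12_prod_meas1//.
rewrite integral0_eq// => u _; rewrite /fubini_F/= /hh/=.
under eq_integral do rewrite EFinM.
rewrite integralZl ?h0 ?mule0//.
apply: (integrable1 (C := c)) => // v; rewrite (le_trans (hc v))// -exp84 ler_wpM2l//.
by rewrite ler_peMr ?expR_ge0// e8_ge1// dot_ge0.
Qed.

Let hhs p := (hh p * dot p.1 p.2)%R.

Let mhhs : measurable_fun [set: 'rV[R]_m * 'rV[R]_m] hhs.
Proof. by apply: measurable_funM => //; exact: measurable_dot. Qed.

Let ihhs : G.-integrable setT (fun p => (hhs p)%:E).
Proof.
apply: (integrableG (C := (4 * c ^+ 2)%R)) => // p.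
rewrite normrM /E4 -exp84 [leRHS](_ : _ = c ^+ 2 * expR ((dot p.1 p.1 + dot p.2 p.2) / 8) *
   (4 * expR ((dot p.1 p.1 + dot p.2 p.2) / 8)))%R; last by ring.
apply: ler_pM => //.
have := dot_cs p.1 p.2; have := expR_ge1Dx ((dot p.1 p.1 + dot p.2 p.2) / 8)%R; lra.
Qed.

Let int_hhs : \int[G]_p (hhs p)%:E = 0.
Proof.
rewrite /G -integral12_prod_meas1//.
rewrite integral0_eq// => u _; rewrite /fubini_F/= /hhs /hh/=.
transitivity (\int[gauss R m]_v \sum_(j < m) ((h u * u ord0 j)%:E * (h v * v ord0 j)%:E)).
  apply: eq_integral => v _; rewrite /dot mulr_sumr -sumEFin.
  by apply: eq_bigr => j _; rewrite -EFinM; congr EFin; ring.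
have ij (j : 'I_m) : (gauss R m).-integrable setT (fun v => (h v * v ord0 j)%:E).
  apply: (integrable1 (C := (4 * c)%R)).
    by apply: measurable_funM => //; exact: measurable_coord.
  move=> v; rewrite normrM -exp84.
  rewrite [leRHS](_ : _ = c * expR (dot v v / 8) * (4 * expR (dot v v / 8)))%R; last by ring.
  apply: ler_pM => //.
  have vj : (`|v ord0 j| ^+ 2 <= dot v v)%R.
    rewrite /dot (bigD1 j)//= real_normK ?num_real// expr2 lerDl.
    by apply: sumr_ge0 => i _; rewrite -expr2 sqr_ge0.
  have := expR_ge1Dx (dot v v / 8)%R; have := sqr_ge0 (`|v ord0 j| - 1)%R; lra.
rewrite integral_sum//; last by move=> j; exact: integrableZl.
by apply: big1 => j _; rewrite integralZl// h1 mule0.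
Qed.

Let mhX x' : measurable_fun [set: Omega] (fun w => h (field_row eta x' w)).
Proof. exact: (measurableT_comp mh (measurable_field_row eta x')). Qed.

Lemma two_point_signed (k : R) : (0 < k)%R -> (k ^+ 2 = 1 - r ^+ 2)%R ->
  \int[P]_w (h (field_row eta x w) * h (field_row eta y w))%:E =
  \int[G]_p (hh p * mehler_kernel r k p)%:E.
Proof.
move=> k0 kr; rewrite integralE [RHS]integralE; congr (_ - _).
  transitivity (\int[P]_w (Num.max (h (field_row eta x w) * h (field_row eta y w)) 0)%:E).
    by apply: eq_integral => w _; rewrite funeposE -EFin_max.
  rewrite (two_point_density (F := fun u v => (Num.max (h u * h v) 0)%:E) k0 kr); last 2 first.
  - by apply/measurable_EFinP; exact: measurable_maxr.
  - by move=> u v; rewrite lee_fin le_max lexx orbT.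
  apply: eq_integral => p _; rewrite funeposE -EFin_max -EFinM; congr EFin.
  by rewrite maxr_pMl ?mul0r// /mehler_kernel mulr_ge0 ?expR_ge0// invr_ge0 exprn_ge0// ltW.
transitivity (\int[P]_w (Num.max (- (h (field_row eta x w) * h (field_row eta y w))) 0)%:E).
  by apply: eq_integral => w _; rewrite funenegE -EFin_max.
rewrite (two_point_density (F := fun u v => (Num.max (- (h u * h v)) 0)%:E) k0 kr); last 2 first.
- by apply/measurable_EFinP; apply: measurable_maxr => //; exact: measurableT_comp.
- by move=> u v; rewrite lee_fin le_max lexx orbT.
apply: eq_integral => p _; rewrite funenegE -EFin_max -EFinM; congr EFin.
by rewrite maxr_pMl ?mul0r ?mulNr// /mehler_kernel mulr_ge0 ?expR_ge0// invr_ge0 exprn_ge0// ltW.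
Qed.

Lemma mehler_small : (`|r| <= 16^-1)%R ->
  `|\int[P]_w (h (field_row eta x w) * h (field_row eta y w))%:E| <=
  ((m%:R * 2 ^+ m + 1040) * 2 ^+ m * c ^+ 2 * r ^+ 2)%:E.
Proof.
move=> r16.
have kr0 : (0 < 1 - r ^+ 2)%R.
  have := normr_ge0 r; rewrite -(real_normK (num_real r)); nra.
pose k := Num.sqrt (1 - r ^+ 2).
have k0 : (0 < k)%R by rewrite sqrtr_gt0.
have kr : (k ^+ 2 = 1 - r ^+ 2)%R by rewrite sqr_sqrtr// ltW.
rewrite (two_point_signed k0 kr).
set C := (m%:R * 2 ^+ m + 1040)%R.
pose D p := (hh p * mehler_kernel r k p - hh p - r * hhs p)%R.
have Db p : (`|D p| <= C * c ^+ 2 * r ^+ 2 * E4 p)%R.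
  have -> : D p = (hh p * (mehler_kernel r k p - 1 - r * dot p.1 p.2))%R by rewrite /D /hhs; ring.
  rewrite normrM /E4 -exp84 [leRHS](_ : _ = c ^+ 2 * expR ((dot p.1 p.1 + dot p.2 p.2) / 8) *
     (C * r ^+ 2 * expR ((dot p.1 p.1 + dot p.2 p.2) / 8)))%R; last by ring.
  apply: ler_pM => //.
  exact: mehler_kernel_taylor.
have mD : measurable_fun [set: 'rV[R]_m * 'rV[R]_m] D.
  apply: measurable_funB; last exact: measurable_funM.
  apply: measurable_funB => //; apply: measurable_funM => //; exact: measurable_mehler_kernel.
have iD := integrableG mD Db.
have -> : \int[G]_p (hh p * mehler_kernel r k p)%:E = \int[G]_p (D p)%:E.
  transitivity (\int[G]_p ((D p)%:E + ((hh p)%:E + r%:E * (hhs p)%:E))).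
    by apply: eq_integral => p _; rewrite -EFinM -!EFinD; congr EFin; rewrite /D; ring.
  rewrite integralD//; last by apply: integrableD => //; exact: integrableZl.
  rewrite integralD//; last exact: integrableZl.
  by rewrite int_hh integralZl// int_hhs mule0 !adde0.
apply: (le_trans (le_abse_integral _ measurableT _)); first exact/measurable_EFinP.
apply: (@le_trans _ _ (\int[G]_p ((C * c ^+ 2 * r ^+ 2)%:E * (E4 p)%:E))).
  apply: ge0_le_integral => //.
  - by apply/measurable_EFinP; exact: measurableT_comp.
  - by apply: emeasurable_funM => //; exact/measurable_EFinP.
  - by move=> p _ /=; rewrite lee_fin; exact: Db.
have C0 : (0 <= C)%R.
  by apply: addr_ge0; [apply: mulr_ge0; [exact: ler0n|exact: exprn_ge0]|exact: ler0n].
rewrite ge0_integralZl//.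
- by rewrite intE4 -EFinM lee_fin; rewrite le_eqVlt; apply/orP; left; apply/eqP; ring.
- exact/measurable_EFinP.
- by move=> p _; rewrite lee_fin expR_ge0.
- by rewrite lee_fin; apply: mulr_ge0; [apply: mulr_ge0 => //; exact: sqr_ge0|exact: sqr_ge0].
Qed.

Let sqr_int x' : K x' x' = 1%R ->
  \int[P]_w (h (field_row eta x' w) ^+ 2)%:E <= (c ^+ 2 * Num.sqrt 2 ^+ m)%:E.
Proof.
move=> Kx'.
rewrite (one_point_law eta_gauss eta_centered eta_cov (F := fun u => (h u ^+ 2)%:E) Kx'); last 2 first.
- by apply/measurable_EFinP; exact: measurable_funX.
- by move=> u; rewrite lee_fin sqr_ge0.
apply: (@le_trans _ _ (\int[gauss R m]_u ((c ^+ 2)%:E * (expR (dot u u / 4))%:E))).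
  apply: ge0_le_integral => //.
  - by move=> u _; rewrite lee_fin sqr_ge0.
  - by apply/measurable_EFinP; exact: measurable_funX.
  - exact: emeasurable_funM.
  - move=> u _; rewrite -EFinM lee_fin -exp84 -expr2 -exprMn -(real_normK (num_real (h u))).
    by rewrite lerXn2r ?nnegrE ?mulr_ge0 ?expR_ge0.
rewrite ge0_integralZl// ?lee_fin ?sqr_ge0//.
by rewrite gauss_exp_quarter -EFinM.
Qed.

(* The zeroth and first Hermite coefficients of [h] vanish, so only the second order of the Mehler
   kernel in [r] remains; for [1/16 < |r|] the bound is Cauchy-Schwarz. *)
Lemma mehler_bound :
  `|\int[P]_w (h (field_row eta x w) * h (field_row eta y w))%:E| <=
  ((m%:R * 2 ^+ m + 1040) * 2 ^+ m * c ^+ 2 * r ^+ 2)%:E.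
Proof.
have [r16|r16] := leP `|r|%R (16^-1)%R; first exact: mehler_small.
have mXY : measurable_fun [set: Omega] (fun w => (h (field_row eta x w) * h (field_row eta y w))%:E).
  by apply/measurable_EFinP; exact: measurable_funM.
have mX2 x' : measurable_fun [set: Omega] (fun w => (h (field_row eta x' w) ^+ 2)%:E).
  by apply/measurable_EFinP; exact: measurable_funX.
apply: (le_trans (le_abse_integral _ measurableT mXY)).
apply: (@le_trans _ _ (\int[P]_w ((h (field_row eta x w) ^+ 2)%:E + (h (field_row eta y w) ^+ 2)%:E))).
  apply: ge0_le_integral => //.
  - exact: measurableT_comp.
  - exact: emeasurable_funD.
  - move=> w _ /=; rewrite lee_fin normrM.
    rewrite -(real_normK (num_real (h (field_row eta x w)))) -(real_normK (num_real (h (field_row eta y w)))).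
    have := sqr_ge0 (`|h (field_row eta x w)| - `|h (field_row eta y w)|)%R.
    have := sqr_ge0 (`|h (field_row eta x w)| + `|h (field_row eta y w)|)%R; lra.
rewrite ge0_integralD//; last 2 first.
- by move=> w _; rewrite lee_fin sqr_ge0.
- by move=> w _; rewrite lee_fin sqr_ge0.
apply: (le_trans (leeD (sqr_int Kx) (sqr_int Ky))).
rewrite -EFinD lee_fin.
have s2 : (Num.sqrt 2 ^+ m <= 2 ^+ m :> R)%R.
  rewrite lerXn2r ?nnegrE ?sqrtr_ge0//.
  have := sqrtr_ge0 (2:R); have := sqr_sqrtr (ler0n R 2); nra.
(* As [1040 / 256 > 2], the constant of the case of small [r] also covers the bound by twice the
   second moment. *)
have r2 : (256^-1 <= r ^+ 2)%R.
  rewrite -(real_normK (num_real r)) expr2 (_ : 256^-1 = 16^-1 * 16^-1)%R; last by field.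
  by apply: ler_pM => //; apply: ltW.
have a0 : (0 <= c ^+ 2 * 2 ^+ m)%R by rewrite mulr_ge0 ?sqr_ge0 ?exprn_ge0.
have b0 : (0 <= c ^+ 2 * 2 ^+ m * (m%:R * 2 ^+ m * r ^+ 2))%R.
  apply: mulr_ge0 => //; apply: mulr_ge0; last exact: sqr_ge0.
  by apply: mulr_ge0; [exact: ler0n|exact: exprn_ge0].
have d0 : (c ^+ 2 * Num.sqrt 2 ^+ m <= c ^+ 2 * 2 ^+ m)%R by rewrite ler_wpM2l ?sqr_ge0.
have e0 : (0 <= c ^+ 2 * 2 ^+ m * (1040 * r ^+ 2 - 2))%R by apply: mulr_ge0; [exact: a0|lra].
lra.
Qed.
End pair.
End mehler.

(** * Regular variation *)

Section slowly_varying.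
Context (R : realType).
Notation mu := (@lebesgue_measure R).

Lemma integral_increment_cvg0 (h : R -> R) (y : nat -> R) :
  measurable_fun [set: R] h ->
  (forall s, h (x + s) - h x @[x --> +oo] --> (0 : R)) ->
  (forall m, m%:R <= y m) ->
  (\int[mu]_v ((\1_(`[0, 2]%classic) v * Num.min 1 `|h (y m + v) - h (y m)|)%:E) @[m --> \oo] --> 0)%E.
Proof.
move=> mh h0 hy.
have yoo : y @ \oo --> +oo.
  apply/cvgryPge => A; near=> m; apply: (@le_trans _ _ m%:R) => //.
  by near: m; exact: nbhs_infty_ger.
rewrite -[X in _ --> X](integral0 (T := measurableTypeR R) mu [set: R]).
apply: (@dominated_cvg_integral _ (measurableTypeR R) R mu _ _ (fun v => (\1_(`[0, 2]%classic) v : R)%:E)).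
- move=> m; apply/measurable_EFinP; apply: measurable_funM.
    exact: measurable_indic.
  apply: measurable_minr; first exact: measurable_cst.
  apply: (measurableT_comp (@normr_measurable R setT)).
  apply: measurable_funB; last exact: measurable_cst.
  apply: (measurableT_comp mh).
  by apply: measurable_funD; [exact: measurable_cst|exact: measurable_id].
- move=> v; apply: cvg_EFin; first exact: nearW.
  rewrite -[X in _ --> X](mulr0 (\1_(`[0, 2]%classic) v)).
  apply: cvgM; first exact: cvg_cst.
  have H : (fun m => `|h (y m + v) - h (y m)|) @ \oo --> (0:R).
    rewrite -(normr0 R); apply: cvg_norm.
    exact: (cvg_comp _ _ yoo (h0 v)).
  apply: (squeeze_cvgr _ (cvg_cst 0) H).
  by apply: nearW => m; rewrite le_min ler01 normr_ge0/= ge_min lexx orbT.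
- exact: integrable_indic_itv.
- move=> m v; rewrite lee_fin normrM ger0_norm ?indicE ?ler0n//.
  by rewrite ler_piMr// ger0_norm ?ge_min ?lexx// le_min ler01/=.
Unshelve. all: by end_near. Qed.

(** Uniform convergence theorem for slowly varying functions in additive form, meant for
    [h x = ln (L (expR x))]. If [h] differs by more than [e] between [x] and [x + u], then each
    value [h (x + v)] is far from one of the two, and the averaged increments based at [x] and at
    [x + u] cannot both be small. Along a sequence of counterexamples both tend to 0 by dominated
    convergence, the truncation at 1 providing the dominating function. *)
Lemma increment_uniform (h : R -> R) (e : R) :
  measurable_fun [set: R] h ->
  (forall s, h (x + s) - h x @[x --> +oo] --> (0 : R)) -> 0 < e ->
  exists X, forall x u, X <= x -> 0 <= u <= 1 -> `|h (x + u) - h x| <= e.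
Proof.
move=> mh h0 e0; apply: contrapT => /forallNP N.
have : forall m : nat, exists p : R * R, [/\ m%:R <= p.1, 0 <= p.2 <= 1 & e < `|h (p.1 + p.2) - h p.1| ].
  move=> m; have /existsNP[x /existsNP[u /not_implyP[mx /not_implyP[u01 /negP]]]] := N m%:R.
  by rewrite -ltNge => ?; exists (x, u).
move=> /choice[p hp].
have y1 m : m%:R <= (p m).1 by case: (hp m).
have y2 m : m%:R <= (p m).1 + (p m).2.
  by case: (hp m) => ? /andP[? _] _; rewrite ler_wpDr.
have C1 := integral_increment_cvg0 mh h0 y1.
have C2 := integral_increment_cvg0 mh h0 y2.
have C := cvgeD (fin_num_adde_defr _ (erefl : 0%E \is a fin_num)) C1 C2.
rewrite adde0 in C; move/(_ _) : C => C.
have e1 : 0 < Num.min 1 e by rewrite lt_min ltr01.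
suff: ((Num.min 1 e)%:E <= (0 : \bar R))%E by rewrite lee_fin leNgt e1.
apply: (cvge_to_ge C); apply: nearW => m /=.
have [_ /andP[u0 u1] He] := hp m.
set u := (p m).2 in u0 u1 He *; set x := (p m).1 in He *.
pose g (z v : R) : \bar R := (\1_(`[0, 2]%classic) v * Num.min 1 `|h (z + v) - h z|)%:E.
have g0 z v : (0 <= g z v)%E.
  by rewrite lee_fin mulr_ge0 ?indicE ?ler0n// le_min ler01/=.
have mg z : measurable_fun [set: R] (g z).
  apply/measurable_EFinP; apply: measurable_funM.
    exact: measurable_indic.
  apply: measurable_minr; first exact: measurable_cst.
  apply: (measurableT_comp (@normr_measurable R setT)).
  apply: measurable_funB; last exact: measurable_cst.
  apply: (measurableT_comp mh).
  by apply: measurable_funD; [exact: measurable_cst|exact: measurable_id].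
(* After a translation by [u] both base points are compared with the same point [x + v]. For [v] in
   [[1, 2]] and [u] in [[0, 1]] the translate [v - u] stays in [[0, 2]], whence the length of the
   window. *)
have E2 : (\int[mu]_v g (x + u)%R v = \int[mu]_v g (x + u)%R (1 * v + - u)%R)%E.
  by rewrite lebesgue_affine// invr1 mul1e.
rewrite -[X in (_ <= X + _)%E]/(\int[mu]_v g x v)%E -[X in (_ <= _ + X)%E]/(\int[mu]_v g (x + u)%R v)%E E2.
have mgu : measurable_fun [set: R] (fun v : R => g (x + u) (1 * v + - u)).
  by apply: (measurableT_comp (mg _)); exact: measurable_affine.
rewrite -(@ge0_integralD _ (measurableTypeR R) R mu _ measurableT (g x) _ (fun v _ => g0 x v) (mg x) _ mgu); last by move=> *; exact: g0.
have -> : ((Num.min 1 e)%:E = \int[mu]_v ((Num.min 1 e)%:E * (\1_(`[1, 2]%classic) v)%:E) :> \bar R)%E.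
  rewrite ge0_integralZl//; last by rewrite lee_fin ltW.
    rewrite integral_indic//= setIT.
    have -> : lebesgue_measure (`[1, 2]%classic : set R) = 1%E :> \bar R.
      by rewrite lebesgue_measure_itv/= lte_fin ltr1n -EFinD; congr EFin; lra.
    by rewrite mule1.
  by apply/measurable_EFinP; exact: measurable_indic.
apply: ge0_le_integralT.
  by move=> v; rewrite -EFinM lee_fin mulr_ge0 ?indicE ?ler0n// ltW.
move=> v; rewrite indicE.
case: (boolP (v \in _)); last by rewrite mule0 adde_ge0.
rewrite inE/= in_itv/= => /andP[v1 v2]; rewrite mule1 /g -EFinD lee_fin !indicE.
rewrite !mem_set/= ?in_itv/=; [|by lra|by lra].
rewrite !mul1r (_ : x + u + (v - u) = x + v); last by lra.
have T : `|h (x + u) - h x| <= `|h (x + v) - h x| + `|h (x + v) - h (x + u)|.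
  rewrite (_ : h (x + u) - h x = (h (x + v) - h x) - (h (x + v) - h (x + u))); last by lra.
  exact: ler_normB.
have := lt_le_trans He T.
move: (normr_ge0 (h (x + v) - h x)) (normr_ge0 (h (x + v) - h (x + u))).
set A := `|_|; set B := `|_| => A0 B0 AB.
rewrite /Num.min; do ![case: ifPn => ?]; lra.
Unshelve. all: by end_near. Qed.
End slowly_varying.

(** * Potter bounds *)

Section potter.
Context (R : realType) (L : R -> R).
Hypothesis sL : slowly_varying L.

Lemma cvgy_expR : expR x @[x --> +oo] --> (+oo : set_system R).
Proof.
apply/cvgryPge => A; near=> x; apply: (le_trans _ (expR_ge1Dx x)).
rewrite ler_wpDl//; near: x; apply: nbhs_pinfty_ge; exact: num_real.
Unshelve. all: by end_near. Qed.

(** The distance [u] is cut into at most [Num.truncn u + 1] steps of length at most 1, each costing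
    [e] by the uniform bound. *)
Lemma potter_ln (e : R) : 0 < e ->
  exists2 X, 0 < X & forall t u, X <= t -> 0 <= u ->
    0 < L t /\ `|ln (L (expR u * t)) - ln (L t)| <= e * (1 + u).
Proof.
case: sL => mL [X0 [_ L0]] Lr e0.
pose h x := ln (L (expR x)).
have mh : measurable_fun [set: R] h.
  apply: (measurableT_comp (@measurable_ln R)).
  apply: (measurable_comp (F := (`]0, +oo[%classic : set R))) => //.
  by move=> _ [x _ <-]; rewrite /= in_itv/= expR_gt0.
have Loo x : X0 <= x -> 0 < L (expR x).
  by move=> ?; apply: L0; apply: (le_lt_trans (y := x)) => //; apply: lt_le_trans (expR_ge1Dx x); rewrite ltrDr.
have hs s : h (x + s) - h x @[x --> +oo] --> (0 : R).
  have H : L (expR s * t) / L t @[t --> +oo] --> (1 : R) by apply: Lr; exact: expR_gt0.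
  have E : L (expR s * expR x) / L (expR x) @[x --> +oo] --> (1 : R) := cvg_comp _ _ cvgy_expR H.
  have E2 : ln (L (expR s * expR x) / L (expR x)) @[x --> +oo] --> (0 : R).
    by rewrite -[X in _ --> X](@ln1 R); exact: (cvg_comp _ _ E (continuous_ln ltr01)).
  apply: cvg_trans E2; apply: near_eq_cvg; near=> x.
  have x1 : X0 <= x by near: x; apply: nbhs_pinfty_ge; exact: num_real.
  have x2 : X0 <= x + s by rewrite -lerBlDr; near: x; apply: nbhs_pinfty_ge; exact: num_real.
  by rewrite /h ln_div ?posrE -?expRD 1?[s + x]addrC ?Loo.
have [X1 hX] := increment_uniform mh hs e0.
pose Y := Num.max X0 X1.
exists (expR Y) => [|t u Yt u0]; first exact: expR_gt0.
have t0 : 0 < t by apply: lt_le_trans Yt; exact: expR_gt0.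
have Yl : Y <= ln t by rewrite -ler_expR lnK.
rewrite -(lnK t0); move: (ln t) Yl => {t t0 Yt} x Yx.
split; first by apply: Loo; apply: le_trans Yx; rewrite le_max lexx.
have Yx1 : X1 <= x by apply: le_trans Yx; rewrite le_max lexx orbT.
rewrite -expRD -/(h _) -/(h x) [u + x]addrC.
suff main N v z : X1 <= z -> 0 <= v <= N.+1%:R -> `|h (z + v) - h z| <= e * N.+1%:R.
  apply: (le_trans (main (Num.truncn u) _ _ _ _)) => //.
    by rewrite u0 ltW// truncnS_gt.
  by rewrite ler_pM2l// -natr1 addrC lerD2l truncn_le.
elim: N v z => [|N IH] v z z1 /andP[v0 vN].
  by rewrite mulr1; apply: hX => //; rewrite v0.
have [v1|v1] := leP v 1.
  apply: (le_trans (hX _ _ z1 _)); first by rewrite v0.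
  by rewrite ler_pMr// ler1n.
have H1 : `|h (z + 1) - h z| <= e by apply: hX => //; rewrite ler01 lexx.
have H2 : `|h (z + v) - h (z + 1)| <= e * N.+1%:R.
  rewrite (_ : z + v = z + 1 + (v - 1)); last by lra.
  by apply: IH; [lra|rewrite -natr1 in vN; lra].
rewrite (_ : h (z + v) - h z = (h (z + v) - h (z + 1)) + (h (z + 1) - h z)); last by lra.
by apply: (le_trans (ler_normD _ _)); rewrite -[N.+2%:R]natr1 mulrDr mulr1 lerD.
Unshelve. all: by end_near. Qed.

Lemma potter (e : R) : 0 < e ->
  exists2 X, 0 < X & forall t s, X <= t -> 1 <= s ->
    [/\ 0 < L t, 0 < L (s * t), L (s * t) <= expR e * s `^ e * L t
      & L t <= expR e * s `^ e * L (s * t)].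
Proof.
move=> e0; have [X X0 HX] := potter_ln e0; exists X => // t s Xt s1.
have s0 : 0 < s by lra.
have [Lt Hln] := HX t (ln s) Xt (ln_ge0 s1).
rewrite lnK// in Hln.
have Xst : X <= s * t by apply: (le_trans Xt); rewrite ler_peMl//; exact: le_trans (ltW X0) Xt.
have [Lst _] := HX _ _ Xst (lexx 0).
split=> //; rewrite /powR (gt_eqF s0) -expRD -ler_ln ?posrE ?mulr_gt0 ?expR_gt0// lnM ?posrE ?expR_gt0// expRK;
  move: Hln; rewrite ler_norml => /andP[]; lra.
Qed.

End potter.
Section regular.
Context (R : realType) (L : R -> R) (alpha : R).
Hypothesis sL : slowly_varying L.
Hypothesis al0 : 0 < alpha.
Notation rho u := (u `^ (- alpha) * L u).
Hypothesis rho1 : forall u, 0 < u -> `|rho u| <= 1.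

Lemma measurable_rho : measurable_fun (`]0, +oo[ : set R) (fun u => rho u).
Proof.
case: sL => mL _ _; apply: measurable_funM => //.
by apply: measurable_funTS; exact: measurable_powR.
Qed.

Lemma powR_quot (x y e : R) : 0 < x -> 0 < y -> (x / y) `^ e = x `^ e / y `^ e.
Proof.
move=> x0 y0; rewrite powRM ?invr_ge0 ?(ltW x0) ?(ltW y0)//.
by rewrite -powR_inv1 ?(ltW y0)// -powRrM mulN1r powRN.
Qed.

Lemma slowly_varying_gt0 : exists2 X, 0 < X & forall t, X <= t -> 0 < L t.
Proof.
have [X X0 H] := potter sL ltr01; exists X => // t Xt.
by have [] := H t 1 Xt (lexx 1).
Qed.

(** Below the Potter threshold only [|rho| <= 1] is available, but there [u ^ (- tau)] is bounded
    away from 0; above it the Potter bound costs the exponent [alpha - tau]. *)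
Lemma regular_decay (tau : R) : 0 < tau < alpha ->
  exists2 A, 0 < A & forall u, 0 < u -> `|rho u| <= A * u `^ (- tau).
Proof.
move=> /andP[t0 ta].
have e0 : 0 < alpha - tau by rewrite subr_gt0.
have [X X0 H] := potter sL e0.
have [LX _ _ _] := H X 1 (lexx _) (lexx _).
pose C := expR (alpha - tau) * (X `^ (alpha - tau))^-1 * L X.
have pX s : 0 < X `^ s by exact: powR_gt0.
have C0 : 0 < C by rewrite !mulr_gt0 ?expR_gt0 ?invr_gt0.
exists (C + X `^ tau) => [|u u0]; first by rewrite addr_gt0.
have pu s : 0 < u `^ s by exact: powR_gt0.
have [uX|Xu] := leP u X.
  apply: (le_trans (rho1 u0)); rewrite mulrDl ler_wpDl//.
    by rewrite mulr_ge0 ?ltW.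
  rewrite powRN ler_pdivlMr// mul1r.
  by apply: ge0_ler_powR => //; rewrite ?nnegrE ltW.
have s1 : 1 <= u / X by rewrite ler_pdivlMr// mul1r ltW.
have [_ Lu Lu1 _] := H X (u / X) (lexx _) s1.
rewrite divfK ?gt_eqF// in Lu Lu1.
rewrite ger0_norm ?(mulr_ge0 (ltW (pu _)) (ltW Lu))// mulrDl.
apply: ler_wpDr; first exact: mulr_ge0 (ltW (pX _)) (ltW (pu _)).
have := ler_wpM2l (ltW (pu (- alpha))) Lu1; move/le_trans; apply.
rewrite powR_quot// /C le_eqVlt; apply/orP; left; apply/eqP.
rewrite (_ : u `^ (- tau) = u `^ (- alpha) * u `^ (alpha - tau)); first by ring.
by rewrite -powRD ?(gt_eqF u0) ?implybT//; congr (_ `^ _); lra.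
Qed.

(** By Potter, [L r] stays above a multiple of [r ^ (- e / 2)]: half of the power compensates for
    this and the other half diverges. *)
Lemma slowly_varying_pow_cvgy (e : R) : 0 < e -> r `^ e * L r @[r --> +oo] --> +oo.
Proof.
move=> e0; have e2 : 0 < e / 2 by rewrite divr_gt0.
have [X X0 H] := potter sL e2.
have [LX _ _ _] := H X 1 (lexx _) (lexx _).
pose C := expR (e / 2) * (X `^ (e / 2))^-1.
have C0 : 0 < C by rewrite mulr_gt0 ?expR_gt0 ?invr_gt0 ?powR_gt0.
apply/cvgryPge => A; near=> r.
have Xr : X <= r by near: r; apply: nbhs_pinfty_ge; exact: num_real.
have r0 : 0 < r by exact: lt_le_trans Xr.
have s1 : 1 <= r / X by rewrite ler_pdivlMr// mul1r.
have [_ Lu _ Lu1] := H X (r / X) (lexx _) s1.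
rewrite divfK ?gt_eqF// in Lu Lu1.
have E : expR (e / 2) * (r / X) `^ (e / 2) = C * r `^ (e / 2).
  by rewrite powR_quot// /C; ring.
rewrite E in Lu1.
have P0 : 0 < r `^ (e / 2) by exact: powR_gt0.
have B : A * C / L X <= r `^ (e / 2).
  have [B0|B0] := leP (A * C / L X) 0; first by apply: (le_trans B0); exact: ltW.
  have -> : A * C / L X = ((A * C / L X) `^ (e / 2)^-1) `^ (e / 2).
    by rewrite -powRrM mulVf ?gt_eqF// powRr1// ltW.
  have B1 : (A * C / L X) `^ (e / 2)^-1 <= r.
    near: r; apply: nbhs_pinfty_ge; exact: num_real.
  by apply: ge0_ler_powR; rewrite ?nnegrE ?powR_ge0 ?(ltW e2) ?(ltW r0).
have -> : r `^ e = r `^ (e / 2) * r `^ (e / 2).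
  by rewrite -powRD ?(gt_eqF r0) ?implybT//; congr (_ `^ _); lra.
have H1 : A * C * L X <= C * (r `^ (e / 2) * r `^ (e / 2) * L r) * L X.
  rewrite ler_pM2r// ; move: B; rewrite ler_pdivrMr// => B; apply: (le_trans B).
  rewrite [leRHS](_ : _ = r `^ (e / 2) * (C * r `^ (e / 2) * L r)); last by ring.
  by rewrite ler_pM2l.
by rewrite -(ler_pM2l C0) -(ler_pM2r LX) [C * A]mulrC.
Unshelve. all: by end_near. Qed.

(** The domination must hold down to [s = 0]. As long as [r * s] exceeds the Potter threshold [X],
    Potter applies between [r] and [r * s], in the direction given by the position of [s] with
    respect to 1. Once [r * s] is below [X] nothing is known but [|rho| <= 1]; then [s < X / r], and
    [s ^ (- (alpha + delta)) * rho r] is at least 1 because [r ^ delta * L r] tends to infinity. *)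
Lemma regular_ratio_bound (M delta : R) : 0 < M -> 0 < delta ->
  exists A, exists2 X, 0 < X & forall r s, X <= r -> 0 < s <= M ->
    `|rho (r * s)| <= A * s `^ (- (alpha + delta)) * rho r.
Proof.
move=> M0 d0; have [X X0 H] := potter sL d0.
have [Y [_ HY]] : \forall r \near +oo, X `^ (alpha + delta) <= r `^ delta * L r.
  have /cvgryPge := slowly_varying_pow_cvgy d0; exact.
pose N := Num.max 1 M.
have N1 : 1 <= N by rewrite le_max lexx.
pose A := expR delta * N `^ (delta + delta).
have Np1 : 1 <= N `^ (delta + delta).
  have : 1 `^ (delta + delta) <= N `^ (delta + delta) by apply: ge0_ler_powR; rewrite ?nnegrE; lra.
  by rewrite powR1.
exists A; exists (Num.max X (Num.max Y 0 + 1)); first by rewrite lt_max X0.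
move=> r s; rewrite ge_max => /andP[Xr Yr] /andP[s0 sM].
have {Yr}/HY Yr : Y < r by move: Yr; rewrite /Num.max; case: ifPn => ?; lra.
have r0 : 0 < r by exact: lt_le_trans Xr.
have [Lr _ _ _] := H r 1 Xr (lexx _).
have ps t : 0 < s `^ t by exact: powR_gt0.
have pr t : 0 < r `^ t by exact: powR_gt0.
have A1 : 1 <= A.
  rewrite -(mulr1 1); by apply: ler_pM => //; rewrite -expR0 ler_expR ltW.
have [rsX|Xrs] := leP X (r * s); last first.
  have rs0 : 0 < r * s by exact: mulr_gt0.
  apply: (le_trans (rho1 rs0)).
  have H1 : 1 <= s `^ (- (alpha + delta)) * (r `^ (- alpha) * L r).
    rewrite powRN mulrC ler_pdivlMr// mul1r.
    have H2 : (r * s) `^ (alpha + delta) <= X `^ (alpha + delta).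
      by apply: ge0_ler_powR; rewrite ?nnegrE ?(ltW rs0) ?(ltW X0) ?(ltW Xrs)// ltW// addr_gt0.
    have := le_trans H2 Yr; rewrite powRM ?(ltW r0) ?(ltW s0)// powRN.
    rewrite [r `^ _]powRD ?(gt_eqF r0) ?implybT// => H3.
    rewrite mulrC ler_pdivlMr// -(ler_pM2l (pr delta)); lra.
  by rewrite -mulrA -[leLHS]mulr1 ler_pM.
have E1 : `|rho (r * s)| = r `^ (- alpha) * s `^ (- alpha) * `|L (s * r)|.
  by rewrite powRM ?(ltW r0) ?(ltW s0)// normrM ger0_norm ?(mulr_ge0 (ltW (pr _)) (ltW (ps _)))// [r * s]mulrC.
rewrite E1 opprD powRD ?(gt_eqF s0) ?implybT//.
have H3 : `|L (s * r)| <= A * s `^ (- delta) * L r.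
  have [s1|/ltW s1] := leP 1 s.
    have [_ L1 L2 _] := H r s Xr s1.
    rewrite (gtr0_norm L1); apply: (le_trans L2); rewrite ler_pM2r//.
    rewrite -mulrA ler_pM2l ?expR_gt0// powRN ler_pdivlMr//.
    rewrite -powRD ?(gt_eqF s0) ?implybT//.
    apply: ge0_ler_powR; rewrite ?nnegrE; [lra|lra|lra|].
    by rewrite le_max sM orbT.
  have s1' : 1 <= s^-1 by rewrite invf_ge1.
  have [L1 L2 _ L3] := H (r * s) (s^-1) rsX s1'.
  rewrite [r * s]mulrC mulKf ?gt_eqF// in L1 L2 L3.
  rewrite (gtr0_norm L1); apply: (le_trans L3).
  rewrite -powR_inv1 ?(ltW s0)// -powRrM mulN1r ler_pM2r// ler_pM2r// /A ler_pMr ?expR_gt0//.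
have := ler_wpM2l (ltW (mulr_gt0 (pr (- alpha)) (ps (- alpha)))) H3.
by move/le_trans; apply; rewrite le_eqVlt; apply/orP; left; apply/eqP; ring.
Qed.

Lemma regular_ratio_cvg (s : R) : 0 < s ->
  rho (r * s) / rho r @[r --> +oo] --> s `^ (- alpha).
Proof.
move=> s0; case: (sL) => _ _ Lr.
rewrite -[X in _ --> X]mulr1.
have H : s `^ (- alpha) * (L (s * r) / L r) @[r --> +oo] --> s `^ (- alpha) * 1.
  by apply: cvgM; [exact: cvg_cst|exact: Lr].
apply: cvg_trans H; apply: near_eq_cvg; near=> r.
have r0 : 0 < r by near: r; apply: nbhs_pinfty_gt; exact: num_real.
have pr : r `^ (- alpha) != 0 by rewrite gt_eqF// powR_gt0.
by rewrite powRM ?(ltW r0) ?(ltW s0)// [r * s]mulrC invfM -!mulrA [in RHS]mulrCA; congr (_ * _); rewrite [in RHS]mulrCA; rewrite mulVKf.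
Unshelve. all: by end_near. Qed.

End regular.

(** * Gamma and beta integrals *)

Section exp_measure.
Context (R : realType).
Notation mu := (@lebesgue_measure R).

Definition exp_measure (A : set (measurableTypeR R)) : \bar R := (\int[mu]_(u in A) (expR u)%:E)%E.

Let exp_measure0 : exp_measure set0 = 0%E.
Proof. by rewrite /exp_measure integral_set0. Qed.

Let exp_measure_ge0 A : (0 <= exp_measure A)%E.
Proof. by apply: integral_ge0 => x _; rewrite lee_fin expR_ge0. Qed.

Let exp_measure_sigma_additive : semi_sigma_additive exp_measure.
Proof.
move=> /= A mA tA mUA.
rewrite /exp_measure ge0_integral_bigcup//=.
- apply: is_cvg_ereal_nneg_natsum_cond => n _ _.
  by apply: integral_ge0 => /= x ?; rewrite lee_fin expR_ge0.
- by apply/measurable_EFinP; apply: measurable_funTS; exact: measurable_expR.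
Qed.

HB.instance Definition _ := isMeasure.Build _ _ _ exp_measure
  exp_measure0 exp_measure_ge0 exp_measure_sigma_additive.

Lemma exp_measure_Nyc (c : R) : exp_measure `]-oo, c]%classic = (expR c)%:E.
Proof.
rewrite /exp_measure -[c]opprK ge0_integration_by_substitutionNy; last 2 first.
- by apply: continuous_subspaceT => x; exact: continuous_expR.
- by move=> x _; exact: expR_ge0.
rewrite (@ge0_continuous_FTC2y _ _ (fun x => - expR (- x)) _ 0).
- by rewrite -EFinB sub0r !opprK.
- by move=> x _; exact: expR_ge0.
- apply: continuous_subspaceT => x.
  by apply: continuous_comp; [exact: opp_continuous|exact: continuous_expR].
- by rewrite -oppr0; apply: cvgN; exact: cvgr_expR.
- by move=> x _; apply: ex_derive.
- apply: cvg_at_right_filter.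
  apply: cvgN; apply: continuous_comp; [exact: opp_continuous|exact: continuous_expR].
- move=> x _ /=; rewrite derive1E derive_val/=.
  by rewrite /GRing.scale/=; ring.
Qed.

Lemma exp_measure_oc (a c : R) : a <= c ->
  exp_measure `]a, c]%classic = (expR c - expR a)%:E.
Proof.
move=> ac.
have := exp_measure_Nyc c.
rewrite (_ : `]-oo, c]%classic = `]-oo, a]%classic `|` `]a, c]%classic); last first.
  apply/seteqP; split=> x /=; rewrite !in_itv/=.
    by have [xa|xa] := leP x a; [left|right].
  by case=> [xa|/andP[]//]; exact: le_trans ac.
rewrite measureU//; last first.
  apply/seteqP; split=> x //=; rewrite !in_itv/= => -[xa /andP[ax _]].
  by move: ax; rewrite ltNge xa.
rewrite [X in (X + _)%E = _ -> _](exp_measure_Nyc a) => H.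
by rewrite EFinB -H [X in (X - _)%E]addeC addeK.
Qed.

(* The measure [dt] on the half-line is the image of [exp u du]: every power substitution in the
   integrals below becomes an affine one. *)
Lemma integral_exp_subst (G : R -> \bar R) :
  measurable_fun [set: R] G -> (forall x, 0 <= G x)%E ->
  (\int[mu]_(t in `]0%R, +oo[) G t = \int[mu]_u (G (expR u) * (expR u)%:E))%E.
Proof.
move=> mG G0.
have mN : measurable (`]-oo, 0]%classic : set (measurableTypeR R)) by [].
have mexp : measurable_fun [set: measurableTypeR R] (expR : measurableTypeR R -> measurableTypeR R).
  exact: measurable_expR.
pose h : measurableTypeR R -> measurableTypeR R := expR.
(* The image measure lives on the positive half-line; Lebesgue measure on the other half is added so
   that uniqueness of Lebesgue measure on the whole line applies. *)
pose nu0 : {measure set (measurableTypeR R) -> \bar R} := measure_add (pushforward exp_measure h) (mrestr mu mN).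
pose nu := nu0 mexp.
have nuE A : measurable A -> mu A = nu A.
  move=> mA; apply: lebesgue_measure_unique => // _ [[a c]] _ <-.
  rewrite [RHS](_ : _ = (exp_measure (h @^-1` `]a, c]%classic) + mu (`]a, c]%classic `&` `]-oo, 0%R]%classic))%E); last exact: measure_addE.
  have [ca|ac] := leP c a.
    have E0 : (`]a, c]%classic : set R) = set0.
      by apply/seteqP; split=> x //=; rewrite in_itv/= => /andP[]; lra.
    by rewrite E0 preimage_set0 set0I !measure0 adde0.
  have [c0|c0] := leP c 0.
    have -> : h @^-1` `]a, c]%classic = set0.
      apply/seteqP; split=> x //=; rewrite in_itv/= => /andP[_].
      by rewrite leNgt (le_lt_trans c0)// expR_gt0.
    have -> : (`]a, c]%classic `&` `]-oo, 0]%classic : set R) = `]a, c]%classic.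
      apply/seteqP; split=> x /=; rewrite !in_itv/=; first by case.
      move=> xac.
      by split => //; case/andP: xac => _ /le_trans; exact.
    by rewrite measure0 add0e.
  have [a0|a0] := ltP 0 a.
    have -> : h @^-1` `]a, c]%classic = `]ln a, ln c]%classic.
      by apply/seteqP; split=> x; rewrite /= !in_itv/= /h -[ln a < x]ltr_expR -[x <= ln c]ler_expR !lnK.
    have -> : (`]a, c]%classic `&` `]-oo, 0]%classic : set R) = set0.
      by apply/seteqP; split=> x //=; rewrite !in_itv/= => -[/andP[]]; lra.
    rewrite measure0 adde0 [RHS]exp_measure_oc; last by rewrite ler_ln ?posrE// ltW.
    by rewrite !lnK// lebesgue_measure_itv/= lte_fin ac.
  have -> : h @^-1` `]a, c]%classic = `]-oo, ln c]%classic.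
    by apply/seteqP; split=> x; rewrite /= !in_itv/= /h -[x <= ln c]ler_expR lnK// (le_lt_trans a0 (expR_gt0 _)).
  have -> : (`]a, c]%classic `&` `]-oo, 0]%classic : set R) = `]a, 0]%classic.
    apply/seteqP; split=> x /=; rewrite !in_itv/=; first by case=> /andP[-> _].
    move=> /andP[-> x0]; split=> //.
    by rewrite (le_trans x0) ?ltW.
  rewrite [X in (X + _)%E]exp_measure_Nyc lnK// !lebesgue_measure_itv/= !lte_fin ac.
  move: a0; rewrite le_eqVlt => /orP[/eqP->|->]; first by rewrite ltxx adde0 sube0.
  by rewrite add0r.
have mO : measurable (`]0, +oo[%classic : set (measurableTypeR R)) by [].
rewrite (@eq_measure_integral _ _ R _ nu); last by move=> A mA _; exact: nuE.
rewrite [LHS]ge0_integral_measure_add//; last exact: measurable_funTS.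
have M0 : mrestr mu mN `]0, +oo[%classic = 0%E.
  rewrite /mrestr (_ : _ `&` _ = set0) ?measure0//.
  by apply/seteqP; split=> x //=; rewrite !in_itv/= => -[]; rewrite andbT; lra.
have mGO : measurable_fun (`]0, +oo[%classic : set (measurableTypeR R)) G by exact: measurable_funTS.
rewrite [X in (_ + X)%E](null_set_integral mO mGO M0).
rewrite adde0 (ge0_integral_pushforward mexp)//.
have -> : h @^-1` `]0, +oo[%classic = setT.
  by apply/seteqP; split=> x //= _; rewrite in_itv/= andbT expR_gt0.
rewrite (@ge0_integral_density _ _ _ mu exp_measure expR (@measurable_expR R) (@expR_ge0 R))//.
- exact: measurableT_comp.
- by move=> x; exact: G0.
Qed.
End exp_measure.
Section halfline.
Context (R : realType).
Notation mu := (@lebesgue_measure R).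
Notation hl := (`]0%R, +oo[%classic : set R).
Local Open Scope ereal_scope.

Lemma lebesgue_opp (F : R -> \bar R) :
  measurable_fun [set: R] F -> (forall x, 0 <= F x) ->
  \int[mu]_x F (- x)%R = \int[mu]_x F x.
Proof.
move=> mF F0.
pose h (x : measurableTypeR R) : measurableTypeR R := (- x)%R.
have mh : measurable_fun [set: measurableTypeR R] h by exact: oppr_measurable.
pose nu0 : {measure set (measurableTypeR R) -> \bar R} := pushforward mu h.
pose nu := nu0 mh.
have E (A : set (measurableTypeR R)) : measurable A -> mu A = nu A.
  move=> mA; apply: lebesgue_measure_unique => // _ [[a c]] _ <-.
  rewrite [RHS](_ : _ = mu (h @^-1` [set` `]a, c]%R]))//.
  have -> : h @^-1` `]a, c] = [set` `[(- c)%R, (- a)%R[%R].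
    by apply/seteqP; split=> x /=; rewrite !in_itv/= /h; lra.
  by rewrite !lebesgue_measure_itv/= !lte_fin ltrN2 -!EFinD opprK addrC.
rewrite [in RHS](@eq_measure_integral _ _ R setT nu); last by move=> A mA _; exact: E.
by rewrite [RHS](ge0_integral_pushforward mh)// preimage_setT.
Qed.

Lemma ge0_integralZT dT (T : measurableType dT) (m : {measure set T -> \bar R}) (k : R) (f : T -> \bar R) :
  (0 <= k)%R -> measurable_fun [set: T] f -> (forall x, 0 <= f x) ->
  \int[m]_x (k%:E * f x) = k%:E * \int[m]_x f x.
Proof. by move=> k0 mf f0; exact: ge0_integralZl_EFin. Qed.

Lemma integral_halfline_scale (G : R -> \bar R) (c : R) : (0 < c)%R ->
  measurable_fun [set: R] G -> (forall x, 0 <= G x) ->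
  \int[mu]_(t in hl) G (c * t)%R = c^-1%:E * \int[mu]_(t in hl) G t.
Proof.
move=> c0 mG G0.
have mGc : measurable_fun [set: R] (fun t : R => G (c * t)%R).
  by apply: (measurableT_comp mG); exact: measurable_funM.
rewrite !integral_exp_subst//.
have mGe : measurable_fun [set: R] (fun u : R => G (expR u) * (expR u)%:E).
  apply: emeasurable_funM; first exact: (measurableT_comp mG (@measurable_expR R)).
  by apply/measurable_EFinP; exact: measurable_expR.
have Ge0 u : 0 <= G (expR u) * (expR u)%:E by rewrite mule_ge0// lee_fin expR_ge0.
pose H (u : R) := G (expR u) * (expR u)%:E.
have E u : G (c * expR u)%R * (expR u)%:E = c^-1%:E * H (u + ln c)%R.
  rewrite /H expRD lnK// [(expR u * c)%R]mulrC.
  by rewrite [c^-1%:E * _]muleCA -EFinM mulKf ?gt_eqF.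
under eq_integral do rewrite E.
rewrite -[X in _ = _ * X]/(\int[mu]_u H u).
have {}mGe : measurable_fun [set: R] H by exact: mGe.
have {}Ge0 u : 0 <= H u by exact: Ge0.
move: H mGe Ge0 {E} => H mH H0.
rewrite (@ge0_integralZT _ (measurableTypeR R))//; last 2 first.
- by rewrite invr_ge0 ltW.
- by apply: (measurableT_comp mH); exact: measurable_funD.
congr (_ * _); rewrite -[RHS]mul1e -[1%E]/((1%R)%:E) -[X in X%:E * _]invr1 -(lebesgue_affine (ln c) ltr01 mH H0).
by apply: eq_integral => u _; rewrite mul1r.
Qed.

Lemma lebesgue_scale (F : R -> \bar R) (k : R) : (k != 0)%R ->
  measurable_fun [set: R] F -> (forall x, 0 <= F x) ->
  \int[mu]_x (`|k|%:E * F (k * x)%R) = \int[mu]_x F x.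
Proof.
move=> k0 mF F0.
have mFk : measurable_fun [set: R] (fun x : R => F (k * x)%R).
  by apply: (measurableT_comp mF); exact: measurable_funM.
rewrite (@ge0_integralZT _ (measurableTypeR R))//.
have {}k0 : (0 < `|k|)%R by rewrite normr_gt0.
have E : \int[mu]_x F (`|k| * x + 0)%R = (`|k|^-1)%:E * \int[mu]_x F x by exact: lebesgue_affine.
have -> : \int[mu]_x F (k * x)%R = \int[mu]_x F (`|k| * x + 0)%R.
  have [kp|kn] := ger0P k; first by under [RHS]eq_integral do rewrite addr0.
  rewrite -(lebesgue_opp mFk)//.
  by apply: eq_integral => x _; congr F; lra.
by rewrite E muleA -EFinM mulfV ?mul1e// gt_eqF.
Qed.

Lemma integral_halfline_powR (G : R -> \bar R) (k : R) : (k != 0)%R ->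
  measurable_fun [set: R] G -> (forall x, 0 <= G x) ->
  \int[mu]_(t in hl) (G (t `^ k)%R * (`|k| * t `^ (k - 1))%:E) = \int[mu]_(t in hl) G t.
Proof.
move=> k0 mG G0.
have mGp : measurable_fun [set: R] (fun t : R => G (t `^ k)%R * (`|k| * t `^ (k - 1))%:E).
  apply: emeasurable_funM; first exact: (measurableT_comp mG (@measurable_powR R k)).
  by apply/measurable_EFinP; apply: measurable_funM => //; exact: measurable_powR.
rewrite !integral_exp_subst//; last first.
  by move=> x; rewrite mule_ge0// lee_fin mulr_ge0// powR_ge0.
have mGe : measurable_fun [set: R] (fun u : R => G (expR u) * (expR u)%:E).
  apply: emeasurable_funM; first exact: (measurableT_comp mG (@measurable_expR R)).
  by apply/measurable_EFinP; exact: measurable_expR.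
have Ge0 u : 0 <= G (expR u) * (expR u)%:E by rewrite mule_ge0// lee_fin expR_ge0.
rewrite -(lebesgue_scale k0 mGe Ge0); apply: eq_integral => u _.
rewrite -!expRM [(u * k)%R]mulrC [in RHS]muleCA -!muleA; congr (_ * _).
rewrite -!EFinM -mulrA -expRD; congr ((_ * expR _)%:E); ring.
Qed.
End halfline.
Section gamma.
Context (R : realType).
Notation mu := (@lebesgue_measure R).
Notation hl := (`]0%R, +oo[%classic : set R).
Local Open Scope ereal_scope.

Lemma measurable_gamma_integrand (s : R) :
  measurable_fun [set: R] (fun t : R => (t `^ (s - 1) * expR (- t))%R).
Proof.
apply: measurable_funM; first exact: measurable_powR.
by apply: (measurableT_comp (@measurable_expR R)); exact: oppr_measurable.
Qed.

Lemma gamma_integrand_ge0 (s t : R) : (0 <= t `^ (s - 1) * expR (- t))%R.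
Proof. by rewrite mulr_ge0 ?powR_ge0 ?expR_ge0. Qed.

Lemma gamma_exp (s : R) : \int[mu]_(t in hl) (t `^ (s - 1) * expR (- t))%:E =
  \int[mu]_u (expR (s * u - expR u))%:E.
Proof.
rewrite (@integral_exp_subst R (fun t => (t `^ (s - 1) * expR (- t))%:E)); last 2 first.
- by apply/measurable_EFinP; exact: measurable_gamma_integrand.
- by move=> t; rewrite lee_fin gamma_integrand_ge0.
apply: eq_integral => u _; rewrite -EFinM -expRM -!expRD; congr (expR _)%:E; ring.
Qed.

Lemma gamma_lty (s : R) : (0 < s)%R ->
  \int[mu]_(t in hl) (t `^ (s - 1) * expR (- t))%:E < +oo.
Proof.
move=> s0; rewrite gamma_exp.
(* For [u >= 0] the function [(s + 1) u - exp u] is at most its maximum, attained at [ln (s + 1)],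
   so the integrand is at most [C exp (- u)]; for [u < 0] it is at most [exp (s u)]. Both majorants
   are multiples of exponential densities. *)
pose C := (expR ((s + 1) * (ln (s + 1) - 1)))%R.
pose f1 (u : R) := C%:E * (exponential_pdf 1 u)%:E.
pose f2 (u : R) := s^-1%:E * (exponential_pdf s (- u))%:E.
have pdf0 (r : R) : (0 < r)%R -> forall u, (0 <= exponential_pdf r u)%R.
  by move=> r0 u; apply: exponential_pdf_ge0; exact: ltW.
have pe (r : R) : (0 < r)%R -> forall u, 0 <= (exponential_pdf r u)%:E.
  by move=> r0 u; rewrite lee_fin pdf0.
have mp (r : R) : measurable_fun [set: R] (fun u => (exponential_pdf r u)%:E).
  by apply/measurable_EFinP; exact: measurable_exponential_pdf.
have mpN (r : R) : measurable_fun [set: R] (fun u : R => (exponential_pdf r (- u))%:E).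
  by apply: (measurableT_comp (mp r)); exact: oppr_measurable.
have C0 : (0 <= C)%R by rewrite expR_ge0.
have I1 : \int[mu]_u f1 u = C%:E.
  rewrite (@ge0_integralZT _ _ (measurableTypeR R) mu _ _ C0 (mp 1%R) (pe 1%R ltr01)).
  by rewrite integral_exponential_pdf ?mule1.
have I2 : \int[mu]_u f2 u = s^-1%:E.
  have si : (0 <= s^-1)%R by rewrite invr_ge0 ltW.
  rewrite (@ge0_integralZT _ _ (measurableTypeR R) mu _ _ si (mpN s) (fun x => pe s s0 (- x)%R)).
  rewrite (lebesgue_opp (mp s) (pe s s0)).
  by rewrite integral_exponential_pdf// mule1.
apply: (@le_lt_trans _ _ (\int[mu]_u (f1 u + f2 u))).
  apply: ge0_le_integralT => u; first by rewrite lee_fin expR_ge0.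
  rewrite /f1 /f2 -!EFinM -EFinD lee_fin.
  have [u0|u0] := leP 0%R u.
    rewrite (exponential_pdfE _ u0); apply: ler_wpDr.
      by rewrite mulr_ge0 ?pdf0// invr_ge0 ltW.
    rewrite mul1r -expRD ler_expR.
    have s1 : (0 < s + 1)%R by rewrite addr_gt0.
    have := expR_ge1Dx (u - ln (s + 1)); rewrite -(ler_pM2l s1).
    rewrite (_ : (s + 1) * expR (u - ln (s + 1)) = expR u)%R; first lra.
    by rewrite -[X in (X * _)%R](lnK s1) -expRD addrC subrK.
  rewrite (lt0_exponential_pdf _ u0) mulr0 add0r exponential_pdfE; last by rewrite oppr_ge0 ltW.
  by rewrite mulKf ?gt_eqF// ler_expR; have := expR_ge0 u; lra.
have mf1 : measurable_fun [set: R] f1 by apply: emeasurable_funM; [exact: measurable_cst|exact: mp].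
have mf2 : measurable_fun [set: R] f2 by apply: emeasurable_funM; [exact: measurable_cst|exact: mpN].
rewrite ge0_integralD//; first by rewrite I1 I2 -EFinD ltry.
- by move=> u _; rewrite mule_ge0 ?lee_fin ?pdf0.
- by move=> u _; rewrite mule_ge0 ?lee_fin ?pdf0 ?invr_ge0// ltW.
Qed.

Lemma gamma_gt0_integral (s : R) : 0 < \int[mu]_(t in hl) (t `^ (s - 1) * expR (- t))%:E.
Proof.
rewrite gamma_exp.
have H : (0%R < expR (- `|s| - 1))%R by exact: expR_gt0.
apply: (@lt_le_trans _ _ (\int[mu]_u ((expR (- `|s| - 1))%:E * (\1_(`[(-1)%R, 0%R]%classic : set R) u)%:E))).
  rewrite (@ge0_integralZT _ _ (measurableTypeR R) mu _ _ (ltW H)); last 2 first.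
  - by apply/measurable_EFinP; exact: measurable_indic.
  - by move=> x; rewrite lee_fin indicE.
  rewrite integral_indic//= setIT.
  have -> : mu (`[(-1)%R, 0%R]%classic : set R) = 1%E :> \bar R.
    by rewrite lebesgue_measure_itv/= lte_fin ltrN10 -EFinD; congr EFin; lra.
  by rewrite mule1 lte_fin.
apply: ge0_le_integralT => u.
  by rewrite -EFinM lee_fin mulr_ge0 ?expR_ge0// indicE ler0n.
rewrite -EFinM lee_fin indicE; case: (boolP (u \in _)); last by rewrite mulr0 expR_ge0.
rewrite inE/= in_itv/= => /andP[u1 u2]; rewrite mulr1 ler_expR.
have : (expR u <= 1)%R by rewrite -expR0 ler_expR.
suff : (- `|s| <= s * u)%R by lra.
rewrite lerNl -mulrN; apply: (le_trans (ler_norm _)); rewrite normrM ler_piMr//.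
by rewrite normrN ler_norml; lra.
Qed.

Lemma gamma_funE (s : R) : (0 < s)%R ->
  \int[mu]_(t in hl) (t `^ (s - 1) * expR (- t))%:E = (gamma_fun s)%:E.
Proof.
move=> s0; rewrite /gamma_fun /Rintegral fineK// ge0_fin_numE ?gamma_lty//.
exact/ltW/gamma_gt0_integral.
Qed.

Lemma gamma_fun_gt0 (s : R) : (0 < s)%R -> (0 < gamma_fun s)%R.
Proof. by move=> s0; rewrite -lte_fin -gamma_funE// gamma_gt0_integral. Qed.

Lemma gamma_scale (s c : R) : (0 < s)%R -> (0 < c)%R ->
  \int[mu]_(t in hl) (t `^ (s - 1) * expR (- (c * t)))%:E = (gamma_fun s * c `^ (- s))%:E.
Proof.
move=> s0 c0.
pose G (t : R) := (t `^ (s - 1) * expR (- t))%:E.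
have mG : measurable_fun [set: R] G by apply/measurable_EFinP; exact: measurable_gamma_integrand.
have G0 x : 0 <= G x by rewrite lee_fin gamma_integrand_ge0.
have H := integral_halfline_scale c0 mG G0.
rewrite gamma_funE// in H.
have mGc : measurable_fun [set: R] (fun t : R => G (c * t)%R).
  by apply: (measurableT_comp mG); exact: measurable_funM.
transitivity (\int[mu]_(t in hl) ((c `^ (1 - s))%:E * G (c * t)%R)).
  apply: eq_integral => t; rewrite inE/= in_itv/= andbT => t0.
  rewrite -EFinM powRM ?ltW// mulrA mulrA -powRD ?(gt_eqF c0) ?implybT//.
  by rewrite (_ : 1 - s + (s - 1) = 0)%R ?powRr0 ?mul1r//; ring.
rewrite ge0_integralZl_EFin//; last 2 first.
- exact: measurable_funTS.
- exact: powR_ge0.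
rewrite H -!EFinM; congr EFin; rewrite mulrA mulrC; congr (_ * _)%R.
rewrite -powR_inv1 ?ltW// -powRD ?(gt_eqF c0) ?implybT//; congr (_ `^ _)%R; ring.
Qed.
End gamma.

Section beta.
Context (R : realType).
Notation mu := (@lebesgue_measure R).
Notation hl := (`]0%R, +oo[%classic : set R).
Local Open Scope ereal_scope.

Lemma integral_indicM dT (T : measurableType dT) (m : {measure set T -> \bar R}) (A : set T) (f : T -> \bar R) :
  \int[m]_(x in A) f x = \int[m]_x ((\1_A x)%:E * f x).
Proof.
rewrite integral_mkcond; apply: eq_integral => x _.
by rewrite patchE indicE; case: ifPn => _; rewrite ?mul1e ?mul0e.
Qed.

Lemma measurable_indicM dT (T : measurableType dT) (A : set T) (f : T -> \bar R) :
  measurable A -> measurable_fun [set: T] f -> measurable_fun [set: T] (fun x => (\1_A x)%:E * f x).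
Proof.
by move=> mA mf; apply: emeasurable_funM => //; apply/measurable_EFinP; exact: measurable_indic.
Qed.

Lemma indicM_ge0 T (A : set T) (f : T -> \bar R) : (forall x, 0 <= f x) ->
  forall x, 0 <= (\1_A x)%:E * f x.
Proof. by move=> f0 x; rewrite mule_ge0// lee_fin indicE. Qed.

Lemma tonelli_in d1 d2 (T1 : measurableType d1) (T2 : measurableType d2)
    (m1 : {sigma_finite_measure set T1 -> \bar R})
    (m2 : {sigma_finite_measure set T2 -> \bar R}) (A : set T1) (B : set T2) (f : T1 -> T2 -> \bar R) :
  measurable A -> measurable B ->
  measurable_fun [set: T1 * T2] (fun p => f p.1 p.2) -> (forall x y, 0 <= f x y) ->
  \int[m1]_(x in A) \int[m2]_(y in B) f x y = \int[m2]_(y in B) \int[m1]_(x in A) f x y.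
Proof.
move=> mA mB mf f0.
have iA x : 0 <= (\1_A x : R)%:E by rewrite lee_fin indicE.
have iB x : 0 <= (\1_B x : R)%:E by rewrite lee_fin indicE.
have mf1 x : measurable_fun [set: T2] (f x) by exact: (measurableT_comp mf (measurable_pair1 x)).
have mf2 y : measurable_fun [set: T1] (f^~ y) by exact: (measurableT_comp mf (measurable_pair2 y)).
pose g x y := (\1_A x : R)%:E * ((\1_B y : R)%:E * f x y).
have mg : measurable_fun [set: T1 * T2] (fun p => g p.1 p.2).
  apply: emeasurable_funM.
    apply/measurable_EFinP; apply: (measurableT_comp (f := \1_A : T1 -> R)) measurable_fst; exact: measurable_indic.
  apply: emeasurable_funM => //.
  apply/measurable_EFinP; apply: (measurableT_comp (f := \1_B : T2 -> R)) measurable_snd; exact: measurable_indic.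
have := @tonelli _ _ T1 T2 R m1 m2 g mg; rewrite /g => H.
rewrite integral_indicM [RHS]integral_indicM.
transitivity (\int[m1]_x \int[m2]_y g x y).
  apply: eq_integral => x _; rewrite /g ge0_integralZT//.
  - by rewrite [in LHS]integral_indicM.
  - exact: measurable_indicM.
  - exact: indicM_ge0.
rewrite H; last by move=> x y; rewrite !mule_ge0.
apply: eq_integral => y _; rewrite [in RHS]integral_indicM -ge0_integralZT//.
- by apply: eq_integral => x _; rewrite muleCA.
- by apply: measurable_indicM => //.
- by move=> x; exact: mule_ge0.
Qed.

Lemma ge0_integralZ_in dT (T : measurableType dT) (m : {measure set T -> \bar R}) (D : set T) (k : R) (f : T -> \bar R) :
  measurable D -> (0 <= k)%R -> measurable_fun [set: T] f -> (forall x, 0 <= f x) ->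
  \int[m]_(x in D) (k%:E * f x) = k%:E * \int[m]_(x in D) f x.
Proof.
by move=> mD k0 mf f0; apply: ge0_integralZl_EFin => //; exact: measurable_funTS.
Qed.

(** The unnormalized incomplete beta integral in the variable [w = 1 / t - 1], which maps
    [t < 1 / (1 + c)] to [w > c]. The Student tail arises in this form, with [w] the ratio of the
    squared numerator to the sum of squares in the denominator. *)
Definition beta_tail (c p q : R) : \bar R :=
  \int[mu]_(w in `]c, +oo[) (w `^ (q - 1) * (1 + w) `^ (- (p + q)))%:E.

Lemma measurable_powR1D (e : R) : measurable_fun [set: R] (fun w : R => (1 + w) `^ e)%R.
Proof.
apply: (measurableT_comp (measurable_powR e)).
by apply: measurable_funD; [exact: measurable_cst|exact: measurable_id].
Qed.

Lemma measurable_beta_tail (p q : R) :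
  measurable_fun [set: R] (fun w : R => (w `^ (q - 1) * (1 + w) `^ (- (p + q)))%R).
Proof. by apply: measurable_funM; [exact: measurable_powR|exact: measurable_powR1D]. Qed.

(** Tonelli for [w^(q-1) t^(p+q-1) exp (- (1 + w) t)]: integrating in [t] first gives the left side,
    in [w] first the right side. *)
Lemma beta_gamma (p q : R) : (0 < p)%R -> (0 < q)%R ->
  (gamma_fun (p + q))%:E * beta_tail 0 p q = (gamma_fun p * gamma_fun q)%:E.
Proof.
move=> p0 q0; have pq0 : (0 < p + q)%R by rewrite addr_gt0.
pose f (w t : R) := (w `^ (q - 1) * (t `^ (p + q - 1) * expR (- ((1 + w) * t))))%:E.
have f0 w t : 0 <= f w t by rewrite lee_fin !mulr_ge0 ?powR_ge0 ?expR_ge0.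
have mf : measurable_fun [set: R * R] (fun p => f p.1 p.2).
  apply/measurable_EFinP; apply: measurable_funM.
    exact: (measurableT_comp (measurable_powR _) measurable_fst).
  apply: measurable_funM.
    exact: (measurableT_comp (measurable_powR _) measurable_snd).
  apply: (measurableT_comp (@measurable_expR R)).
  apply: (measurableT_comp (@oppr_measurable R setT)).
  apply: measurable_funM; last exact: measurable_snd.
  by apply: measurable_funD; [exact: measurable_cst|exact: measurable_fst].
have mh : measurable hl by [].
have := @tonelli_in _ _ (measurableTypeR R) (measurableTypeR R) mu mu hl hl f mh mh mf f0.
pose B (w : R) := (w `^ (q - 1) * (1 + w) `^ (- (p + q)))%:E.
have mB : measurable_fun [set: R] B by apply/measurable_EFinP; exact: measurable_beta_tail.
have B0 w : 0 <= B w by rewrite lee_fin mulr_ge0 ?powR_ge0.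
pose g (r t : R) := (t `^ (r - 1) * expR (- t))%:E.
have mg r : measurable_fun [set: R] (g r) by apply/measurable_EFinP; exact: measurable_gamma_integrand.
have g0 r w : 0 <= g r w by rewrite lee_fin gamma_integrand_ge0.
pose e (r k t : R) := (t `^ (r - 1) * expR (- (k * t)))%:E.
have me r k : measurable_fun [set: R] (e r k).
  apply/measurable_EFinP; apply: measurable_funM; first exact: measurable_powR.
  apply: (measurableT_comp (@measurable_expR R)).
  by apply: (measurableT_comp (@oppr_measurable R setT)); exact: measurable_funM.
have e0 r k w : 0 <= e r k w by rewrite lee_fin mulr_ge0 ?powR_ge0 ?expR_ge0.
have gg r : (0 < r)%R -> (0 <= gamma_fun r :> R)%R by move=> r0; rewrite ltW ?gamma_fun_gt0.
rewrite -[beta_tail _ _ _]/(\int[mu]_(w in hl) B w).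
rewrite -(@ge0_integralZ_in _ (measurableTypeR R) mu hl _ B mh (gg _ pq0) mB B0).
have E1 w : w \in hl -> \int[mu]_(t in hl) f w t =
    (gamma_fun (p + q))%:E * B w.
  rewrite inE/= in_itv/= andbT => w0.
  transitivity (\int[mu]_(t in hl) ((w `^ (q - 1))%:E * e (p + q)%R (1 + w)%R t)).
    by apply: eq_integral => t _; rewrite /f EFinM.
  rewrite (@ge0_integralZ_in _ (measurableTypeR R) mu hl _ (e (p + q)%R (1 + w)%R) mh (powR_ge0 _ _) (me _ _) (e0 _ _)).
  by rewrite gamma_scale// ?addr_gt0// /B -!EFinM; congr EFin; ring.
have E2 t : t \in hl -> \int[mu]_(w in hl) f w t =
    (gamma_fun q)%:E * g p t.
  rewrite inE/= in_itv/= andbT => t0.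
  transitivity (\int[mu]_(w in hl) ((t `^ (p + q - 1) * expR (- t))%:E * e q t w)).
    apply: eq_integral => w _; rewrite /f /e -EFinM; congr EFin.
    by rewrite (_ : (- ((1 + w) * t) = - t + - (t * w)))%R ?expRD; ring.
  have te0 : (0 <= t `^ (p + q - 1) * expR (- t))%R by rewrite mulr_ge0 ?powR_ge0 ?expR_ge0.
  rewrite (@ge0_integralZ_in _ (measurableTypeR R) mu hl _ (e q t) mh te0 (me _ _) (e0 _ _)).
  rewrite gamma_scale// -!EFinM; congr EFin.
  rewrite (_ : t `^ (p - 1) = t `^ (p + q - 1) * t `^ (- q))%R; first by ring.
  by rewrite -powRD ?(gt_eqF t0) ?implybT//; congr (_ `^ _)%R; ring.
have {}E1 : \int[mu]_(w in hl) \int[mu]_(t in hl) f w t = \int[mu]_(w in hl) ((gamma_fun (p + q))%:E * B w).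
  exact: eq_integral.
have {}E2 : \int[mu]_(t in hl) \int[mu]_(w in hl) f w t = \int[mu]_(t in hl) ((gamma_fun q)%:E * g p t).
  exact: eq_integral.
rewrite -E1 => ->; rewrite E2 (@ge0_integralZ_in _ (measurableTypeR R) mu hl _ (g p) mh (gg _ q0) (mg p) (g0 p)).
by rewrite /g (gamma_funE p0) -EFinM mulrC.
Qed.

Lemma incomplete_beta_tail (c p q : R) : (0 <= c)%R ->
  \int[mu]_(t in `]0%R, (1 + c)^-1%R[) (t `^ (p - 1) * (1 - t) `^ (q - 1))%:E = beta_tail c p q.
Proof.
move=> c0.
have c1 : (0 < 1 + c)%R by rewrite ltr_pwDl.
pose G (t : R) := (\1_(`]0%R, (1 + c)^-1%R[%classic : set R) t * (t `^ (p - 1) * (1 - t) `^ (q - 1)))%:E.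
have mG : measurable_fun [set: R] G.
  apply/measurable_EFinP; apply: measurable_funM; first exact: measurable_indic.
  apply: measurable_funM; first exact: measurable_powR.
  apply: (measurableT_comp (measurable_powR _)).
  by apply: measurable_funB; [exact: measurable_cst|exact: measurable_id].
have G0 x : 0 <= G x by rewrite lee_fin !mulr_ge0 ?powR_ge0// indicE.
transitivity (\int[mu]_(t in hl) G t).
  rewrite integral_indicM [RHS]integral_indicM; apply: eq_integral => t _.
  rewrite /G -!EFinM !indicE; congr EFin.
  case: (boolP (t \in (`]0%R, (1 + c)^-1%R[%classic : set R))); last by rewrite !mul0r mulr0.
  by rewrite inE/= in_itv/= => /andP[t0 _]; rewrite mem_set/= ?in_itv/= ?t0// !mul1r.
have N1 : (-1 != 0 :> R)%R by rewrite oppr_eq0 oner_eq0.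
rewrite -(integral_halfline_powR N1 mG G0) /beta_tail [RHS]integral_indicM.
pose H (w : R) := (\1_(`]c, +oo[%classic : set R) w)%:E * (w `^ (q - 1) * (1 + w) `^ (- (p + q)))%:E.
have mH : measurable_fun [set: R] H.
  apply: measurable_indicM => //; first by apply/measurable_EFinP; exact: measurable_beta_tail.
have H0 x : 0 <= H x by rewrite mule_ge0 ?lee_fin ?indicE// mulr_ge0 ?powR_ge0.
rewrite -[RHS]/(\int[mu]_w H w) -[RHS]mul1e -[1]/(1%R%:E) -[X in X%:E * _]invr1.
rewrite -(lebesgue_affine (-1) ltr01 mH H0) integral_indicM.
apply: eq_integral => x _; rewrite mul1r /H /G !indicE -!EFinM; congr EFin.
case: (boolP (x \in hl)); last first.
  rewrite notin_setE/= in_itv/= andbT => /negP; rewrite -leNgt => x0.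
  rewrite mul0r memNset ?mul0r//= in_itv/= andbT => ?; lra.
rewrite inE/= in_itv/= andbT => x0; rewrite powR_inv1 ?ltW//.
have -> : (x^-1%R \in (`]0%R, (1 + c)^-1%R[%classic : set R)) = ((x - 1)%R \in (`]c, +oo[%classic : set R)).
  apply/idP/idP; rewrite !inE/= !in_itv/= andbT invr_gt0 x0/= ltf_pV2 ?posrE//; lra.
case: (boolP (_ \in _)); last by rewrite !mul0r mulr0.
rewrite inE/= in_itv/= andbT => xc; rewrite !mul1r normrN normr1 mul1r.
have x1 : (0 < x - 1)%R by lra.
rewrite (_ : 1 - x^-1 = (x - 1) * x^-1)%R; last by field; rewrite gt_eqF.
rewrite (addrC 1%R) subrK powRM ?invr_ge0 ?ltW// -powR_inv1 ?ltW// -!powRrM.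
rewrite (_ : x `^ (- (p + q)) = x `^ (-1 * (p - 1)) * (x `^ (-1 * (q - 1)) * x `^ (-1 - 1)))%R; first by ring.
by rewrite -!powRD ?(gt_eqF x0) ?implybT//; congr (_ `^ _)%R; ring.
Qed.
End beta.

(** * Symmetries and low moments of the Gaussian measure *)

Section gauss_symmetry.
Context (R : realType).
Notation mu := (@lebesgue_measure R).
Notation phi := (normal_pdf 0 (1:R)).
Local Open Scope ereal_scope.

Lemma rV_consN d (a : R) (x : 'rV[R]_d) : (- rV_cons (a, x) = rV_cons (- a, - x))%R.
Proof. by apply/rowP => i; rewrite !mxE; case: unliftP => [j _|_] /=; rewrite ?mxE. Qed.

Lemma measurable_rV_opp d : measurable_fun [set: 'rV[R]_d] (fun x => - x)%R.
Proof.
apply: measurable_fun_rVP => i; under eq_fun do rewrite mxE.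
by apply: (measurableT_comp (@oppr_measurable R setT)); exact: measurable_coord.
Qed.

Lemma measurable_rV_consl d (a : R) : measurable_fun [set: 'rV[R]_d] (fun x => rV_cons (a, x)).
Proof. by apply: (measurableT_comp (@measurable_rV_cons R d)); exact: measurable_pair1. Qed.

Lemma leb_opp d (F : 'rV[R]_d -> \bar R) :
  measurable_fun [set: 'rV[R]_d] F -> (forall x, 0 <= F x) ->
  \int[leb R d]_x F (- x)%R = \int[leb R d]_x F x.
Proof.
elim: d F => [|d IH] F mF F0.
  rewrite !leb_integral0//; first by congr F; apply/rowP; case.
  by apply: (measurableT_comp mF); exact: measurable_rV_opp.
rewrite leb_integralS//; last by apply: (measurableT_comp mF); exact: measurable_rV_opp.
rewrite (leb_integralS mF F0).
rewrite -[RHS](lebesgue_opp (measurable_leb_integral mF F0)); last by move=> a; exact: integral_ge0.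
apply: eq_integral => a _; rewrite -(IH (fun x => F (rV_cons (- a, x)%R)))//; last first.
  by apply: (measurableT_comp mF); exact: measurable_rV_consl.
by apply: eq_integral => x _; rewrite rV_consN.
Qed.

Lemma dotNN d (x : 'rV[R]_d) : dot (- x)%R (- x)%R = dot x x.
Proof. by apply: eq_bigr => i _; rewrite !mxE mulrNN. Qed.

Lemma gauss_opp d (F : 'rV[R]_d -> \bar R) :
  measurable_fun [set: 'rV[R]_d] F -> (forall x, 0 <= F x) ->
  \int[gauss R d]_x F (- x)%R = \int[gauss R d]_x F x.
Proof.
move=> mF F0.
have mFN : measurable_fun [set: 'rV[R]_d] (fun x => F (- x)%R).
  by apply: (measurableT_comp mF); exact: measurable_rV_opp.
rewrite (gauss_integral mF F0) (gauss_integral mFN (fun x => F0 _)).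
pose H x := F x * (gpdf x)%:E.
have mH : measurable_fun [set: 'rV[R]_d] H.
  by apply: emeasurable_funM => //; apply/measurable_EFinP; exact: measurable_gpdf.
have H0 x : 0 <= H x by rewrite mule_ge0// lee_fin gpdf_ge0.
rewrite -[RHS]/(\int[leb R d]_x H x) -(leb_opp mH H0).
by apply: eq_integral => x _; rewrite /H !gpdfE dotNN.
Qed.

Lemma gauss_integralSr m (F : 'rV[R]_m.+1 -> \bar R) :
  measurable_fun [set: 'rV[R]_m.+1] F -> (forall x, 0 <= F x) ->
  \int[gauss R m.+1]_x F x =
  \int[gauss R m]_x \int[mu]_a (F (rV_cons (a, x)) * (phi a)%:E).
Proof.
move=> mF F0; rewrite gauss_integralS//.
have mc a : measurable_fun [set: 'rV[R]_m] (fun x => F (rV_cons (a, x))).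
  by apply: (measurableT_comp mF); exact: measurable_rV_consl.
rewrite -(@tonelli _ _ (measurableTypeR R) _ R mu (gauss R m) (fun a x => F (rV_cons (a, x)) * (phi a)%:E)).
- apply: eq_integral => a _; rewrite ge0_integralZr//.
  by rewrite lee_fin ltW// phi_gt0.
- apply: emeasurable_funM; first exact: (measurableT_comp mF (@measurable_rV_cons R m)).
  by apply/measurable_EFinP; exact: (measurableT_comp (@measurable_phi R) measurable_fst).
- by move=> a x; rewrite mule_ge0// lee_fin ltW// phi_gt0.
Qed.

(** Reflecting only the last coordinates preserves the Student statistic as well as the measure; the
    moments that are odd in one of these coordinates therefore vanish. *)
Lemma gauss_opp_tail m (F : 'rV[R]_m.+1 -> \bar R) :
  measurable_fun [set: 'rV[R]_m.+1] F -> (forall x, 0 <= F x) ->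
  \int[gauss R m.+1]_x F (rV_cons (x ord0 ord0, - (\row_j x ord0 (lift ord0 j))))%R =
  \int[gauss R m.+1]_x F x.
Proof.
move=> mF F0.
have mt : measurable_fun [set: 'rV[R]_m.+1] (fun x : 'rV[R]_m.+1 => rV_cons (x ord0 ord0, - (\row_j x ord0 (lift ord0 j))))%R.
  apply: (measurableT_comp (@measurable_rV_cons R m)).
  apply/measurable_fun_pairP; split; first exact: measurable_coord.
  apply: (measurableT_comp (@measurable_rV_opp m)).
  apply: measurable_fun_rVP => j; under eq_fun do rewrite mxE.
  exact: measurable_coord.
rewrite gauss_integralS//; last exact: measurableT_comp.
rewrite (gauss_integralS mF F0); apply: eq_integral => a _; congr (_ * _).
rewrite -(@gauss_opp m (fun x => F (rV_cons (a, x))))//; last first.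
  by apply: (measurableT_comp mF); exact: measurable_rV_consl.
apply: eq_integral => x _; congr F; congr rV_cons; rewrite rV_cons0; congr pair; congr (- _)%R.
by apply/rowP => j; rewrite mxE rV_consl.
Qed.

Lemma integral_odd dT (T : measurableType dT) (m : {measure set T -> \bar R}) (s : T -> T) (h : T -> R) :
  (forall F : T -> \bar R, measurable_fun [set: T] F -> (forall x, 0 <= F x) ->
    \int[m]_x F (s x) = \int[m]_x F x) ->
  m.-integrable [set: T] (EFin \o h) -> (forall x, h (s x) = - h x)%R ->
  \int[m]_x (h x)%:E = 0.
Proof.
move=> Hs ih hs.
have mh : measurable_fun [set: T] h by move/integrableP : ih => [/measurable_EFinP].
have := integrable_fin_num measurableT ih.
rewrite integralE.
suff -> : \int[m]_x ((EFin \o h)^\- x) = \int[m]_x ((EFin \o h)^\+ x).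
  by case: (\int[m]_x _) => [r| |]//= _; rewrite -EFinB subrr.
transitivity (\int[m]_x (fun x => (Num.max (h x) 0)%:E) (s x)).
  by apply: eq_integral => x _; rewrite funenegE /= -EFin_max hs.
rewrite (Hs (fun x => (Num.max (h x) 0)%:E)).
- by apply: eq_integral => x _; rewrite funeposE /= -EFin_max.
- by apply/measurable_EFinP; apply: measurable_maxr => //; exact: measurable_cst.
- by move=> x; rewrite lee_fin le_max lexx orbT.
Qed.

Lemma gauss_integrable m (h : 'rV[R]_m -> R) (c : R) :
  measurable_fun [set: 'rV[R]_m] h -> (forall u, `|h u| <= c * expR (dot u u / 4))%R ->
  (gauss R m).-integrable [set: 'rV[R]_m] (EFin \o h).
Proof.
move=> mh hc.
have me : measurable_fun [set: 'rV[R]_m] (fun u => (expR (dot u u / 4))%:E).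
  apply/measurable_EFinP; apply: measurableT_comp => //.
  by apply: measurable_funM => //; exact: measurable_dotxx.
have c0 : (0 <= c)%R.
  have := le_trans (normr_ge0 _) (hc 0%R).
  by rewrite pmulr_lge0 ?expR_gt0.
apply/integrableP; split; first exact/measurable_EFinP.
apply: (@le_lt_trans _ _ (\int[gauss R m]_u (c%:E * (expR (dot u u / 4))%:E))).
  apply: ge0_le_integralT => u //=.
  by rewrite -EFinM lee_fin.
rewrite ge0_integralZT//; first by rewrite gauss_exp_quarter -EFinM ltry.
Qed.

Lemma sqr_coord_le m (u : 'rV[R]_m) j : (u ord0 j ^+ 2 <= dot u u)%R.
Proof.
rewrite /dot (bigD1 j)//= -expr2 lerDl sumr_ge0// => i _.
by rewrite -expr2 sqr_ge0.
Qed.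

Lemma gauss_coord_integrable m j : (gauss R m).-integrable [set: 'rV[R]_m] (fun u => (u ord0 j)%:E).
Proof.
apply: (@gauss_integrable m _ 2); first exact: measurable_coord.
move=> u; have := sqr_coord_le u j; have := expR_ge1Dx (dot u u / 4).
set t := u ord0 j; rewrite ler_norml => H1 H2.
have : (0 <= (t - 2) ^+ 2)%R by exact: sqr_ge0.
have : (0 <= (t + 2) ^+ 2)%R by exact: sqr_ge0.
by rewrite -mulr_natl; nra.
Qed.

Lemma gauss_coord_prod_integrable m i j :
  (gauss R m).-integrable [set: 'rV[R]_m] (fun u => (u ord0 i * u ord0 j)%:E).
Proof.
apply: (@gauss_integrable m _ 4).
  by apply: measurable_funM; exact: measurable_coord.
move=> u; have := sqr_coord_le u i; have := sqr_coord_le u j; have := expR_ge1Dx (dot u u / 4).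
set t := u ord0 j; set s := u ord0 i; rewrite ler_norml => H1 H2 H3.
have : (0 <= (t - s) ^+ 2)%R by exact: sqr_ge0.
have : (0 <= (t + s) ^+ 2)%R by exact: sqr_ge0.
nra.
Qed.

Lemma gauss_coord_mean m j : \int[gauss R m]_u (u ord0 j)%:E = 0.
Proof.
apply: (@integral_odd _ _ (gauss R m) (fun u => - u)%R (fun u : 'rV[R]_m => u ord0 j) (@gauss_opp m)).
- exact: gauss_coord_integrable.
- by move=> x; rewrite mxE.
Qed.

Lemma gauss_coord0_sqr m : \int[gauss R m.+1]_u (u ord0 ord0 * u ord0 ord0)%:E = 1.
Proof.
rewrite (@gauss_integralSr m (fun u => (u ord0 ord0 * u ord0 ord0)%:E)).
- under eq_integral => x _.
    under eq_integral => a _ do rewrite rV_cons0 -EFinM -expr2.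
    rewrite integral_sqr_phi; over.
  by rewrite integral_cst// -[RHS]mule1; congr (_ * _); exact: probability_setT.
- by apply/measurable_EFinP; apply: measurable_funM; exact: measurable_coord.
- by move=> x; rewrite lee_fin -expr2 sqr_ge0.
Qed.

Lemma gauss_coord0_lift m j : \int[gauss R m.+1]_u (u ord0 ord0 * u ord0 (lift ord0 j))%:E = 0.
Proof.
apply: (@integral_odd _ _ (gauss R m.+1) _ (fun u : 'rV[R]_m.+1 => u ord0 ord0 * u ord0 (lift ord0 j)) (@gauss_opp_tail m))%R.
- exact: gauss_coord_prod_integrable.
- by move=> x; rewrite rV_cons0 rV_consl !mxE mulrN.
Qed.

Lemma gauss_dot_eq0 m : (0 < m)%N -> \int[gauss R m]_u (((dot u u == 0)%R)%:R)%:E = 0.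
Proof.
case: m => // m _; apply/eqP; rewrite eq_le; apply/andP; split; last first.
  by apply: integral_ge0 => u _; rewrite lee_fin.
pose F (u : 'rV[R]_m.+1) := (\1_[set 0%R] (u ord0 ord0) : R)%:E.
have mF : measurable_fun [set: 'rV[R]_m.+1] F.
  apply/measurable_EFinP; apply: (measurableT_comp (f := \1_[set 0%R] : R -> R)); last exact: measurable_coord.
  by apply: measurable_indic; exact: measurable_set1.
have F0 u : 0 <= F u by rewrite lee_fin indicE.
have -> : 0 = \int[gauss R m.+1]_u F u.
  rewrite gauss_integralSr//; apply/esym; rewrite -[RHS](integral0 (gauss R m) setT).
  apply: eq_integral => x _.
  transitivity (\int[mu]_a ((\1_[set 0%R] a : R)%:E * (phi a)%:E)).
    by apply: eq_integral => a _; rewrite /F rV_cons0.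
  by rewrite -integral_indicM integral_set1.
apply: ge0_le_integralT => u; first by rewrite lee_fin.
rewrite lee_fin indicE; case: eqP => // d0; rewrite mem_set//=.
by apply/eqP; rewrite -sqrf_eq0 eq_le sqr_ge0 -[leRHS]d0 sqr_coord_le.
Qed.
End gauss_symmetry.

(** * The Student statistic *)

Section student_statistic.
Context (R : realType) (n : nat).
Hypothesis n0 : (0 < n)%N.
Notation mu := (@lebesgue_measure R).
Notation phi := (normal_pdf 0 (1:R)).
Local Open Scope ereal_scope.

Definition student_stat (u : 'rV[R]_n.+1) : R :=
  (u ord0 ord0 / Num.sqrt (n%:R^-1 * \sum_(j < n) u ord0 (lift ord0 j) ^+ 2))%R.

Lemma student_stat_cons (a : R) x : student_stat (rV_cons (a, x)) = (a / Num.sqrt (n%:R^-1 * dot x x))%R.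
Proof.
rewrite /student_stat rV_cons0; congr (_ / Num.sqrt (_ * _))%R.
by apply: eq_bigr => i _; rewrite rV_consl expr2.
Qed.

Lemma measurable_student_stat : measurable_fun [set: 'rV[R]_n.+1] student_stat.
Proof.
rewrite (_ : student_stat = fun u => u ord0 ord0 *
   (n%:R^-1 * \sum_(j < n) u ord0 (lift ord0 j) ^+ 2) `^ (- 2^-1))%R; last first.
  apply/funext => u; rewrite /student_stat powRN powR12_sqrt// mulr_ge0//.
  by apply: sumr_ge0 => j _; rewrite sqr_ge0.
apply: measurable_funM; first exact: measurable_coord.
apply: (measurableT_comp (measurable_powR _)); apply: measurable_funM; first exact: measurable_cst.
apply: measurable_sum => j; apply: measurable_funX; exact: measurable_coord.
Qed.

Definition student_event (b : R) : set 'rV[R]_n.+1 := [set u | (b < student_stat u)%R].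

Lemma measurable_student_event b : measurable (student_event b).
Proof.
rewrite (_ : student_event b = student_stat @^-1` `]b, +oo[%classic); last first.
  by apply/seteqP; split=> u /=; rewrite in_itv/= andbT.
by rewrite -[X in measurable X]setTI; exact: measurable_student_stat.
Qed.

(** Division by 0 returns 0, so a vanishing denominator gives the statistic the value 0, which
    exceeds no [b >= 0]; hence the separate condition [0 < dot x x]. *)
Lemma student_event_cons b (a : R) x : (0 <= b)%R ->
  student_event b (rV_cons (a, x)) <-> (0 < dot x x)%R /\ (b * Num.sqrt (n%:R^-1 * dot x x) < a)%R.
Proof.
move=> b0; rewrite /student_event/= student_stat_cons.
have := dot_ge0 x; rewrite le_eqVlt => /orP[/eqP <-|S0].
  rewrite mulr0 sqrtr0 invr0 mulr0 ltxx; split; last by case.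
  by rewrite ltNge b0.
by rewrite ltr_pdivlMr ?sqrtr_gt0 ?mulr_gt0 ?invr_gt0 ?ltr0n// S0; split => // -[].
Qed.

(** This constant is never evaluated: the tail at level 0 equals 1/2 by symmetry, and comparison
    with that level eliminates it. *)
Definition student_const : \bar R :=
  (2^-1 * normal_peak 1)%:E * \int[gauss R n]_x (Num.sqrt (dot x x))%:E.

Lemma measurable_sqrt_dot : measurable_fun [set: 'rV[R]_n] (fun x => Num.sqrt (dot x x)).
Proof.
rewrite (_ : (fun x => _) = (fun x : 'rV[R]_n => (dot x x) `^ 2^-1))%R; last first.
  by apply/funext => x; rewrite powR12_sqrt// dot_ge0.
by apply: (measurableT_comp (measurable_powR _)); exact: measurable_dotxx.
Qed.

Lemma dotZ d (r : R) (x : 'rV[R]_d) : dot (r *: x)%R (r *: x)%R = (r ^+ 2 * dot x x)%R.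
Proof. by rewrite /dot mulr_sumr; apply: eq_bigr => i _; rewrite !mxE; ring. Qed.

(* Gaussian tilting: an [exp (- w |x|^2 / 2)] factor is absorbed by rescaling [x] by [sqrt (1 + w)]. *)
Lemma gauss_exp_scale (w : R) (F : 'rV[R]_n -> R) (k : R) : (0 <= w)%R ->
  measurable_fun [set: 'rV[R]_n] F -> (forall x, (0 <= F x)%R) ->
  (forall r x, (0 < r)%R -> F (r *: x)%R = (r `^ k * F x)%R) ->
  \int[gauss R n]_x (F x * expR (- (w * dot x x / 2)))%:E =
  ((1 + w) `^ (- ((n%:R + k) / 2)))%:E * \int[gauss R n]_x (F x)%:E.
Proof.
move=> w0 mF F0 Fh.
have w1 : (0 < 1 + w)%R by rewrite ltr_pwDl.
pose r := Num.sqrt (1 + w).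
have r0 : (0 < r)%R by rewrite sqrtr_gt0.
have rE : r = ((1 + w) `^ 2^-1)%R by rewrite powR12_sqrt// ltW.
pose H x := (F x * gpdf x)%:E.
have mH : measurable_fun [set: 'rV[R]_n] H.
  by apply/measurable_EFinP; apply: measurable_funM => //; exact: measurable_gpdf.
have H0 x : 0 <= H x by rewrite lee_fin mulr_ge0// gpdf_ge0.
have me : measurable_fun [set: 'rV[R]_n] (fun x => (F x * expR (- (w * dot x x / 2)))%:E).
  apply/measurable_EFinP; apply: measurable_funM => //.
  apply: (measurableT_comp (@measurable_expR R)).
  apply: (measurableT_comp (@oppr_measurable R setT)).
  apply: measurable_funM => //; apply: measurable_funM => //; exact: measurable_dotxx.
have e0 x : 0 <= (F x * expR (- (w * dot x x / 2)))%:E by rewrite lee_fin mulr_ge0// expR_ge0.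
have mFe : measurable_fun [set: 'rV[R]_n] (EFin \o F) by exact/measurable_EFinP.
rewrite (gauss_integral me e0) (gauss_integral mFe (fun x => F0 x)).
rewrite -[X in _ * X]/(\int[leb R n]_x H x).
have E := leb_affine 0%R r0 mH H0.
transitivity (\int[leb R n]_x ((r `^ (- k))%:E * H (r *: x + 0)%R)).
  apply: eq_integral => x _; rewrite addr0 /H Fh// -!EFinM; congr EFin.
  have -> : (r `^ (- k) * (r `^ k * F x * gpdf (r *: x)) = F x * gpdf (r *: x))%R.
    by rewrite !mulrA -powRD ?(gt_eqF r0) ?implybT// addNr powRr0 mul1r.
  rewrite !gpdfE dotZ sqr_sqrtr ?(ltW w1)// -[LHS]mulrA; congr (_ * _)%R.
  by rewrite mulrCA -expRD; congr (_ * expR _)%R; ring.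
have mHr : measurable_fun [set: 'rV[R]_n] (fun x => H (r *: x + 0)%R).
  by apply: (measurableT_comp mH); exact: measurable_rV_affine.
rewrite (ge0_integralZT (leb R n) (powR_ge0 r (- k)) mHr (fun x => H0 _)) E muleA -EFinM.
congr (_%:E * _).
rewrite -powR_inv1 ?ltW// -powR_mulrn ?powR_ge0// -powRrM -powRD ?(gt_eqF r0) ?implybT//.
by rewrite rE -powRrM; congr (_ `^ _)%R; field.
Qed.

Lemma integral_gauss_exp (w : R) : (0 <= w)%R ->
  \int[gauss R n]_x (expR (- (w * dot x x / 2)))%:E = ((1 + w) `^ (- (n%:R / 2)))%:E.
Proof.
move=> w0; have := @gauss_exp_scale w (fun=> 1%R) 0%R w0.
rewrite integral_cst// [X in _ * (1 * X)](_ : _ = 1); last exact: probability_setT.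
rewrite !mule1 addr0 => <- //.
- by apply: eq_integral => x _; rewrite mul1r.
- by move=> r x r0; rewrite powRr0 mul1r.
Qed.

(** For fixed denominator coordinates [x] the numerator is written [|x| sqrt w]. The event becomes
    [w > b^2 / n], free of [x], and the normal density becomes a multiple of [exp (- w |x|^2 / 2)];
    integrating over [x] by tilting leaves a power of [1 + w]. *)
Lemma student_tail (b : R) : (0 <= b)%R ->
  gauss R n.+1 (student_event b) = student_const * beta_tail (b ^+ 2 / n%:R) (n%:R / 2) 2^-1.
Proof.
move=> b0; set c := (b ^+ 2 / n%:R)%R.
have c0 : (0 <= c)%R by rewrite mulr_ge0 ?sqr_ge0 ?invr_ge0.
have nn0 : (0 < n%:R :> R)%R by rewrite ltr0n.
have mI := measurable_student_event b.
pose F u : \bar R := (\1_(student_event b) u)%:E.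
have mF : measurable_fun [set: 'rV[R]_n.+1] F by apply/measurable_EFinP; exact: measurable_indic.
have F0 u : 0 <= F u by rewrite lee_fin indicE.
have -> : gauss R n.+1 (student_event b) = \int[gauss R n.+1]_u F u.
  by rewrite /F integral_indic// setIT.
rewrite (gauss_integralSr mF F0).
pose C := (`]c, +oo[%classic : set R).
have mC : measurable C by exact: measurable_itv.
pose f (x : 'rV[R]_n) (w : R) := ((w `^ (2^-1 - 1) * (2^-1 * normal_peak 1)) *
   (Num.sqrt (dot x x) * expR (- (w * dot x x / 2))))%:E.
have f0 x w : 0 <= f x w by rewrite lee_fin !mulr_ge0 ?powR_ge0 ?expR_ge0 ?sqrtr_ge0// ltW// peak1_gt0.
have mf : measurable_fun [set: 'rV[R]_n * R] (fun p => f p.1 p.2).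
  apply/measurable_EFinP; apply: measurable_funM.
    apply: measurable_funM => //; exact: (measurableT_comp (measurable_powR _) measurable_snd).
  apply: measurable_funM; first exact: (measurableT_comp measurable_sqrt_dot measurable_fst).
  apply: (measurableT_comp (@measurable_expR R)).
  apply: (measurableT_comp (@oppr_measurable R setT)).
  apply: measurable_funM => //; apply: measurable_funM; first exact: measurable_snd.
  exact: (measurableT_comp (@measurable_dotxx _ _) measurable_fst).
have inner x : \int[mu]_a (F (rV_cons (a, x)) * (phi a)%:E) = \int[mu]_(w in C) f x w.
  have := dot_ge0 x; rewrite le_eqVlt => /orP[/eqP S0|S0].
    transitivity (\int[mu]_(w in C) (cst 0) w); last first.
      by apply: eq_integral => w _; rewrite /f -S0 sqrtr0 mul0r mulr0.
    rewrite integral0; transitivity (\int[mu]_a (cst 0) a); last by rewrite integral0.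
    apply: eq_integral => a _; rewrite /F indicE memNset ?mul0e//.
    by move/(student_event_cons _ _ b0) => -[]; rewrite -S0 ltxx.
  set S := dot x x in S0 *.
  pose k := (b * Num.sqrt (n%:R^-1 * S))%R.
  have k0 : (0 <= k)%R by rewrite mulr_ge0 ?sqrtr_ge0.
  pose H (a : R) := (\1_(`]k, +oo[%classic : set R) a)%:E * (phi a)%:E.
  have mH : measurable_fun [set: R] H.
    by apply: measurable_indicM => //; apply/measurable_EFinP; exact: measurable_phi.
  have H0 a : 0 <= H a by rewrite mule_ge0 ?lee_fin ?indicE// ltW// phi_gt0.
  have -> : \int[mu]_a (F (rV_cons (a, x)) * (phi a)%:E) = \int[mu]_(a in `]0%R, +oo[) H a.
    rewrite [RHS]integral_indicM; apply: eq_integral => a _; rewrite /F /H [RHS]muleA -[X in _ = X * _]EFinM; congr (_ * _); congr EFin.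
    rewrite !indicE -natrM mulnb; congr (nat_of_bool _)%:R.
    apply/idP/idP; rewrite !inE/= ?in_itv/= ?andbT.
      by move/(student_event_cons _ _ b0) => -[_ ka]; rewrite !mem_set//= in_itv/= andbT// (le_lt_trans k0).
    by move=> /andP[_]; rewrite inE/= in_itv/= andbT => ka; apply/(student_event_cons _ _ b0).
  pose s := Num.sqrt S.
  have s0 : (0 < s)%R by rewrite sqrtr_gt0.
  have mHs : measurable_fun [set: R] (fun x : R => s%:E * H (s * x)%R).
    by apply: emeasurable_funM => //; apply: (measurableT_comp mH); exact: measurable_funM.
  have Hs0 y : 0 <= s%:E * H (s * y)%R by rewrite mule_ge0// lee_fin ltW.
  have -> : \int[mu]_(a in `]0%R, +oo[) H a = \int[mu]_(a in `]0%R, +oo[) (s%:E * H (s * a)%R).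
    rewrite (@ge0_integralZ_in _ _ (measurableTypeR R) mu _ _ (fun a : R => H (s * a)%R))//; last 2 first.
    - exact: ltW.
    - by apply: (measurableT_comp mH); exact: measurable_funM.
    by rewrite integral_halfline_scale// muleA -EFinM mulfV ?mul1e// gt_eqF.
  have h0 : (2^-1 != 0 :> R)%R by [].
  rewrite -(integral_halfline_powR h0 mHs Hs0).
  rewrite integral_indicM [RHS]integral_indicM; apply: eq_integral => w _.
  have [w0|w0] := leP w 0%R.
    have wC : ~ C w by rewrite /C/= in_itv/= andbT => /(le_lt_trans c0); rewrite ltNge w0.
    have wh : ~ (`]0%R, +oo[%classic : set R) w by rewrite /= in_itv/= andbT ltNge w0.
    by rewrite !indicE (memNset wC) (memNset wh) !mul0e.
  have wp : (0 < w `^ 2^-1)%R by exact: powR_gt0.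
  have w2 : ((w `^ 2^-1) ^+ 2 = w)%R by rewrite -powR_mulrn ?powR_ge0// -powRrM mulVf// powRr1// ltW.
  have -> : (\1_(`]0%R, +oo[%classic : set R) w = 1 :> R)%R by rewrite indicE mem_set//= in_itv/= w0.
  rewrite mul1e /H /f.
  have -> : \1_(`]k, +oo[%classic : set R) (s * w `^ 2^-1)%R = \1_C w :> R.
    rewrite !indicE; congr (nat_of_bool _)%:R.
    have kE : k = (s * Num.sqrt c)%R.
      rewrite /k /s /c sqrtrM ?invr_ge0// sqrtrM ?sqr_ge0// sqrtr_sqr ger0_norm//; ring.
    by apply/idP/idP; rewrite /C !inE/= !in_itv/= !andbT kE ltr_pM2l// powR12_sqrt ?(ltW w0)// ltr_sqrt.
  rewrite -!EFinM; congr EFin; rewrite phiE -/S -/s.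
  rewrite (_ : ((s * w `^ 2^-1) ^+ 2 / 2 = w * S / 2))%R; last first.
    by rewrite exprMn w2 sqr_sqrtr ?ltW//; ring.
  by rewrite [`|_|%R]ger0_norm; [ring|rewrite invr_ge0].
under eq_integral do rewrite inner.
rewrite (@tonelli_in R _ _ 'rV[R]_n (measurableTypeR R) (gauss R n) mu setT C f)//.
rewrite /student_const /beta_tail -/C.
set I0 := \int[gauss R n]_x _.
have I00 : 0 <= I0 by apply: integral_ge0 => x _; rewrite lee_fin sqrtr_ge0.
pose B (w : R) := (w `^ (2^-1 - 1) * (1 + w) `^ (- (n%:R / 2 + 2^-1)))%:E.
have mB : measurable_fun [set: R] B by apply/measurable_EFinP; exact: measurable_beta_tail.
have B0 w : 0 <= B w by rewrite lee_fin mulr_ge0 ?powR_ge0.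
have pk : (0 <= 2^-1 * normal_peak 1 :> R)%R by rewrite mulr_ge0// ltW// peak1_gt0.
transitivity (\int[mu]_(w in C) ((2^-1 * normal_peak 1)%:E * (B w * I0))); last first.
  have mBI : measurable_fun [set: R] (fun w => B w * I0).
    by apply: emeasurable_funM => //; exact: measurable_cst.
  rewrite (@ge0_integralZ_in _ _ (measurableTypeR R) mu C _ _ mC pk mBI); last by move=> w; rewrite mule_ge0.
  rewrite ge0_integralZr//; last exact: measurable_funTS.
  by rewrite -muleA [I0 * _]muleC.
apply: eq_integral => w; rewrite /C inE/= in_itv/= andbT => cw.
have w0 : (0 <= w)%R by exact: le_trans (ltW cw).
have h1 : (0 <= w `^ (2^-1 - 1) * (2^-1 * normal_peak 1))%R by rewrite mulr_ge0 ?powR_ge0.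
have mg : measurable_fun [set: 'rV[R]_n] (fun x => (Num.sqrt (dot x x) * expR (- (w * dot x x / 2)))%:E).
  apply/measurable_EFinP; apply: measurable_funM; first exact: measurable_sqrt_dot.
  apply: (measurableT_comp (@measurable_expR R)).
  apply: (measurableT_comp (@oppr_measurable R setT)).
  apply: measurable_funM => //; apply: measurable_funM => //; exact: measurable_dotxx.
transitivity (\int[gauss R n]_x ((w `^ (2^-1 - 1) * (2^-1 * normal_peak 1))%:E * (Num.sqrt (dot x x) * expR (- (w * dot x x / 2)))%:E)).
  by apply: eq_integral => x _; rewrite /f -EFinM.
rewrite (ge0_integralZT _ h1 mg); last by move=> x; rewrite lee_fin mulr_ge0 ?sqrtr_ge0 ?expR_ge0.
rewrite (@gauss_exp_scale w (fun x => Num.sqrt (dot x x)) 1%R)//; last 2 first.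
- exact: measurable_sqrt_dot.
- by move=> r x r0; rewrite dotZ sqrtrM ?sqr_ge0// sqrtr_sqr ger0_norm ?powRr1// ltW.
rewrite -/I0 /B !muleA -!EFinM; congr (_%:E * _).
rewrite (_ : (n%:R + 1) / 2 = n%:R / 2 + 2^-1 :> R)%R; last by field.
by ring.
Qed.

(** The statistic is odd and its zero set is null. *)
Lemma student_tail0 : gauss R n.+1 (student_event 0) = (2^-1)%:E.
Proof.
have m0 := measurable_student_event 0.
have ph a : (0 <= phi a)%R by exact/ltW/phi_gt0.
pose F u : \bar R := (\1_(student_event 0) u)%:E.
have mF : measurable_fun [set: 'rV[R]_n.+1] F by apply/measurable_EFinP; exact: measurable_indic.
have F0 u : 0 <= F u by rewrite lee_fin indicE.
pose N : set 'rV[R]_n.+1 := (fun u => - u)%R @^-1` student_event 0.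
have mN : measurable N by rewrite -[X in measurable X]setTI; exact: measurable_rV_opp.
have E1 : gauss R n.+1 (student_event 0) = gauss R n.+1 N.
  transitivity (\int[gauss R n.+1]_u F (- u)%R).
    by rewrite gauss_opp// /F integral_indic// setIT.
  by rewrite (_ : (fun u => F (- u)%R) = fun u => (\1_N u)%:E)// integral_indic// setIT.
pose Z : set 'rV[R]_n.+1 := [set u | student_stat u = 0%R].
have mZ : measurable Z.
  rewrite (_ : Z = student_stat @^-1` [set 0%R])//.
  rewrite -[X in measurable X]setTI; exact: measurable_student_stat.
have Z0 : gauss R n.+1 Z = 0.
  apply/eqP; rewrite eq_le measure_ge0 andbT.
  pose D (u : 'rV[R]_n.+1) : \bar R := (((dot u u == 0)%R)%:R)%:E.
  pose FZ u : \bar R := (\1_Z u)%:E.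
  have mFZ : measurable_fun [set: 'rV[R]_n.+1] FZ by apply/measurable_EFinP; exact: measurable_indic.
  have -> : gauss R n.+1 Z = \int[gauss R n.+1]_u FZ u by rewrite /FZ integral_indic// setIT.
  rewrite gauss_integralSr//; last by move=> u; rewrite lee_fin indicE.
  rewrite -(gauss_dot_eq0 R n0).
  apply: ge0_le_integralT.
    move=> x; apply: integral_ge0 => a _; rewrite mule_ge0 ?lee_fin ?indicE ?ph//.
  move=> x; have [S0|S0] := eqVneq (dot x x) 0%R.
    apply: (@le_trans _ _ (\int[mu]_a (phi a)%:E)); last by rewrite integral_phi.
    apply: ge0_le_integralT => a; first by rewrite mule_ge0 ?lee_fin ?indicE ?ph//.
    by rewrite -EFinM lee_fin ler_piMl ?ph// indicE; case: (_ \in _).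
  apply: (@le_trans _ _ (\int[mu]_a ((\1_[set 0%R] a : R)%:E * (phi a)%:E))).
    apply: ge0_le_integralT => a; first by rewrite mule_ge0 ?lee_fin ?indicE ?ph//.
    rewrite lee_wpmul2r ?lee_fin ?ph// !indicE.
    case: (boolP (_ \in Z)) => //; rewrite inE /Z/= student_stat_cons => /eqP.
    rewrite mulf_eq0 invr_eq0 sqrtr_eq0 leNgt mulr_gt0 ?invr_gt0 ?ltr0n//; last by rewrite lt0r S0 dot_ge0.
    by rewrite orbF => /eqP ->; rewrite mem_set.
  by rewrite -integral_indicM integral_set1.
have sN u : student_stat (- u)%R = (- student_stat u)%R.
  rewrite /student_stat mxE mulNr; congr (- (_ / Num.sqrt (_ * _)))%R.
  by apply: eq_bigr => j _; rewrite mxE sqrrN.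
have TE : [set: 'rV[R]_n.+1] = (student_event 0 `|` N) `|` Z.
  apply/seteqP; split=> u //= _.
  have [h|h|h] := ltgtP 0%R (student_stat u).
  - by left; left.
  - by left; right; rewrite /N /student_event/= sN oppr_gt0.
  - by right.
have H1 : gauss R n.+1 ((student_event 0 `|` N) `|` Z) = gauss R n.+1 (student_event 0 `|` N) + gauss R n.+1 Z.
  apply: measureU => //; first exact: measurableU.
  apply/seteqP; split=> u //= -[[] h Zu]; move: h; rewrite /N /student_event/= ?sN Zu ?oppr0 ltxx//.
have H2 : gauss R n.+1 (student_event 0 `|` N) = gauss R n.+1 (student_event 0) + gauss R n.+1 N.
  apply: measureU => //.
  by apply/seteqP; split=> u //=; rewrite /N /student_event/= sN => -[]; lra.
have H3 : gauss R n.+1 [set: 'rV[R]_n.+1] = 1 by exact: probability_setT.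
move: H3; rewrite TE H1 H2 Z0 adde0 -E1.
have : gauss R n.+1 (student_event 0) \is a fin_num by exact: fin_num_measure.
case: (gauss R n.+1 (student_event 0)) => [r| |]// _; rewrite -EFinD => -[]; move=> h; congr EFin; lra.
Qed.

Lemma student_prob (b : R) : (0 <= b)%R ->
  gauss R n.+1 (student_event b) =
  (2^-1 * incomplete_beta (n%:R / (n%:R + b ^+ 2)) (n%:R / 2) 2^-1)%:E.
Proof.
move=> b0.
have nn0 : (0 < n%:R :> R)%R by rewrite ltr0n.
have p0 : (0 < n%:R / 2 :> R)%R by rewrite divr_gt0.
have q0 : (0 < 2^-1 :> R)%R by rewrite invr_gt0.
have pq0 : (0 < n%:R / 2 + 2^-1 :> R)%R by rewrite addr_gt0.
have := student_tail (lexx 0%R); rewrite student_tail0 expr0n mul0r => E0.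
have B0 := beta_gamma p0 q0.
have gpq := gamma_fun_gt0 pq0; have gp := gamma_fun_gt0 p0; have gq := gamma_fun_gt0 q0.
rewrite student_tail//; set c := (b ^+ 2 / n%:R)%R.
have c0 : (0 <= c)%R by rewrite mulr_ge0 ?sqr_ge0 ?invr_ge0 ?ltW.
rewrite /incomplete_beta.
have -> : (n%:R / (n%:R + b ^+ 2) = (1 + c)^-1)%R.
  have h : (n%:R + b ^+ 2 != 0)%R by rewrite gt_eqF// ltr_pwDl ?sqr_ge0.
  have h2 : (1 + c != 0)%R by rewrite gt_eqF// ltr_pwDl.
  by rewrite /c; field; rewrite h (gt_eqF nn0).
rewrite /Rintegral (incomplete_beta_tail _ _ c0).
have bt0 k : 0 <= beta_tail k (n%:R / 2) 2^-1 :> \bar R.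
  by apply: integral_ge0 => w _; rewrite lee_fin mulr_ge0 ?powR_ge0.
have le : beta_tail c (n%:R / 2) 2^-1 <= beta_tail 0 (n%:R / 2) 2^-1 :> \bar R.
  rewrite /beta_tail integral_indicM [leRHS]integral_indicM.
  apply: ge0_le_integralT => w.
    by rewrite mule_ge0 ?lee_fin ?indicE// mulr_ge0 ?powR_ge0.
  rewrite lee_wpmul2r ?lee_fin ?mulr_ge0 ?powR_ge0// !indicE.
  case: (boolP (w \in (`]c, +oo[%classic))) => //; rewrite inE/= in_itv/= andbT => cw.
  by rewrite mem_set//= in_itv/= andbT (le_lt_trans c0).
have K0 : 0 <= student_const.
  apply: mule_ge0; first by rewrite lee_fin mulr_ge0// ltW// peak1_gt0.
  by apply: integral_ge0 => x _; rewrite lee_fin sqrtr_ge0.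
move: (gamma_fun _) (gamma_fun _) (gamma_fun _) gpq gp gq B0 => g1 g2 g3 gpq gp gq B0.
move: E0 B0 le (bt0 0%R) (bt0 c) K0 => {bt0}.
case: (beta_tail 0 _ _) => [x| |]//; last by move=> _; rewrite gt0_muley ?lte_fin.
case: (beta_tail c _ _) => [y| |]//.
(* An infinite constant is excluded: multiplied by the positive beta integral at level 0 it has to
   give 1/2. *)
case: student_const => [k| |]//; last first.
  move=> E0 [B0] _ _ _ _; exfalso; move: E0.
  have x0 : (0 < x)%R by rewrite -(pmulr_rgt0 x gpq) B0 mulr_gt0.
  by rewrite gt0_mulye.
rewrite -!EFinM => -[E0] [B0] _ _ _ _; congr EFin; rewrite /=.
have x0 : (0 < x)%R by rewrite -(pmulr_rgt0 x gpq) B0 mulr_gt0.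
rewrite -B0 E0; field.
by rewrite !gt_eqF.
Qed.
End student_statistic.

(** * First-order Hermite expansion of the exceedance indicator *)

Section student_moments.
Context (R : realType) (n : nat).
Hypothesis n0 : (0 < n)%N.
Notation mu := (@lebesgue_measure R).
Notation phi := (normal_pdf 0 (1:R)).
Local Open Scope ereal_scope.

Lemma integral_id_phi_tail (k : R) : (0 <= k)%R ->
  \int[mu]_(a in `]k, +oo[) (a * phi a)%:E = (phi k)%:E.
Proof.
move=> k0.
have mf : measurable_fun [set: R] (fun a : R => (a * phi a)%:E).
  by apply/measurable_EFinP; apply: measurable_funM => //; exact: measurable_phi.
rewrite integral_itv_obnd_cbnd; last exact: measurable_funTS.
have dphi (x : R) : is_derive x (1%R:R) (fun x => - phi x)%R (x * phi x)%R.
  by have d := is_derive_phi x; apply: is_derive_eq; ring.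
rewrite (@ge0_continuous_FTC2y _ _ (fun x => - phi x)%R _ 0%R).
- by rewrite -EFinB sub0r opprK.
- by move=> x kx; apply: mulr_ge0; [exact: le_trans kx|exact/ltW/phi_gt0].
- apply: continuous_subspaceT => x.
  by apply: continuousM; [exact: cvg_id|exact: continuous_phi].
- rewrite -[X in _ --> X](oppr0 R); apply: cvgN.
  have H (x : R) : (`|1%R : R| <= 1 * (1 + `|x|))%R by rewrite normr1 mul1r lerDl.
  have [] := cvg_mul_phi ltr01 H.
  by move=> H1 _; apply: cvg_trans H1; apply: near_eq_cvg; apply: nearW => x; rewrite mul1r.
- by move=> x _; apply: ex_derive; exact: dphi.
- apply: cvg_at_right_filter; apply: cvgN; exact: continuous_phi.
- by move=> x _ /=; rewrite derive1E; have d := dphi x; rewrite derive_val.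
Qed.

(* The first Hermite coefficient of the indicator of [student_event b]; by symmetry only the
   coordinate in the numerator of the statistic contributes. *)
Definition student_slope (b : R) : R := (normal_peak 1 * (1 + b ^+ 2 / n%:R) `^ (- (n%:R / 2)))%R.

(** For fixed denominator coordinates the integral of [a * phi a] beyond the threshold [k] is
    [phi k], a Gaussian function of [x] whose mean is given by [integral_gauss_exp]. *)
Lemma student_mean0 (b : R) : (0 <= b)%R ->
  \int[gauss R n.+1]_u (\1_(student_event b) u * u ord0 ord0)%:E = (student_slope b)%:E.
Proof.
move=> b0; set c := (b ^+ 2 / n%:R)%R.
have c0 : (0 <= c)%R by rewrite mulr_ge0 ?sqr_ge0 ?invr_ge0.
have nn0 : (0 < n%:R :> R)%R by rewrite ltr0n.
have mI := @measurable_student_event R n b.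
have ph a : (0 <= phi a)%R by exact/ltW/phi_gt0.
pose F (u : 'rV[R]_n.+1) : \bar R := (\1_(student_event b) u * u ord0 ord0)%:E.
have mF : measurable_fun [set: 'rV[R]_n.+1] F.
  apply/measurable_EFinP; apply: measurable_funM; first exact: measurable_indic.
  exact: measurable_coord.
have F0 u : 0 <= F u.
  rewrite lee_fin indicE; case: (boolP (u \in _)); last by rewrite mul0r.
  rewrite inE -[u]rV_consS => /(student_event_cons n0 _ _ b0)[_ h].
  by rewrite mul1r rV_cons0 ltW// (le_lt_trans _ h)// mulr_ge0// sqrtr_ge0.
rewrite -[LHS]/(\int[gauss R n.+1]_u F u) (gauss_integralSr mF F0).
have inner x : \int[mu]_a (F (rV_cons (a, x)) * (phi a)%:E) =
    ((dot x x != 0)%R%:R * (normal_peak 1 * expR (- (c * dot x x / 2))))%:E.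
  have [S0|S0] := eqVneq (dot x x) 0%R.
    rewrite mul0r; transitivity (\int[mu]_a (cst 0) a); last by rewrite integral0.
    apply: eq_integral => a _; rewrite /F indicE memNset ?mul0r ?mul0e//.
    by move/(student_event_cons n0 _ _ b0) => -[]; rewrite S0 ltxx.
  have Sp : (0 < dot x x)%R by rewrite lt0r S0 dot_ge0.
  rewrite mul1r; set k := (b * Num.sqrt (n%:R^-1 * dot x x))%R.
  have k0 : (0 <= k)%R by rewrite mulr_ge0 ?sqrtr_ge0.
  transitivity (phi k)%:E; last first.
    rewrite phiE (_ : (k ^+ 2 / 2 = c * dot x x / 2)%R)//.
    by rewrite /k exprMn sqr_sqrtr ?mulr_ge0 ?invr_ge0 ?dot_ge0 ?(ltW nn0)// /c; ring.
  rewrite -(integral_id_phi_tail k0) [RHS]integral_indicM; apply: eq_integral => a _.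
  rewrite /F rV_cons0 -!EFinM -mulrA !indicE; congr (_%:R * _)%:E.
  congr nat_of_bool; apply/idP/idP; rewrite !inE/= ?in_itv/= ?andbT.
    by move/(student_event_cons n0 _ _ b0) => -[_].
  by move=> ka; apply/(student_event_cons n0 _ _ b0).
under eq_integral do rewrite inner.
pose g (x : 'rV[R]_n) : \bar R := (normal_peak 1 * expR (- (c * dot x x / 2)))%:E.
pose D (x : 'rV[R]_n) : \bar R := (((dot x x == 0)%R)%:R)%:E.
have pk : (0 <= normal_peak 1 :> R)%R by rewrite ltW// peak1_gt0.
have me : measurable_fun [set: 'rV[R]_n] (fun x => (expR (- (c * dot x x / 2)))%:E).
  apply/measurable_EFinP; apply: (measurableT_comp (@measurable_expR R)).
  apply: (measurableT_comp (@oppr_measurable R setT)).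
  apply: measurable_funM => //; apply: measurable_funM => //; exact: measurable_dotxx.
have Ig : \int[gauss R n]_x g x = (student_slope b)%:E.
  under eq_integral do rewrite /g EFinM.
  rewrite (ge0_integralZT _ pk me); last by move=> x; rewrite lee_fin expR_ge0.
  by rewrite integral_gauss_exp// -EFinM.
(* On the null set [dot x x = 0] the inner integral is 0 instead of [normal_peak 1]. One inequality
   is immediate; for the other, a multiple of the indicator [D] of this set is added. *)
apply/eqP; rewrite eq_le; apply/andP; split.
  rewrite -Ig; apply: ge0_le_integralT => x.
    by rewrite lee_fin mulr_ge0// mulr_ge0// expR_ge0.
  by rewrite lee_fin ler_piMl ?mulr_ge0 ?expR_ge0//; case: eqP.
have mD0 : measurable [set x : 'rV[R]_n | dot x x = 0%R].
  rewrite (_ : [set x | _] = (fun x => dot x x) @^-1` [set 0%R])//.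
  rewrite -[X in measurable X]setTI; exact: measurable_dotxx.
have mD : measurable_fun [set: 'rV[R]_n] D.
  rewrite (_ : D = EFin \o \1_[set x : 'rV[R]_n | dot x x = 0%R]).
    by apply/measurable_EFinP; exact: measurable_indic.
  apply/funext => x /=; rewrite /D indicE; congr (nat_of_bool _)%:R%:E.
  by apply/eqP/idP => h; [rewrite mem_set|rewrite inE in h].
pose h (x : 'rV[R]_n) : \bar R := ((dot x x != 0)%R%:R * (normal_peak 1 * expR (- (c * dot x x / 2))))%:E.
have mh : measurable_fun [set: 'rV[R]_n] h.
  rewrite (_ : h = fun x => (1 - D x) * ((normal_peak 1)%:E * (expR (- (c * dot x x / 2)))%:E)); last first.
    apply/funext => x; rewrite /h /D -EFinB -!EFinM; congr (_ * _)%:E.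
    by case: eqP => _; rewrite ?subrr ?subr0.
  apply: emeasurable_funM; first by apply: emeasurable_funB => //; exact: measurable_cst.
  by apply: emeasurable_funM => //; exact: measurable_cst.
have h0 x : 0 <= h x by rewrite lee_fin mulr_ge0// mulr_ge0// expR_ge0.
have D0 x : 0 <= D x by rewrite lee_fin.
have pD : \int[gauss R n]_x ((normal_peak 1)%:E * D x) = 0.
  by rewrite (ge0_integralZT _ pk mD D0) gauss_dot_eq0// mule0.
rewrite -Ig -[leRHS]adde0 -pD -ge0_integralD//; last 3 first.
- by move=> x _; exact: h0.
- by move=> x _; rewrite mule_ge0 ?lee_fin.
- by apply: emeasurable_funM => //; exact: measurable_cst.

apply: ge0_le_integralT => x; first by rewrite lee_fin mulr_ge0 ?expR_ge0.
rewrite /g /h /D -EFinM -EFinD lee_fin.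
case: eqP => [->|_]; last by rewrite mulr0 addr0 mul1r.
by rewrite mulr0 mul0r oppr0 expR0 mul0r add0r.
Qed.

Lemma student_event_integrable b (h : 'rV[R]_n.+1 -> R) :
  (gauss R n.+1).-integrable setT (EFin \o h) ->
  (gauss R n.+1).-integrable setT (fun u => (\1_(student_event b) u * h u)%:E).
Proof.
move=> ih; have mI := @measurable_student_event R n b.
apply: (@le_integrable _ _ _ _ _ measurableT _ (EFin \o h)) => //.
  apply/measurable_EFinP; apply: measurable_funM; first exact: measurable_indic.
  by move/integrableP : ih => [/measurable_EFinP].
move=> u _ /=; rewrite lee_fin normrM ler_piMl// indicE; case: (_ \in _); rewrite ?normr1 ?normr0//.
Qed.

Lemma student_mean_lift (b : R) j :
  \int[gauss R n.+1]_u (\1_(student_event b) u * u ord0 (lift ord0 j))%:E = 0.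
Proof.
apply: (@integral_odd _ _ _ (gauss R n.+1) _ (fun u : 'rV[R]_n.+1 => \1_(student_event b) u * u ord0 (lift ord0 j))%R (@gauss_opp_tail R n)).
- apply: (@student_event_integrable b (fun u => u ord0 (lift ord0 j))); exact: gauss_coord_integrable.
- move=> x; rewrite rV_consl !mxE mulrN; congr (- (_ * _))%R.
  rewrite !indicE; congr (nat_of_bool _)%:R.
  have E : student_stat (rV_cons (x ord0 ord0, - (\row_j x ord0 (lift ord0 j))))%R = student_stat x.
    by rewrite -[in RHS](rV_consS x) !student_stat_cons dotNN.
  by apply/idP/idP; rewrite !inE /student_event/= E.
Qed.

Definition student_residual (b : R) (u : 'rV[R]_n.+1) : R :=
  (\1_(student_event b) u - fine (gauss R n.+1 (student_event b)) - student_slope b * u ord0 ord0)%R.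

Lemma measurable_student_residual b : measurable_fun [set: 'rV[R]_n.+1] (student_residual b).
Proof.
have mI := @measurable_student_event R n b.
apply: measurable_funB; last by apply: measurable_funM => //; exact: measurable_coord.
by apply: measurable_funB; [exact: measurable_indic|exact: measurable_cst].
Qed.

Lemma student_slope_ge0 b : (0 <= student_slope b)%R.
Proof. by rewrite mulr_ge0 ?powR_ge0// ltW// peak1_gt0. Qed.

Lemma student_slope_le1 b : (student_slope b <= 1)%R.
Proof.
rewrite -(mulr1 1%R) ler_pM ?powR_ge0//.
- by rewrite ltW// peak1_gt0.
- rewrite /normal_peak invf_le1 ?sqrtr_gt0; last first.
    by rewrite mulrn_wgt0// expr1n mul1r pi_gt0.
  rewrite -[leLHS]sqrtr1 ler_wsqrtr// expr1n mul1r; have := @pi_ge2 R.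
  by rewrite -mulr_natr; lra.
- rewrite powRN invf_le1; last by rewrite powR_gt0// ltr_pwDl// mulr_ge0 ?sqr_ge0 ?invr_ge0.
  rewrite -[leLHS](powRr0 (1 + b ^+ 2 / n%:R)) ler_powR// ?divr_ge0//.
  by rewrite lerDl mulr_ge0 ?sqr_ge0 ?invr_ge0.
Qed.

(** The constant does not depend on [b], so the Mehler bound stays uniform while the level grows.
    The indicator, its mean and the slope are all between 0 and 1, and the linear term is absorbed
    by the exponential. *)
Lemma student_residual_bound b u : (`|student_residual b u| <= 4 * expR (dot u u / 8))%R.
Proof.
have p1 : (0 <= fine (gauss R n.+1 (student_event b)) <= 1)%R.
  rewrite fine_ge0//=.
  have : gauss R n.+1 (student_event b) <= 1 by apply: probability_le1; exact: measurable_student_event.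
  have : 0 <= gauss R n.+1 (student_event b) by [].
  by case: (gauss R n.+1 (student_event b)) => [r| |]//=.
rewrite /student_residual; move: p1; set p := fine _ => p1.
have i1 : (0 <= (\1_(student_event b) u : R) <= 1)%R.
  by rewrite indicE; case: (_ \in _); rewrite /= ?lexx ?ler01.
have s0 := student_slope_ge0 b; have s1 := student_slope_le1 b.
have := sqr_coord_le u ord0; have := expR_ge1Dx (dot u u / 8).
move: i1 s0 s1; set t := u ord0 ord0; set i := \1_ _ u; set s := student_slope b => i1 s0 s1 e1 tS.
have T : (`|s * t| <= `|t|)%R by rewrite normrM ler_piMl// ger0_norm.
have T2 : (`|t| <= t ^+ 2 / 8 + 2)%R.
  have : (0 <= (`|t| - 4) ^+ 2)%R by exact: sqr_ge0.
  rewrite sqrrB real_normK ?num_real//; lra.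
have T3 : (`|i - p - s * t| <= 2 + `|s * t|)%R.
  apply: (le_trans (ler_normB _ _)); rewrite lerD2r ler_norml; lra.
have d0 : (0 <= dot u u)%R by exact: dot_ge0.
lra.
Qed.

Lemma integral_comb3 dT (T : measurableType dT) (m : {measure set T -> \bar R}) (f g h : T -> R) (c s : R) :
  m.-integrable setT (EFin \o f) -> m.-integrable setT (EFin \o g) -> m.-integrable setT (EFin \o h) ->
  \int[m]_x (f x - c * g x - s * h x)%:E =
  \int[m]_x (f x)%:E - c%:E * \int[m]_x (g x)%:E - s%:E * \int[m]_x (h x)%:E.
Proof.
move=> If Ig Ih.
have Icg : m.-integrable setT (fun x => c%:E * (EFin \o g) x) by exact: integrableZl.
have Ish : m.-integrable setT (fun x => s%:E * (EFin \o h) x) by exact: integrableZl.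
transitivity (\int[m]_x (((f x)%:E - c%:E * (g x)%:E) - s%:E * (h x)%:E)).
  by apply: eq_integral => x _; rewrite -!EFinM -!EFinB.
rewrite integralB//; last exact: integrableB.
rewrite integralB//.
by rewrite !integralZl.
Qed.

Lemma student_event_indic_integrable b : (gauss R n.+1).-integrable setT (EFin \o \1_(student_event b)).
Proof. by apply: integrable_indic; exact: measurable_student_event. Qed.

Lemma gauss_prob_fine (A : set 'rV[R]_n.+1) : measurable A ->
  \int[gauss R n.+1]_u (\1_A u)%:E = (fine (gauss R n.+1 A))%:E.
Proof. by move=> mA; rewrite integral_indic// setIT fineK// fin_num_measure. Qed.

Lemma student_residual_mean b : \int[gauss R n.+1]_u (student_residual b u)%:E = 0.
Proof.
have mI := @measurable_student_event R n b.
have I1 : (gauss R n.+1).-integrable setT (EFin \o (fun=> 1%R : R)).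
  exact: finite_measure_integrable_cst.
have := integral_comb3 (fine (gauss R n.+1 (student_event b))) (student_slope b)
  (student_event_indic_integrable b) I1 (@gauss_coord_integrable R _ ord0).
rewrite gauss_coord_mean mule0 sube0 integral_cst// [X in _ * (1 * X)](_ : _ = 1); last exact: probability_setT.
rewrite !mule1 gauss_prob_fine// subee// => <-.
by apply: eq_integral => u _; rewrite mulr1.
Qed.

Lemma student_residual_orth b j : (0 <= b)%R ->
  \int[gauss R n.+1]_u (student_residual b u * u ord0 j)%:E = 0.
Proof.
move=> b0; have mI := @measurable_student_event R n b.
have If := student_event_integrable b (@gauss_coord_integrable R _ j).
have := integral_comb3 (fine (gauss R n.+1 (student_event b))) (student_slope b)
  If (@gauss_coord_integrable R _ j) (@gauss_coord_prod_integrable R _ ord0 j).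
rewrite gauss_coord_mean mule0 sube0.
have -> : \int[gauss R n.+1]_x (\1_(student_event b) x * x ord0 j)%:E -
   (student_slope b)%:E * \int[gauss R n.+1]_x (x ord0 ord0 * x ord0 j)%:E = 0.
  case: (unliftP ord0 j) => [k ->|->].
    by rewrite student_mean_lift gauss_coord0_lift mule0 sube0.
  by rewrite student_mean0// gauss_coord0_sqr mule1 subee.
move=> <-; apply: eq_integral => u _; congr EFin; rewrite /student_residual; ring.
Qed.
End student_moments.

(** * Riesz energies *)

Section riesz.
Context (R : realType) (d : nat).
Local Open Scope ereal_scope.

Lemma integral_lin3 dT (T : measurableType dT) (m : {measure set T -> \bar R}) (D : set T)
    (f g h : T -> R) (a b c : R) : measurable D ->
  m.-integrable D (EFin \o f) -> m.-integrable D (EFin \o g) -> m.-integrable D (EFin \o h) ->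
  \int[m]_(x in D) (a * f x + b * g x + c * h x)%:E =
  a%:E * \int[m]_(x in D) (f x)%:E + b%:E * \int[m]_(x in D) (g x)%:E + c%:E * \int[m]_(x in D) (h x)%:E.
Proof.
move=> mD If Ig Ih.
have I1 : m.-integrable D (fun x => a%:E * (EFin \o f) x) by exact: integrableZl.
have I2 : m.-integrable D (fun x => b%:E * (EFin \o g) x) by exact: integrableZl.
have I3 : m.-integrable D (fun x => c%:E * (EFin \o h) x) by exact: integrableZl.
transitivity (\int[m]_(x in D) ((a%:E * (f x)%:E + b%:E * (g x)%:E) + c%:E * (h x)%:E)).
  by apply: eq_integral => x _; rewrite -!EFinM -!EFinD.
rewrite integralD//; last exact: integrableD.
rewrite integralD//.
by rewrite !integralZl.
Qed.

(** The squared modulus of the integral of [exp (i th)] is the double integral of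
    [cos (th x - th y)]; the added 1 keeps the integrand nonnegative and contributes [V ^+ 2]. *)
Lemma integral_cos_sub dT (T : measurableType dT) (m : {measure set T -> \bar R}) (D : set T) (V : R) (th : T -> R) :
  measurable D -> m D = V%:E -> measurable_fun [set: T] th ->
  \int[m]_(x in D) \int[m]_(y in D) (1 + cos (th x - th y))%:E =
  (V ^+ 2 + (\int[m]_(x in D) cos (th x)) ^+ 2 + (\int[m]_(x in D) sin (th x)) ^+ 2)%R%:E.
Proof.
move=> mD mV mth.
have bI (f : T -> R) : measurable_fun [set: T] f -> (forall x, `|f x| <= 1)%R -> m.-integrable D (EFin \o f).
  move=> mf f1; apply: measurable_bounded_integrable => //.
  - by rewrite mV ltry.
  - exact: measurable_funTS.
  - by exists 1%R; split; [exact: num_real|move=> x x1 y _; apply: (le_trans (f1 y)); exact: ltW].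
have mc : measurable_fun [set: T] (fun x => cos (th x)) by exact: (measurableT_comp (@measurable_cos R)).
have ms : measurable_fun [set: T] (fun x => sin (th x)).
  by apply: (measurableT_comp _ mth); apply: continuous_measurable_fun; exact: continuous_sin.
have I1 : m.-integrable D (EFin \o (fun=> 1%R : R)) by apply: bI => // x; rewrite normr1.
have Ic := bI _ mc (fun x => norm_cos_le1 _).
have Is := bI _ ms (fun x => norm_sin_le1 _).
set C := (\int[m]_(x in D) cos (th x))%R; set S := (\int[m]_(x in D) sin (th x))%R.
have EC : \int[m]_(x in D) (cos (th x))%:E = C%:E.
  by rewrite /C /Rintegral fineK//; exact: integrable_fin_num.
have ES : \int[m]_(x in D) (sin (th x))%:E = S%:E.
  by rewrite /S /Rintegral fineK//; exact: integrable_fin_num.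
have E1 : \int[m]_(x in D) (1%R)%:E = V%:E by rewrite integral_cst// mul1e.
transitivity (\int[m]_(x in D) (V * 1 + C * cos (th x) + S * sin (th x))%:E); last first.
  rewrite (integral_lin3 V C S mD I1 Ic Is) E1 EC ES -!EFinM -!EFinD; congr EFin; ring.
apply: eq_integral => x _.
transitivity (\int[m]_(y in D) (1 * 1 + cos (th x) * cos (th y) + sin (th x) * sin (th y))%:E).
  by apply: eq_integral => y _; rewrite cosB mulr1 addrA.
rewrite (integral_lin3 1%R (cos (th x)) (sin (th x)) mD I1 Ic Is) E1 EC ES -!EFinM -!EFinD; congr EFin; ring.
Qed.

(** A dilation by [sqrt t] reduces this to [gauss_cos]; the prefactor is the mass of the
    unnormalized Gaussian. *)
Lemma gauss_kernel_cos (t : R) (z : 'rV[R]_d) : (0 < t)%R ->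
  \int[leb R d]_l ((1 + cos (dot l z)) * expR (- (t * (dot l l / 2))))%:E =
  (((2 * pi / t) `^ (d%:R / 2)) * (1 + expR (- (t^-1 * (dot z z / 2)))))%:E.
Proof.
move=> t0; pose r := Num.sqrt t; have r0 : (0 < r)%R by rewrite sqrtr_gt0.
have r2 : (r ^+ 2 = t)%R by rewrite sqr_sqrtr// ltW.
have p0 := peak1_gt0 R.
pose F (u : 'rV[R]_d) : \bar R := ((1 + cos (0 + dot (r^-1 *: z)%R u)) * gpdf u)%:E.
have dZ (a : R) (x y : 'rV[R]_d) : dot (a *: x)%R y = (a * dot x y)%R.
  by rewrite /dot mulr_sumr; apply: eq_bigr => i _; rewrite mxE mulrA.
have dC (x y : 'rV[R]_d) : dot x y = dot y x by apply: eq_bigr => i _; rewrite mulrC.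
have mG : measurable_fun [set: 'rV[R]_d] (fun u => (1 + cos (0 + dot (r^-1 *: z)%R u))%:E).
  apply: measurable_1Dcos; apply: measurable_funD => //.
  by apply: measurable_dot_comp => //; exact: measurable_cst.
have mF : measurable_fun [set: 'rV[R]_d] F.
  by apply/measurable_EFinP; apply: measurable_funM; [exact/measurable_EFinP|exact: measurable_gpdf].
have F0 u : 0 <= F u by rewrite lee_fin mulr_ge0 ?gpdf_ge0// -lee_fin onePcos_ge0.
have IF : \int[leb R d]_u F u = (1 + expR (- (t^-1 * (dot z z / 2))))%:E.
  have := gauss_cos (r^-1 *: z)%R 0%R; rewrite (gauss_integral mG (fun u => onePcos_ge0 _)).
  rewrite cos0 mul1r dotZ exprVn r2 mulrA => <-.
  by apply: eq_integral => u _; rewrite -EFinM.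
have E := leb_affine 0%R r0 mF F0; rewrite IF in E.
transitivity (\int[leb R d]_l ((normal_peak 1 ^- d)%:E * F (r *: l + 0)%R)).
  apply: eq_integral => l _; rewrite /F -EFinM; congr EFin.
  rewrite addr0 add0r dZ [dot z _]dC dZ mulKf ?gt_eqF// gpdfE dotZ r2.
  rewrite [RHS]mulrCA; congr (_ * _)%R; rewrite mulKf ?expf_neq0 ?gt_eqF//; congr (expR (- _)); ring.
rewrite ge0_integralZT//; last 2 first.
- by rewrite invr_ge0 exprn_ge0// ltW.
- by apply: (measurableT_comp mF); exact: measurable_rV_affine.
rewrite E -!EFinM mulrA; congr ((_ * _)%:E).
rewrite -exprVn -exprMn -invfM -powR_mulrn ?invr_ge0 ?mulr_ge0 ?ltW//.
have -> : ((normal_peak 1 * r)^-1 = (2 * pi / t) `^ 2^-1 :> R)%R.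
  rewrite powR12_sqrt; last by rewrite mulr_ge0 ?invr_ge0 ?mulr_ge0 ?pi_ge0// ltW.
  rewrite /normal_peak invfM invrK expr1n mul1r /r -mulr_natl.
  by rewrite [in RHS]sqrtrM ?mulr_ge0 ?pi_ge0// sqrtrV// ltW.
by rewrite -powRrM; congr (_ `^ _)%R; rewrite mulrC.
Qed.

Lemma measurable_integral_in d1 d2 (T1 : measurableType d1) (T2 : measurableType d2)
    (m2 : {sigma_finite_measure set T2 -> \bar R}) (B : set T2) (f : T1 -> T2 -> \bar R) :
  measurable B -> measurable_fun [set: T1 * T2] (fun p => f p.1 p.2) -> (forall x y, 0 <= f x y) ->
  measurable_fun [set: T1] (fun x => \int[m2]_(y in B) f x y).
Proof.
move=> mB mf f0.
rewrite (_ : (fun x => _) = fun x => \int[m2]_y ((\1_B y : R)%:E * f x y)); last first.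
  by apply/funext => x; rewrite integral_indicM.
apply: (@measurable_fun_fubini_tonelli_F _ _ _ _ R m2 (fun p => (\1_B p.2 : R)%:E * f p.1 p.2)).
  apply: emeasurable_funM => //; apply/measurable_EFinP.
  by apply: (measurableT_comp (f := \1_B : T2 -> R)) measurable_snd; exact: measurable_indic.
by move=> p; rewrite mule_ge0// lee_fin indicE.
Qed.

Lemma measurable_rV_set1 (b : 'rV[R]_d) : measurable [set b].
Proof.
rewrite (_ : [set b] = \bigcap_(i in [set: 'I_d]) ((fun x : 'rV[R]_d => x ord0 i) @^-1` [set b ord0 i])).
  apply: fin_bigcap_measurable => // i _.
  by rewrite -[X in measurable X]setTI; exact: measurable_coord.
apply/seteqP; split=> x /=; first by move=> -> i.
by move=> h; apply/rowP => i; apply: h.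
Qed.

Hypothesis d0 : (0 < d)%N.

Lemma leb_set1 (b : 'rV[R]_d) : leb R d [set b] = 0.
Proof.
rewrite (_ : [set b] = [set x | forall i, [set b ord0 i] (x ord0 i)]); last first.
  by apply/seteqP; split=> x /=; [move=> -> i|move=> h; apply/rowP => i; exact: h].
rewrite (@leb_prod R d (fun i => [set b ord0 i]))//.
by rewrite (bigD1 (Ordinal d0))//= lebesgue_measure_set1 mul0e.
Qed.

Lemma dot_eq0 (z : 'rV[R]_d) : (dot z z == 0%R) = (z == 0%R).
Proof.
apply/eqP/eqP => [h|->]; last by rewrite /dot big1// => i _; rewrite mxE mul0r.
apply/rowP => i; rewrite mxE; apply/eqP; rewrite -sqrf_eq0 eq_le sqr_ge0 -[leRHS]h.
by rewrite sqr_coord_le.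
Qed.

(** At the origin a negative power of the norm is 0 by convention, whereas the Gamma integral that
    represents it elsewhere diverges. The factor [off0] removes this null set, so that the mixture
    formulas hold at every point. *)
Definition off0 (z : 'rV[R]_d) : R := ((z != 0)%R%:R)%R.

Lemma measurable_off0 : measurable_fun [set: 'rV[R]_d] off0.
Proof.
rewrite (_ : off0 = \1_(~` [set 0%R])).
  by apply: measurable_indic; apply: measurableC; exact: measurable_rV_set1.
apply/funext => z; rewrite /off0 indicE; congr (nat_of_bool _)%:R.
by apply/idP/idP => [/eqP h|]; [rewrite mem_set|rewrite inE => h; apply/eqP].
Qed.

Lemma measurable_sub : measurable_fun [set: 'rV[R]_d * 'rV[R]_d] (fun p => p.1 - p.2)%R.
Proof.
apply: measurable_fun_rVP => i; under eq_fun do rewrite !mxE.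
apply: measurable_funB; first exact: (measurableT_comp (measurable_coord i) measurable_fst).
exact: (measurableT_comp (measurable_coord i) measurable_snd).
Qed.

Lemma measurable_subl (b : 'rV[R]_d) : measurable_fun [set: 'rV[R]_d] (fun x => b - x)%R.
Proof. exact: (measurableT_comp measurable_sub (measurable_pair1 b)). Qed.

Lemma integral_off0 (D : set 'rV[R]_d) (b : 'rV[R]_d) (F : 'rV[R]_d -> \bar R) :
  measurable D -> measurable_fun [set: 'rV[R]_d] F -> (forall x, 0 <= F x) ->
  \int[leb R d]_(x in D) ((off0 (b - x))%:E * F x) = \int[leb R d]_(x in D) F x.
Proof.
move=> mD mF F0.
have mo : measurable_fun [set: 'rV[R]_d] (fun x => (off0 (b - x))%:E).
  by apply/measurable_EFinP; apply: (measurableT_comp measurable_off0); exact: measurable_subl.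
have o0 (x : 'rV[R]_d) : 0 <= (off0 (b - x))%:E by rewrite lee_fin.
have ms := measurable_rV_set1 b.
have moF : measurable_fun [set: 'rV[R]_d] (fun x => (off0 (b - x))%:E * F x) by exact: emeasurable_funM.
have msF : measurable_fun [set: 'rV[R]_d] (fun x => (\1_[set b] x : R)%:E * F x) by exact: measurable_indicM.
have s0 x : 0 <= (\1_[set b] x : R)%:E * F x by exact: indicM_ge0.
transitivity (\int[leb R d]_(x in D) ((off0 (b - x))%:E * F x + (\1_[set b] x : R)%:E * F x)).
  rewrite ge0_integralD//; last 3 first.
  - by move=> x _; rewrite mule_ge0.
  - exact: measurable_funTS.
  - exact: measurable_funTS.
  rewrite [X in _ + X](_ : _ = 0) ?adde0//; apply/eqP; rewrite eq_le; apply/andP; split; last first.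
    by apply: integral_ge0 => x _; exact: s0.
  rewrite integral_indicM; apply: (@le_trans _ _ (\int[leb R d]_x ((\1_[set b] x : R)%:E * F x))).
    apply: ge0_le_integralT => x; first by rewrite mule_ge0// lee_fin indicE.
    rewrite -[leRHS]mul1e lee_wpmul2r// lee_fin indicE; by case: (_ \in _).
  by rewrite -integral_indicM null_set_integral//; [exact: measurable_funTS|exact: leb_set1].
apply: eq_integral => x _; rewrite /off0 subr_eq0 indicE.
have [->|h] := eqVneq b x; first by rewrite mul0e add0e mem_set// mul1e.
by rewrite memNset ?mul0e ?adde0 ?mul1e//= => e; move: h; rewrite e eqxx.
Qed.
End riesz.

Section riesz_identity.
Context (R : realType) (d : nat).
Hypothesis d0 : (0 < d)%N.
Notation mu := (@lebesgue_measure R).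
Notation hl := (`]0%R, +oo[%classic : set R).
Context (D : set 'rV[R]_d) (V : R).
Hypothesis mD : measurable D.
Hypothesis DV : leb R d D = V%:E.
Local Open Scope ereal_scope.

Definition fourier_sqr (l : 'rV[R]_d) : R :=
  ((\int[leb R d]_(u in D) cos (dot l u)) ^+ 2 + (\int[leb R d]_(u in D) sin (dot l u)) ^+ 2)%R.

Lemma fourier_sqr_ge0 l : (0 <= fourier_sqr l)%R.
Proof. by rewrite addr_ge0 ?sqr_ge0. Qed.

Lemma dotBr (l x y : 'rV[R]_d) : dot l (x - y)%R = (dot l x - dot l y)%R.
Proof. by rewrite /dot -sumrB; apply: eq_bigr => i _; rewrite !mxE mulrBr. Qed.

Lemma fourier_sqrE l :
  \int[leb R d]_(x in D) \int[leb R d]_(y in D) (1 + cos (dot l (x - y)%R))%:E = (V ^+ 2 + fourier_sqr l)%:E.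
Proof.
rewrite /fourier_sqr [in RHS]addrA -(integral_cos_sub mD DV); last first.
  by apply: measurable_dot_comp => //; exact: measurable_cst.
by apply: eq_integral => x _; apply: eq_integral => y _; rewrite dotBr.
Qed.

Lemma measurable_rV_sub dT (T : measurableType dT) (f g : T -> 'rV[R]_d) :
  measurable_fun [set: T] f -> measurable_fun [set: T] g -> measurable_fun [set: T] (fun t => f t - g t)%R.
Proof.
move=> mf mg; apply: measurable_fun_rVP => i; under eq_fun do rewrite !mxE.
by apply: measurable_funB; apply: (measurableT_comp (measurable_coord i)).
Qed.

Let T3 := ('rV[R]_d * 'rV[R]_d * 'rV[R]_d)%type.

Let mcos3 : measurable_fun [set: T3] (fun p : T3 => (1 + cos (dot p.1.1 (p.1.2 - p.2)%R))%:E).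
Proof.
apply: measurable_1Dcos; apply: measurable_dot_comp.
  exact: (measurableT_comp measurable_fst measurable_fst).
by apply: measurable_rV_sub; [exact: (measurableT_comp measurable_snd measurable_fst)|exact: measurable_snd].
Qed.

Lemma measurable_fourier_sqr : measurable_fun [set: 'rV[R]_d] fourier_sqr.
Proof.
have m1 := @measurable_integral_in R _ _ _ _ (leb R d) D
  (fun (p : 'rV[R]_d * 'rV[R]_d) y => (1 + cos (dot p.1 (p.2 - y)%R))%:E) mD mcos3 (fun p y => onePcos_ge0 _).
have m2 := @measurable_integral_in R _ _ _ _ (leb R d) D
  (fun l x => \int[leb R d]_(y in D) (1 + cos (dot l (x - y)%R))%:E) mD m1.
have {}m2 : measurable_fun [set: 'rV[R]_d] (fun l => (V ^+ 2 + fourier_sqr l)%:E).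
  under eq_fun do rewrite -fourier_sqrE; apply: m2 => l x.
  by apply: integral_ge0 => y _; exact: onePcos_ge0.
move/measurable_EFinP : m2 => m2.
rewrite (_ : fourier_sqr = fun l => (V ^+ 2 + fourier_sqr l) - V ^+ 2)%R; last by apply/funext => l; ring.
by apply: measurable_funB => //; exact: measurable_cst.
Qed.

Definition heat_energy (s : R) : \bar R :=
  \int[leb R d]_(x in D) \int[leb R d]_(y in D) (expR (- (s * (dot (x - y) (x - y) / 2))))%R%:E.

Let measurable_heat dT (T : measurableType dT) (s : T -> R) (z : T -> 'rV[R]_d) :
  measurable_fun [set: T] s -> measurable_fun [set: T] z ->
  measurable_fun [set: T] (fun t => expR (- (s t * (dot (z t) (z t) / 2))))%R.
Proof.
move=> ms mz; apply: (measurableT_comp (@measurable_expR R)).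
apply: (measurableT_comp (@oppr_measurable R setT)); apply: measurable_funM => //.
by apply: measurable_funM => //; exact: measurable_dot_comp.
Qed.

Let m12 : measurable_fun [set: T3] (fun p : T3 => (p.1.2 - p.2)%R).
Proof.
by apply: measurable_rV_sub; [exact: (measurableT_comp measurable_snd measurable_fst)|exact: measurable_snd].
Qed.

(** Plancherel for Gaussian kernels. Tonelli is applied with [1 + cos] in place of [cos]; the
    summand 1 contributes the same finite amount [c * V ^+ 2] to both sides and is cancelled at the
    end. *)
Lemma fourier_sqr_gauss (t : R) : (0 < t)%R ->
  \int[leb R d]_l (fourier_sqr l * expR (- (t * (dot l l / 2))))%:E =
  ((2 * pi / t) `^ (d%:R / 2))%:E * heat_energy t^-1.
Proof.
move=> t0; set c := ((2 * pi / t) `^ (d%:R / 2))%R.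
have c0 : (0 <= c)%R by exact: powR_ge0.
have mE : measurable_fun [set: 'rV[R]_d] (fun l => (expR (- (t * (dot l l / 2))))%:E).
  by apply/measurable_EFinP; apply: measurable_heat => //; exact: measurable_cst.
have E0 (l : 'rV[R]_d) : 0 <= (expR (- (t * (dot l l / 2))))%:E by rewrite lee_fin expR_ge0.
pose f (l x y : 'rV[R]_d) : \bar R := ((1 + cos (dot l (x - y))) * expR (- (t * (dot l l / 2))))%R%:E.
have f0 l x y : 0 <= f l x y.
  by rewrite lee_fin mulr_ge0 ?expR_ge0// -lee_fin onePcos_ge0.
have mf : measurable_fun [set: T3] (fun p : T3 => f p.1.1 p.1.2 p.2).
  apply/measurable_EFinP; apply: measurable_funM; first by have /measurable_EFinP := mcos3.
  apply: measurable_heat; first exact: measurable_cst.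
  exact: (measurableT_comp measurable_fst measurable_fst).
pose g (l x : 'rV[R]_d) : \bar R := \int[leb R d]_(y in D) f l x y.
have mg : measurable_fun [set: 'rV[R]_d * 'rV[R]_d] (fun p => g p.1 p.2).
  exact: (@measurable_integral_in R _ _ _ _ (leb R d) D (fun (p : 'rV[R]_d * 'rV[R]_d) y => f p.1 p.2 y)).
have g0 l x : 0 <= g l x by apply: integral_ge0 => y _; exact: f0.
have L1 : \int[leb R d]_l \int[leb R d]_(x in D) g l x =
   \int[leb R d]_l ((V ^+ 2)%:E * (expR (- (t * (dot l l / 2))))%:E) +
   \int[leb R d]_l (fourier_sqr l * expR (- (t * (dot l l / 2))))%:E.
  rewrite -ge0_integralD//; last 4 first.
  - by move=> l _; rewrite mule_ge0 ?lee_fin ?sqr_ge0.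
  - by apply: emeasurable_funM => //; exact: measurable_cst.
  - by move=> l _; rewrite lee_fin mulr_ge0 ?expR_ge0 ?fourier_sqr_ge0.
  - apply/measurable_EFinP; apply: measurable_funM; first exact: measurable_fourier_sqr.
    exact/measurable_EFinP.
  apply: eq_integral => l _; rewrite -EFinM -EFinD -mulrDl EFinM -fourier_sqrE.
  have mc1 (x : 'rV[R]_d) : measurable_fun [set: 'rV[R]_d] (fun y => (1 + cos (dot l (x - y)%R))%:E).
    apply: measurable_1Dcos; apply: measurable_dot_comp; first exact: measurable_cst.
    exact: measurable_subl.
  have mc2 : measurable_fun [set: 'rV[R]_d * 'rV[R]_d] (fun p => (1 + cos (dot l (p.1 - p.2)%R))%:E).
    apply: measurable_1Dcos; apply: measurable_dot_comp; first exact: measurable_cst.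
    exact: measurable_sub.
  have mI := @measurable_integral_in R _ _ _ _ (leb R d) D (fun x y : 'rV[R]_d => (1 + cos (dot l (x - y)%R))%:E) mD mc2
    (fun x y => onePcos_ge0 _).
  rewrite -ge0_integralZr//; last 2 first.
  - exact: measurable_funTS.
  - by move=> x _; apply: integral_ge0 => y _; exact: onePcos_ge0.
  apply: eq_integral => x _; rewrite -ge0_integralZr//; last exact: measurable_funTS.
have L2 : \int[leb R d]_l \int[leb R d]_(x in D) g l x = c%:E * ((V ^+ 2)%:E + heat_energy t^-1).
  rewrite (@tonelli_in R _ _ _ _ (leb R d) (leb R d) setT D g)//.
  pose e (x y : 'rV[R]_d) := (1 + expR (- (t^-1 * (dot (x - y) (x - y) / 2))))%R.
  have e0 x y : 0 <= (e x y)%:E by rewrite lee_fin addr_ge0// expR_ge0.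
  have mh2 : measurable_fun [set: 'rV[R]_d * 'rV[R]_d] (fun p => (expR (- (t^-1 * (dot (p.1 - p.2) (p.1 - p.2) / 2))))%R%:E).
    by apply/measurable_EFinP; apply: measurable_heat; [exact: measurable_cst|exact: measurable_sub].
  have mh1 (x : 'rV[R]_d) : measurable_fun [set: 'rV[R]_d] (fun y => (expR (- (t^-1 * (dot (x - y) (x - y) / 2))))%R%:E).
    exact: (measurableT_comp mh2 (measurable_pair1 x)).
  have me (x : 'rV[R]_d) : measurable_fun [set: 'rV[R]_d] (fun y => (e x y)%:E).
    apply/measurable_EFinP; by apply: measurable_funD => //; have /measurable_EFinP := mh1 x.
  have inner x : \int[leb R d]_l g l x = c%:E * (V%:E + \int[leb R d]_(y in D) (expR (- (t^-1 * (dot (x - y) (x - y) / 2))))%R%:E).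
    rewrite /g (@tonelli_in R _ _ _ _ (leb R d) (leb R d) setT D (fun l y => f l x y))//; last first.
      apply/measurable_EFinP; apply: measurable_funM.
        have /measurable_EFinP // : measurable_fun [set: 'rV[R]_d * 'rV[R]_d] (fun p => (1 + cos (dot p.1 (x - p.2)%R))%:E).
        apply: measurable_1Dcos; apply: measurable_dot_comp; first exact: measurable_fst.
        by apply: measurable_rV_sub; [exact: measurable_cst|exact: measurable_snd].
      by apply: measurable_heat; [exact: measurable_cst|exact: measurable_fst].
    transitivity (\int[leb R d]_(y in D) (c%:E * (e x y)%:E)).
      by apply: eq_integral => y _; rewrite /f gauss_kernel_cos// -EFinM.
    rewrite (ge0_integralZ_in (leb R d) mD c0 (me x) (e0 x)); congr (_ * _).
    rewrite -DV -[in X in _ = X + _](mul1e (leb R d D)) -integral_cst// -ge0_integralD//.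
    exact: measurable_funTS.
  under eq_integral => x _ do rewrite inner.
  have mH : measurable_fun [set: 'rV[R]_d] (fun x => \int[leb R d]_(y in D) (expR (- (t^-1 * (dot (x - y) (x - y) / 2))))%R%:E).
    exact: (@measurable_integral_in R _ _ _ _ (leb R d) D (fun x y : 'rV[R]_d => (expR (- (t^-1 * (dot (x - y) (x - y) / 2))))%R%:E) mD mh2
     (fun x y => expR_ge0 _)).
  have H0 (x : 'rV[R]_d) : 0 <= \int[leb R d]_(y in D) (expR (- (t^-1 * (dot (x - y) (x - y) / 2))))%R%:E.
    by apply: integral_ge0 => y _; rewrite lee_fin expR_ge0.
  have V0 : 0 <= V%:E by rewrite -DV.
  rewrite (ge0_integralZ_in (leb R d) mD c0); last 2 first.
  - by apply: emeasurable_funD => //; exact: measurable_cst.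
  - by move=> x; exact: adde_ge0.
  congr (_ * _); rewrite ge0_integralD//; last exact: measurable_funTS.
  by rewrite integral_cst// expr2 EFinM; congr (_ * _ + _); exact: DV.
have L3 : \int[leb R d]_l ((V ^+ 2)%:E * (expR (- (t * (dot l l / 2))))%:E) = (c * V ^+ 2)%:E.
  have IE : \int[leb R d]_l (expR (- (t * (dot l l / 2))))%:E = c%:E.
    have := @gauss_kernel_cos R d t 0%R t0.
    rewrite (_ : dot (0 : 'rV[R]_d) 0 = 0)%R; last by rewrite /dot big1// => i _; rewrite mxE mulr0.
    rewrite mul0r mulr0 oppr0 expR0 -/c.
    have -> : \int[leb R d]_l ((1 + cos (dot l 0%R)) * expR (- (t * (dot l l / 2))))%:E =
              \int[leb R d]_l (2%:E * (expR (- (t * (dot l l / 2))))%:E).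
      apply: eq_integral => l _; rewrite (_ : dot l 0%R = 0%R) ?cos0 ?EFinM//.
      by rewrite /dot big1// => i _; rewrite mxE mulr0.
    rewrite (ge0_integralZT (leb R d) _ mE E0)//.
    move=> h; have : (2^-1)%:E * (2%:E * \int[leb R d]_l (expR (- (t * (dot l l / 2))))%:E) = (2^-1)%:E * (c * 2)%:E.
      by rewrite h.
    by rewrite muleA -!EFinM mulVf// mul1e mulrCA mulVf// mulr1.
  by rewrite (ge0_integralZT (leb R d) (sqr_ge0 V) mE E0) IE -EFinM mulrC.
move: L1; rewrite L2 L3 ge0_muleDr ?lee_fin ?sqr_ge0//; last first.
  by apply: integral_ge0 => x _; apply: integral_ge0 => y _; rewrite lee_fin expR_ge0.
rewrite -EFinM => /esym; set A := \int[_]_l _; set B := _ * _.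
by move=> /(congr1 (fun z => z - (c * V ^+ 2)%:E)); rewrite [X in X - _ = _]addeC addeK// [X in _ = X - _]addeC addeK.
Qed.

(** The substitution [t -> 1 / t] turns this into a Gamma integral. With [w = |z|^2 / 2] it writes a
    negative power of [|z|] as a mixture of Gaussian kernels of variance [t], the parametrization
    produced by [fourier_sqr_gauss]. *)
Lemma inverse_gamma (q w : R) : (0 < q)%R -> (0 < w)%R ->
  \int[mu]_(t in hl) (t `^ (- q - 1) * expR (- (t `^ (-1) * w)))%:E = (gamma_fun q * w `^ (- q))%:E.
Proof.
move=> q0 w0.
pose G (t : R) := (t `^ (- q - 1) * expR (- (t `^ (-1) * w)))%:E.
have mG : measurable_fun [set: R] G.
  apply/measurable_EFinP; apply: measurable_funM; first exact: measurable_powR.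
  apply: (measurableT_comp (@measurable_expR R)); apply: (measurableT_comp (@oppr_measurable R setT)).
  by apply: measurable_funM => //; exact: measurable_powR.
have G0 x : 0 <= G x by rewrite lee_fin mulr_ge0 ?powR_ge0 ?expR_ge0.
have N1 : (-1 != 0 :> R)%R by rewrite oppr_eq0 oner_eq0.
rewrite -[LHS]/(\int[mu]_(t in hl) G t) -(integral_halfline_powR N1 mG G0) -(gamma_scale q0 w0).
apply: eq_integral => t; rewrite inE/= in_itv/= andbT => t0.
rewrite /G -!powRrM normrN1 mul1r -EFinM; congr EFin.
rewrite mulrAC -powRD ?(gt_eqF t0) ?implybT//.
have -> : (-1 * (- q - 1) + (-1 - 1) = q - 1 :> R)%R by ring.
by rewrite mulrNN mulr1 powRr1 ?(ltW t0)// [(t * w)%R]mulrC.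
Qed.

Definition riesz_energy (b : R) : \bar R :=
  \int[leb R d]_(x in D) \int[leb R d]_(y in D) (enorm (x - y)%R `^ (- b))%:E.

Lemma enorm_powR (z : 'rV[R]_d) (b : R) : (enorm z `^ b = dot z z `^ (b / 2))%R.
Proof. by rewrite /enorm -powR12_sqrt ?dot_ge0// -powRrM mulrC. Qed.

Lemma off0_gt0 (z : 'rV[R]_d) : off0 z != 0%R -> (0 < dot z z)%R.
Proof. by rewrite /off0 pnatr_eq0 eqb0 negbK => z0; rewrite lt0r dot_ge0 dot_eq0 z0. Qed.

Lemma off0_eq0 (z : 'rV[R]_d) : off0 z = 0%R -> z = 0%R.
Proof. by rewrite /off0; have [->//|z0] := eqVneq z 0%R; move/eqP; rewrite oner_eq0. Qed.

Lemma off0_neq0 (z : 'rV[R]_d) : off0 z != 0%R -> off0 z = 1%R.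
Proof. by rewrite /off0; case: (eqVneq z 0%R) => // _; rewrite eqxx. Qed.

Lemma off0N (z : 'rV[R]_d) : off0 (- z)%R = off0 z.
Proof. by rewrite /off0 oppr_eq0. Qed.

Lemma measurable_off0_comp dT (T : measurableType dT) (f : T -> 'rV[R]_d) :
  measurable_fun [set: T] f -> measurable_fun [set: T] (fun t => off0 (f t)).
Proof. by move=> mf; exact: (measurableT_comp (@measurable_off0 R d) mf). Qed.

(* Both energies are mixtures over [t] of the identity for Gaussian kernels [fourier_sqr_gauss],
   integrated against a power of [t]. *)
Lemma riesz_identity (a : R) : (0 < a < d%:R)%R ->
  (gamma_fun ((d%:R - a) / 2) * 2 `^ ((d%:R - a) / 2))%:E *
    \int[leb R d]_l (fourier_sqr l / enorm l `^ (d%:R - a))%:E =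
  ((2 * pi) `^ (d%:R / 2) * (gamma_fun (a / 2) * 2 `^ (a / 2)))%:E * riesz_energy a.
Proof.
move=> /andP[a0 ad].
set p := ((d%:R - a) / 2)%R; set q := (a / 2)%R.
have p0 : (0 < p)%R by rewrite divr_gt0// subr_gt0.
have q0 : (0 < q)%R by rewrite divr_gt0.
have mhl : measurable hl by exact: measurable_itv.
have mfs := measurable_fourier_sqr.
have o0 (z : 'rV[R]_d) : (0 <= off0 z)%R by rewrite /off0.
pose W (z : 'rV[R]_d) : R := (dot z z / 2)%R.
have W0 z : off0 z != 0%R -> (0 < W z)%R by move=> h; rewrite divr_gt0// off0_gt0.
have mW dT (T : measurableType dT) (f : T -> 'rV[R]_d) : measurable_fun [set: T] f -> measurable_fun [set: T] (fun t => W (f t)).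
  by move=> mf; apply: measurable_funM => //; exact: measurable_dot_comp.
have Wpow z b : off0 z != 0%R -> (W z `^ (- b) = 2 `^ b * dot z z `^ (- b))%R.
  move=> h; have := off0_gt0 h => dz.
  by rewrite /W powR_quot// [(2 `^ (- b))%R]powRN invrK mulrC.
pose f1 (t : R) (l : 'rV[R]_d) : \bar R := (fourier_sqr l * off0 l * (t `^ (p - 1) * expR (- (W l * t))))%:E.
have f10 t l : 0 <= f1 t l by rewrite lee_fin !mulr_ge0 ?powR_ge0 ?expR_ge0 ?fourier_sqr_ge0.
have mf1 : measurable_fun [set: R * 'rV[R]_d] (fun x => f1 x.1 x.2).
  apply/measurable_EFinP; apply: measurable_funM.
    apply: measurable_funM; first exact: (measurableT_comp mfs measurable_snd).
    by apply: measurable_off0_comp; exact: measurable_snd.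
  apply: measurable_funM; first exact: (measurableT_comp (measurable_powR _) measurable_fst).
  apply: (measurableT_comp (@measurable_expR R)); apply: (measurableT_comp (@oppr_measurable R setT)).
  by apply: measurable_funM; [apply: mW; exact: measurable_snd|exact: measurable_fst].
have gp0 := ltW (gamma_fun_gt0 p0); have gq0 := ltW (gamma_fun_gt0 q0).
have L : \int[mu]_(t in hl) \int[leb R d]_l f1 t l =
    (gamma_fun p * 2 `^ p)%:E * \int[leb R d]_l (fourier_sqr l / enorm l `^ (d%:R - a))%:E.
  rewrite (@tonelli_in R _ _ (measurableTypeR R) _ mu (leb R d) hl setT f1)//.
  have k0 : (0 <= gamma_fun p * 2 `^ p)%R := mulr_ge0 gp0 (powR_ge0 _ _).
  have me : measurable_fun [set: 'rV[R]_d] (fun l => (fourier_sqr l / enorm l `^ (d%:R - a))%:E).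
    rewrite (_ : (fun l => _) = fun l => (fourier_sqr l * dot l l `^ (- p))%:E).
      apply/measurable_EFinP; apply: measurable_funM => //.
      by apply: (measurableT_comp (measurable_powR _)); exact: measurable_dotxx.
    by apply/funext => l; rewrite enorm_powR powRN.
  rewrite -(ge0_integralZT (leb R d) k0 me); last first.
    by move=> l; rewrite lee_fin mulr_ge0 ?fourier_sqr_ge0// invr_ge0 powR_ge0.
  apply: eq_integral => l _; rewrite /f1.
  have [h|h] := eqVneq (off0 l) 0%R.
    under eq_integral do rewrite h mulr0 mul0r.
    rewrite integral0 (off0_eq0 h).
    rewrite enorm_powR -/p (_ : dot (0 : 'rV[R]_d) 0 = 0)%R; last by apply/eqP; rewrite dot_eq0.
    by rewrite powR0 ?gt_eqF// invr0 mulr0 mule0.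
  rewrite (off0_neq0 h).
  rewrite mulr1; transitivity (\int[mu]_(t in hl) ((fourier_sqr l)%:E * (t `^ (p - 1) * expR (- (W l * t)))%:E)).
    by apply: eq_integral => t _.
  rewrite (@ge0_integralZ_in _ _ (measurableTypeR R))//; last 3 first.
  - exact: fourier_sqr_ge0.
  - apply/measurable_EFinP; apply: measurable_funM; first exact: measurable_powR.
    apply: (measurableT_comp (@measurable_expR R)); apply: (measurableT_comp (@oppr_measurable R setT)).
    exact: measurable_funM.
  - by move=> t; rewrite lee_fin mulr_ge0 ?powR_ge0 ?expR_ge0.
  rewrite (gamma_scale p0 (W0 _ h)) Wpow// enorm_powR -/p powRN -!EFinM; congr EFin; ring.
pose f2 (t : R) (x y : 'rV[R]_d) : \bar R :=
  (off0 (x - y) * (t `^ (- q - 1) * expR (- (t `^ (-1) * W (x - y)))))%R%:E.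
have f20 t x y : 0 <= f2 t x y by rewrite lee_fin !mulr_ge0 ?powR_ge0 ?expR_ge0.
have mf2 : measurable_fun [set: R * 'rV[R]_d * 'rV[R]_d] (fun x => f2 x.1.1 x.1.2 x.2).
  have ms : measurable_fun [set: R * 'rV[R]_d * 'rV[R]_d] (fun x => x.1.2 - x.2)%R.
    by apply: measurable_rV_sub; [exact: (measurableT_comp measurable_snd measurable_fst)|exact: measurable_snd].
  have mt : measurable_fun [set: R * 'rV[R]_d * 'rV[R]_d] (fun x => x.1.1).
    exact: (measurableT_comp measurable_fst measurable_fst).
  apply/measurable_EFinP; apply: measurable_funM; first exact: measurable_off0_comp.
  apply: measurable_funM; first exact: (measurableT_comp (measurable_powR _) mt).
  apply: (measurableT_comp (@measurable_expR R)); apply: (measurableT_comp (@oppr_measurable R setT)).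
  by apply: measurable_funM; [exact: (measurableT_comp (measurable_powR _) mt)|exact: mW].
have me2 : measurable_fun [set: 'rV[R]_d * 'rV[R]_d] (fun x => (enorm (x.1 - x.2)%R `^ (- a))%:E).
  under eq_fun do rewrite enorm_powR.
  apply/measurable_EFinP; apply: (measurableT_comp (measurable_powR _)).
  by apply: measurable_dot_comp; exact: measurable_sub.
have R2 : \int[mu]_(t in hl) \int[leb R d]_(x in D) \int[leb R d]_(y in D) f2 t x y =
   (gamma_fun q * 2 `^ q)%:E * riesz_energy a.
  have mi2 := @measurable_integral_in R _ _ _ _ (leb R d) D (fun (p : R * 'rV[R]_d) y => f2 p.1 p.2 y) mD mf2 (fun p y => f20 _ _ _).
  rewrite (@tonelli_in R _ _ (measurableTypeR R) _ mu (leb R d) hl D (fun t x => \int[leb R d]_(y in D) f2 t x y))//; last first.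
    by move=> t x; apply: integral_ge0 => y _; exact: f20.
  have k0 : (0 <= gamma_fun q * 2 `^ q)%R := mulr_ge0 gq0 (powR_ge0 _ _).
  rewrite /riesz_energy -(ge0_integralZ_in (leb R d) mD k0); last 2 first.
  - exact: (@measurable_integral_in R _ _ _ _ (leb R d) D (fun x y : 'rV[R]_d => (enorm (x - y)%R `^ (- a))%:E) mD me2 (fun x y => powR_ge0 _ _)).
  - by move=> x; apply: integral_ge0 => y _; rewrite lee_fin powR_ge0.
  apply: eq_integral => x _.
  have mf2x : measurable_fun [set: R * 'rV[R]_d] (fun p => f2 p.1 x p.2).
    have ms : measurable_fun [set: R * 'rV[R]_d] (fun p => x - p.2)%R.
      by apply: measurable_rV_sub; [exact: measurable_cst|exact: measurable_snd].
    apply/measurable_EFinP; apply: measurable_funM; first exact: measurable_off0_comp.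
    apply: measurable_funM; first exact: (measurableT_comp (measurable_powR _) measurable_fst).
    apply: (measurableT_comp (@measurable_expR R)); apply: (measurableT_comp (@oppr_measurable R setT)).
    by apply: measurable_funM; [exact: (measurableT_comp (measurable_powR _) measurable_fst)|exact: mW].
  rewrite (@tonelli_in R _ _ (measurableTypeR R) _ mu (leb R d) hl D (fun t y => f2 t x y))//.
  rewrite -(ge0_integralZ_in (leb R d) mD k0); last 2 first.
  - exact: (measurableT_comp me2 (measurable_pair1 x)).
  - by move=> y; rewrite lee_fin powR_ge0.
  apply: eq_integral => y _; rewrite /f2.
  have [h|h] := eqVneq (off0 (x - y)%R) 0%R.
    under eq_integral do rewrite h mul0r.
    rewrite integral0 (off0_eq0 h).
    rewrite enorm_powR (_ : dot (0 : 'rV[R]_d) 0 = 0)%R; last by apply/eqP; rewrite dot_eq0.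
    by rewrite powR0 ?mule0// mulf_neq0// oppr_eq0 gt_eqF.
  rewrite (off0_neq0 h).
  under eq_integral do rewrite mul1r.
  rewrite inverse_gamma ?W0// Wpow// enorm_powR mulNr -/q -EFinM; congr EFin; ring.
rewrite -L EFinM -muleA -R2.
have c0 : (0 <= (2 * pi) `^ (d%:R / 2) :> R)%R by exact: powR_ge0.
rewrite -(@ge0_integralZ_in _ _ (measurableTypeR R) mu hl _ _ mhl c0); last 2 first.
- have mi2 := @measurable_integral_in R _ _ _ _ (leb R d) D (fun (p : R * 'rV[R]_d) y => f2 p.1 p.2 y) mD mf2 (fun p y => f20 _ _ _).
  apply: (@measurable_integral_in R _ _ (measurableTypeR R) _ (leb R d) D (fun t x => \int[leb R d]_(y in D) f2 t x y)) => //.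
  by move=> t x; apply: integral_ge0 => y _; exact: f20.
- by move=> t; apply: integral_ge0 => x _; apply: integral_ge0 => y _; exact: f20.
apply: eq_integral => t; rewrite inE/= in_itv/= andbT => t0.
pose E (x y : 'rV[R]_d) : \bar R := (expR (- (t^-1 * (dot (x - y) (x - y) / 2))))%R%:E.
have mE : measurable_fun [set: 'rV[R]_d * 'rV[R]_d] (fun p => E p.1 p.2).
  by apply/measurable_EFinP; apply: measurable_heat; [exact: measurable_cst|exact: measurable_sub].
have E0 x y : 0 <= E x y by rewrite lee_fin expR_ge0.
have tq : (0 <= t `^ (- q - 1))%R by exact: powR_ge0.
have -> : \int[leb R d]_(x in D) \int[leb R d]_(y in D) f2 t x y = (t `^ (- q - 1))%:E * heat_energy t^-1.
  rewrite /heat_energy -(ge0_integralZ_in (leb R d) mD tq); last 2 first.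
  - exact: (@measurable_integral_in R _ _ _ _ (leb R d) D E mD mE E0).
  - by move=> x; apply: integral_ge0 => y _; exact: E0.
  apply: eq_integral => x _.
  have mEx : measurable_fun [set: 'rV[R]_d] (E x) := measurableT_comp mE (measurable_pair1 x).
  rewrite -(integral_off0 d0 x mD mEx (E0 x)) -(ge0_integralZ_in (leb R d) mD tq); last 2 first.
  - apply: emeasurable_funM => //; apply/measurable_EFinP; apply: measurable_off0_comp; exact: measurable_subl.
  - by move=> y; rewrite mule_ge0 ?lee_fin.
  apply: eq_integral => y _; rewrite /f2 /E -!EFinM powR_inv1 ?(ltW t0)//; congr EFin; ring.
have tp : (0 <= t `^ (p - 1))%R by exact: powR_ge0.
pose F (l : 'rV[R]_d) : \bar R := (fourier_sqr l * expR (- (t * (dot l l / 2))))%:E.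
have mF : measurable_fun [set: 'rV[R]_d] F.
  apply/measurable_EFinP; apply: measurable_funM => //.
  by apply: measurable_heat => //; exact: measurable_cst.
have F0 l : 0 <= F l by rewrite lee_fin mulr_ge0 ?expR_ge0 ?fourier_sqr_ge0.
transitivity ((t `^ (p - 1))%:E * \int[leb R d]_l F l).
  rewrite -(@integral_off0 _ _ d0 setT 0%R F)// -ge0_integralZT//; last 2 first.
  - apply: emeasurable_funM => //; apply/measurable_EFinP; apply: measurable_off0_comp; exact: measurable_subl.
  - by move=> y; apply: mule_ge0 => //; rewrite lee_fin.
  apply: eq_integral => l _; rewrite /f1 /F sub0r off0N -!EFinM [(t * _)%R]mulrC; congr EFin; ring.
rewrite /F fourier_sqr_gauss// !muleA -!EFinM; congr (_%:E * _).
rewrite powR_quot// ?mulr_gt0 ?pi_gt0//.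
(* Since [p + q = d / 2], the factor [t ^ (- d / 2)] from Plancherel makes the weights of the two
   mixtures coincide. *)
have -> : (t `^ (- q - 1) = t `^ (p - 1) * (t `^ (d%:R / 2))^-1)%R.
  rewrite -powRN -powRD ?(gt_eqF t0) ?implybT//; congr (_ `^ _)%R; rewrite /p /q; field.
- by ring.
- by ring.
Qed.
End riesz_identity.

(** * Finiteness and positivity of Riesz energies *)

Section riesz_finite.
Context (R : realType) (d : nat).
Hypothesis d0 : (0 < d)%N.
Notation mu := (@lebesgue_measure R).
Notation hl := (`]0%R, +oo[%classic : set R).
Context (D : set 'rV[R]_d) (V M : R).
Hypothesis mD : measurable D.
Hypothesis DV : leb R d D = V%:E.
Hypothesis M0 : (0 < M)%R.
Hypothesis DM : forall x, D x -> forall i, (`|x ord0 i| <= M)%R.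
Local Open Scope ereal_scope.

Let pole (b : R) (s : R) : \bar R := (\1_(hl `&` `]-oo, 2 * M]%classic) s * s `^ (- b))%:E.
(** On [[- 2 M, 2 M]] this is [|s| ^ (- b)] for [b > 0], with [+oo] at 0 where the power would be 0
    by convention. The Euclidean norm dominates every [|z i|], so the Riesz kernel of exponent [b]
    is at most the product over the coordinates of [|z i| ^ (- b / d)], and [b < d] makes each
    factor integrable on bounded intervals. *)
Let kernel1 (b : R) (s : R) : \bar R := (\1_[set 0%R] s : R)%:E * +oo + (pole b s + pole b (- s)%R).

Let pole_ge0 b s : 0 <= pole b s.
Proof. by rewrite lee_fin mulr_ge0 ?powR_ge0// indicE. Qed.

Let kernel1_ge0 b s : 0 <= kernel1 b s.
Proof.
apply: adde_ge0; last exact: adde_ge0.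
by apply: mule_ge0; [rewrite lee_fin indicE|exact: leey].
Qed.

Let measurable_pole b : measurable_fun [set: R] (pole b).
Proof.
apply/measurable_EFinP; apply: measurable_funM; last exact: measurable_powR.
by apply: measurable_indic; apply: measurableI.
Qed.

Let measurable_pole_opp b : measurable_fun [set: R] (fun s => pole b (- s)%R).
Proof. by apply: (measurableT_comp (measurable_pole b)); exact: oppr_measurable. Qed.

Let measurable_infty : measurable_fun [set: R] (fun s => (\1_[set 0%R] s : R)%:E * +oo).
Proof. by apply: emeasurable_funM => //; apply/measurable_EFinP; apply: measurable_indic. Qed.

Let measurable_kernel1 b : measurable_fun [set: R] (kernel1 b).
Proof. by apply: emeasurable_funD => //; exact: emeasurable_funD. Qed.

Let kernel1_0 b : kernel1 b 0%R = +oo.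
Proof.
by rewrite /kernel1 indicE mem_set//= mul1e addye.
Qed.

Let kernel1_neq0 b s : (s != 0)%R -> (`|s| <= 2 * M)%R -> kernel1 b s = (`|s| `^ (- b))%:E.
Proof.
move=> s0 sM; rewrite /kernel1 indicE memNset ?mul0e ?add0e; last by move=> /= h; rewrite h eqxx in s0.
have hM (z : R) : (0 < z)%R -> (z <= 2 * M)%R -> pole b z = (z `^ (- b))%:E.
  by move=> z0 zM; rewrite /pole indicE mem_set ?mul1r//=; split; rewrite /= in_itv/= ?z0.
have hN (z : R) : (z <= 0)%R -> pole b z = 0.
  by move=> z0; rewrite /pole indicE memNset ?mul0r//= => -[]; rewrite in_itv/= andbT ltNge z0.
move: s0; rewrite neq_lt => /orP[s0|s0].
  rewrite hN ?(ltW s0)// add0e ltr0_norm// hM//; first by rewrite oppr_gt0.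
  by move: sM; rewrite ltr0_norm.
rewrite (hN (- s)%R) ?oppr_le0 ?(ltW s0)// adde0 (gtr0_norm s0) hM//.
by move: sM; rewrite gtr0_norm.
Qed.

Let integral_kernel1 b : (b < 1)%R -> \int[mu]_s kernel1 b s < +oo.
Proof.
move=> b1.
have I1 : \int[mu]_s pole b s < +oo.
  (* On []0, 2 M]] the factor [exp (2 M - s)] is at least 1, so a Gamma integral dominates the
     pole. *)
  apply: (@le_lt_trans _ _ (\int[mu]_(s in hl) ((expR (2 * M))%:E * (s `^ ((1 - b) - 1) * expR (- s))%:E))).
    rewrite [leRHS]integral_indicM; apply: ge0_le_integralT => s //.
    rewrite /pole !indicE; case: (boolP (s \in hl)) => [|sh].
      rewrite inE => sh; rewrite mul1e -EFinM lee_fin.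
      case: (boolP (s \in _)); last by rewrite mul0r !mulr_ge0 ?expR_ge0 ?powR_ge0.
      rewrite inE/= => -[_]; rewrite in_itv/= => sM; rewrite mul1r mulrCA -expRD.
      have -> : (1 - b - 1 = - b)%R by ring.
      rewrite ler_peMr ?powR_ge0//; have := expR_ge1Dx (2 * M - s); lra.
    by rewrite memNset ?mul0r ?mul0e// => -[sh' _]; move/negP: sh; apply; rewrite inE.
  have mh : measurable hl by exact: measurable_itv.
  have b1' : (0 < 1 - b)%R by rewrite subr_gt0.
  rewrite (@ge0_integralZ_in _ _ (measurableTypeR R) mu hl _ _ mh (expR_ge0 _)); last 2 first.
  - by apply/measurable_EFinP; exact: measurable_gamma_integrand.
  - by move=> s; rewrite lee_fin gamma_integrand_ge0.
  by rewrite gamma_funE// -EFinM ltry.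
rewrite ge0_integralD//; last 2 first.
- by move=> s _; rewrite adde_ge0.
- exact: (emeasurable_funD (measurable_pole b) (measurable_pole_opp b)).
rewrite -integral_indicM integral_set1 add0e ge0_integralD//.
- by rewrite (lebesgue_opp (measurable_pole b) (pole_ge0 b)) lte_add_pinfty.
- exact: measurable_pole.
- exact: measurable_pole_opp.
Qed.

Let energy_kernel_le (b : R) (x y : 'rV[R]_d) : (0 < b)%R -> D x -> D y ->
  (enorm (x - y)%R `^ (- b))%:E <= \prod_(i < d) kernel1 (b / d%:R) ((1 *: y + (- x)) ord0 i)%R.
Proof.
move=> b0 Dx Dy; rewrite scale1r.
pose z := (y - x)%R; rewrite -/z.
have zi i : z ord0 i = (y ord0 i - x ord0 i)%R by rewrite !mxE.
have -> : enorm (x - y)%R = enorm z by rewrite /enorm -opprB dotNN.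
have zM i : (`|z ord0 i| <= 2 * M)%R.
  rewrite zi; apply: (le_trans (ler_normB _ _)).
  have := DM Dx i; have := DM Dy i; lra.
have [/existsP[i /eqP zi0]|] := boolP [exists i, z ord0 i == 0%R].
  rewrite (bigD1 i)//= zi0 kernel1_0 gt0_mulye ?leey//.
  elim/big_ind : _ => //; first by move=> u v; exact: mule_gt0.
  move=> j _; have [->|zj0] := eqVneq (z ord0 j) 0%R; first by rewrite kernel1_0.
  by rewrite kernel1_neq0// lte_fin powR_gt0// normr_gt0.
rewrite negb_exists => /forallP z0.
rewrite (eq_bigr (fun i => (`|z ord0 i| `^ (- (b / d%:R)))%:E)); last first.
  by move=> i _; rewrite kernel1_neq0.
rewrite prodEFin lee_fin.
have e0 : (0 < enorm z)%R.
  rewrite /enorm sqrtr_gt0 lt0r dot_ge0 dot_eq0 andbT//; apply/eqP => h.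
  by move: (z0 (Ordinal d0)); rewrite h mxE eqxx.
have -> : (enorm z `^ (- b) = \prod_(i < d) (enorm z `^ (- (b / d%:R))))%R.
  rewrite prodr_const card_ord -powR_mulrn ?powR_ge0// -powRrM; congr (_ `^ _)%R.
  by field; rewrite pnatr_eq0 -lt0n.
apply: ler_prod => i _; rewrite powR_ge0/=.
have zi0 : (0 < `|z ord0 i|)%R by rewrite normr_gt0.
rewrite !powRN lef_pV2 ?posrE ?powR_gt0//.
apply: ge0_ler_powR; rewrite ?nnegrE ?(ltW e0)//; first by rewrite divr_ge0// ltW.
by rewrite -sqrtr_sqr /enorm ler_sqrt ?dot_ge0// sqr_coord_le.
Qed.

Lemma measurable_riesz_kernel (b : R) :
  measurable_fun [set: 'rV[R]_d * 'rV[R]_d] (fun p => (enorm (p.1 - p.2)%R `^ b)%:E).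
Proof.
under eq_fun do rewrite enorm_powR.
apply/measurable_EFinP; apply: (measurableT_comp (measurable_powR _)).
by apply: measurable_dot_comp; exact: measurable_sub.
Qed.

Lemma riesz_energy_lty (b : R) : (0 < b < d%:R)%R -> riesz_energy D b < +oo.
Proof.
move=> /andP[b0 bd].
have bd1 : (b / d%:R < 1)%R by rewrite ltr_pdivrMr ?mul1r ?ltr0n.
have I1 := integral_kernel1 bd1.
have I0 : 0 <= \int[mu]_s kernel1 (b / d%:R) s by apply: integral_ge0 => s _; exact: kernel1_ge0.
have [C CE] : exists C : R, \int[mu]_s kernel1 (b / d%:R) s = C%:E.
  by exists (fine (\int[mu]_s kernel1 (b / d%:R) s)); rewrite fineK// ge0_fin_numE.
pose F (z : 'rV[R]_d) : \bar R := \prod_(i < d) kernel1 (b / d%:R) (z ord0 i).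
have mF : measurable_fun [set: 'rV[R]_d] F.
  by apply: emeasurable_prod => i; apply: (measurableT_comp (measurable_kernel1 _)); exact: measurable_coord.
have F0 z : 0 <= F z by apply: prode_ge0.
have IF (x : 'rV[R]_d) : \int[leb R d]_y F (1 *: y + (- x))%R = (C ^+ d)%:E.
  rewrite (leb_affine (- x)%R ltr01 mF F0) invr1 expr1n mul1e /F.
  rewrite (@leb_prod_integral R d (fun=> kernel1 (b / d%:R)))//.
  by rewrite CE prodEFin prodr_const card_ord.
apply: (@le_lt_trans _ _ (\int[leb R d]_(x in D) (C ^+ d)%:E)); last first.
  by rewrite integral_cst// [X in _ * X](_ : _ = V%:E) ?ltry// -EFinM ltry.
rewrite /riesz_energy integral_indicM [leRHS]integral_indicM; apply: ge0_le_integralT => x.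
  rewrite mule_ge0 ?lee_fin ?indicE//; apply: integral_ge0 => y _; by rewrite lee_fin powR_ge0.
rewrite indicE; case: (boolP (x \in D)) => [|_]; last by rewrite !mul0e.
rewrite inE => Dx; rewrite !mul1e -(IF x) integral_indicM; apply: ge0_le_integralT => y.
  by rewrite mule_ge0 ?lee_fin ?indicE ?powR_ge0.
rewrite indicE; case: (boolP (y \in D)) => [|_]; last by rewrite mul0e.
by rewrite inE => Dy; rewrite mul1e; exact: energy_kernel_le.
Qed.

(** [B] exceeds every squared distance between points of [D], so the kernel is bounded below off the
    diagonal, whose sections are null. *)
Lemma riesz_energy_gt0 (b : R) : (0 < b)%R -> (0 < V)%R -> 0 < riesz_energy D b.
Proof.
move=> b0 V0; pose B := (1 + d%:R * (2 * M) ^+ 2)%R.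
have B0 : (0 < B)%R by rewrite ltr_pwDl// mulr_ge0 ?sqr_ge0.
have k0 : (0 <= B `^ (- (b / 2)))%R by exact: powR_ge0.
apply: (@lt_le_trans _ _ (\int[leb R d]_(x in D) (B `^ (- (b / 2)) * V)%:E)).
  rewrite integral_cst// [X in _ * X](_ : _ = V%:E)// -EFinM lte_fin !mulr_gt0// powR_gt0//.
rewrite /riesz_energy integral_indicM [leRHS]integral_indicM; apply: ge0_le_integralT => x.
  by rewrite mule_ge0 ?lee_fin ?indicE// mulr_ge0// ltW.
rewrite indicE; case: (boolP (x \in D)) => [|_]; last by rewrite !mul0e.
rewrite inE => Dx; rewrite !mul1e.
have -> : (B `^ (- (b / 2)) * V)%:E = \int[leb R d]_(y in D) ((off0 (x - y)%R)%:E * (B `^ (- (b / 2)))%:E).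
  by rewrite integral_off0// integral_cst// EFinM; congr (_ * _); apply/esym; exact: DV.
rewrite integral_indicM [leRHS]integral_indicM; apply: ge0_le_integralT => y.
  by rewrite !mule_ge0 ?lee_fin ?indicE ?powR_ge0// /off0.
rewrite indicE; case: (boolP (y \in D)) => [|_]; last by rewrite !mul0e.
rewrite inE => Dy; rewrite !mul1e -EFinM lee_fin.
have [h|h] := eqVneq (off0 (x - y)%R) 0%R; first by rewrite h mul0r powR_ge0.
rewrite (off0_neq0 h) mul1r enorm_powR mulNr !powRN.
have z0 := off0_gt0 h.
rewrite lef_pV2 ?posrE ?powR_gt0//; apply: ge0_ler_powR; rewrite ?nnegrE ?(ltW z0) ?(ltW B0)//.
  by rewrite divr_ge0// ltW.
rewrite /B ler_wpDl// /dot -[d in leRHS]card_ord mulr_natl -sumr_const; apply: ler_sum => i _.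
rewrite -expr2 -[leLHS]real_normK ?num_real// ler_pXn2r ?nnegrE//; last by rewrite mulr_ge0// ltW.
rewrite !mxE; apply: (le_trans (ler_normB _ _)).
have := DM Dx i; have := DM Dy i; lra.
Qed.
End riesz_finite.

(** * The product of the constants [c2] and [c3] as a Riesz energy *)

Section c2_c3.
Context (R : realType) (d : nat).
Hypothesis d0 : (0 < d)%N.
Local Open Scope ereal_scope.

(** Monotonicity in the domain holds for the possibly nonmeasurable [A], and the integrals over [D]
    and [F] differ by a null set. *)
Lemma ge0_integral_sandwich dT (T : measurableType dT) (m : {measure set T -> \bar R})
    (D A F : set T) (f : T -> \bar R) :
  measurable D -> measurable F -> D `<=` A -> A `<=` F -> m (F `\` D) = 0 ->
  measurable_fun [set: T] f -> (forall x, 0 <= f x) ->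
  \int[m]_(x in A) f x = \int[m]_(x in D) f x.
Proof.
move=> mD mF DA AF FD mf f0.
have mono (B C : set T) : B `<=` C -> \int[m]_(x in B) f x <= \int[m]_(x in C) f x.
  move=> BC; rewrite integral_indicM [leRHS]integral_indicM.
  apply: ge0_le_integralT => x; first exact: indicM_ge0.
  rewrite lee_wpmul2r// lee_fin !indicE; case: (boolP (x \in B)) => //; rewrite inE => /BC Cx.
  by rewrite mem_set.
apply/eqP; rewrite eq_le (mono _ _ DA) andbT.
apply: (le_trans (mono _ _ AF)).
have -> : F = D `|` (F `\` D) by rewrite setDUK//; exact: subset_trans AF.
have mFD : measurable (F `\` D) by exact: measurableD.
rewrite ge0_integral_setU//; last 2 first.
- exact: measurable_funTS.
- by apply/disj_setPS => x [] Dx [].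
by rewrite [X in _ + X]null_set_integral ?adde0//; exact: measurable_funTS.
Qed.

Lemma integral_sandwich dT (T : measurableType dT) (m : {measure set T -> \bar R})
    (D A F : set T) (f : T -> R) :
  measurable D -> measurable F -> D `<=` A -> A `<=` F -> m (F `\` D) = 0 ->
  measurable_fun [set: T] f ->
  \int[m]_(x in A) (f x)%:E = \int[m]_(x in D) (f x)%:E.
Proof.
move=> mD mF DA AF FD mf; rewrite integralE [RHS]integralE.
have mfE : measurable_fun [set: T] (EFin \o f) by exact/measurable_EFinP.
by congr (_ - _); apply: (ge0_integral_sandwich mD mF DA AF FD) => //;
  [exact: measurable_funepos|exact: measurable_funeneg].
Qed.

(** This is [riesz_identity] solved for the spectral integral; [c2] is the inverse of the resulting
    constant. Finiteness of the Riesz energy makes the spectral integral finite, so the real-valued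
    integral in [c3] is the true one. *)
Lemma c2_c3E (D A F : set 'rV[R]_d) (V M a : R) :
  measurable D -> measurable F -> D `<=` A -> A `<=` F -> leb R d (F `\` D) = 0 ->
  leb R d D = V%:E -> (forall x, D x -> forall i, (`|x ord0 i| <= M)%R) ->
  (0 < a < d%:R)%R -> (c2 d a * c3 A a)%:E = riesz_energy D a.
Proof.
move=> mD mF DA AF FD DV DM ad; have /andP[a0 ad1] := ad.
have fE l : (ComplexField.Normc.normc (fourier_set A l) ^+ 2 = fourier_sqr D l)%R.
  have ml : measurable_fun [set: 'rV[R]_d] (fun u => dot l u).
    by apply: measurable_dot_comp => //; exact: measurable_cst.
  rewrite /fourier_set /Cintegral /Rintegral /expi /=.
  rewrite (integral_sandwich mD mF DA AF FD); last exact: (measurableT_comp (@measurable_cos R)).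
  rewrite (integral_sandwich mD mF DA AF FD); last first.
    by apply: (measurableT_comp _ ml); apply: continuous_measurable_fun; exact: continuous_sin.
  by rewrite sqr_sqrtr// addr_ge0 ?sqr_ge0.
have c3E : c3 A a = fine (\int[leb R d]_l (fourier_sqr D l / enorm l `^ (d%:R - a))%:E).
  by rewrite /c3 /Rintegral; congr fine; apply: eq_integral => l _; rewrite fE.
have := riesz_identity d0 mD DV ad; have := riesz_energy_lty d0 mD DV DM ad.
have : 0 <= riesz_energy D a.
  by apply: integral_ge0 => x _; apply: integral_ge0 => y _; rewrite lee_fin powR_ge0.
have p0 : (0 < (d%:R - a) / 2)%R by rewrite divr_gt0// subr_gt0.
have q0 : (0 < a / 2)%R by rewrite divr_gt0.
have gp := gamma_fun_gt0 p0; have gq := gamma_fun_gt0 q0.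
rewrite c3E /c2; move: (gamma_fun ((d%:R - a) / 2)) (gamma_fun (a / 2)) gp gq => gp gq gp0 gq0.
have X0 : 0 <= \int[leb R d]_l (fourier_sqr D l / enorm l `^ (d%:R - a))%:E.
  by apply: integral_ge0 => l _; rewrite lee_fin mulr_ge0 ?fourier_sqr_ge0// invr_ge0 powR_ge0.
case: (riesz_energy D a) => [I| |]// I0 _.
move: X0; case: (\int[_]_l _) => [X| |]// X0; last first.
  by rewrite gt0_muley// lte_fin mulr_gt0// powR_gt0.
rewrite -!EFinM => -[] h /=; congr EFin.
have n2 : (2 `^ ((d%:R - a) / 2) != 0 :> R)%R by rewrite gt_eqF// powR_gt0.
have npi : (pi `^ (d%:R / 2) != 0 :> R)%R by rewrite gt_eqF// powR_gt0// pi_gt0.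
have n2a : (2 `^ a != 0 :> R)%R by rewrite gt_eqF// powR_gt0.
have -> : X = ((2 * pi) `^ (d%:R / 2) * (gq * 2 `^ (a / 2)) * I / (gp * 2 `^ ((d%:R - a) / 2)))%R.
  by rewrite -h mulrC mulKf// mulf_neq0// gt_eqF.
have E : (2 `^ (d%:R / 2) * 2 `^ (a / 2) = 2 `^ ((d%:R - a) / 2) * 2 `^ a :> R)%R.
  by rewrite -!powRD ?pnatr_eq0 ?implybT//; congr (_ `^ _)%R; field.
rewrite powRM ?pi_ge0//.
rewrite (_ : (2 `^ (d%:R / 2) * pi `^ (d%:R / 2) * (gq * 2 `^ (a / 2)) =
   (2 `^ ((d%:R - a) / 2) * 2 `^ a) * pi `^ (d%:R / 2) * gq))%R; last by rewrite -E; ring.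
by field; rewrite n2 npi n2a !gt_eqF.
Qed.
End c2_c3.

(** * Space integrals of random fields *)

Section second_moment.
Context (dO : measure_display) (Omega : measurableType dO) (R : realType)
  (P : probability Omega R) (d : nat) (D : set 'rV[R]_d) (V : R).
Hypothesis mD : measurable D.
Hypothesis DV : leb R d D = V%:E.
Hypothesis V0 : (0 < V)%R.
Context (H : 'rV[R]_d -> Omega -> R) (s2 : R) (g : 'rV[R]_d -> 'rV[R]_d -> R).
Hypothesis mH : measurable_fun [set: 'rV[R]_d * Omega] (fun p => H p.1 p.2).
Local Open Scope ereal_scope.
Hypothesis Hs2 : forall x, \int[P]_w (H x w ^+ 2)%:E = s2%:E.
Hypothesis Hg : forall x y, \int[P]_w ((H x w + H y w) ^+ 2)%:E = (2 * s2 + 2 * g x y)%:E.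

Definition space_integral (w : Omega) : R := (\int[leb R d]_(x in D) H x w)%R.

Definition space_energy (w : Omega) : \bar R := \int[leb R d]_(x in D) (H x w ^+ 2)%:E.

Let mHw w : measurable_fun [set: 'rV[R]_d] (H^~ w).
Proof. exact: (measurableT_comp mH (measurable_pair2 w)). Qed.

Let mHx x : measurable_fun [set: Omega] (H x).
Proof. exact: (measurableT_comp mH (measurable_pair1 x)). Qed.

Let mswap : measurable_fun [set: Omega * 'rV[R]_d] (fun p => H p.2 p.1).
Proof. exact: (measurableT_comp mH (@measurable_swap _ _ _ _)). Qed.

Lemma space_energy_ge0 w : 0 <= space_energy w.
Proof. by apply: integral_ge0 => x _; rewrite lee_fin sqr_ge0. Qed.

Let msq : measurable_fun [set: Omega * 'rV[R]_d] (fun p => (H p.2 p.1 ^+ 2)%:E).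
Proof. by apply/measurable_EFinP; apply: measurable_funX; exact: mswap. Qed.

Lemma measurable_space_energy : measurable_fun [set: Omega] space_energy.
Proof.
apply: (@measurable_integral_in R _ _ _ _ (leb R d) D (fun w x => (H x w ^+ 2)%:E) mD msq).
by move=> w x; rewrite lee_fin sqr_ge0.
Qed.

Lemma measurable_space_integral : measurable_fun [set: Omega] space_integral.
Proof.
have mm (f : R -> R) : measurable_fun [set: R] f -> (forall x, (0 <= f x)%R) ->
    measurable_fun [set: Omega] (fun w => \int[leb R d]_(x in D) (f (H x w))%:E).
  move=> mf f0; apply: (@measurable_integral_in R _ _ _ _ (leb R d) D (fun w x => (f (H x w))%:E)) => //.
    by apply/measurable_EFinP; exact: (measurableT_comp mf mswap).
  by move=> w x; rewrite lee_fin.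
rewrite (_ : space_integral = fine \o (fun w => \int[leb R d]_(x in D) (H x w)%:E))//.
apply: measurableT_comp => //.
rewrite (_ : (fun w => _) = fun w => \int[leb R d]_(x in D) (Num.max (H x w) 0)%:E - \int[leb R d]_(x in D) (Num.max (- H x w) 0)%:E).
  apply: emeasurable_funB.
    apply: (mm (fun x => Num.max x 0%R)); first exact: measurable_maxr.
    by move=> x; rewrite le_max lexx orbT.
  apply: (mm (fun x => Num.max (- x) 0)%R); last by move=> x; rewrite le_max lexx orbT.
  by apply: measurable_maxr => //; exact: oppr_measurable.
apply/funext => w; rewrite integralE; congr (_ - _); apply: eq_integral => x _.
  by rewrite funeposE -EFin_max.
by rewrite funenegE -EFin_max.
Qed.

Lemma space_energy_mean : \int[P]_w space_energy w = (V * s2)%:E.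
Proof.
have := @tonelli_in R _ _ _ _ P (leb R d) setT D (fun w x => (H x w ^+ 2)%:E) measurableT mD msq.
move=> ->; last by move=> w x; rewrite lee_fin sqr_ge0.
under eq_integral do rewrite Hs2.
by rewrite integral_cst// mulrC EFinM; congr (_ * _); exact: DV.
Qed.

Lemma space_integrable1 : (leb R d).-integrable D (EFin \o (fun=> 1%R : R)).
Proof.
apply/integrableP; split; first exact: measurable_cst.
rewrite (eq_integral (cst 1%:E)); last by move=> x _ /=; rewrite normr1.
by rewrite integral_cst// mul1e [X in X < _]DV ltry.
Qed.

Lemma space_integrable w : space_energy w < +oo ->
  (leb R d).-integrable D (EFin \o H^~ w) /\ (leb R d).-integrable D (fun x => (H x w ^+ 2)%:E).
Proof.
move=> qw.
have I1 := space_integrable1.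
have I2 : (leb R d).-integrable D (fun x => (H x w ^+ 2)%:E).
  apply/integrableP; split; first by apply: measurable_funTS; apply/measurable_EFinP; exact: measurable_funX.
  by under eq_integral do rewrite abse_EFin ger0_norm ?sqr_ge0//.
split => //; apply: (@le_integrable _ _ _ _ _ mD _ (fun x => (EFin \o (fun=> 1%R : R)) x + (H x w ^+ 2)%:E)).
- by apply: measurable_funTS; apply/measurable_EFinP.
- move=> x _; change (`|(H x w)%:E| <= `|(1 + H x w ^+ 2)%R%:E|); rewrite lee_fin [leRHS]ger0_norm ?addr_ge0 ?sqr_ge0//.
  by have := normr_le_1Dsqr (H x w); rewrite mul1r.
- exact: integrableD.
Qed.

Lemma space_integral_sqr w (q a : R) : space_energy w = q%:E ->
  \int[leb R d]_(x in D) ((a + H x w) ^+ 2)%:E = (V * a ^+ 2 + 2 * a * space_integral w + q)%:E.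
Proof.
move=> qw; have [|IH IH2] := @space_integrable w; first by rewrite qw ltry.
have I1 := space_integrable1.
have EI : \int[leb R d]_(x in D) (H x w)%:E = (space_integral w)%:E.
  by rewrite /space_integral /Rintegral fineK//; exact: integrable_fin_num.
transitivity (\int[leb R d]_(x in D) (a ^+ 2 * 1 + (2 * a) * H x w + 1 * H x w ^+ 2)%:E).
  by apply: eq_integral => x _; congr EFin; ring.
rewrite (integral_lin3 (a ^+ 2)%R (2 * a)%R 1%R mD I1 IH IH2) EI.
rewrite -[X in _ + 1%:E * X]/(space_energy w) qw integral_cst// [X in _ * X + _ + _](_ : _ = V%:E); last by rewrite mul1e; exact: DV.
by rewrite -!EFinM -!EFinD; congr EFin; ring.
Qed.

Lemma space_integral_polar w (q : R) : space_energy w = q%:E ->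
  \int[leb R d]_(x in D) \int[leb R d]_(y in D) ((H x w + H y w) ^+ 2)%:E =
  (2 * V * q + 2 * space_integral w ^+ 2)%:E.
Proof.
move=> qw; have [|IH IH2] := @space_integrable w; first by rewrite qw ltry.
under eq_integral => x _ do rewrite (space_integral_sqr (H x w) qw).
have I1 := space_integrable1.
have EI : \int[leb R d]_(x in D) (H x w)%:E = (space_integral w)%:E.
  by rewrite /space_integral /Rintegral fineK//; exact: integrable_fin_num.
transitivity (\int[leb R d]_(x in D) (q * 1 + (2 * space_integral w) * H x w + V * H x w ^+ 2)%:E).
  by apply: eq_integral => x _; congr EFin; ring.
rewrite (integral_lin3 q (2 * space_integral w)%R V mD I1 IH IH2) EI.
rewrite -[X in _ + V%:E * X]/(space_energy w) qw integral_cst// mul1e [X in _ * X + _ + _](_ : _ = V%:E)//.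
by rewrite -!EFinM -!EFinD; congr EFin; ring.
Qed.

Lemma space_energy_ae : {ae P, forall w, exists q : R, space_energy w = q%:E}.
Proof.
have Iq : P.-integrable setT space_energy.
  apply/integrableP; split; first exact: measurable_space_energy.
  under eq_integral do rewrite gee0_abs ?space_energy_ge0//.
  by rewrite space_energy_mean ltry.
have := integrable_ae measurableT Iq; apply: filterS => w /(_ I) h.
by exists (fine (space_energy w)); rewrite fineK.
Qed.

(** A covariance may be negative, so Tonelli is applied to [(H x + H y) ^ 2], at the price of the
    diagonal terms in [s2]. Expanding the square along a path requires finite energy, which holds
    almost surely; on the exceptional paths [space_integral] may be a mere default value. *)
Lemma second_moment :
  \int[leb R d]_(x in D) \int[leb R d]_(y in D) (2 * s2 + 2 * g x y)%:E =
  (2 * V ^+ 2 * s2)%:E + 2%:E * \int[P]_w (space_integral w ^+ 2)%:E.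
Proof.
pose f (w : Omega) (x y : 'rV[R]_d) : \bar R := ((H x w + H y w) ^+ 2)%:E.
have f0 w x y : 0 <= f w x y by rewrite lee_fin sqr_ge0.
have mf : measurable_fun [set: Omega * 'rV[R]_d * 'rV[R]_d] (fun p => f p.1.1 p.1.2 p.2).
  apply/measurable_EFinP; apply: measurable_funX; apply: measurable_funD.
    exact: (measurableT_comp mswap measurable_fst).
  have h : measurable_fun [set: Omega * 'rV[R]_d * 'rV[R]_d] (fun x => (x.1.1, x.2)).
    by apply/measurable_fun_pairP; split; [exact: (measurableT_comp measurable_fst measurable_fst)|exact: measurable_snd].
  exact: (measurableT_comp mswap h).
have mf1 := @measurable_integral_in R _ _ _ _ (leb R d) D (fun (p : Omega * 'rV[R]_d) y => f p.1 p.2 y) mD mf (fun p y => f0 _ _ _).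
have f10 w x : 0 <= \int[leb R d]_(y in D) f w x y by apply: integral_ge0.
have mf2 := @measurable_integral_in R _ _ _ _ (leb R d) D (fun w x => \int[leb R d]_(y in D) f w x y) mD mf1 f10.
have T : \int[P]_w \int[leb R d]_(x in D) \int[leb R d]_(y in D) f w x y =
   \int[leb R d]_(x in D) \int[leb R d]_(y in D) (2 * s2 + 2 * g x y)%:E.
  rewrite (@tonelli_in R _ _ _ _ P (leb R d) setT D (fun w x => \int[leb R d]_(y in D) f w x y))//.
  apply: eq_integral => x _.
  rewrite (@tonelli_in R _ _ _ _ P (leb R d) setT D (fun w y => f w x y))//.
    by apply: eq_integral => y _; rewrite /f Hg.
  apply/measurable_EFinP; apply: measurable_funX; apply: measurable_funD => //.
  exact: (measurableT_comp (mHx x) measurable_fst).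
rewrite -T.
have mI2 : measurable_fun [set: Omega] (fun w => (space_integral w ^+ 2)%:E).
  by apply/measurable_EFinP; apply: measurable_funX; exact: measurable_space_integral.
transitivity (\int[P]_w ((2 * V)%:E * space_energy w + 2%:E * (space_integral w ^+ 2)%:E)).
  apply: ge0_ae_eq_integral => //.
  - by apply: emeasurable_funD; apply: emeasurable_funM => //; exact: measurable_space_energy.
  - by move=> w _; apply: integral_ge0.
  - move=> w _; apply: adde_ge0; apply: mule_ge0; rewrite ?lee_fin ?sqr_ge0 ?space_energy_ge0//.
    by rewrite mulr_ge0// ltW.
  - have := space_energy_ae; apply: filterS => w [q qw] _.
    by rewrite /f (space_integral_polar qw) qw -!EFinM -EFinD.
have V2 : (0 <= 2 * V)%R by rewrite mulr_ge0// ltW.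
rewrite ge0_integralD//; last 4 first.
- by move=> w _; apply: mule_ge0; rewrite ?lee_fin ?space_energy_ge0.
- by apply: emeasurable_funM => //; exact: measurable_space_energy.
- by move=> w _; rewrite mule_ge0 ?lee_fin ?sqr_ge0.
- exact: emeasurable_funM.
rewrite (ge0_integralZT P V2 measurable_space_energy space_energy_ge0) space_energy_mean.
rewrite (ge0_integralZT P _ mI2)//; last by move=> w; rewrite lee_fin sqr_ge0.
by rewrite -EFinM; congr (_%:E + _); ring.
Qed.

(* The points are chosen one by one: averaging the new error over [D] shows that some point increases
   the accumulated squared error by at most [s2 + 1]. *)
Lemma greedy_points (k : nat) : exists x : 'I_k -> 'rV[R]_d,
  \int[P]_w ((\sum_(i < k) (H (x i) w - space_integral w / V)) ^+ 2)%:E <= (k%:R * (s2 + 1))%:E.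
Proof.
have s20 : (0 <= s2)%R.
  by rewrite -lee_fin -(Hs2 0%R); apply: integral_ge0 => w _; rewrite lee_fin sqr_ge0.
have mI := measurable_space_integral.
have mm : measurable_fun [set: Omega] (fun w => space_integral w / V)%R by exact: measurable_funM.
elim: k => [|k [x IH]].
  exists (fun=> 0%R); under eq_integral do rewrite big_ord0 expr0n.
  by rewrite integral0 mul0r.
pose S w := (\sum_(i < k) (H (x i) w - space_integral w / V))%R.
have mS : measurable_fun [set: Omega] S.
  by apply: measurable_sum => i; apply: measurable_funB.
pose m w := (space_integral w / V)%R.
pose psi y : \bar R := \int[P]_w ((S w - m w + H y w) ^+ 2)%:E.
have [y [Dy hy]] : exists y, D y /\ psi y <= ((k.+1)%:R * (s2 + 1))%:E.
  apply: contrapT => /forallNP N.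
  have lt1 y : D y -> ((k.+1)%:R * (s2 + 1))%:E <= psi y.
    by move=> Dy; apply: ltW; rewrite ltNge; apply/negP => h; apply: (N y).
  have : (V * (k.+1%:R * (s2 + 1)))%:E <= \int[leb R d]_(y in D) psi y.
    have -> : (V * (k.+1%:R * (s2 + 1)))%:E = \int[leb R d]_(y in D) (k.+1%:R * (s2 + 1))%:E.
      by rewrite integral_cst// mulrC EFinM; congr (_ * _); apply/esym; exact: DV.
    rewrite integral_indicM [leRHS]integral_indicM; apply: ge0_le_integralT => z.
      by rewrite mule_ge0 ?lee_fin ?indicE// mulr_ge0// addr_ge0.
    rewrite indicE; case: (boolP (z \in D)) => [|_]; last by rewrite !mul0e.
    by rewrite inE => Dz; rewrite !mul1e; exact: lt1.
  have mSq : measurable_fun [set: Omega] (fun w => (S w ^+ 2)%:E).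
    by apply/measurable_EFinP; exact: measurable_funX.
  have mf : measurable_fun [set: Omega * 'rV[R]_d] (fun p => ((S p.1 - m p.1 + H p.2 p.1) ^+ 2)%:E).
    apply/measurable_EFinP; apply: measurable_funX; apply: measurable_funD => //.
    have h : measurable_fun [set: Omega] (fun w => S w - m w)%R by exact: measurable_funB.
    exact: (measurableT_comp h measurable_fst).
  rewrite -(@tonelli_in R _ _ _ _ P (leb R d) setT D (fun w y => ((S w - m w + H y w) ^+ 2)%:E))//; last first.
    by move=> w y; rewrite lee_fin sqr_ge0.
  have B : \int[P]_w \int[leb R d]_(y in D) ((S w - m w + H y w) ^+ 2)%:E <=
     \int[P]_w (V%:E * (S w ^+ 2)%:E + space_energy w).
    apply: ge0_le_integralT => w; first by apply: integral_ge0 => y _; rewrite lee_fin sqr_ge0.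
    have [qy|qy] := eqVneq (space_energy w) +oo; first by rewrite qy addey ?leey// -EFinM.
    have qw : space_energy w = (fine (space_energy w))%:E.
      by rewrite fineK// ge0_fin_numE ?space_energy_ge0// ltey.
    rewrite (space_integral_sqr _ qw) {2}qw -EFinM -EFinD lee_fin lerD2r.
    have -> : (space_integral w = V * m w)%R by rewrite /m mulrCA mulfV ?mulr1// gt_eqF.
    (* With [space_integral w = V m] the cross terms combine to [V (S - m)^2 + 2 V m (S - m) = V
       (S^2 - m^2)], so averaging over the new point removes the correlation with the accumulated
       error. *)
    have := mulr_ge0 (ltW V0) (sqr_ge0 (m w)); nra.
  move/le_trans => /(_ _ B).
  rewrite ge0_integralD//; last 4 first.
  - by move=> w _; rewrite mule_ge0 ?lee_fin ?sqr_ge0// ltW.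
  - exact: emeasurable_funM.
  - by move=> w _; exact: space_energy_ge0.
  - exact: measurable_space_energy.
  rewrite (ge0_integralZT P (ltW V0) mSq); last by move=> w; rewrite lee_fin sqr_ge0.
  rewrite space_energy_mean.
  have := IH; rewrite -/S.
  have : 0 <= \int[P]_w (S w ^+ 2)%:E by apply: integral_ge0 => w _; rewrite lee_fin sqr_ge0.
  case: (\int[P]_w (S w ^+ 2)%:E) => [e| |]// e0; rewrite -EFinM -EFinD !lee_fin => h1 h2.
  have := le_trans h2 (_ : _ <= V * (k%:R * (s2 + 1)) + V * s2)%R.
  rewrite lerD2r ler_pM2l// => /(_ h1).
  rewrite -mulrDr ler_pM2l// -natr1; lra.
exists (fun i => oapp x y (unlift ord_max i)).
apply: le_trans hy; rewrite le_eqVlt; apply/orP; left; apply/eqP.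
apply: eq_integral => w _; congr (_ ^+ 2)%:E; rewrite big_ord_recr/= unlift_none/=.
rewrite (_ : \sum_(i < k) _ = S w)%R; first by rewrite /m; ring.
apply: eq_bigr => i _; congr (H _ w - _)%R.
by rewrite (_ : widen_ord _ i = lift ord_max i) ?liftK//; apply: val_inj; rewrite /= /bump leqNgt ltn_ord.
Qed.

(** A sum of [k] errors has second moment of order [k] only, so their average has second moment of
    order [1 / k]; the choice of [k] makes [V^2 (s2 + 1) / k] at most [e]. *)
Lemma monte_carlo (e : R) : (0 < e)%R -> exists k (x : 'I_k -> 'rV[R]_d),
  \int[P]_w ((space_integral w - V / k%:R * \sum_(i < k) H (x i) w) ^+ 2)%:E <= e%:E.
Proof.
move=> e0; pose k := (Num.truncn (V ^+ 2 * (s2 + 1) / e)).+1.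
have [x hx] := greedy_points k; exists k, x.
have k0 : (0 < k%:R :> R)%R by rewrite ltr0n.
pose S w := (\sum_(i < k) (H (x i) w - space_integral w / V))%R.
have mS : measurable_fun [set: Omega] (fun w => (S w ^+ 2)%:E).
  apply/measurable_EFinP; apply: measurable_funX; apply: measurable_sum => i.
  by apply: measurable_funB => //; apply: measurable_funM => //; exact: measurable_space_integral.
have c0 : (0 <= (V / k%:R) ^+ 2)%R by exact: sqr_ge0.
rewrite (_ : \int[P]_w _ = \int[P]_w (((V / k%:R) ^+ 2)%:E * (S w ^+ 2)%:E)); last first.
  apply: eq_integral => w _; rewrite -EFinM -exprMn -sqrrN; congr (_ ^+ 2)%:E.
  rewrite /S sumrB sumr_const card_ord -[(_ *+ k)%R]mulr_natl; field.
  by rewrite !gt_eqF.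
rewrite (ge0_integralZT P c0 mS); last by move=> w; rewrite lee_fin sqr_ge0.
apply: (@le_trans _ _ (((V / k%:R) ^+ 2)%:E * (k%:R * (s2 + 1))%:E)); first by rewrite lee_wpmul2l.
have : (V ^+ 2 * (s2 + 1) / e < k%:R)%R by rewrite /k truncnS_gt.
rewrite ltr_pdivrMr// => h.
have E : ((V / k%:R) ^+ 2 * (k%:R * (s2 + 1)) = V ^+ 2 * (s2 + 1) / k%:R)%R by field; rewrite gt_eqF.
rewrite -EFinM lee_fin E.
by rewrite ler_pdivrMr// [(e * _)%R]mulrC ltW.
Qed.
End second_moment.

Lemma ge0_le_integral_in (dT : measure_display) (T : measurableType dT) (R : realType)
    (m : {measure set T -> \bar R}) (D : set T) (f g : T -> \bar R) :
  (forall x, 0 <= f x)%E -> (forall x, f x <= g x)%E ->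
  (\int[m]_(x in D) f x <= \int[m]_(x in D) g x)%E.
Proof.
move=> f0 fg; rewrite integral_mkcond [leRHS]integral_mkcond.
apply: ge0_le_integralT => x; rewrite /patch; case: ifP => // _.
Qed.

Section student_field_moments.
Context (dO : measure_display) (Omega : measurableType dO) (R : realType)
  (P : probability Omega R) (d n : nat) (eta : 'rV[R]_d -> 'I_n.+1 -> {RV P >-> R})
  (K : 'rV[R]_d -> 'rV[R]_d -> R).
Hypothesis n0 : (0 < n)%N.
Hypothesis eta_meas : measurable_field eta.
Hypothesis eta_gauss : gaussian_field eta.
Hypothesis eta_centered : centered_field eta.
Hypothesis eta_cov : forall x y, cross_moment eta x y = (K x y)%:M.
Hypothesis K1 : forall x, K x x = 1.
Hypothesis Ksym : forall x y, K x y = K y x.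
Hypothesis mK : measurable_fun [set: 'rV[R]_d * 'rV[R]_d] (fun p => K p.1 p.2).
Context (D : set 'rV[R]_d) (V : R).
Hypothesis mD : measurable D.
Hypothesis DV : leb R d D = V%:E.
Hypothesis V0 : (0 < V)%R.
Context (r b : R).
Hypothesis b0 : (0 <= b)%R.
Local Open Scope ereal_scope.

Lemma integral_sqrD (X Y : Omega -> R) (s g : R) :
  P.-integrable setT (fun w => (X w ^+ 2)%:E) -> P.-integrable setT (fun w => (Y w ^+ 2)%:E) ->
  P.-integrable setT (fun w => (X w * Y w)%:E) ->
  \int[P]_w (X w ^+ 2)%:E = s%:E -> \int[P]_w (Y w ^+ 2)%:E = s%:E -> \int[P]_w (X w * Y w)%:E = g%:E ->
  \int[P]_w ((X w + Y w) ^+ 2)%:E = (2 * s + 2 * g)%:E.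
Proof.
move=> IX IY IXY EX EY EXY.
transitivity (\int[P]_w (1 * (X w ^+ 2) + 1 * (Y w ^+ 2) + 2 * (X w * Y w))%:E).
  by apply: eq_integral => w _; congr EFin; ring.
rewrite (integral_lin3 1%R 1%R 2%R measurableT IX IY IXY) EX EY EXY -!EFinM -!EFinD; congr EFin; ring.
Qed.

(** Space integrals are taken over the fixed set [D]; the dilation is carried by the argument
    [r *: x] of the field. *)
Definition field_coord (x : 'rV[R]_d) (w : Omega) : R := eta (r *: x)%R ord0 w.

Definition field_residual (x : 'rV[R]_d) (w : Omega) : R := student_residual b (field_row eta (r *: x)%R w).

Definition field_exceed (x : 'rV[R]_d) (w : Omega) : R := \1_(student_event b) (field_row eta (r *: x)%R w).

Let mscale : measurable_fun [set: 'rV[R]_d * Omega] (fun p => (r *: p.1, p.2)%R).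
Proof.
apply/measurable_fun_pairP; split; last exact: measurable_snd.
apply: measurable_fun_rVP => i; rewrite /comp/=; under eq_fun do rewrite mxE.
by apply: measurable_funM => //; apply: (measurableT_comp (measurable_coord i)); exact: measurable_fst.
Qed.

Let mrow : measurable_fun [set: 'rV[R]_d * Omega] (fun p => field_row eta (r *: p.1)%R p.2).
Proof.
apply: measurable_fun_rVP => j; under eq_fun do rewrite mxE.
exact: (measurableT_comp (eta_meas j) mscale).
Qed.

Lemma measurable_field_coord : measurable_fun [set: 'rV[R]_d * Omega] (fun p => field_coord p.1 p.2).
Proof. exact: (measurableT_comp (eta_meas ord0) mscale). Qed.

Lemma measurable_field_residual : measurable_fun [set: 'rV[R]_d * Omega] (fun p => field_residual p.1 p.2).
Proof. exact: (measurableT_comp (@measurable_student_residual R n b) mrow). Qed.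

Lemma measurable_field_exceed : measurable_fun [set: 'rV[R]_d * Omega] (fun p => field_exceed p.1 p.2).
Proof.
apply: (measurableT_comp (f := \1_(student_event b) : 'rV[R]_n.+1 -> R)) mrow.
by apply: measurable_indic; exact: measurable_student_event.
Qed.

Lemma field_coord_sqr x : \int[P]_w (field_coord x w ^+ 2)%:E = 1%:E.
Proof.
under eq_integral do rewrite expr2.
by rewrite (eta_prod_mean eta_gauss eta_cov) K1 eqxx mulr1n.
Qed.

Lemma field_coord_polar x y :
  \int[P]_w ((field_coord x w + field_coord y w) ^+ 2)%:E = (2 * 1 + 2 * K (r *: x) (r *: y))%R%:E.
Proof.
apply: integral_sqrD; rewrite ?field_coord_sqr//.
- exact: eta_sqr_integrable.
- exact: eta_sqr_integrable.
- exact: eta_prod_integrable.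
- by rewrite (eta_prod_mean eta_gauss eta_cov) eqxx mulr1n.
Qed.

Definition residual_var : R := fine (\int[gauss R n.+1]_u (student_residual b u ^+ 2)%:E).

Let mres2 : measurable_fun [set: 'rV[R]_n.+1] (fun u => (student_residual b u ^+ 2)%:E).
Proof. by apply/measurable_EFinP; apply: measurable_funX; exact: measurable_student_residual. Qed.

Let gauss_res2 : \int[gauss R n.+1]_u (student_residual b u ^+ 2)%:E = residual_var%:E.
Proof.
rewrite /residual_var fineK//; apply: integrable_fin_num => //.
apply: (@gauss_integrable R n.+1 (fun u => student_residual b u ^+ 2)%R (4 * 4)).
  by apply: measurable_funX; exact: measurable_student_residual.
move=> u; rewrite normrX; have h := student_residual_bound b u.
apply: (@le_trans _ _ ((4 * expR (dot u u / 8)) ^+ 2)%R).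
  by rewrite ler_pXn2r// nnegrE// mulr_ge0// expR_ge0.
rewrite exprMn [(expR _ ^+ 2)%R]expr2 -expRD -expr2 (_ : dot u u / 8 + dot u u / 8 = dot u u / 4)%R//; by field.
Qed.

Lemma field_residual_sqr x : \int[P]_w (field_residual x w ^+ 2)%:E = residual_var%:E.
Proof.
rewrite -gauss_res2 /field_residual.
apply: (@one_point_law _ _ _ _ _ _ _ _ eta_gauss eta_centered eta_cov (r *: x)%R
  (fun u => (student_residual b u ^+ 2)%:E)) => //.
by move=> u; rewrite lee_fin sqr_ge0.
Qed.

Let mresx x : measurable_fun [set: Omega] (field_residual x).
Proof. exact: (measurableT_comp measurable_field_residual (measurable_pair1 x)). Qed.

Let res2_int x : P.-integrable setT (fun w => (field_residual x w ^+ 2)%:E).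
Proof.
apply/integrableP; split; first by apply/measurable_EFinP; exact: measurable_funX.
under eq_integral do rewrite abse_EFin ger0_norm ?sqr_ge0//.
by rewrite field_residual_sqr ltry.
Qed.

Let res_prod_int x y : P.-integrable setT (fun w => (field_residual x w * field_residual y w)%:E).
Proof.
have i2 := integrableD measurableT (res2_int x) (res2_int y).
apply: le_integrable i2 => //; first by apply/measurable_EFinP; exact: measurable_funM.
move=> w _; change (is_true (`|field_residual x w * field_residual y w|%R%:E <= `|field_residual x w ^+ 2 + field_residual y w ^+ 2|%R%:E)); rewrite lee_fin normrM [leRHS]ger0_norm; last by apply: addr_ge0; exact: sqr_ge0.
set u := field_residual x w; set v := field_residual y w.
rewrite -(real_normK (num_real u)) -(real_normK (num_real v)).
have := sqr_ge0 (`|u| - `|v|)%R; have := sqr_ge0 (`|u| + `|v|)%R; nra.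
Qed.

Definition residual_cov x y : R := fine (\int[P]_w (field_residual x w * field_residual y w)%:E).

(** The constant of [mehler_bound] for [n.+1] components and for the growth constant 4 of
    [student_residual_bound]. *)
Definition residual_const : R := ((n.+1%:R * 2 ^+ n.+1 + 1040) * 2 ^+ n.+1 * 4 ^+ 2)%R.

Lemma residual_const_ge0 : (0 <= residual_const)%R.
Proof.
apply: mulr_ge0; last by rewrite exprn_ge0.
apply: mulr_ge0; last by rewrite exprn_ge0.
by apply: addr_ge0; [apply: mulr_ge0; rewrite ?exprn_ge0|exact: ler0n].
Qed.

Lemma residual_covE x y : \int[P]_w (field_residual x w * field_residual y w)%:E = (residual_cov x y)%:E.
Proof. by rewrite /residual_cov fineK//; apply: integrable_fin_num => //; exact: res_prod_int. Qed.

Lemma residual_cov_le x y : (residual_cov x y <= residual_const * K (r *: x) (r *: y) ^+ 2)%R.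
Proof.
apply: (le_trans (ler_norm _)); rewrite -lee_fin -abse_EFin -residual_covE.
exact: (mehler_bound eta_gauss eta_centered eta_cov (K1 _) (K1 _) erefl (Ksym _ _)
  (@measurable_student_residual R n b) (@student_residual_bound R n b) (student_residual_mean n b)
  (fun j => student_residual_orth n0 j b0)).
Qed.

Lemma field_residual_polar x y :
  \int[P]_w ((field_residual x w + field_residual y w) ^+ 2)%:E = (2 * residual_var + 2 * residual_cov x y)%:E.
Proof. by apply: integral_sqrD; rewrite ?field_residual_sqr ?residual_covE//; exact: res_prod_int. Qed.

Definition coord_integral := space_integral D field_coord.
Definition residual_integral := space_integral D field_residual.

Lemma residual_var_ge0 : (0 <= residual_var)%R.
Proof. by apply: fine_ge0; apply: integral_ge0 => u _; rewrite lee_fin sqr_ge0. Qed.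

Lemma residual_second_moment :
  \int[P]_w (residual_integral w ^+ 2)%:E <=
  residual_const%:E * \int[leb R d]_(x in D) \int[leb R d]_(y in D) (K (r *: x) (r *: y) ^+ 2)%R%:E.
Proof.
have C0 := residual_const_ge0.
have := second_moment mD DV V0 measurable_field_residual field_residual_sqr field_residual_polar.
rewrite -/residual_integral.
have mk : measurable_fun [set: 'rV[R]_d * 'rV[R]_d] (fun p => (K (r *: p.1) (r *: p.2) ^+ 2)%R%:E).
  apply/measurable_EFinP; apply: measurable_funX.
  have h : measurable_fun [set: 'rV[R]_d * 'rV[R]_d] (fun p => (r *: p.1, r *: p.2)%R).
    apply/measurable_fun_pairP; split; apply: measurable_fun_rVP => i; rewrite /comp/=; under eq_fun do rewrite mxE;
    apply: measurable_funM => //; apply: (measurableT_comp (measurable_coord i)); [exact: measurable_fst|exact: measurable_snd].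
  exact: (measurableT_comp mK h).
have k0 x y : 0 <= (K (r *: x) (r *: y) ^+ 2)%R%:E by rewrite lee_fin sqr_ge0.
have mk1 (x : 'rV[R]_d) : measurable_fun [set: 'rV[R]_d] (fun y => (K (r *: x) (r *: y) ^+ 2)%R%:E).
  exact: (measurableT_comp mk (measurable_pair1 x)).
pose J x : \bar R := \int[leb R d]_(y in D) (K (r *: x) (r *: y) ^+ 2)%R%:E.
have mJ : measurable_fun [set: 'rV[R]_d] J.
  exact: (@measurable_integral_in R _ _ _ _ (leb R d) D (fun x y : 'rV[R]_d => (K (r *: x) (r *: y) ^+ 2)%R%:E) mD mk k0).
have J0 x : 0 <= J x by exact: integral_ge0.
have s0 : (0 <= 2 * residual_var)%R by rewrite mulr_ge0// residual_var_ge0.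
have c0 : (0 <= 2 * residual_const)%R by rewrite mulr_ge0.
have U : \int[leb R d]_(x in D) \int[leb R d]_(y in D) (2 * residual_var + 2 * residual_cov x y)%:E <=
    (2 * V ^+ 2 * residual_var)%:E + (2 * residual_const)%:E * \int[leb R d]_(x in D) J x.
  have E1 x : \int[leb R d]_(y in D) ((2 * residual_var)%:E + (2 * residual_const)%:E * (K (r *: x) (r *: y) ^+ 2)%R%:E) =
      (2 * residual_var * V)%:E + (2 * residual_const)%:E * J x.
    rewrite ge0_integralD//; last 2 first.
    - by move=> y _; rewrite mule_ge0.
    - by apply: measurable_funTS; apply: emeasurable_funM => //; exact: measurable_cst.
    by rewrite integral_cst// (ge0_integralZ_in (leb R d) mD c0 (mk1 x) (k0 x)) [in RHS]EFinM; congr (_ * _ + _); exact: DV.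
  have E2 : \int[leb R d]_(x in D) ((2 * residual_var * V)%:E + (2 * residual_const)%:E * J x) =
      (2 * V ^+ 2 * residual_var)%:E + (2 * residual_const)%:E * \int[leb R d]_(x in D) J x.
    rewrite ge0_integralD//; last 3 first.
    - by move=> x _; rewrite lee_fin mulr_ge0// ltW.
    - by move=> x _; rewrite mule_ge0.
    - by apply: measurable_funTS; apply: emeasurable_funM => //; exact: measurable_cst.
    rewrite integral_cst// (ge0_integralZ_in (leb R d) mD c0 mJ J0); congr (_ + _).
    rewrite (_ : 2 * V ^+ 2 * residual_var = (2 * residual_var * V) * V)%R; last by ring.
    by rewrite [in RHS]EFinM; congr (_ * _); exact: DV.
  rewrite -E2; under [leRHS]eq_integral do rewrite -E1.
  apply: ge0_le_integral_in => x.
    apply: integral_ge0 => y _.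
    by rewrite -field_residual_polar; apply: integral_ge0 => w _; rewrite lee_fin sqr_ge0.
  apply: ge0_le_integral_in => y.
    by rewrite -field_residual_polar; apply: integral_ge0 => w _; rewrite lee_fin sqr_ge0.
  rewrite -EFinM -EFinD lee_fin lerD2l -mulrA ler_pM2l//.
  exact: residual_cov_le.
move=> E; move: U; rewrite E.
(* The diagonal terms in [residual_var] are the same in the exact formula and in the upper bound,
   and cancel. *)
rewrite leeD2lE// -[X in X * _ <= _]/(2%:E) EFinM -muleA.
by rewrite lee_pmul2l.
Qed.

Lemma coord_second_moment :
  \int[leb R d]_(x in D) \int[leb R d]_(y in D) (2 * 1 + 2 * K (r *: x) (r *: y))%R%:E =
  (2 * V ^+ 2 * 1)%:E + 2%:E * \int[P]_w (coord_integral w ^+ 2)%:E.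
Proof. exact: (second_moment mD DV V0 measurable_field_coord field_coord_sqr field_coord_polar). Qed.

(* Only finite linear combinations of the field are known to be Gaussian, hence the approximation of
   the space integral by averages over finitely many points. *)
Lemma coord_monte_carlo (e : R) : (0 < e)%R -> exists Y : Omega -> R, exists v : R,
  [/\ measurable_fun [set: Omega] Y, gaussian_law (pushforward P Y),
      \int[P]_w (Y w)%:E = 0, \int[P]_w (Y w ^+ 2)%:E = v%:E
    & \int[P]_w ((coord_integral w - Y w) ^+ 2)%:E <= e%:E].
Proof.
move=> e0.
have [k [x hx]] := monte_carlo mD DV V0 measurable_field_coord field_coord_sqr e0.
pose c (i : 'I_k) (j : 'I_n.+1) : R := (V / k%:R * (j == ord0)%:R)%R.
have YE w : (V / k%:R * \sum_(i < k) field_coord (x i) w =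
   \sum_(i < k) \sum_(j < n.+1) c i j * eta (r *: x i) j w)%R.
  rewrite mulr_sumr; apply: eq_bigr => i _; rewrite (bigD1 ord0)//= /c eqxx mulr1 big1 ?addr0// => j j0.
  by rewrite (negbTE j0) mulr0 mul0r.
exists (fun w => \sum_(i < k) \sum_(j < n.+1) c i j * eta (r *: x i) j w)%R.
eexists; split.
- by apply: measurable_sum => i; apply: measurable_sum => j; exact: measurable_funM.
- exact: (eta_gauss (fun i => r *: x i)%R c).
- exact: (@comb_mean _ _ _ _ _ _ _ eta_gauss eta_centered k (fun i => r *: x i)%R c).
- exact: (@comb_sqr_mean _ _ _ _ _ _ _ _ eta_gauss eta_cov k (fun i => r *: x i)%R c).
- by under eq_integral do rewrite -YE.
Qed.

Definition exceed_integral w : R := (\int[leb R d]_(x in D) field_exceed x w)%R.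

Lemma measurable_exceed_integral : measurable_fun [set: Omega] exceed_integral.
Proof.
exact: (measurable_space_integral mD measurable_field_exceed).
Qed.

(** The integral splits linearly only along paths whose first coordinate is integrable over [D];
    finite energy ensures this almost surely. *)
Lemma exceed_decomposition : {ae P, forall w, exceed_integral w =
  fine (gauss R n.+1 (student_event b)) * V + student_slope n b * coord_integral w + residual_integral w}%R.
Proof.
have := space_energy_ae mD DV measurable_field_coord field_coord_sqr.
apply: filterS => w [q qw].
have [|IH _] := space_integrable mD DV measurable_field_coord (w := w); first by rewrite qw ltry.
have I1 := space_integrable1 mD DV.
have Ie : (leb R d).-integrable D (EFin \o field_exceed^~ w).
  apply: measurable_bounded_integrable => //.
  - by rewrite [X in X < _](_ : _ = V%:E) ?ltry//; exact: DV.
  - by apply: measurable_funTS; exact: (measurableT_comp measurable_field_exceed (measurable_pair2 w)).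
  - exists 1%R; split; first exact: num_real.
    move=> y y1 x _ /=; rewrite /field_exceed indicE; apply: (le_trans _ (ltW y1)).
    by case: (_ \in _); rewrite ?normr1 ?normr0.
have EFE (f : 'rV[R]_d -> R) : (leb R d).-integrable D (EFin \o f) ->
    \int[leb R d]_(x in D) (f x)%:E = (\int[leb R d]_(x in D) f x)%R%:E.
  by move=> If; rewrite /Rintegral fineK//; exact: integrable_fin_num.
set p := fine _.
apply: EFin_inj; rewrite [RHS]EFinD /residual_integral /space_integral.
have -> : (\int[leb R d]_(x in D) field_residual x w)%R%:E =
    1%:E * (exceed_integral w)%:E + (- p)%:E * V%:E + (- student_slope n b)%:E * (coord_integral w)%:E.
  rewrite /exceed_integral /coord_integral /space_integral -!EFE//; last first.
    rewrite (_ : EFin \o _ = fun x => ((EFin \o field_exceed^~ w) x - p%:E * (EFin \o (fun=> 1%R)) x) - (student_slope n b)%:E * (EFin \o field_coord^~ w) x).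
      by apply: integrableB => //; [apply: integrableB => //|]; exact: integrableZl.
    apply/funext => x /=; by rewrite /field_residual /student_residual mulr1 /field_coord mxE.
  transitivity (\int[leb R d]_(x in D) (1 * field_exceed x w + (- p) * 1 + (- student_slope n b) * field_coord x w)%:E).
    apply: eq_integral => x _; congr EFin; rewrite /field_residual /student_residual /field_coord mxE -/p -/(field_exceed _ _).
    by rewrite /field_exceed; ring.
  rewrite (integral_lin3 1%R (- p)%R (- student_slope n b)%R mD Ie I1 IH) integral_cst// !mul1e.
  by congr (_ + _ * _ + _); exact: DV.
by rewrite -!EFinM -!EFinD; congr EFin; ring.
Qed.
End student_field_moments.

(** * Convergence in law *)

Section gaussian_cdf.
Context (R : realType).
Local Open Scope ereal_scope.

Definition normal_cdf (t : R) : R := fine (normal_prob 0 1 `]-oo, t]%classic).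

Lemma normal_cdfE (t : R) : normal_prob 0 1 `]-oo, t]%classic = (normal_cdf t)%:E.
Proof. by rewrite /normal_cdf fineK// fin_num_measure. Qed.

Lemma normal_cdf_lip (s t : R) : (normal_cdf t <= normal_cdf s + `|t - s|)%R.
Proof.
rewrite -lee_fin EFinD -!normal_cdfE; case: (leP t s) => ts.
  apply: (@le_trans _ _ (normal_prob 0 1 `]-oo, s]%classic)); last by rewrite leeDl// lee_fin.
  apply: le_measure; rewrite ?inE//; apply/subsetP => x; rewrite !inE/= !in_itv/= => h; exact: le_trans ts.
have -> : `]-oo, t]%classic = `]-oo, s]%classic `|` `]s, t]%classic :> set R.
  apply/seteqP; split=> x /=; rewrite !in_itv/=.
    by move=> xt; case: (leP x s) => xs; [left|right].
  by case=> [xs|/andP[]//]; exact: (le_trans xs (ltW ts)).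
apply: (le_trans (measureU2 _ _ _)) => //; rewrite leeD2l// gtr0_norm ?subr_gt0//.
rewrite /normal_prob.
apply: (@le_trans _ _ (\int[lebesgue_measure]_(x in `]s, t]) (cst 1 x))); last first.
  rewrite integral_cst//= mul1e; have := @lebesgue_measure_itv R `]s, t]%R; rewrite /= lte_fin ts => ->.
  by [].
apply: ge0_le_integral => //.
- by move=> x _; rewrite lee_fin normal_pdf_ge0.
- by apply/measurable_EFinP; apply: measurable_funTS; exact: measurable_normal_pdf.
- move=> x _; rewrite lee_fin; apply: (le_trans (normal_pdf_ub _ _ _)); first exact: oner_neq0.
  rewrite /normal_peak invf_le1 ?sqrtr_gt0 ?pmulrn_lgt0 ?mulr_gt0 ?pi_gt0// expr1n mul1r.
  rewrite -[leLHS]sqrtr1 ler_sqrt ?pmulrn_lgt0 ?pi_gt0//; have := @pi_ge2 R; rewrite -mulr_natr; nra.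
Qed.
End gaussian_cdf.

Section gaussian_approximation.
Context (dO : measure_display) (Omega : measurableType dO) (R : realType) (P : probability Omega R).
Local Open Scope ereal_scope.

Lemma sqr_markov (Z : Omega -> R) (h e : R) : measurable_fun [set: Omega] Z -> (0 < h)%R ->
  \int[P]_w (Z w ^+ 2)%:E <= e%:E -> P [set w | (h <= `|Z w|)%R] <= (e / h ^+ 2)%:E.
Proof.
move=> mZ h0 Ze.
have mA : measurable [set w | (h <= `|Z w|)%R].
  rewrite -[X in measurable X]setTI; apply: measurable_fun_le => //; exact: measurableT_comp.
rewrite mulrC EFinM -[leLHS]mul1e -(@mulVf _ (h ^+ 2)%R) ?gt_eqF ?exprn_gt0// EFinM -muleA.
rewrite lee_pmul2l ?lte_fin ?invr_gt0 ?exprn_gt0//; apply: le_trans Ze.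
rewrite -[X in P X]setIT -integral_indic// -ge0_integralZT//; last 2 first.
- by rewrite sqr_ge0.
- by apply/measurable_EFinP; exact: measurable_indic.
apply: ge0_le_integralT => w; first by rewrite mule_ge0 ?lee_fin ?sqr_ge0 ?indicE.
rewrite indicE; case: (boolP (w \in _)) => /=; last by rewrite mule0 lee_fin sqr_ge0.
by rewrite inE/= mule1 lee_fin -(real_normK (num_real (Z w))) => hw; rewrite lerXn2r// nnegrE ltW.
Qed.

(** By Markov's inequality an L^2 error [h ^ 3] means a deviation of at least [h] with probability
    at most [h]; otherwise a shift of the threshold by [h] compares [X] with [Y]. Dividing by the
    standard deviation [s], which is within [h] of 1, moves the threshold by at most [2 (|t| + 1) h]
    in all, and the normal distribution function is 1-Lipschitz. *)
Lemma gaussian_approx_cdf (X Y : Omega -> R) (v h t : R) :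
  measurable_fun [set: Omega] X -> measurable_fun [set: Omega] Y ->
  gaussian_law (pushforward P Y) -> \int[P]_w (Y w)%:E = 0 -> \int[P]_w (Y w ^+ 2)%:E = v%:E ->
  (0 < h <= 2^-1)%R -> (`|v - 1| <= h)%R -> \int[P]_w ((X w - Y w) ^+ 2)%:E <= (h ^+ 3)%:E ->
  (`|normal_cdf t - fine (P [set w | (X w <= t)%R])| <= (2 * `|t| + 3) * h)%R.
Proof.
move=> mX mY gY Y0 Yv /andP[h0 h1] vh XY.
have [v0 YP] := centered_gaussian_law mY gY Y0 Yv.
have [v1 v2] : (1 - h <= v)%R /\ (v <= 1 + h)%R by move: vh; rewrite ler_norml => /andP[]; split; lra.
set s := Num.sqrt v.
have s0 : (0 <= s)%R by exact: sqrtr_ge0.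
have sv : (s ^+ 2 = v)%R by exact: sqr_sqrtr.
have [s1 s2] : (1 - h <= s)%R /\ (s <= 1 + h)%R by split; nra.
have sp : (0 < s)%R by lra.
have YE u : P [set w | (Y w <= u)%R] = (normal_cdf (u / s))%:E.
  have := YP [set` `]-oo, u]%R] (measurable_itv _).
  rewrite (_ : Y @^-1` _ = [set w | (Y w <= u)%R]); last by apply/seteqP; split=> w /=; rewrite in_itv.
  move=> ->; rewrite -normal_cdfE; congr (normal_prob 0 1 _).
  by apply/seteqP; split=> z /=; rewrite !in_itv/= addr0 (ler_pdivlMr _ _ sp) mulrC.
have mYu u : measurable [set w | (Y w <= u)%R] by rewrite -[X in measurable X]setTI; exact: measurable_fun_le.
have mXu u : measurable [set w | (X w <= u)%R] by rewrite -[X in measurable X]setTI; exact: measurable_fun_le.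
have mXY : measurable_fun [set: Omega] (fun w => X w - Y w)%R by exact: measurable_funB.
have mA : measurable [set w | (h <= `|X w - Y w|)%R].
  by rewrite -[X in measurable X]setTI; apply: measurable_fun_le => //; exact: measurableT_comp.
have PA : (fine (P [set w | (h <= `|X w - Y w|)%R]) <= h)%R.
  rewrite -lee_fin fineK ?fin_num_measure//; apply: (le_trans (sqr_markov mXY h0 XY)).
  by rewrite lee_fin exprSr mulrC mulrA mulVf ?mul1r// gt_eqF// exprn_gt0.
have sub3 (A B C : set Omega) : measurable A -> measurable B -> measurable C -> A `<=` B `|` C ->
    (fine (P A) <= fine (P B) + fine (P C))%R.
  move=> a b c abc; rewrite -lee_fin EFinD !fineK ?fin_num_measure//.
  apply: (le_trans _ (measureU2 _ _ _)) => //; apply: le_measure; rewrite ?inE//; exact: measurableU.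
have close u : (`|u - t| <= h)%R -> (`|u / s - t| <= 2 * (`|t| + 1) * h)%R.
  move=> uh; have -> : (u / s - t = ((u - t) + t * (1 - s)) / s)%R by field; rewrite gt_eqF.
  rewrite normrM normfV (gtr0_norm sp) ler_pdivrMr//.
  apply: (le_trans (ler_normD _ _)); rewrite normrM.
  have : (`|1 - s| <= h)%R by rewrite ler_norml; apply/andP; split; lra.
  move=> sh; have t0 := normr_ge0 t.
  have k1 : (`|t| * `|1 - s| <= `|t| * h)%R by rewrite ler_wpM2l.
  have k2 : (0 <= (`|t| + 1) * h * (2 * s - 1))%R by rewrite !mulr_ge0//; lra.
  lra.
have up := sub3 _ _ _ (mXu t) (mYu (t + h)%R) mA.
have lo := sub3 _ _ _ (mYu (t - h)%R) (mXu t) mA.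
have {up} up : (fine (P [set w | (X w <= t)%R]) <= normal_cdf ((t + h) / s) + h)%R.
  apply: le_trans (up _) _; last by rewrite YE lerD2l.
  move=> w /= Xt; case: (leP (Y w) (t + h)%R) => Yt; [by left|right].
  by rewrite distrC; apply: le_trans (ler_norm _); lra.
have {lo} lo : (normal_cdf ((t - h) / s) <= fine (P [set w | (X w <= t)%R]) + h)%R.
  rewrite -[leLHS]/(fine (normal_cdf ((t - h) / s))%:E) -YE; apply: le_trans (lo _) _; last by rewrite lerD2l.
  move=> w /= Yt; case: (leP (X w) t) => Xt; [by left|right].
  by apply: le_trans (ler_norm _); lra.
have c1 := close (t + h)%R; have c2 := close (t - h)%R.
have e1 : (`|t + h - t| <= h)%R by rewrite addrAC subrr add0r gtr0_norm.
have e2 : (`|t - h - t| <= h)%R by rewrite addrAC subrr add0r normrN gtr0_norm.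
have {}c1 := c1 e1; have {}c2 := c2 e2.
have l1 := normal_cdf_lip t ((t + h) / s); have l2 := normal_cdf_lip ((t - h) / s) t.
rewrite (distrC t) in l2.
by rewrite ler_norml; apply/andP; split; lra.
Qed.

(** The Gaussian approximant may change with [r] and with the accuracy [e]: the error in
    [gaussian_approx_cdf] depends on the accuracy and on [t] only. *)
Lemma gaussian_approx_cvg_in_law (X : R -> Omega -> R) :
  (forall e : R, (0 < e)%R -> \forall r \near +oo%R,
    measurable_fun [set: Omega] (X r) /\ exists Y v,
    [/\ measurable_fun [set: Omega] Y, gaussian_law (pushforward P Y), \int[P]_w (Y w)%:E = 0 &
      [/\ \int[P]_w (Y w ^+ 2)%:E = v%:E, (`|v - 1| <= e)%R & \int[P]_w ((X r w - Y w) ^+ 2)%:E <= e%:E]]) ->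
  cvg_in_law P X (normal_prob 0 1).
Proof.
move=> H; have mX : \forall r \near +oo%R, measurable_fun [set: Omega] (X r).
  by apply: filterS (H 1%R ltr01) => r [].
split=> // t _; rewrite normal_cdfE; apply/fine_cvgP; split.
  apply: filterS mX => r mXr; rewrite fin_num_measure// -[X in measurable X]setTI; exact: measurable_fun_le.
apply/cvgrPdist_le => e e0.
have k0 : (0 < 2 * `|t| + 3)%R by have := normr_ge0 t; lra.
pose h := (Num.min 2^-1 (e / (2 * `|t| + 3)))%R.
have h0 : (0 < h)%R by rewrite lt_min invr_gt0 ltr0n/= divr_gt0.
have h1 : (h <= 2^-1)%R by rewrite ge_min lexx.
have he : ((2 * `|t| + 3) * h <= e)%R by rewrite mulrC -ler_pdivlMr// ge_min lexx orbT.
apply: filterS (H (h ^+ 3)%R (exprn_gt0 _ h0)) => r [mXr [Y [v [mY gY Y0 [Yv v1 XY]]]]] /=.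
apply: le_trans he; apply: (gaussian_approx_cdf _ mXr mY gY Y0 Yv) => //; first by rewrite h0.
by apply: (le_trans v1); rewrite exprS ger_pMr// exprn_ile1// ?(ltW h0)//; lra.
Qed.
End gaussian_approximation.

(** * Jordan measurable sets and sojourn volumes *)

Section jordan.
Context (R : realType) (d : nat).
Local Open Scope ereal_scope.

Lemma measurable_box (a b : 'rV[R]_d) : measurable (box a b).
Proof.
rewrite (_ : box a b = \bigcap_(i in [set: 'I_d]) ((fun x : 'rV[R]_d => x ord0 i) @^-1` `[a ord0 i, b ord0 i]%classic)).
  apply: fin_bigcap_measurable => // i _.
  by rewrite -[X in measurable X]setTI; apply: measurable_coord.
by apply/seteqP; split=> x /= h i; [move=> _|]; have := h i; rewrite /= in_itv/= => ->.
Qed.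

Lemma measurable_elementary (E : set 'rV[R]_d) : elementary E -> measurable E.
Proof.
move=> [s ->]; elim: s => [|p s IH]; first by rewrite big_nil.
by rewrite big_cons; apply: measurableU => //; exact: measurable_box.
Qed.

(** The union of the inner and the intersection of the outer elementary sets, for gaps below
    [1 / (k + 1)], are Borel and differ by a null set. *)
Lemma jordan_sandwich (A : set 'rV[R]_d) : jordan_measurable A ->
  exists D F, [/\ measurable D, measurable F, D `<=` A, A `<=` F & leb R d (F `\` D) = 0].
Proof.
move=> JA; have H k : exists EF : set 'rV[R]_d * set 'rV[R]_d,
    [/\ measurable EF.1, measurable EF.2, EF.1 `<=` A, A `<=` EF.2 & leb R d (EF.2 `\` EF.1) < (k.+1%:R^-1)%:E].
  have [|E [F [eE eF EA AF EF]]] := JA k.+1%:R^-1%R; first by rewrite invr_gt0 ltr0n.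
  by exists (E, F); split=> //; exact: measurable_elementary.
have [G HG] := choice H.
exists (\bigcup_k (G k).1), (\bigcap_k (G k).2).
have m1 : measurable (\bigcup_k (G k).1) by apply: bigcup_measurable => k _; have [] := HG k.
have m2 : measurable (\bigcap_k (G k).2) by apply: bigcap_measurable => [|k _]; [by exists 0%N|have [] := HG k].
split=> //.
- by move=> x [k _]; have [_ _ + _ _] := HG k; exact.
- by move=> x Ax k _; have [_ _ _ + _] := HG k; exact.
apply/eqP; rewrite eq_le measure_ge0 andbT; apply/lee_addgt0Pr => e e0; rewrite add0e.
have [k _ ke] := near_infty_natSinv_lt (PosNum e0).
have [a b _ _ c] := HG k; apply: (@le_trans _ _ (leb R d ((G k).2 `\` (G k).1))).
  apply: le_leb => x [h1 h2]; split; first exact: h1.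
  by move=> h; apply: h2; exists k.
by apply: ltW; apply: (lt_trans c); rewrite lte_fin; apply: ke => /=.
Qed.

Lemma leb_bounded_lty (A : set 'rV[R]_d) (M : R) : (forall x, A x -> forall i, (`|x ord0 i| <= M)%R) ->
  leb R d A < +oo.
Proof.
move=> AM; apply: (@le_lt_trans _ _ (leb R d [set x | forall i, [set` `[(- M)%R, M]] (x ord0 i)])).
  by apply: le_leb => x /AM h i /=; rewrite in_itv/= -ler_norml.
rewrite (leb_prod (A := fun=> [set` `[(- M)%R, M]]))// big_const.
elim: #|_| => [|k IH] /=; first exact: ltry.
by rewrite lte_mul_pinfty// lebesgue_measure_itv/=; case: ifP.
Qed.

Lemma bounded_coord (A : set 'rV[R]_d) : bounded_set A ->
  exists2 M : R, (0 < M)%R & forall x, A x -> forall i, (`|x ord0 i| <= M)%R.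
Proof.
move=> [M0 [_ HM]]; exists (Num.max 1 (M0 + 1))%R; first by rewrite lt_max ltr01.
move=> x Ax i; apply: le_trans (HM (Num.max 1 (M0 + 1))%R _ x Ax); last by rewrite lt_max ltrDl ltr01 orbT.
rewrite /Num.norm/= mx_normrE.
by rewrite (le_bigmax _ _ (ord0, i)).
Qed.

Lemma dilateE (r : R) (A : set 'rV[R]_d) : (0 < r)%R -> dilate r A = [set x | A (r^-1 *: x)%R].
Proof.
move=> r0; have rn : r != 0%R by rewrite gt_eqF.
apply/seteqP; split=> x /=; first by move=> [y Ay <-]; rewrite scalerA mulVf// scale1r.
by move=> Ax; exists (r^-1 *: x)%R => //; rewrite scalerA divff// scale1r.
Qed.

Lemma measurable_dilate (r : R) (A : set 'rV[R]_d) : (0 < r)%R -> measurable A -> measurable (dilate r A).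
Proof.
move=> r0 mA; rewrite dilateE// -[X in measurable X]setTI (_ : mkset _ = (fun x => r^-1 *: x + 0)%R @^-1` A); last first.
  by apply/seteqP; split=> x /=; rewrite addr0.
exact: measurable_rV_affine.
Qed.

Lemma leb_dilate (r : R) (A : set 'rV[R]_d) : (0 < r)%R -> measurable A ->
  leb R d (dilate r A) = (r ^+ d)%:E * leb R d A.
Proof.
move=> r0 mA; have rn : r != 0%R by rewrite gt_eqF.
have mD := measurable_dilate r0 mA.
have mF : measurable_fun [set: 'rV[R]_d] (fun x => (\1_(dilate r A) x)%:E : \bar R).
  by apply/measurable_EFinP; exact: measurable_indic.
have F0 x : 0 <= (\1_(dilate r A) x)%:E :> \bar R by rewrite lee_fin indicE.
have IE : \int[leb R d]_x (\1_(dilate r A) x)%:E = leb R d (dilate r A).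
  by rewrite integral_indic//; congr (leb R d _); exact: setIT.
have := leb_affine 0%R r0 mF F0; rewrite IE => E.
have -> : leb R d A = \int[leb R d]_x (\1_(dilate r A) (r *: x + 0)%R)%:E.
  rewrite -[X in leb R d X]setIT -integral_indic//; apply: eq_integral => x _; congr EFin.
  rewrite !indicE addr0; congr (nat_of_bool _)%:R; apply/idP/idP; rewrite !inE dilateE//= scalerA mulVf// scale1r//.
by rewrite E muleA -EFinM -exprMn divff// expr1n mul1e.
Qed.

End jordan.

Section sojourn_exceed.
Context (dO : measure_display) (Omega : measurableType dO) (R : realType)
  (P : probability Omega R) (d n : nat) (eta : 'rV[R]_d -> 'I_n.+1 -> {RV P >-> R}).
Hypothesis eta_meas : measurable_field eta.
Context (D A F : set 'rV[R]_d).
Hypothesis mD : measurable D.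
Hypothesis mF : measurable F.
Hypothesis DA : D `<=` A.
Hypothesis AF : A `<=` F.
Hypothesis FD : leb R d (F `\` D) = 0%E.
Local Open Scope ereal_scope.

Lemma studentE x w : student eta x w = student_stat (field_row eta x w).
Proof.
rewrite /student /student_stat mxE; congr (_ / Num.sqrt (_ * _))%R.
by apply: eq_bigr => j _; rewrite mxE.
Qed.

(** Monotonicity of [leb] on arbitrary sets squeezes the sojourn volume in [A] between those in the
    Borel sets [D] and [F], which agree because dilations preserve null sets; a dilation then brings
    the volume back to the fixed set [D]. *)
Lemma sojourn_exceed (a : R -> R) (r : R) (w : Omega) : (0 < r)%R ->
  sojourn eta A a r w = (r ^+ d * exceed_integral eta D r (a r) w)%R.
Proof.
move=> r0; have rn : r != 0%R by rewrite gt_eqF.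
pose S := [set x | (a r < student eta x w)%R]; pose Q X := leb R d [set x | dilate r X x /\ S x].
have mS : measurable S.
  have m1 : measurable_fun [set: 'rV[R]_d] (fun x => student eta x w).
    under eq_fun do rewrite studentE.
    apply: (measurableT_comp (@measurable_student_stat R n)).
    apply: measurable_fun_rVP => j; under eq_fun do rewrite mxE.
    exact: (measurableT_comp (eta_meas j) (measurable_pair2 w)).
  by rewrite -[X in measurable X]setTI; exact: measurable_fun_ltr.
have QF : Q F = Q D.
  apply/eqP; rewrite eq_le; apply/andP; split; last first.
    by apply: le_leb => x [[y Dy <-] Sx]; split=> //; exists y => //; apply: AF; exact: DA.
  have md : measurable (dilate r (F `\` D)) by apply: measurable_dilate => //; exact: measurableD.
  apply: (@le_trans _ _ (leb R d ((dilate r D `&` S) `|` dilate r (F `\` D)))).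
    apply: le_leb => x [[y Fy <-] Sx]; case: (pselect (D y)) => Dy.
      by left; split=> //; exists y.
    by right; exists y.
  apply: (le_trans (measureU2 _ _ _)) => //.
    by apply: measurableI => //; exact: measurable_dilate.
  have z0 : leb R d (dilate r (F `\` D)) = 0 by rewrite (leb_dilate r0 (measurableD mF mD)) FD mule0.
  by rewrite [X in _ + X](_ : _ = 0) ?adde0//; exact: z0.
have QA : Q A = Q D.
  apply/eqP; rewrite eq_le; apply/andP; split; last first.
    by apply: le_leb => x [[y Dy <-] Sx]; split=> //; exists y => //; exact: DA.
  by rewrite -QF; apply: le_leb => x [[y Dy <-] Sx]; split=> //; exists y => //; exact: AF.
rewrite /sojourn -/(Q A) QA /Q.
pose S' := [set x | S (r *: x)%R].
have mS' : measurable S'.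
  rewrite -[X in measurable X]setTI (_ : S' = (fun x => r *: x + 0)%R @^-1` S); last first.
    by apply/seteqP; split=> x; rewrite /S'/= addr0.
  exact: measurable_rV_affine.
rewrite (_ : mkset _ = dilate r (S' `&` D)); last first.
  apply/seteqP; split=> x /=; first by move=> [[y Dy <-] Sx]; exists y.
  by move=> [y [Sy Dy] <-]; split=> //; exists y.
rewrite leb_dilate//; last exact: measurableI.
rewrite -integral_indic//.
have -> : exceed_integral eta D r (a r) w = fine (\int[leb R d]_(x in D) (\1_S' x)%:E).
  rewrite /exceed_integral /Rintegral; congr fine; apply: eq_integral => x _; congr EFin.
  rewrite /field_exceed !indicE; congr (nat_of_bool _)%:R.
  by apply/idP/idP; rewrite !inE /S' /S /student_event /= studentE.
have i0 : 0 <= \int[leb R d]_(x in D) (\1_S' x)%:E by apply: integral_ge0 => x _; rewrite lee_fin indicE.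
(* An infinite volume would be sent to 0 by [fine] on both sides. *)
case: (\int[leb R d]_(x in D) (\1_S' x)%:E) i0 => [s| |]//= _.
by rewrite gt0_muley ?mulr0// lte_fin exprn_gt0.
Qed.
End sojourn_exceed.

(** * Asymptotics of the covariance *)

Section covariance.
Context (dO : measure_display) (Omega : measurableType dO) (R : realType)
  (P : probability Omega R) (d m : nat) (eta : 'rV[R]_d -> 'I_m.+1 -> {RV P >-> R})
  (L : R -> R) (alpha : R).
Hypothesis d0 : (0 < d)%N.
Hypothesis eta_iso : homogeneous_isotropic eta.
Hypothesis eta_gauss : gaussian_field eta.
Hypothesis eta_unit : cross_moment eta 0 0 = 1%:M.
Hypothesis eta_corr : forall x : 'rV[R]_d, x != 0 ->
  cross_moment eta 0 x = (enorm x `^ (- alpha) * L (enorm x))%:M.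
Hypothesis sL : slowly_varying L.

(** The diagonal is separate because the formula with [L] describes distinct points only, and a
    negative power of the distance 0 is 0 by convention. *)
Definition correlation (x y : 'rV[R]_d) : R :=
  if x == y then 1 else enorm (x - y) `^ (- alpha) * L (enorm (x - y)).

Lemma enormN (x : 'rV[R]_d) : enorm (- x) = enorm x.
Proof. by rewrite /enorm dotNN. Qed.

Lemma correlationE x y : cross_moment eta x y = (correlation x y)%:M.
Proof.
have [B HB] := eta_iso; rewrite /correlation; case: eqVneq => [->|xy].
  by rewrite -eta_unit !HB !subrr.
by rewrite -eta_corr ?subr_eq0// !HB sub0r enormN.
Qed.

Lemma correlation_diag x : correlation x x = 1.
Proof. by rewrite /correlation eqxx. Qed.

Lemma correlation_sym x y : correlation x y = correlation y x.
Proof. by rewrite /correlation eq_sym -(opprB y x) enormN. Qed.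

Lemma measurable_correlation :
  measurable_fun [set: 'rV[R]_d * 'rV[R]_d] (fun p => correlation p.1 p.2).
Proof.
pose g : R -> R := (fun u => u `^ (- alpha) * L u) \_ `]0, +oo[.
have mg : measurable_fun [set: R] g.
  by apply/(measurable_restrictT _ _).1 => //; exact: measurable_rho.
have mz : measurable_fun [set: 'rV[R]_d * 'rV[R]_d] (fun p => p.1 - p.2).
  by apply: measurable_rV_sub; [exact: measurable_fst|exact: measurable_snd].
have me : measurable_fun [set: 'rV[R]_d * 'rV[R]_d] (fun p => enorm (p.1 - p.2)).
  have /measurable_EFinP := @measurable_riesz_kernel R d 1; apply: eq_measurable_fun => p _.
  by rewrite powRr1// sqrtr_ge0.
have mo := measurable_off0_comp mz.
rewrite (_ : (fun p => _) = fun p : 'rV[R]_d * 'rV[R]_d => off0 (p.1 - p.2) * g (enorm (p.1 - p.2)) + (1 - off0 (p.1 - p.2))).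
  apply: measurable_funD; first by apply: measurable_funM => //; exact: (measurableT_comp mg me).
  exact: measurable_funB.
apply/funext => -[x y] /=; rewrite /correlation /off0 subr_eq0; case: eqVneq => [->|xy] /=.
  by rewrite mul0r subr0 add0r.
rewrite mul1r subrr addr0 /g patchE mem_set//= in_itv/= andbT sqrtr_gt0.
by rewrite lt_def dot_ge0 andbT dot_eq0 subr_eq0.
Qed.

(** Cauchy-Schwarz for unit variances: the second moment of [eta x + s * eta y] is nonnegative for
    [s = 1] and [s = -1]. *)
Lemma correlation_le1 x y : `|correlation x y| <= 1.
Proof.
have h (s : R) : s ^+ 2 = 1 -> 0 <= 1 + 1 + 2 * s * correlation x y.
  move=> s2; rewrite -lee_fin.
  have Ex z : (\int[P]_w (eta z ord0 w ^+ 2)%:E = 1%:E)%E.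
    under eq_integral do rewrite expr2.
    by rewrite (eta_prod_mean eta_gauss correlationE) correlation_diag eqxx mulr1n.
  have Exy := eta_prod_mean eta_gauss correlationE x ord0 y ord0.
  have i1 := eta_sqr_integrable eta_gauss x ord0; have i2 := eta_sqr_integrable eta_gauss y ord0.
  have i3 := eta_prod_integrable eta_gauss x ord0 y ord0.
  have := integral_lin3 1 1 (2 * s) measurableT i1 i2 i3; rewrite !Ex Exy eqxx mulr1n -!EFinM -!EFinD !mul1r => <-.
  apply: integral_ge0 => w _; rewrite lee_fin.
  have -> : 1 * eta x ord0 w ^+ 2 + 1 * eta y ord0 w ^+ 2 + 2 * s * (eta x ord0 w * eta y ord0 w) =
    (eta x ord0 w + s * eta y ord0 w) ^+ 2 by rewrite -{1}s2; ring: s2.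
  exact: sqr_ge0.
have := h 1 (expr1n _ _); have := h (-1) (etrans (sqrrN _) (expr1n _ _)); rewrite ler_norml => *; apply/andP; split; lra.
Qed.

(** Every [u > 0] occurs as the distance of two points, since [d > 0]. *)
Lemma correlation_le1_pos (u : R) : 0 < u -> `|u `^ (- alpha) * L u| <= 1.
Proof.
move=> u0; pose z : 'rV[R]_d := u *: delta_mx ord0 (Ordinal d0).
have zE : enorm z = u.
  rewrite /enorm /dot (bigD1 (Ordinal d0))//= big1 ?addr0; last first.
    by move=> i ni; rewrite !mxE (negbTE ni) andbF mulr0 mul0r.
  by rewrite !mxE !eqxx mulr1 -expr2 sqrtr_sqr gtr0_norm.
have z0 : z != 0.
  apply/eqP => z0; move: u0; rewrite -zE z0 /enorm /dot big1 ?sqrtr0 ?ltxx// => i _.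
  by rewrite mxE mulr0.
by have := correlation_le1 z 0; rewrite /correlation (negbTE z0) subr0 zE.
Qed.
End covariance.

Section product_integral.
Context (R : realType) (d : nat) (D : set 'rV[R]_d).
Hypothesis mD : measurable D.
Local Open Scope ereal_scope.
Local Notation mu2 := (leb R d \x leb R d).

Lemma ge0_product_integral (f : 'rV[R]_d * 'rV[R]_d -> \bar R) :
  measurable_fun [set: 'rV[R]_d * 'rV[R]_d] f -> (forall p, 0 <= f p) ->
  \int[mu2]_(p in D `*` D) f p = \int[leb R d]_(x in D) \int[leb R d]_(y in D) f (x, y).
Proof.
move=> mf f0; have mDD : measurable (D `*` D) by exact: measurableX.
rewrite integral_mkcond fubini_tonelli1; last 2 first.
- by apply/(measurable_restrictT _ _).1 => //; exact: measurable_funTS.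
- by move=> p; rewrite patchE; case: ifP.
rewrite [RHS]integral_mkcond; apply: eq_integral => x _.
rewrite /fubini_F patchE; case: ifPn => xD.
  rewrite [RHS]integral_mkcond; apply: eq_integral => y _; rewrite !patchE.
  suff -> : ((x, y) \in D `*` D) = (y \in D) by [].
  by apply/idP/idP; rewrite !inE/=; [case|move=> yD; split=> //; exact: set_mem].
apply: integral0_eq => y _; rewrite patchE ifF//; apply/negP; rewrite inE/= => -[xD' _].
by move: xD; rewrite (mem_set xD').
Qed.

Lemma ae_offdiag (Q : set ('rV[R]_d * 'rV[R]_d)) : (0 < d)%N -> (forall p, p.1 != p.2 -> Q p) ->
  {ae mu2, forall p, Q p}.
Proof.
move=> d0 HQ; have mz : measurable_fun [set: 'rV[R]_d * 'rV[R]_d] (fun p => (p.1 - p.2)%R).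
  by apply: measurable_rV_sub; [exact: measurable_fst|exact: measurable_snd].
exists ((fun p => (p.1 - p.2)%R) @^-1` [set 0%R]); split.
- by rewrite -[X in measurable X]setTI; apply: mz => //; exact: measurable_rV_set1.
- rewrite /product_measure1 /=; apply: integral0_eq => x _.
  rewrite (_ : xsection _ _ = [set x]); first exact: leb_set1.
  apply/seteqP; split=> y; rewrite /xsection/= inE/=.
    by move/eqP; rewrite subr_eq0 => /eqP.
  by move=> ->; rewrite subrr.
- move=> p /= nQ; apply/eqP; rewrite subr_eq0; apply/negPn/negP => /HQ.
  exact: nQ.
Qed.
End product_integral.

(** * Regular variation of the correlation energy *)

Section energy_asymptotics.
Context (R : realType) (d : nat) (D : set 'rV[R]_d) (V M : R) (L : R -> R) (alpha : R).
Hypothesis d0 : (0 < d)%N.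
Hypothesis mD : measurable D.
Hypothesis DV : leb R d D = V%:E.
Hypothesis M0 : (0 < M)%R.
Hypothesis DM : forall x, D x -> forall i, (`|x ord0 i| <= M)%R.
Hypothesis sL : slowly_varying L.
Hypothesis al : (0 < alpha < d%:R)%R.
Hypothesis rho1 : forall u : R, (0 < u)%R -> (`|u `^ (- alpha) * L u| <= 1)%R.
Local Open Scope ereal_scope.
Local Notation mu2 := (leb R d \x leb R d).
Local Notation K := (correlation L alpha).
Local Notation rho u := (u `^ (- alpha) * L u)%R.

Let al0 : (0 < alpha)%R. Proof. by case/andP: al. Qed.

Let mDD : measurable (D `*` D : set ('rV[R]_d * 'rV[R]_d)). Proof. exact: measurableX. Qed.

Lemma riesz_integrable (b : R) : (0 < b < d%:R)%R ->
  mu2.-integrable (D `*` D) (fun p => (enorm (p.1 - p.2) `^ (- b))%:E).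
Proof.
move=> hb; apply/integrableP; split; first exact: measurable_funTS (measurable_riesz_kernel _).
under eq_integral do rewrite gee0_abs ?lee_fin ?powR_ge0//.
rewrite (ge0_product_integral mD (measurable_riesz_kernel (- b))); last by move=> p; rewrite lee_fin powR_ge0.
exact: (riesz_energy_lty d0 mD DV DM hb).
Qed.

(** The correlation may be negative, so its energy is an integral for the product measure, where
    boundedness by 1 gives integrability and a single dominated convergence suffices. *)
Definition correlation_energy (r : R) : R := fine (\int[mu2]_(p in D `*` D) (K (r *: p.1) (r *: p.2))%R%:E).

Lemma measurable_correlation_scale (r : R) :
  measurable_fun [set: 'rV[R]_d * 'rV[R]_d] (fun p => (K (r *: p.1) (r *: p.2))%R%:E).
Proof.
apply/measurable_EFinP.
have h : measurable_fun [set: 'rV[R]_d * 'rV[R]_d] (fun p => (r *: p.1, r *: p.2)%R).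
  apply/measurable_fun_pairP; split; apply: measurable_fun_rVP => i; rewrite /comp/=; under eq_fun do rewrite mxE;
  apply: measurable_funM => //; apply: (measurableT_comp (measurable_coord i)); [exact: measurable_fst|exact: measurable_snd].
exact: (measurableT_comp (@measurable_correlation R d L alpha sL) h).
Qed.

Lemma correlation_bound1 (x y : 'rV[R]_d) : (`|K x y| <= 1)%R.
Proof.
rewrite /correlation; case: eqVneq => [_|xy]; first by rewrite normr1.
by apply: rho1; rewrite sqrtr_gt0 lt_def dot_ge0 andbT dot_eq0 subr_eq0.
Qed.

Lemma leb2_DD : mu2 (D `*` D) = (V * V)%:E.
Proof. by rewrite product_measure1E// EFinM; congr (_ * _); exact: DV. Qed.

Lemma correlation_integrable (r : R) :
  mu2.-integrable (D `*` D) (fun p => (K (r *: p.1) (r *: p.2))%R%:E).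
Proof.
apply: measurable_bounded_integrable => //.
- by rewrite [X in X < _](_ : _ = (V * V)%:E) ?ltry//; exact: leb2_DD.
- by apply: measurable_funTS; apply/measurable_EFinP; exact: measurable_correlation_scale.
- exists 1%R; split; first exact: num_real.
  by move=> y y1 p _ /=; apply: le_trans (ltW y1); exact: correlation_bound1.
Qed.

Lemma enormZ (r : R) (z : 'rV[R]_d) : (0 <= r)%R -> enorm (r *: z) = (r * enorm z)%R.
Proof. by move=> r0; rewrite /enorm dotZ sqrtrM ?sqr_ge0// sqrtr_sqr ger0_norm. Qed.

Lemma correlation_scaleE (r : R) (x y : 'rV[R]_d) : (0 < r)%R -> x != y ->
  K (r *: x) (r *: y) = rho (r * enorm (x - y)).
Proof.
move=> r0 xy; rewrite /correlation -scalerBr enormZ ?ltW// ifF//; apply/negbTE.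
by rewrite -subr_eq0 -scalerBr scaler_eq0 negb_or gt_eqF//= subr_eq0.
Qed.

Lemma enorm_le_coord (z : 'rV[R]_d) (B : R) : (0 <= B)%R -> (forall i, (`|z ord0 i| <= B)%R) ->
  (enorm z <= Num.sqrt d%:R * B)%R.
Proof.
move=> B0 zB; rewrite -[leRHS]ger0_norm ?mulr_ge0 ?sqrtr_ge0// -sqrtr_sqr ler_wsqrtr// exprMn sqr_sqrtr ?ler0n//.
apply: (@le_trans _ _ (\sum_(i < d) B ^+ 2)%R); last by rewrite sumr_const card_ord mulr_natl.
apply: ler_sum => i _; rewrite -expr2 -(real_normK (num_real (z ord0 i))).
by rewrite ler_pXn2r ?nnegrE.
Qed.

Lemma enorm_gt0 (z : 'rV[R]_d) : z != 0%R -> (0 < enorm z)%R.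
Proof. by move=> z0; rewrite sqrtr_gt0 lt_def dot_ge0 andbT dot_eq0. Qed.

Lemma correlation_energy_cvg :
  (correlation_energy r / rho r)%R @[r --> +oo%R] --> fine (riesz_energy D alpha).
Proof.
(* [delta] is the loss in the Potter bound, small enough for the exponent [alpha + delta] of the
   dominating Riesz kernel to stay below [d]. *)
pose delta := ((d%:R - alpha) / 2)%R.
have [a0 ad] := andP al.
have de0 : (0 < delta)%R by rewrite divr_gt0// subr_gt0.
have ade : (0 < alpha + delta < d%:R)%R by rewrite /delta; apply/andP; split; lra.
pose B := (Num.sqrt d%:R * (2 * M) + 1)%R.
have B0 : (0 < B)%R by rewrite ltr_wpDl// mulr_ge0 ?sqrtr_ge0// mulr_ge0// ltW.
have DB (x y : 'rV[R]_d) : D x -> D y -> (enorm (x - y) <= B)%R.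
  move=> Dx Dy; apply: (@le_trans _ _ (Num.sqrt d%:R * (2 * M))%R); last by rewrite lerDl.
  apply: enorm_le_coord => [|i]; first by rewrite mulr_ge0// ltW.
  rewrite !mxE mulr_natl mulr2n; apply: (le_trans (ler_normB _ _)); apply: lerD; exact: DM.
have [A [X1 X10 HA]] := regular_ratio_bound sL al0 rho1 B0 de0.
have [X2 X20 HX2] := slowly_varying_gt0 sL.
pose X := Num.max X1 X2.
have rho0 r : (X <= r)%R -> (0 < r)%R /\ (0 < rho r)%R.
  rewrite ge_max => /andP[r1 r2]; have r0 := lt_le_trans X10 r1.
  by split=> //; rewrite mulr_gt0 ?powR_gt0//; exact: HX2.
apply/cvg_pinftyP => u /cvgryPge uy.
(* Dominated convergence asks for the bound at every index; passing from [u m] to [v m] changes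
   finitely many terms only. *)
pose v m := Num.max X (u m).
pose F (m : nat) (p : 'rV[R]_d * 'rV[R]_d) := (K (v m *: p.1) (v m *: p.2) / rho (v m))%R%:E.
have vX m : (X <= v m)%R by rewrite le_max lexx.
have vy : v m @[m --> \oo] --> +oo%R.
  apply/cvgryPge => x; apply: filterS (uy x) => m xm; by rewrite le_max xm orbT.
have mF m : measurable_fun (D `*` D) (F m).
  apply: measurable_funTS; apply/measurable_EFinP; apply: measurable_funM => //.
  by apply/measurable_EFinP; exact: measurable_correlation_scale.
have mG : measurable_fun (D `*` D) (fun p : 'rV[R]_d * 'rV[R]_d => (enorm (p.1 - p.2) `^ (- alpha))%:E).
  by apply: measurable_funTS; exact: measurable_riesz_kernel.
have FG : {ae mu2, forall p, (D `*` D) p -> F ^~ p @ \oo --> (enorm (p.1 - p.2) `^ (- alpha))%:E}.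
  apply: (ae_offdiag d0) => p pn _.
  have s0 : (0 < enorm (p.1 - p.2))%R by apply: enorm_gt0; rewrite subr_eq0.
  apply: cvg_EFin; first by near=> m.
  have h := cvg_comp _ _ vy (regular_ratio_cvg (alpha := alpha) sL s0).
  apply: cvg_trans h; apply: near_eq_cvg; near=> m.
  rewrite /F /=; rewrite correlation_scaleE//; by have [] := rho0 _ (vX m).
have ig : mu2.-integrable (D `*` D) (fun p => A%:E * (enorm (p.1 - p.2) `^ (- (alpha + delta)))%:E).
  by apply: integrableZl => //; exact: riesz_integrable.
have Fg : {ae mu2, forall p m, (D `*` D) p -> `|F m p| <= A%:E * (enorm (p.1 - p.2) `^ (- (alpha + delta)))%:E}.
  apply: (ae_offdiag d0) => p pn m [Dx Dy].
  have s0 : (0 < enorm (p.1 - p.2))%R by apply: enorm_gt0; rewrite subr_eq0.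
  have [v0 rv0] := rho0 _ (vX m).
  rewrite /F correlation_scaleE// abse_EFin -EFinM lee_fin normrM normfV (gtr0_norm rv0) ler_pdivrMr//.
  apply: HA; first by apply: le_trans (vX m); rewrite le_max lexx.
  by rewrite s0 DB.
have [_ _ H] := dominated_convergence mDD mF mG FG ig Fg.
have EE : \int[mu2]_(p in D `*` D) (enorm (p.1 - p.2) `^ (- alpha))%:E = riesz_energy D alpha.
  rewrite (ge0_product_integral mD (measurable_riesz_kernel (- alpha)))// => p; first by rewrite lee_fin powR_ge0.
rewrite EE in H.
have [e Ee] : exists e, riesz_energy D alpha = e%:E.
  exists (fine (riesz_energy D alpha)); rewrite fineK// ge0_fin_numE ?(riesz_energy_lty d0 mD DV DM al)//.
  by apply: integral_ge0 => x _; apply: integral_ge0 => y _; rewrite lee_fin powR_ge0.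
rewrite Ee in H *; move/fine_cvgP: H => [_ H] /=.
apply: cvg_trans H; apply: near_eq_cvg; near=> m => /=.
have uX : (X <= u m)%R by near: m; exact: uy.
rewrite (_ : u m = v m); last by rewrite /v; apply/esym/max_idPr.
rewrite /F; under eq_integral do rewrite EFinM.
rewrite integralZr//; last exact: correlation_integrable.
by rewrite fineM//; exact: integrable_fin_num (correlation_integrable _).
Unshelve. all: by end_near. Qed.
End energy_asymptotics.

Section correlation_sqr.
Context (R : realType) (d : nat) (D : set 'rV[R]_d) (L : R -> R) (alpha : R).
Hypothesis d0 : (0 < d)%N.
Hypothesis mD : measurable D.
Hypothesis sL : slowly_varying L.
Local Open Scope ereal_scope.

(** Homogeneity of the Riesz kernel extracts the power of [r]. Squaring the correlation doubles its
    decay exponent, which is the gain of the residual over the coordinate term. *)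
Lemma correlation_sqr_energy_le (tau A r : R) : (0 <= A)%R -> (0 < r)%R ->
  (forall u : R, 0 < u -> `|u `^ (- alpha) * L u| <= A * u `^ (- tau))%R ->
  \int[leb R d]_(x in D) \int[leb R d]_(y in D) (correlation L alpha (r *: x) (r *: y) ^+ 2)%R%:E <=
  (A ^+ 2 * r `^ (- (2 * tau)))%:E * riesz_energy D (2 * tau).
Proof.
move=> A0 r0 HA; set c := (A ^+ 2 * r `^ (- (2 * tau)))%R.
have c0 : (0 <= c)%R by rewrite mulr_ge0 ?sqr_ge0 ?powR_ge0.
pose k (p : 'rV[R]_d * 'rV[R]_d) : \bar R := (enorm (p.1 - p.2) `^ (- (2 * tau)))%:E.
have mk : measurable_fun [set: 'rV[R]_d * 'rV[R]_d] k := measurable_riesz_kernel _.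
have k0 p : 0 <= k p by rewrite lee_fin powR_ge0.
have mk1 (x : 'rV[R]_d) : measurable_fun [set: 'rV[R]_d] (fun y => k (x, y)).
  exact: (measurableT_comp mk (measurable_pair1 x)).
pose J (x : 'rV[R]_d) : \bar R := \int[leb R d]_(y in D) k (x, y).
have mJ : measurable_fun [set: 'rV[R]_d] J.
  exact: (@measurable_integral_in R _ _ _ _ (leb R d) D (fun x y : 'rV[R]_d => k (x, y)) mD mk (fun x y => k0 (x, y))).
have J0 x : 0 <= J x by exact: integral_ge0.
rewrite [X in _ * X](_ : _ = \int[leb R d]_(x in D) J x)//.
rewrite -(ge0_integralZ_in (leb R d) mD c0 mJ J0).
apply: ge0_le_integral_in => x; first by apply: integral_ge0 => y _; rewrite lee_fin sqr_ge0.
rewrite -(ge0_integralZ_in (leb R d) mD c0 (mk1 x) (fun y => k0 (x, y))).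
have mf : measurable_fun [set: 'rV[R]_d] (fun y : 'rV[R]_d => (correlation L alpha (r *: x) (r *: y) ^+ 2)%R%:E).
  apply/measurable_EFinP; apply: measurable_funX; apply/measurable_EFinP.
  exact: (measurableT_comp (@measurable_correlation_scale R d L alpha sL r) (measurable_pair1 x)).
have f0 (y : 'rV[R]_d) : 0 <= (correlation L alpha (r *: x) (r *: y) ^+ 2)%R%:E by rewrite lee_fin sqr_ge0.
(* The pointwise bound may fail at [y = x], where the correlation is 1 while the power of the zero
   distance can be 0; this point is removed first. *)
rewrite -(integral_off0 d0 x mD mf f0); apply: ge0_le_integral_in => y.
  by apply: mule_ge0 => //; rewrite lee_fin /off0 ler0n.
rewrite /off0 subr_eq0; case: eqVneq => [xy|xy] /=; first by rewrite mul0e mule_ge0.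
rewrite mul1e -EFinM lee_fin correlation_scaleE//= -[leLHS](real_normK (num_real _)).
set e := enorm _; have e0 : (0 < e)%R by apply: enorm_gt0; rewrite subr_eq0.
have -> : (c * e `^ (- (2 * tau)) = (A * (r * e) `^ (- tau)) ^+ 2)%R.
  rewrite exprMn -[((r * e) `^ (- tau) ^+ 2)%R]powR_mulrn ?powR_ge0// -powRrM (_ : - tau * 2%:R = - (2 * tau))%R; last by ring.
  by rewrite powRM ?ltW// mulrA.
by rewrite ler_pXn2r ?nnegrE ?mulr_ge0 ?powR_ge0//; apply: HA; exact: mulr_gt0.
Qed.
End correlation_sqr.

Section coord_energy.
Context (dO : measure_display) (Omega : measurableType dO) (R : realType)
  (P : probability Omega R) (d n : nat) (eta : 'rV[R]_d -> 'I_n.+1 -> {RV P >-> R})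
  (L : R -> R) (alpha : R).
Hypothesis eta_meas : measurable_field eta.
Hypothesis eta_gauss : gaussian_field eta.
Hypothesis eta_cov : forall x y, cross_moment eta x y = (correlation L alpha x y)%:M.
Context (D : set 'rV[R]_d) (V : R).
Hypothesis mD : measurable D.
Hypothesis DV : leb R d D = V%:E.
Hypothesis V0 : (0 < V)%R.
Hypothesis sL : slowly_varying L.
Hypothesis rho1 : forall u : R, (0 < u)%R -> (`|u `^ (- alpha) * L u| <= 1)%R.
Local Open Scope ereal_scope.

Lemma coord_energyE (r : R) : \int[P]_w (coord_integral eta D r w ^+ 2)%:E = (correlation_energy D L alpha r)%:E.
Proof.
have := coord_second_moment eta_meas eta_gauss eta_cov (correlation_diag L alpha) mD DV V0 r.
have mK := @measurable_correlation_scale R d L alpha sL r.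
have iK := correlation_integrable mD DV sL rho1 r.
pose f (p : 'rV[R]_d * 'rV[R]_d) : \bar R := (2 * 1 + 2 * correlation L alpha (r *: p.1) (r *: p.2))%R%:E.
have mf : measurable_fun [set: 'rV[R]_d * 'rV[R]_d] f.
  apply/measurable_EFinP; apply: measurable_funD => //; apply: measurable_funM => //; exact/measurable_EFinP.
have f0 p : 0 <= f p.
  rewrite lee_fin; have := correlation_bound1 rho1 (r *: p.1) (r *: p.2); rewrite ler_norml => /andP[? ?]; lra.
rewrite -(ge0_product_integral mD mf f0).
have mDD : measurable (D `*` D : set ('rV[R]_d * 'rV[R]_d)) by exact: measurableX.
have i1 : (leb R d \x leb R d).-integrable (D `*` D) (EFin \o (fun=> 1%R)).
  apply/integrableP; split; first by apply: measurable_funTS; exact: measurable_cst.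
  under eq_integral do rewrite /= normr1.
  rewrite integral_cst// mul1e [X in X < _](_ : _ = (V * V)%:E) ?ltry//; exact: leb2_DD.
have -> : \int[leb R d \x leb R d]_(p in D `*` D) f p = (2 * (V * V) + 2 * correlation_energy D L alpha r)%:E.
  have := integral_lin3 2 2 0 mDD i1 iK i1; rewrite integral_cst// mul1e mul0e adde0.
  rewrite [X in _ = _ * X + _ -> _](_ : _ = (V * V)%:E); last exact: leb2_DD.
  move=> hE; rewrite (EFinD (2 * (V * V))) (EFinM 2 (V * V)) (EFinM 2 (correlation_energy _ _ _ _)).
  rewrite /correlation_energy fineK; last exact: integrable_fin_num iK.
  by rewrite -hE; apply: eq_integral => p _; rewrite /f; congr EFin; ring.
have : 0 <= \int[P]_w (coord_integral eta D r w ^+ 2)%:E by apply: integral_ge0 => w _; rewrite lee_fin sqr_ge0.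
case: (\int[P]_w (coord_integral eta D r w ^+ 2)%:E) => [s| |]// _.
  by rewrite -EFinM -EFinD => -[E]; congr EFin; rewrite expr2 in E; lra.
by rewrite gt0_muley ?lte_fin// => /eqP.
Qed.
End coord_energy.

Lemma gaussian_law_scale (dO : measure_display) (Omega : measurableType dO) (R : realType)
    (P : probability Omega R) (Y : Omega -> R) (k : R) : 0 < k ->
  measurable_fun [set: Omega] Y ->
  gaussian_law (pushforward P Y) -> gaussian_law (pushforward P (fun w => k * Y w)).
Proof.
move=> k0 mY; have mk : measurable_fun [set: R] (fun z : R => k * z) by exact: measurable_funM.
have E (A : set R) : pushforward P (fun w => k * Y w) A = pushforward P Y ((fun z => k * z) @^-1` A) by [].
have mpre (A : set R) : measurable A -> measurable ((fun z => k * z) @^-1` A).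
  by move=> mA; rewrite -[X in measurable X]setTI; exact: mk.
case=> [[m [s [s0 H]]]|[m H]]; [left; exists (k * m), (k * s); split; first exact: mulr_gt0|right; exists (k * m)].
  move=> A mA; rewrite E H; last exact: mpre.
  rewrite (normal_prob_affine m s0 (mpre A mA)) (normal_prob_affine (k * m) (mulr_gt0 k0 s0) mA).
  congr (normal_prob 0 1 _).
  by apply/seteqP; split=> z /=; rewrite mulrDr mulrA.
by move=> A mA; rewrite E H; [rewrite !diracE|exact: mpre].
Qed.

(** * Perturbation in L^2 of a Gaussian limit *)

Section L2_comparison.
Context (dO : measure_display) (Omega : measurableType dO) (R : realType) (P : probability Omega R).
Local Open Scope ereal_scope.

(** Weighted Young inequality, the gap being the square [(h U - W)^2 / h]. For small [h] the second
    moment of [U] is almost unchanged, at the price of a factor of order [1 / h] on that of [W]. *)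
Lemma integral_sqrD_le (U W : Omega -> R) (h u v : R) : (0 < h)%R ->
  measurable_fun [set: Omega] U -> measurable_fun [set: Omega] W ->
  \int[P]_w (U w ^+ 2)%:E <= u%:E -> \int[P]_w (W w ^+ 2)%:E <= v%:E ->
  \int[P]_w ((U w + W w) ^+ 2)%:E <= ((1 + h) * u + (1 + h^-1) * v)%:E.
Proof.
move=> h0 mU mW Uu Wv.
have h1 : (0 <= 1 + h)%R by lra.
have h2 : (0 <= 1 + h^-1)%R by rewrite addr_ge0// invr_ge0 ltW.
have mU2 : measurable_fun [set: Omega] (fun w => (U w ^+ 2)%:E) by apply/measurable_EFinP; exact: measurable_funX.
have mW2 : measurable_fun [set: Omega] (fun w => (W w ^+ 2)%:E) by apply/measurable_EFinP; exact: measurable_funX.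
apply: (@le_trans _ _ (\int[P]_w ((1 + h)%:E * (U w ^+ 2)%:E + (1 + h^-1)%:E * (W w ^+ 2)%:E))).
  apply: ge0_le_integralT => w; first by rewrite lee_fin sqr_ge0.
  rewrite -!EFinM -EFinD lee_fin -subr_ge0.
  have -> : ((1 + h) * U w ^+ 2 + (1 + h^-1) * W w ^+ 2 - (U w + W w) ^+ 2 = (h * U w - W w) ^+ 2 / h)%R.
    by field; rewrite gt_eqF.
  by rewrite divr_ge0 ?sqr_ge0// ltW.
rewrite ge0_integralD//; last 4 first.
- by move=> w _; rewrite -EFinM lee_fin mulr_ge0// sqr_ge0.
- by apply: emeasurable_funM => //; exact: measurable_cst.
- by move=> w _; rewrite -EFinM lee_fin mulr_ge0// sqr_ge0.
- by apply: emeasurable_funM => //; exact: measurable_cst.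
rewrite !ge0_integralZT//; try by move=> w; rewrite lee_fin sqr_ge0.
by rewrite (EFinD ((1 + h) * u)) (EFinM (1 + h) u) (EFinM (1 + h^-1) v); apply: leeD; apply: lee_wpmul2l; rewrite ?lee_fin.
Qed.

(** The approximation error is [h ^+ 2] in order to compensate for the factor [h^-1] in
    [integral_sqrD_le]; using that inequality in both directions brings [v] close to [q], hence to
    1. *)
Lemma integral_sqr_compare (X N Z Y : Omega -> R) (q v h : R) : (0 < h <= 4^-1)%R ->
  measurable_fun [set: Omega] X -> measurable_fun [set: Omega] N -> measurable_fun [set: Omega] Z ->
  measurable_fun [set: Omega] Y -> {ae P, forall w, X w = N w + Z w}%R ->
  \int[P]_w (N w ^+ 2)%:E = q%:E -> (`|q - 1| <= h)%R -> \int[P]_w (Z w ^+ 2)%:E <= h%:E ->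
  \int[P]_w ((N w - Y w) ^+ 2)%:E <= (h ^+ 2)%:E -> \int[P]_w (Y w ^+ 2)%:E = v%:E ->
  (`|v - 1| <= 4 * h)%R /\ \int[P]_w ((X w - Y w) ^+ 2)%:E <= (4 * h)%:E.
Proof.
move=> /andP[h0 h1] mX mN mZ mY XNZ Nq q1 Zh NY Yv.
have mNY : measurable_fun [set: Omega] (fun w => N w - Y w)%R by exact: measurable_funB.
have mYN : measurable_fun [set: Omega] (fun w => Y w - N w)%R by exact: measurable_funB.
have YN : \int[P]_w ((Y w - N w) ^+ 2)%:E <= (h ^+ 2)%:E.
  by apply: le_trans NY; under eq_integral do rewrite -sqrrN opprB.
have hh : (h^-1 * h ^+ 2 = h)%R by rewrite expr2 mulrA mulVf ?mul1r// gt_eqF.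
have vle : (v <= (1 + h) * q + h ^+ 2 + h)%R.
  have Nq' : \int[P]_w (N w ^+ 2)%:E <= q%:E by rewrite Nq.
  have := integral_sqrD_le h0 mN mYN Nq' YN; under eq_integral do rewrite addrC subrK.
  by rewrite Yv lee_fin (mulrDl 1%R h^-1%R) mul1r hh addrA.
have qle : (q <= (1 + h) * v + h ^+ 2 + h)%R.
  have Yv' : \int[P]_w (Y w ^+ 2)%:E <= v%:E by rewrite Yv.
  have := integral_sqrD_le h0 mY mNY Yv' NY; under eq_integral do rewrite addrC subrK.
  by rewrite Nq lee_fin (mulrDl 1%R h^-1%R) mul1r hh addrA.
have [q2 q3] : (1 - h <= q)%R /\ (q <= 1 + h)%R by move: q1; rewrite ler_norml => /andP[? ?]; split; lra.
split; first by rewrite ler_norml; apply/andP; split; nra.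
have -> : \int[P]_w ((X w - Y w) ^+ 2)%:E = \int[P]_w ((Z w + (N w - Y w)) ^+ 2)%:E.
  apply: ge0_ae_eq_integral => //; try by move=> w _; rewrite lee_fin sqr_ge0.
  - by apply/measurable_EFinP; apply: measurable_funX; exact: measurable_funB.
  - by apply/measurable_EFinP; apply: measurable_funX; exact: measurable_funD.
  - by apply: filterS XNZ => w -> _; congr EFin; ring.
apply: (le_trans (integral_sqrD_le ltr01 mZ mNY Zh NY)); rewrite invr1 lee_fin; nra.
Qed.

(** [N] is the principal part, of variance close to 1 but not known to be Gaussian; [Y] is a
    Gaussian approximation of [N], and [Z] is the negligible part. *)
Lemma gaussian_sum_cvg_in_law (X : R -> Omega -> R) :
  (forall h : R, (0 < h <= 4^-1)%R -> \forall r \near +oo%R, measurable_fun [set: Omega] (X r) /\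
    exists (N Z Y : Omega -> R) (q v : R),
    [/\ [/\ measurable_fun [set: Omega] N, measurable_fun [set: Omega] Z, measurable_fun [set: Omega] Y &
            {ae P, forall w, X r w = N w + Z w}%R],
        [/\ \int[P]_w (N w ^+ 2)%:E = q%:E, (`|q - 1| <= h)%R & \int[P]_w (Z w ^+ 2)%:E <= h%:E]
      & [/\ gaussian_law (pushforward P Y), \int[P]_w (Y w)%:E = 0,
            \int[P]_w (Y w ^+ 2)%:E = v%:E & \int[P]_w ((N w - Y w) ^+ 2)%:E <= (h ^+ 2)%:E]]) ->
  cvg_in_law P X (normal_prob 0 1).
Proof.
move=> H; apply: gaussian_approx_cvg_in_law => e e0.
pose h := (Num.min 4^-1 (e / 4))%R.
have h0 : (0 < h <= 4^-1)%R by rewrite lt_min invr_gt0 ltr0n/= divr_gt0//= ge_min lexx.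
have he : (4 * h <= e)%R by rewrite mulrC -ler_pdivlMr// ge_min lexx orbT.
apply: filterS (H h h0) => r [mX [N [Z [Y [q [v [[mN mZ mY XNZ] [Nq q1 Zh] [gY Y0 Yv NY]]]]]]]].
have [v1 XY] := integral_sqr_compare h0 mX mN mZ mY XNZ Nq q1 Zh NY Yv.
split=> //; exists Y, v; split=> //; split=> //; first exact: le_trans v1 he.
by apply: (le_trans XY); rewrite lee_fin.
Qed.
End L2_comparison.

(** * Growth of the normalizing factors *)

Section normalization.
Context (R : realType).

(** Eventually [1 <= a r <= s] with [s = r ^ (gamma / (2 n))], so [1 + a^2 / n <= 2 s^2], and the
    [n]-th power of [s^2] is [r ^ gamma]. *)
Lemma student_normalizer_le (a : R -> R) (n : nat) (gamma : R) : (0 < n)%N ->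
  a r @[r --> +oo] --> +oo ->
  a r / r `^ (gamma / (2 * n%:R)) @[r --> +oo] --> (0 : R) ->
  \forall r \near +oo, ((1 + a r ^+ 2 / n%:R) `^ (n%:R / 2)) ^+ 2 <= 2 ^+ n * r `^ gamma.
Proof.
move=> n0 /cvgryPge ay /cvgrPdist_le a0.
have a1 := ay 1; have {}a0 := a0 1 ltr01.
have r1 : \forall r \near +oo, (1 : R) <= r by apply: nbhs_pinfty_ge; exact: num_real.
near=> r.
have b1 : 1 <= a r by near: r.
have r0 : 0 < r by apply: (@lt_le_trans _ _ 1) => //; near: r.
have bs0 : `|0 - a r / r `^ (gamma / (2 * n%:R))| <= 1 by near: r.
have n1 : 1 <= n%:R :> R by rewrite ler1n.
have np : 0 < n%:R :> R by rewrite ltr0n.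
set s := r `^ (gamma / (2 * n%:R)).
have s0 : 0 < s by exact: powR_gt0.
have s1 : 0 <= s by exact: ltW.
have bs : a r <= s.
  move: bs0; rewrite -/s sub0r normrN => /(le_trans (ler_norm _)).
  by rewrite ler_pdivrMr// mul1r.
have b0 : 0 <= a r by apply: le_trans b1.
have q0 : 0 <= 1 + a r ^+ 2 / n%:R by rewrite addr_ge0// divr_ge0 ?sqr_ge0// ltW.
have -> : ((1 + a r ^+ 2 / n%:R) `^ (n%:R / 2)) ^+ 2 = (1 + a r ^+ 2 / n%:R) ^+ n.
  rewrite -[LHS]powR_mulrn ?powR_ge0// -powRrM -[RHS]powR_mulrn//; congr (_ `^ _); lra.
have -> : r `^ gamma = (s ^+ 2) ^+ n.
  rewrite -exprM -[RHS](powR_mulrn _ s1) -powRrM natrM; congr (_ `^ _); field; lra.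
rewrite -exprMn ler_pXn2r ?nnegrE ?mulr_ge0 ?sqr_ge0//.
have h1 : a r ^+ 2 / n%:R <= a r ^+ 2 by rewrite ler_pdivrMr// ler_peMr ?sqr_ge0.
have h2 : 1 <= a r ^+ 2 by rewrite exprn_ege1.
have h3 : a r ^+ 2 <= s ^+ 2 by rewrite ler_pXn2r ?nnegrE.
lra.
Unshelve. all: by end_near. Qed.

(** A comparison of powers: the squared normalizer is at most of order [r ^ gamma], the residual
    contributes [r ^ (- sigma)], the principal variance [r ^ (- alpha) * L r]. The quotient is at
    most a constant over [r ^ (sigma - gamma - alpha) * L r], which tends to infinity. *)
Lemma residual_scale_le (a L : R -> R) (n : nat) (alpha gamma sigma C h : R) : (0 < n)%N ->
  slowly_varying L -> gamma + alpha < sigma -> 0 <= C -> 0 < h ->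
  a r @[r --> +oo] --> +oo ->
  a r / r `^ (gamma / (2 * n%:R)) @[r --> +oo] --> (0 : R) ->
  \forall r \near +oo,
    ((1 + a r ^+ 2 / n%:R) `^ (n%:R / 2)) ^+ 2 * (C * r `^ (- sigma)) / (r `^ (- alpha) * L r) <= h.
Proof.
move=> n0 sL gs C0 h0 ay a0.
have Tle := student_normalizer_le n0 ay a0.
have e0 : 0 < sigma - gamma - alpha by lra.
have /cvgryPge Ly := slowly_varying_pow_cvgy sL e0.
have {}Ly := Ly (2 ^+ n * C / h).
have [X X0 LX] := slowly_varying_gt0 sL.
have rX : \forall r \near +oo, X <= r by apply: nbhs_pinfty_ge; exact: num_real.
near=> r.
have Xr : X <= r by near: r.
have r0 : 0 < r by exact: lt_le_trans Xr.
have rho0 : 0 < r `^ (- alpha) * L r by rewrite mulr_gt0 ?powR_gt0// LX.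
have L1 : 2 ^+ n * C / h <= r `^ (sigma - gamma - alpha) * L r by near: r.
have T1 : ((1 + a r ^+ 2 / n%:R) `^ (n%:R / 2)) ^+ 2 <= 2 ^+ n * r `^ gamma by near: r.
set T := (_ ^+ 2) in T1 *.
rewrite ler_pdivrMr//.
apply: (@le_trans _ _ (2 ^+ n * r `^ gamma * (C * r `^ (- sigma)))).
  by apply: ler_wpM2r => //; rewrite mulr_ge0// powR_ge0.
rewrite ler_pdivrMr// mulrC in L1.
have -> : 2 ^+ n * r `^ gamma * (C * r `^ (- sigma)) = 2 ^+ n * C * r `^ (gamma - sigma).
  by rewrite powRD ?(gt_eqF r0) ?implybT//; ring.
have w0 : 0 < r `^ (gamma - sigma) by exact: powR_gt0.
apply: (@le_trans _ _ (r `^ (sigma - gamma - alpha) * L r * h * r `^ (gamma - sigma))).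
  by rewrite ler_pM2r// mulrC.
rewrite (_ : _ * L r * h * _ = h * ((r `^ (sigma - gamma - alpha) * r `^ (gamma - sigma)) * L r)); last by ring.
rewrite -powRD ?(gt_eqF r0) ?implybT// (_ : _ + (gamma - sigma) = - alpha)//; by ring.
Unshelve. all: by end_near. Qed.

Lemma student_slopeK (n : nat) (b : R) :
  Num.sqrt (2 * pi) * (1 + b ^+ 2 / n%:R) `^ (n%:R / 2) * student_slope n b = 1.
Proof.
rewrite /student_slope /normal_peak expr1n mul1r -[pi *+ 2]mulr_natl powRN.
have s0 : 0 < Num.sqrt (2 * pi : R) by rewrite sqrtr_gt0 mulr_gt0// pi_gt0.
have t0 : 0 < (1 + b ^+ 2 / n%:R) `^ (n%:R / 2).
  by apply: powR_gt0; rewrite ltr_pwDl// divr_ge0 ?sqr_ge0.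
by field; rewrite !gt_eqF.
Qed.

Lemma integral_sqrZ (dO : measure_display) (Omega : measurableType dO) (P : probability Omega R)
    (k : R) (U : Omega -> R) : measurable_fun [set: Omega] U ->
  (\int[P]_w ((k * U w) ^+ 2)%:E = (k ^+ 2)%:E * \int[P]_w (U w ^+ 2)%:E)%E.
Proof.
move=> mU; rewrite -ge0_integralZT//; last 3 first.
- by rewrite sqr_ge0.
- by apply/measurable_EFinP; exact: measurable_funX.
- by move=> w; rewrite lee_fin sqr_ge0.
by apply: eq_integral => w _; rewrite exprMn.
Qed.

Lemma sqr_integrable_integrable (dO : measure_display) (Omega : measurableType dO) (P : probability Omega R)
    (U : Omega -> R) (v : R) : measurable_fun [set: Omega] U ->
  (\int[P]_w (U w ^+ 2)%:E = v%:E)%E -> P.-integrable setT (fun w => (U w)%:E).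
Proof.
move=> mU Uv.
have i2 : P.-integrable setT (fun w => (U w ^+ 2)%:E).
  apply/integrableP; split; first by apply/measurable_EFinP; exact: measurable_funX.
  by under eq_integral do rewrite gee0_abs ?lee_fin ?sqr_ge0//; rewrite Uv ltry.
have i1 : P.-integrable setT (EFin \o (fun=> 1)) by exact: finite_measure_integrable_cst.
apply: (le_integrable _ _ _ (integrableD measurableT i1 i2)) => //; first exact/measurable_EFinP.
move=> w _; change (`|(U w)%:E| <= `|(1 + U w ^+ 2)%:E|)%E.
rewrite !abse_EFin lee_fin (@ger0_norm _ (1 + _)) ?addr_ge0 ?sqr_ge0// -(real_normK (num_real (U w))).
by have := sqr_ge0 (`|U w| - 2^-1); lra.
Qed.

(** The denominator of the theorem is the volume scale [r ^+ d] times the asymptotic standard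
    deviation of the space integral over the undilated set. *)
Lemma volume_factorE (d : nat) (alpha r l c : R) : 0 < r -> 0 <= l -> 0 <= c ->
  r `^ (d%:R - alpha / 2) * Num.sqrt l * Num.sqrt c = r ^+ d * Num.sqrt (r `^ (- alpha) * l * c).
Proof.
move=> r0 l0 c0; rewrite !sqrtrM ?mulr_ge0 ?powR_ge0//.
rewrite powRD ?(gt_eqF r0) ?implybT// powR_mulrn ?(ltW r0)// -!mulrA; congr (_ * (_ * _)).
rewrite -powR12_sqrt ?powR_ge0// -powRrM; congr (_ `^ _); lra.
Qed.
End normalization.

Theorem theorem8 (dO : measure_display) (Omega : measurableType dO)
  (R : realType) (P : probability Omega R) (d n : nat) (alpha gamma : R)
  (Delta : set 'rV[R]_d) (eta : 'rV[R]_d -> 'I_n.+1 -> {RV P >-> R})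
  (L f a : R -> R) :
  (0 < d)%N -> (0 < n)%N -> 0 < alpha < d%:R ->
  jordan_measurable Delta ->
  convex_set (Delta : set (convex_lmodType 'rV[R]_d)) ->
  bounded_set Delta -> (0 < leb R d Delta)%E -> Delta° 0 ->
  measurable_field eta -> mean_square_continuous eta ->
  homogeneous_isotropic eta -> gaussian_field eta -> centered_field eta ->
  cross_moment eta 0 0 = 1%:M ->
  slowly_varying L ->
  (forall x : 'rV[R]_d, x != 0 ->
     cross_moment eta 0 x = (enorm x `^ (- alpha) * L (enorm x))%:M) ->
  (forall j, spectral_density eta j f) ->
  f ~_(0^'+) (fun u => c2 d alpha * u `^ (alpha - d%:R) * L (1 / u)) ->
  {in `]0, +oo[, continuous a} ->
  {in `]0, +oo[ &, {homo a : r s / r <= s}} ->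
  a r @[r --> +oo] --> +oo ->
  0 < gamma < Num.min alpha (d%:R - alpha) ->
  a r / r `^ (gamma / (2 * n%:R)) @[r --> +oo] --> (0 : R) ->
  cvg_in_law P
    (fun r w =>
       Num.sqrt (2 * pi) * (1 + a r ^+ 2 / n%:R) `^ (n%:R / 2) *
       ((sojourn eta Delta a r w
         - 2^-1 * fine (leb R d Delta) * r ^+ d *
           incomplete_beta (n%:R / (n%:R + a r ^+ 2)) (n%:R / 2) (2^-1))
        / (r `^ (d%:R - alpha / 2) * Num.sqrt (L r) *
           Num.sqrt (c2 d alpha * c3 Delta alpha))))
    (normal_prob 0 1).
Proof.
move=> d0 n0 al JD _ BD PD _ eta_meas _ eta_iso eta_gauss eta_centered eta_unit sL eta_corr _ _ _ _ ay ga a0.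
have [D [F [mD mF DA AF FD]]] := jordan_sandwich JD.
have [M M0 AM] := bounded_coord BD.
have DM x : D x -> forall i, `|x ord0 i| <= M by move=> /DA; exact: AM.
have Dfin : leb R d D \is a fin_num by rewrite ge0_fin_numE// (leb_bounded_lty DM).
pose V := fine (leb R d D).
have DV : leb R d D = V%:E by rewrite fineK.
have AV : leb R d Delta = V%:E.
  apply/eqP; rewrite eq_le -DV (le_leb DA) andbT; apply: (le_trans (le_leb AF)).
  rewrite -(setDKU (subset_trans DA AF)); apply: (le_trans (measureU2 _ _ _)) => //.
    exact: measurableD.
  by rewrite [X in (X + _)%E](_ : _ = 0%E) ?add0e//; exact: FD.
have V0 : 0 < V by move: PD; rewrite AV lte_fin.
have [al0 ald] := andP al.
have eta_cov := correlationE eta_iso eta_unit eta_corr.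
have rho1 := correlation_le1_pos d0 eta_iso eta_gauss eta_unit eta_corr.
have K1 := @correlation_diag R d L alpha.
pose rho r := r `^ (- alpha) * L r.
set c23 := c2 d alpha * c3 Delta alpha.
have Ec23 : riesz_energy D alpha = c23%:E by rewrite -(c2_c3E d0 mD mF DA AF FD DV DM al).
have c0 : 0 < c23 by rewrite -lte_fin -Ec23; exact: (riesz_energy_gt0 d0 mD DV M0 DM al0 V0).
have [g0 g1] := andP ga.
(* [sigma] is half-way between [alpha + gamma] and [alpha + min (alpha, d - alpha) = min (2 alpha,
   d)]. The first inequality makes the residual negligible, the second allows [sigma / 2] as decay
   exponent of the correlation, the third makes the Riesz energy of exponent [sigma] finite. *)
have [sigma [gs s2 sd]] : exists sigma, [/\ gamma + alpha < sigma, sigma / 2 < alpha & sigma < d%:R].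
  set m := Num.min alpha (d%:R - alpha); exists (alpha + (gamma + m) / 2).
  have gm : gamma < m := g1.
  have ma : m <= alpha by rewrite ge_min lexx.
  have md : m <= d%:R - alpha by rewrite ge_min lexx orbT.
  by split; lra.
have tau0 : 0 < sigma / 2 < alpha by apply/andP; split; lra.
have [A A0 HA] := regular_decay sL rho1 tau0.
have sE : 2 * (sigma / 2) = sigma by rewrite mulrC divfK.
have sigd : 0 < sigma < d%:R by apply/andP; split; lra.
have [Es Es0 EsE] : exists2 Es, 0 <= Es & riesz_energy D sigma = Es%:E.
  have e0 : (0 <= riesz_energy D sigma)%E.
    by apply: integral_ge0 => x _; apply: integral_ge0 => y _; rewrite lee_fin powR_ge0.
  exists (fine (riesz_energy D sigma)); first exact: fine_ge0.
  by rewrite fineK// ge0_fin_numE// (riesz_energy_lty d0 mD DV DM sigd).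
(* [C] collects the factors of the normalized residual variance: [2 * pi] from the squared
   normalization, the Mehler constant, the squared decay constant, the Riesz energy of exponent
   [sigma], and the division by the limit variance [c23]. *)
pose C := 2 * pi * (residual_const R n * A ^+ 2 * Es) / c23.
have rc0 := residual_const_ge0 R n.
have C0 : 0 <= C.
  apply: divr_ge0; last exact: ltW.
  apply: mulr_ge0; first by rewrite mulr_ge0// pi_ge0.
  by apply: mulr_ge0 => //; apply: mulr_ge0 => //; exact: sqr_ge0.
have Ncvg := correlation_energy_cvg d0 mD DV M0 DM sL al rho1; rewrite Ec23 /= in Ncvg.
have [X X0 LX] := slowly_varying_gt0 sL.
apply: gaussian_sum_cvg_in_law => h h4; have [h0 h1] := andP h4.
have Nnear : \forall r \near +oo, `|c23 - correlation_energy D L alpha r / rho r| <= h * c23.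
  by move/cvgrPdist_le : Ncvg; apply; exact: mulr_gt0.
have Rnear := residual_scale_le n0 sL gs C0 h0 ay a0.
have rX : \forall r \near +oo, X <= r by apply: nbhs_pinfty_ge; exact: num_real.
have b0near : \forall r \near +oo, 0 <= a r by move/cvgryPge : ay; exact.
near=> r.
have Xr : X <= r by near: r.
have r0 : 0 < r by exact: lt_le_trans Xr.
have Lr0 : 0 < L r by exact: LX.
have rho0 : 0 < rho r by rewrite mulr_gt0 ?powR_gt0.
have b0 : 0 <= a r by near: r.
have Nr : `|c23 - correlation_energy D L alpha r / rho r| <= h * c23 by near: r.
have Rr : ((1 + a r ^+ 2 / n%:R) `^ (n%:R / 2)) ^+ 2 * (C * r `^ (- sigma)) / rho r <= h by near: r.
set b := a r in b0 Rr *; set T := (1 + b ^+ 2 / n%:R) `^ (n%:R / 2) in Rr *.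
(* [nu ^+ 2] is the asymptotic variance of the coordinate integral over [D]; by [volume_factorE] the
   denominator of the statement is [r ^+ d * nu]. *)
pose nu := Num.sqrt (rho r * c23).
have nu0 : 0 < nu by rewrite sqrtr_gt0 mulr_gt0.
have nu2 : nu ^+ 2 = rho r * c23 by rewrite sqr_sqrtr// mulr_ge0 ?ltW.
pose c := Num.sqrt (2 * pi) * T.
have c2E : c ^+ 2 = 2 * pi * T ^+ 2 by rewrite exprMn sqr_sqrtr// mulr_ge0 ?pi_ge0.
pose EI := exceed_integral eta D r b.
pose N := coord_integral eta D r.
pose Res := residual_integral eta D r b.
pose p := 2^-1 * incomplete_beta (n%:R / (n%:R + b ^+ 2)) (n%:R / 2) 2^-1.
have pE : fine (gauss R n.+1 (student_event b)) = p by rewrite (student_prob n0 b0).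
have mEI : measurable_fun [set: Omega] EI by exact: measurable_exceed_integral.
have mN : measurable_fun [set: Omega] N.
  exact: (measurable_space_integral mD (measurable_field_coord eta_meas r)).
have mRes : measurable_fun [set: Omega] Res.
  exact: (measurable_space_integral mD (measurable_field_residual eta_meas r b)).
have XE w : c * ((sojourn eta Delta a r w - 2^-1 * fine (leb R d Delta) * r ^+ d *
      incomplete_beta (n%:R / (n%:R + b ^+ 2)) (n%:R / 2) 2^-1) /
      (r `^ (d%:R - alpha / 2) * Num.sqrt (L r) * Num.sqrt c23)) =
    c / nu * (EI w - p * V).
  rewrite (sojourn_exceed eta_meas mD mF DA AF FD)// -/b -/(EI w) AV /=.
  rewrite volume_factorE ?(ltW c0) ?(ltW Lr0)// -/(rho r) -/nu /p.
  have rd0 : r ^+ d != 0 by rewrite expf_neq0// gt_eqF.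
  by field; rewrite rd0 gt_eqF.
rewrite -/c.
(* The accuracy is [h ^+ 2 * nu ^+ 2] because both the coordinate integral and [Y] are divided by
   [nu] below. *)
have [Y [v [mY gY Y0 Yv NY]]] := coord_monte_carlo eta_meas eta_gauss eta_centered eta_cov K1 mD DV V0 r
  (mulr_gt0 (exprn_gt0 2 h0) (exprn_gt0 2 nu0)).
have nui2 : (nu^-1 ^+ 2 = (rho r * c23)^-1) by rewrite exprVn nu2.
split; first by under eq_fun do rewrite XE; apply: measurable_funM => //; exact: measurable_funB.
exists (fun w => nu^-1 * N w), (fun w => c / nu * Res w), (fun w => nu^-1 * Y w),
  (nu^-1 ^+ 2 * correlation_energy D L alpha r), (nu^-1 ^+ 2 * v); split; split.
- exact: measurable_funM.
- exact: measurable_funM.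
- exact: measurable_funM.
- apply: filterS (exceed_decomposition eta_meas eta_gauss eta_cov K1 mD DV r b) => w Ew.
  rewrite XE /EI Ew pE -/(N w) -/(Res w).
  (* The normalization [c] is the inverse of the slope, so the coordinate integral enters with the
     bare factor [nu^-1], while the residual keeps [c / nu]. *)
  have := student_slopeK n b; rewrite -/T -/c => cs.
  rewrite (_ : c / nu * _ = (c * student_slope n b) / nu * N w + c / nu * Res w); last by ring.
  by rewrite cs mul1r.
- rewrite integral_sqrZ// (coord_energyE eta_meas eta_gauss eta_cov mD DV V0 sL rho1 r).
  by rewrite -EFinM.
- rewrite nui2 (_ : _ - 1 = - ((c23 - correlation_energy D L alpha r / rho r) / c23)); last first.
    by field; rewrite !gt_eqF.
  by rewrite normrN normrM normfV (gtr0_norm c0) ler_pdivrMr.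
- rewrite integral_sqrZ//.
  have mK := @measurable_correlation R d L alpha sL.
  have R1 := residual_second_moment n0 eta_meas eta_gauss eta_centered eta_cov K1
    (correlation_sym L alpha) mK mD DV V0 r b0.
  have R2 := correlation_sqr_energy_le d0 mD sL (ltW A0) r0 HA.
  rewrite sE EsE in R2.
  have R3 : (\int[P]_w (Res w ^+ 2)%:E <= (residual_const R n * (A ^+ 2 * r `^ (- sigma) * Es))%:E)%E.
    apply: (le_trans R1); rewrite (EFinM (residual_const R n)); apply: lee_wpmul2l; first by rewrite lee_fin.
    by apply: (le_trans R2); rewrite -EFinM.
  apply: (@le_trans _ _ (((c / nu) ^+ 2)%:E * (residual_const R n * (A ^+ 2 * r `^ (- sigma) * Es))%:E)%E).
    by apply: lee_wpmul2l => //; rewrite lee_fin sqr_ge0.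
  rewrite -EFinM lee_fin; apply: le_trans Rr; rewrite le_eqVlt; apply/orP; left; apply/eqP.
  rewrite exprMn nui2 c2E /C; field; by rewrite !gt_eqF.
- by apply: gaussian_law_scale => //; rewrite invr_gt0.
- under eq_integral do rewrite EFinM.
  by rewrite integralZl ?Y0 ?mule0//; exact: sqr_integrable_integrable mY Yv.
- by rewrite integral_sqrZ// Yv -EFinM.
- under eq_integral do rewrite -mulrBr.
  rewrite integral_sqrZ; last exact: measurable_funB.
  apply: (@le_trans _ _ ((nu^-1 ^+ 2)%:E * (h ^+ 2 * nu ^+ 2)%:E)%E).
    by apply: lee_wpmul2l => //; rewrite lee_fin sqr_ge0.
  by rewrite -EFinM lee_fin exprVn mulrCA mulVf ?mulr1// gt_eqF// exprn_gt0.
Unshelve. all: by end_near.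
Qed.
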